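(* Every knot in $\mathbb{R}^3$ is the closure of a $1$-pure braid.
   Context: Knots are tame. A braid on $k$ strands is called $1$-pure if $k-1$ of its strands are parallel straight vertical lines, and the remaining strand winds between them, starting and ending in the same position (the leftmost one). Closure convention for turning a pure braid into a knot: the strands are connected rotated by one, so that they form a single component. Explicitly, with positions numbered $0,1,\dots,k-1$ from left to right, the bottom end in position $i$ is connected, around the right side of the braid, to the top end in position $i-1$ for $1\le i\le k-1$, by arcs that do not cross each other, and the bottom end in position $0$ is connected to the top end in position $k-1$ by an arc which first passes to the right under the $k-1$ other closing strands and then goes around. Equivalently, the result is the usual braid closure of the given braid followed by the braid in which the leftmost strand passes behind all others to the rightmost position while every other strand moves one position to the left. *)

(* Defs.v *)
From HB Require Import structures.
From mathcomp Require Import all_boot all_order all_fingroup all_algebra.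
From mathcomp Require Import all_classical all_reals all_analysis.

Set Implicit Arguments.
Unset Strict Implicit.
Unset Printing Implicit Defensive.

Import Order.TTheory GRing.Theory Num.Theory.
Import numFieldNormedType.Exports.

Local Open Scope classical_set_scope.
Local Open Scope ring_scope.

(* R^3 is [R * R * R] with coordinates (x, y, z): x points to the right, y is
   the vertical direction of the braids (pointing up), and z points towards the
   viewer of the diagrams, so that "under" and "behind" mean smaller z. *)

Definition simple_loop (R : realType) (f : R -> R * R * R) : Prop :=
  [/\ {within `[0, 1], continuous f}, f 0 = f 1
    & {in `[0, 1[ &, injective f}].

(* Knots are subsets of R^3, hence unoriented. *)
Definition is_knot (R : realType) (K : set (R * R * R)) : Prop :=
  exists2 f : R -> R * R * R, simple_loop f & K = f @` `[0, 1].

Definition polygonal_knot (R : realType) (K : set (R * R * R)) : Prop :=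
  exists n (f : R -> R * R * R),
    [/\ (0 < n)%N, simple_loop f,
        (forall (i : 'I_n) (t : R), t \in `[0, 1] ->
           f ((i%:R + t) / n%:R) =
           (1 - t) *: f (i%:R / n%:R) + t *: f (i.+1%:R / n%:R))
      & K = f @` `[0, 1]].

Definition homeomorphism (S T : topologicalType) (f : S -> T) : Prop :=
  continuous f /\ exists g : T -> S, [/\ continuous g, cancel f g & cancel g f].

Definition ambient_isotopic (R : realType) (A B : set (R * R * R)) : Prop :=
  exists H : R -> R * R * R -> R * R * R,
    [/\ {within `[0, 1] `*` setT,
          continuous (fun p : R * (R * R * R) => H p.1 p.2)},
        (forall t : R, t \in `[0, 1] -> homeomorphism (H t)),
        (forall p : R * R * R, H 0 p = p)
      & H 1 @` A = B].

Definition tame (R : realType) (K : set (R * R * R)) : Prop :=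
  exists2 P, polygonal_knot P & ambient_isotopic P K.

(* At time t, strand i of the braid b is at the point (x, z) = b i t of the
   horizontal plane of height y = 1 - t, so that strands run from top to bottom.
   Confining the strands to x < k leaves the half-space x >= k free for the
   closing arcs. *)
Definition geometric_braid (R : realType) (k : nat) (b : 'I_k -> R -> R * R) :
    Prop :=
  [/\ (forall i, {within `[0, 1], continuous (b i)}),
      (forall t : R, t \in `[0, 1] -> injective (b^~ t)),
      (forall i (t : R), t \in `[0, 1] -> (b i t).1 < k%:R),
      (forall i, b i 0 = (i%:R, 0))
    & exists s : {perm 'I_k}, forall i, b i 1 = ((s i)%:R, 0)].

Definition pure_braid (R : realType) (k : nat) (b : 'I_k -> R -> R * R) :
    Prop :=
  geometric_braid b /\ forall i, b i 1 = (i%:R, 0).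

Definition one_pure_braid (R : realType) (k : nat) (b : 'I_k -> R -> R * R) :
    Prop :=
  [/\ (0 < k)%N, pure_braid b
    & forall (i : 'I_k) (t : R),
        (0 < i)%N -> t \in `[0, 1] -> b i t = (i%:R, 0)].

Definition segment (R : realType) (p q : R * R * R) : set (R * R * R) :=
  [set (1 - t) *: p + t *: q | t in `[0, 1]].

Fixpoint polyline (R : realType) (p : R * R * R) (s : seq (R * R * R)) :
    set (R * R * R) :=
  if s is q :: s' then segment p q `|` polyline q s' else [set p].

(* The closing arc from the bottom end in position i to the top end in position
   i - 1 (to position k - 1 if i = 0), for i < k. For 0 < i these arcs are
   nested in the plane z = 0, the outermost one being that of i = 1. The arc of
   i = 0 crosses below the others at height y = -1/2, z = -1, and then goes up
   inside all of them. *)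
Definition closing_arc (R : realType) (k i : nat) : set (R * R * R) :=
  if i is j.+1 then
    let d : R := (k - i)%:R in
    polyline (i%:R, 0, 0)
      [:: (i%:R, - d - 1, 0);
          (k%:R + d + 1, - d - 1, 0);
          (k%:R + d + 1, d + 2, 0);
          (j%:R, d + 2, 0);
          (j%:R, 1, 0)]
  else
    polyline (0, 0, 0)
      [:: (0, - 2^-1, 0);
          (0, - 2^-1, - 1);
          (k%:R, - 2^-1, - 1);
          (k%:R, - 2^-1, 0);
          (k%:R, 1 + 2^-1, 0);
          (k.-1%:R, 1 + 2^-1, 0);
          (k.-1%:R, 1, 0)].

Definition strand (R : realType) (b : R -> R * R) : set (R * R * R) :=
  [set ((b t).1, 1 - t, (b t).2) | t in `[0, 1]].

Definition braid_closure (R : realType) (k : nat) (b : 'I_k -> R -> R * R) :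
    set (R * R * R) :=
  \bigcup_i (strand (b i) `|` closing_arc k i).

(* Main.v *)
(* A polygonal knot is put in pole position: in a generic projection along the
   vertical direction y, the knot is cut into pieces in each of which it passes
   only above, or only below, the parts traversed earlier. The i-th piece is
   moved to the height i + 2 or -(i + 2) accordingly, and the pieces are joined
   by vertical segments, the poles. Contracting the horizontal segments one after
   the other gathers the poles in a row, and the last arc of the knot, the only
   one that is not straight, becomes the graph of a function of the height which
   winds around the row of poles. Cutting the row into columns turns the poles
   into the parallel strands and the closing arcs of a one-pure braid, whose
   remaining strand is this arc. All the moves but those of the last arc are
   linear motions of compact sets whose distances stay bounded below, which
   extend to ambient isotopies by McShane's extension of Lipschitz maps. *)

(* The absolute values of the heights increase so that the horizontal segment under contraction lies
   outside all those already gathered and inside all the remaining ones. It can then be contracted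
   by one plane isotopy, applied at full strength on all levels up to that segment and damped to the
   identity at the next one. Such a move preserves levels, so the last arc, which joins the heights
   0 and 1, stays a graph over the height however much it is twisted; this is why it ends up as a
   strand. Once gathered, the poles form a single planar curve, and only its crossings with the last
   arc matter. A stretch of this curve can be pushed out to make a closing arc if the last arc
   passes on one side of all its crossings; where the side changes, a column is inserted. Pushing
   neighbouring stretches to opposite sides is also what lets them be spread out to their standard
   positions. Each move has to be ambient. A move of one coordinate is a shear whose displacement is
   extended continuously from a compact set, and it suffices that the displacement be a function of
   the other two coordinates; this dictates the order of the moves. *)
Require Import Defs.
From HB Require Import structures.
From mathcomp Require Import all_boot all_order all_fingroup all_algebra.
From mathcomp Require Import all_classical all_reals all_analysis.
From mathcomp Require Import ring lra.

Set Implicit Arguments.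
Unset Strict Implicit.
Unset Printing Implicit Defensive.

Import Order.TTheory GRing.Theory Num.Theory.
Import numFieldNormedType.Exports.

Local Open Scope classical_set_scope.
Local Open Scope ring_scope.

(** * Isotopies *)

(* lra tries to interpret every hypothesis, which is slow in large contexts. *)
Ltac keep_inequalities := repeat match goal with
  | H : ?T |- _ => lazymatch type of T with
    | Prop => lazymatch T with
      | is_true (leq _ _) => clear H
      | is_true (andb _ (leq _ _)) => clear H
      | is_true (_ == _) => clear H
      | is_true (negb _) => clear H
      | is_true (mem _ _) => clear H
      | forall _, _ => clear H
      | ex _ => clear H
      | ex2 _ _ => clear H
      | @eq nat _ _ => clear H
      | @eq bool _ _ => clear H
      | @eq (_ -> _) _ _ => clear H
      | @eq (prod _ _) _ _ => clear H
      | continuous _ => clear H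
      end
    end
  end.
Ltac flra := first [solve [keep_inequalities; lra] | lra].
Ltac fnra := first [solve [keep_inequalities; nra] | nra].

Section Continuity.
Context {T U V : topologicalType}.
Lemma cont_id : continuous (fun x : T => x).
Proof. by move=> x; exact: cvg_id. Qed.
Lemma cont_cst (u : U) : continuous (fun _ : T => u).
Proof. by move=> x; exact: cvg_cst. Qed.
Lemma cont_comp (g : U -> V) (f : T -> U) :
  continuous g -> continuous f -> continuous (fun x => g (f x)).
Proof. by move=> cg cf x; apply: (@continuous_comp _ _ _ f g); [exact: cf|exact: cg]. Qed.
Lemma cont_pair (f : T -> U) (g : T -> V) :
  continuous f -> continuous g -> continuous (fun x => (f x, g x)).
Proof. by move=> cf cg x; apply: cvg_pair; [exact: cf|exact: cg]. Qed.
Lemma cont_fst (f : T -> U * V) : continuous f -> continuous (fun x => (f x).1).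
Proof. by move=> cf x; apply: (@continuous_comp _ _ _ f fst); [exact: cf|exact: cvg_fst]. Qed.
Lemma cont_snd (f : T -> U * V) : continuous f -> continuous (fun x => (f x).2).
Proof. by move=> cf x; apply: (@continuous_comp _ _ _ f snd); [exact: cf|exact: cvg_snd]. Qed.
End Continuity.

Section ContinuityReal.
Context {R : realType} {T : topologicalType}.
Section NormedModule.
Context {E : normedModType R}.
Lemma cont_add (f g : T -> E) :
  continuous f -> continuous g -> continuous (fun x => f x + g x).
Proof. by move=> cf cg x; apply: cvgD; [exact: cf|exact: cg]. Qed.
Lemma cont_opp (f : T -> E) : continuous f -> continuous (fun x => - f x).
Proof. by move=> cf x; apply: cvgN; exact: cf. Qed.
Lemma cont_norm (f : T -> E) : continuous f -> continuous (fun x => `|f x| : R).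
Proof. by move=> cf x; apply: cvg_norm; exact: cf. Qed.
Lemma cont_scale (c : T -> R) (f : T -> E) :
  continuous c -> continuous f -> continuous (fun x => c x *: f x).
Proof. by move=> cc cf x; apply: cvgZ; [exact: cc|exact: cf]. Qed.
End NormedModule.
Lemma cont_mul (f g : T -> R) :
  continuous f -> continuous g -> continuous (fun x => f x * g x).
Proof. by move=> cf cg x; apply: cvgM; [exact: cf|exact: cg]. Qed.
Lemma cont_max (f g : T -> R) :
  continuous f -> continuous g -> continuous (fun x => Num.max (f x) (g x)).
Proof.
move=> cf cg; rewrite (_ : (fun _ => _) = (fun x => 2^-1 * (f x + g x + `|f x - g x|))).
  apply: cont_mul; first exact: cont_cst.
  apply: (cont_add (cont_add cf cg)).
  by apply: cont_norm; apply: cont_add => //; apply: cont_opp.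
by apply/funext => x; rewrite maxr_absE mulrC.
Qed.
Lemma cont_min (f g : T -> R) :
  continuous f -> continuous g -> continuous (fun x => Num.min (f x) (g x)).
Proof.
move=> cf cg; rewrite (_ : (fun _ => _) = (fun x => - Num.max (- f x) (- g x))).
  by apply: cont_opp; apply: cont_max; apply: cont_opp.
by apply/funext => x; rewrite -oppr_min opprK.
Qed.
Lemma cont_inv (f : T -> R) :
  (forall x, f x != 0) -> continuous f -> continuous (fun x => (f x)^-1).
Proof. by move=> f0 cf x; apply: cvgV; [exact: f0|exact: cf]. Qed.
End ContinuityReal.

Section ContinuityEta.
Context {R : realType}.
Implicit Types c : R.
(** A function whose body ends in the bare variable can appear eta-contracted, as [*%R c] for
    instance; these are the corresponding forms of the lemmas above. *)
Lemma cont_mul_eta c : continuous ( *%R c : R -> R).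
Proof. by apply: (@cont_mul R R (fun=> c) (fun x => x)); [exact: cont_cst|exact: cont_id]. Qed.
Lemma cont_add_eta c : continuous ( +%R c : R -> R).
Proof. by apply: (@cont_add R R R (fun=> c) (fun x => x)); [exact: cont_cst|exact: cont_id]. Qed.
Lemma cont_opp_eta : continuous (-%R : R -> R).
Proof. by apply: (@cont_opp R R R (fun x => x)); exact: cont_id. Qed.
Lemma cont_norm_eta : continuous (Num.norm : R -> R).
Proof. by apply: (@cont_norm R R R (fun x => x)); exact: cont_id. Qed.
Lemma cont_max_eta c : continuous (Num.max c : R -> R).
Proof. by apply: (@cont_max R R (fun=> c) (fun x => x)); [exact: cont_cst|exact: cont_id]. Qed.
Lemma cont_min_eta c : continuous (Num.min c : R -> R).
Proof. by apply: (@cont_min R R (fun=> c) (fun x => x)); [exact: cont_cst|exact: cont_id]. Qed.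
End ContinuityEta.

(** The rule is selected by the head symbol of the function; a function with another head is left as
    a goal to the caller. *)
Ltac cont1 :=
  lazymatch goal with
  | |- forall x, @continuous_at _ _ x ?f =>
    lazymatch f with
    | fun x => x => exact: cont_id
    | fun _ => ?c => exact: cont_cst
    | @fst _ _ => apply: cont_fst; apply: cont_id
    | @snd _ _ => apply: cont_snd; apply: cont_id
    | @GRing.mul _ _ => apply: cont_mul_eta
    | @GRing.add _ _ => apply: cont_add_eta
    | @GRing.opp _ => apply: cont_opp_eta
    | @Num.norm _ _ => apply: cont_norm_eta
    | @Order.max _ _ _ => apply: cont_max_eta
    | @Order.min _ _ _ => apply: cont_min_eta
    | fun x => @pair _ _ (@?a x) (@?b x) => apply: cont_pair
    | fun x => @fst _ _ (@?a x) => apply: cont_fst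
    | fun x => @snd _ _ (@?a x) => apply: cont_snd
    | fun x => @Num.norm _ _ (@?a x) => first [apply: cont_norm | apply: (@cont_norm _ _ _ (fun x => x))]
    | fun x => @GRing.opp _ (@?a x) => first [apply: cont_opp | apply: (@cont_opp _ _ _ (fun x => x))]
    | fun x => @Order.max _ _ (@?a x) (@?b x) => first [apply: cont_max | apply: (@cont_max _ _ (fun=> _) (fun x => x))]
    | fun x => @Order.min _ _ (@?a x) (@?b x) => first [apply: cont_min | apply: (@cont_min _ _ (fun=> _) (fun x => x))]
    | fun x => @GRing.mul _ (@?a x) (@?b x) => first [apply: cont_mul | apply: (@cont_mul _ _ (fun=> _) (fun x => x))]
    | fun x => @GRing.scale _ _ (@?a x) (@?b x) => apply: cont_scale
    | fun x => @GRing.add _ (@?a x) (@?b x) => first [apply: cont_add | apply: (@cont_add _ _ _ (fun=> _) (fun x => x))]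
    end
  end.
Ltac cont := repeat first [ assumption | progress cont1 ].

(* All maps are total in the time parameter, so that no "within" is needed. *)
Definition isotopy {R : realType} {T : topologicalType} (H H' : R -> T -> T) : Prop :=
  [/\ continuous (fun p : R * T => H p.1 p.2), continuous (fun p : R * T => H' p.1 p.2),
      (forall t, cancel (H t) (H' t)), (forall t, cancel (H' t) (H t))
    & forall x, H 0 x = x].

Section Isotopy.
Context {R : realType} {T : topologicalType}.
Implicit Types (H G : R -> T -> T).

Lemma isotopy_id : isotopy (fun (_ : R) (x : T) => x) (fun _ x => x).
Proof. by split => //; cont. Qed.

Lemma isotopy_sym H H' : isotopy H H' -> isotopy H' H.
Proof. by case=> c c' k k' h0; split => // x; rewrite -{1}(h0 x) k. Qed.

Lemma isotopy_comp H H' G G' : isotopy H H' -> isotopy G G' ->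
  isotopy (fun t x => G t (H t x)) (fun t x => H' t (G' t x)).
Proof.
case=> c c' k k' h0 [d d' l l' g0]; split.
- apply: (@cont_comp _ _ _ (fun p : R * T => G p.1 p.2) (fun p : R * T => (p.1, H p.1 p.2))) => //.
  by cont.
- apply: (@cont_comp _ _ _ (fun p : R * T => H' p.1 p.2) (fun p : R * T => (p.1, G' p.1 p.2))) => //.
  by cont.
- by move=> t x; rewrite l k.
- by move=> t x; rewrite k' l'.
- by move=> x; rewrite h0 g0.
Qed.

Lemma isotopy_cont H H' t : isotopy H H' -> continuous (H t).
Proof.
case=> c _ _ _ _.
apply: (@cont_comp _ _ _ (fun p : R * T => H p.1 p.2) (fun x : T => (t, x))) => //; cont.
Qed.

(** [h] reads a coordinate in [T] of a point of [S] and [g] overwrites it. The time [c] does not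
    depend on that coordinate, so the isotopy runs on each fibre at its own speed and is undone at
    the same speed. *)
Lemma isotopy_reparam H H' (S : topologicalType) (c : R -> S -> R) (h : S -> T)
    (g : T -> S -> S) : isotopy H H' ->
  continuous (fun p : R * S => c p.1 p.2) -> continuous h -> continuous (fun p : T * S => g p.1 p.2) ->
  (forall x y, h (g x y) = x) -> (forall x y t, c t (g x y) = c t y) ->
  (forall x x' y, g x (g x' y) = g x y) -> (forall y, g (h y) y = y) -> (forall y, c 0 y = 0) ->
  isotopy (fun t y => g (H (c t y) (h y)) y) (fun t y => g (H' (c t y) (h y)) y).
Proof.
move=> [C C' k k' h0] cc ch cg hg cgE gg gh c0; split.
- apply: (@cont_comp _ _ _ (fun p : T * S => g p.1 p.2)
    (fun p : R * S => (H (c p.1 p.2) (h p.2), p.2))) => //.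
  cont; apply: (@cont_comp _ _ _ (fun p : R * T => H p.1 p.2)
    (fun p : R * S => (c p.1 p.2, h p.2))) => //.
  by cont; apply: cont_comp => //; cont.
- apply: (@cont_comp _ _ _ (fun p : T * S => g p.1 p.2)
    (fun p : R * S => (H' (c p.1 p.2) (h p.2), p.2))) => //.
  cont; apply: (@cont_comp _ _ _ (fun p : R * T => H' p.1 p.2)
    (fun p : R * S => (c p.1 p.2, h p.2))) => //.
  by cont; apply: cont_comp => //; cont.
- by move=> t y; rewrite hg cgE gg k gh.
- by move=> t y; rewrite hg cgE gg k' gh.
- by move=> y; rewrite c0 h0 gh.
Qed.

Definition isotopic (A B : set T) : Prop :=
  exists (H : R -> T -> T) H', isotopy H H' /\ H 1 @` A = B.

Lemma isotopic_refl A : isotopic A A.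
Proof. by exists (fun _ x => x), (fun _ x => x); split; [exact: isotopy_id|rewrite image_id]. Qed.

Lemma isotopic_sym A B : isotopic A B -> isotopic B A.
Proof.
move=> [H [H' [iH <-]]]; exists H', H; split; first exact: isotopy_sym.
rewrite image_comp; case: iH => _ _ k _ _.
by rewrite (_ : H' 1 \o H 1 = id) ?image_id//; apply/funext => x /=; rewrite k.
Qed.

Lemma isotopic_trans B A C : isotopic A B -> isotopic B C -> isotopic A C.
Proof.
move=> [H [H' [iH <-]]] [G [G' [iG <-]]].
exists (fun t x => G t (H t x)), (fun t x => H' t (G' t x)).
by split; [exact: isotopy_comp|rewrite image_comp].
Qed.
End Isotopy.
Arguments isotopic {R T}.

Section Ambient.
Context {R : realType}.
(** [ambient_isotopic] asks for no joint continuity of the inverses and for nothing outside the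
    times in [[0, 1]], so it is not visibly symmetric. The isotopy supplied by tameness is therefore
    used in its given direction only, after one of the stronger kind. *)
Lemma isotopic_ambient (A B C : set (R * R * R)) :
  @isotopic R _ A B -> ambient_isotopic B C -> ambient_isotopic A C.
Proof.
move=> [G [G' [[c c' k k' g0] <-]]] [H [cH hH H0 <-]].
exists (fun t x => H t (G t x)); split.
- have -> : (fun p : R * (R * R * R) => H p.1 (G p.1 p.2)) =
      (fun p => H p.1 p.2) \o (fun p : R * (R * R * R) => (p.1, G p.1 p.2)) by [].
  apply/subspace_continuousP => p [/= p1 _].
  have cg : {for p, continuous (fun p : R * (R * R * R) => (p.1, G p.1 p.2))}.
    by apply: (@cont_pair _ _ _ (fun p : R * (R * R * R) => p.1)) => //; cont.
  move/subspace_continuousP : cH => /(_ (p.1, G p.1 p.2) (conj p1 I)) cH X /cH.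
  rewrite /nbhs /= /within /= => nX; have := cg _ nX; rewrite /nbhs /=.
  by apply: filterS => q /= Hq [q1 _]; apply: Hq.
- move=> t t01; have [ch [h' [ch' hk h'k]]] := hH t t01.
  have iG : isotopy G G' by [].
  split; first by apply: cont_comp => //; exact: isotopy_cont iG.
  exists (fun x => G' t (h' x)); split.
  + by apply: cont_comp => //; exact: isotopy_cont (isotopy_sym iG).
  + by move=> x; rewrite hk k.
  + by move=> x; rewrite k' h'k.
- by move=> p; rewrite g0 H0.
- by rewrite image_comp.
Qed.
End Ambient.

(** * Extension of Lipschitz motions *)

Section LipschitzPerturbation.
Context {R : realType} {S : topologicalType} {E : completeNormedModType R}.

Lemma contraction_fixpoint (g : E -> E) (l : R) : 0 <= l -> l < 1 ->
  (forall x x', `|g x - g x'| <= l * `|x - x'|) -> exists x, x = g x.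
Proof.
move=> l0 l1 lg.
have sg : {homo g : x / [set: E] x >-> [set: E] x} by [].
pose f : {fun [set: E] >-> [set: E]} := mkfun sg.
have fc : is_contraction f.
  exists (NngNum l0); split => //= -[x x'] _ /=; exact: lg.
have [x _ xg] := banach_fixed_point fc closedT (ex_intro _ 0 I).
by exists x.
Qed.

(** The equation [x + G s x = y] is a fixed point problem for the contraction [x => y - G s x]. The
    map shrinks distances at most by the factor [1 - l], which gives uniqueness of the solution and
    its joint continuity. *)
Lemma lipschitz_perturbation_inverse (G : S -> E -> E) (l : R) : 0 <= l -> l < 1 ->
  continuous (fun p : S * E => G p.1 p.2) ->
  (forall s x x', `|G s x - G s x'| <= l * `|x - x'|) ->
  exists J : S -> E -> E, [/\ continuous (fun p : S * E => J p.1 p.2),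
    forall s, cancel (fun x => x + G s x) (J s) & forall s, cancel (J s) (fun x => x + G s x)].
Proof.
move=> l0 l1 cG lG.
have ex (p : S * E) : exists x, x + G p.1 x = p.2.
  have [|x xE] := @contraction_fixpoint (fun x => p.2 - G p.1 x) l l0 l1.
    by move=> x x'; rewrite opprD opprK addrACA subrr add0r addrC distrC lG.
  by exists x; rewrite [X in X + _]xE subrK.
have [J JE] := choice ex.
have expand s x x' : (1 - l) * `|x - x'| <= `|(x + G s x) - (x' + G s x')|.
  rewrite mulrBl mul1r lerBlDr.
  rewrite {1}(_ : x - x' = x + G s x - (x' + G s x') - (G s x - G s x')); last first.
    by rewrite (opprD x') addrACA addrK.
  by apply: (le_trans (ler_normB _ _)); rewrite lerD2l lG.
have l1' : 0 < 1 - l by rewrite subr_gt0.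
exists (fun s y => J (s, y)); split.
- move=> [s0 y0]; set x0 := J (s0, y0).
  (* A bound for the distance from [J p] to [x0] in which [J] does not occur: it is continuous and
     vanishes at [(s0, y0)]. *)
  pose k (p : S * E) := (1 - l)^-1 * `|p.2 - (x0 + G p.1 x0)|.
  have ck : continuous k.
    rewrite /k; cont.
    apply: (@cont_comp _ _ _ (fun p : S * E => G p.1 p.2) (fun p : S * E => (p.1, x0))) => //.
    by cont.
  have k0 : k (s0, y0) = 0 by rewrite /k /x0 /= (JE (s0, y0)) /= subrr normr0 mulr0.
  apply/cvgrPdist_le => /= e e0.
  have /cvgrPdist_le/(_ e e0) := ck (s0, y0); rewrite k0.
  apply: filterS => -[s y]; rewrite sub0r normrN /= => kp.
  rewrite distrC; apply: le_trans (le_trans (ler_norm _) kp).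
  rewrite /k /= mulrC ler_pdivlMr// mulrC.
  by apply: (le_trans (expand s _ _)); rewrite (JE (s, y)).
- move=> s x; apply/eqP; rewrite -subr_eq0 -normr_le0 -(pmulr_rle0 _ l1').
  by apply: (le_trans (expand s _ _)); rewrite (JE (s, _)) /= subrr normr0.
- by move=> s y; exact: (JE (s, y)).
Qed.
End LipschitzPerturbation.

HB.instance Definition _ (U V : puniformType) := Pointed.on (U * V)%type.
Section ProductComplete.
Variables (U V : completeType).
(** Banach's theorem is applied in the plane and in space, which are products; the limit is taken
    coordinate by coordinate. *)
Lemma prod_complete (F : set_system (U * V)) : ProperFilter F -> cauchy F -> cvg (F : set_system (U*V)).
Proof.
move=> PF cF.
have c1 : cauchy (fst @ F).
  move=> A entA; have := cF [set p : (U*V)*(U*V) | A (p.1.1, p.2.1)].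
  rewrite /=; case.
    exists (A, setT) => /=; first by split => //; exact: filterT.
    by move=> [[a b][c d]] /= [? _]; exists ((a, c), (b, d)).
  move=> [P Q] [/= FP FQ] PQ.
  exists ([set a | exists2 p, P p & p.1 = a], [set a | exists2 p, Q p & p.1 = a]) => /=.
    by split; [apply: filterS FP => p Pp; exists p|apply: filterS FQ => p Pp; exists p].
  move=> [a b] /= [[p Pp <-] [q Qq <-]].
  by apply: (PQ (p,q)).
have c2 : cauchy (snd @ F).
  move=> A entA; have := cF [set p : (U*V)*(U*V) | A (p.1.2, p.2.2)].
  rewrite /=; case.
    exists (setT, A) => /=; first by split => //; exact: filterT.
    by move=> [[a b][c d]] /= [_ ?]; exists ((a, c), (b, d)).
  move=> [P Q] [/= FP FQ] PQ.
  exists ([set a | exists2 p, P p & p.2 = a], [set a | exists2 p, Q p & p.2 = a]) => /=.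
    by split; [apply: filterS FP => p Pp; exists p|apply: filterS FQ => p Pp; exists p].
  move=> [a b] /= [[p Pp <-] [q Qq <-]].
  by apply: (PQ (p,q)).
have Ha : fst @ F --> lim (fst @ F) by apply: cauchy_cvg; exact: c1.
have Hb : snd @ F --> lim (snd @ F) by apply: cauchy_cvg; exact: c2.
apply: (@cvgP _ _ (lim (fst @ F), lim (snd @ F))).
move=> X nX; have H := cvg_pair Ha Hb nX.
have FX : F ((fun x : U * V => (x.1, x.2)) @^-1` X).
  by apply: H; apply: filter_filter.
by apply: filterS FX => -[].
Qed.
HB.instance Definition _ := Uniform_isComplete.Build (U * V)%type prod_complete.
End ProductComplete.

(* McShane's extension: the infimum over A of D a + L |x - a|. *)
Section McShane.
Context {R : realType} {E : normedModType R}.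

Lemma mcshane (A : set E) (D : E -> R) (L : R) : 0 <= L ->
  (forall a b, A a -> A b -> `|D a - D b| <= L * `|a - b|) ->
  exists D' : E -> R, (forall a, A a -> D' a = D a) /\
    (forall a b, `|D' a - D' b| <= L * `|a - b|).
Proof.
move=> L0 lD.
have [[a0 Aa0]|A0] := pselect (A !=set0); last first.
  exists (fun=> 0); split=> [a Aa|a b]; first by case: A0; exists a.
  by rewrite subrr normr0 mulr_ge0.
pose V x := [set D a + L * `|x - a| | a in A].
have lbV x : lbound (V x) (D a0 - L * `|x - a0|).
  move=> _ [a Aa <-]; rewrite lerBlDr -addrA -mulrDr -lerBlDl.
  apply: le_trans (ler_norm _) _; apply: (le_trans (lD _ _ Aa0 Aa)).
  by apply: ler_wpM2l => //; rewrite [leRHS]addrC (distrC x a0); exact: ler_distD.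
have infV x : has_inf (V x).
  by split; [exists (D a0 + L * `|x - a0|), a0|exists (D a0 - L * `|x - a0|)].
have le1 x y : inf (V x) - L * `|x - y| <= inf (V y).
  apply: lb_le_inf; first by case: (infV y).
  move=> _ [a Aa <-]; rewrite lerBlDr.
  have : inf (V x) <= D a + L * `|x - a| by apply: ge_inf; [case: (infV x)|exists a].
  move=> /le_trans; apply; rewrite -addrA lerD2l -mulrDr ler_wpM2l// [leRHS]addrC.
  exact: ler_distD.
exists (fun x => inf (V x)); split=> [a Aa|a b].
  apply/eqP; rewrite eq_le; apply/andP; split.
    apply: ge_inf; [by case: (infV a)|exists a => //].
    by rewrite subrr normr0 mulr0 addr0.
  apply: lb_le_inf; first by case: (infV a).
  move=> _ [b Ab <-]; rewrite -lerBlDl; apply: (le_trans (ler_norm _)).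
  exact: lD.
rewrite ler_norml; apply/andP; split.
  by rewrite lerBrDl distrC; apply: le1.
by rewrite lerBlDr -lerBlDl; apply: le1.
Qed.
End McShane.

(** The property of the space on which linear motions depend. It is used in the plane, to contract
    the poles, and in space, to move polygons. *)
Definition lipschitz_extendable {R : realType} (E : normedModType R) :=
  forall (A : set E) (D : E -> E) (L : R), 0 <= L ->
  (forall a b, A a -> A b -> `|D a - D b| <= L * `|a - b|) ->
  exists D' : E -> E, (forall a, A a -> D' a = D a) /\
    (forall a b, `|D' a - D' b| <= L * `|a - b|).

Lemma prod_normE (R : realType) (U V : normedModType R) (p : U * V) :
  `|p| = Num.max `|p.1| `|p.2|.
Proof. by []. Qed.

(** McShane's extension of each coordinate; as the norm of a product is the maximum of the norms,
    the constant is preserved. *)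
Lemma lipschitz_extendable_plane (R : realType) : lipschitz_extendable (R * R)%type.
Proof.
move=> A D L L0 lD.
have [||D1 [E1 L1]] := @mcshane R _ A (fun p => (D p).1) L => //.
  by move=> a b Aa Ab; apply: le_trans (lD a b Aa Ab); rewrite prod_normE le_max lexx.
have [||D2 [E2 L2]] := @mcshane R _ A (fun p => (D p).2) L => //.
  by move=> a b Aa Ab; apply: le_trans (lD a b Aa Ab); rewrite prod_normE le_max lexx orbT.
exists (fun p => (D1 p, D2 p)); split=> [a Aa|a b].
  by rewrite E1// E2//; case: (D a).
by rewrite prod_normE ge_max L1 L2.
Qed.

Lemma lipschitz_isotopy {R : realType} {E : completeNormedModType R} (G : R -> E -> E) (l : R) :
  0 <= l -> l < 1 -> continuous (fun p : R * E => G p.1 p.2) ->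
  (forall t x x', `|G t x - G t x'| <= l * `|x - x'|) -> (forall x, G 0 x = 0) ->
  exists J, isotopy (fun t x => x + G t x) J.
Proof.
move=> l0 l1 cG lG G0; have [J [cJ GJ JG]] := lipschitz_perturbation_inverse l0 l1 cG lG.
by exists J; split => // [|x]; [cont|rewrite G0 addr0].
Qed.

Lemma lipschitz_continuous {R : realType} {E F : normedModType R} (g : E -> F) (L : R) :
  (forall x y, `|g x - g y| <= L * `|x - y|) -> continuous g.
Proof.
move=> lg x; apply/cvgrPdist_le => e e0.
have L1 : 0 < `|L| + 1 by rewrite ltr_wpDl.
near=> y; apply: (le_trans (lg x y)).
have : `|x - y| <= e / (`|L| + 1).
  near: y; apply: (@cvgr_dist_le _ _ _ _ (nbhs_filter x) id x _ (e / (`|L| + 1))); first exact: cvg_id.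
  by rewrite divr_gt0.
rewrite ler_pdivlMr// mulrC; apply: le_trans.
by rewrite ler_wpM2r// (le_trans (ler_norm _))// lerDl.
Unshelve. all: by end_near.
Qed.

Section LinearIsotopy.
Context {R : realType} {E : completeNormedModType R}.
Hypothesis ext : lipschitz_extendable E.

(* The straight-line homotopy is followed in N steps, each of which extends the
   velocity, seen as a Lipschitz map on the current positions, to all of E. *)
Lemma linear_isotopy (I : Type) (S : set I) (f0 D : I -> E) (c : R) : 0 < c ->
  (forall (t : R) s s', 0 <= t <= 1 -> S s -> S s' ->
     c * `|D s - D s'| <= `|(f0 s + t *: D s) - (f0 s' + t *: D s')|) ->
  exists H H' : R -> E -> E, isotopy H H' /\
    forall (t : R) s, 0 <= t <= 1 -> S s -> H t (f0 s) = f0 s + t *: D s.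
Proof.
(* The extended velocity has Lipschitz constant [c^-1]. Followed for a time [N^-1] it perturbs the
   identity by a map of constant at most 1/2, which [lipschitz_isotopy] inverts. *)
move=> c0 cD; pose N := (Num.truncn (2 / c)).+1.
have N0 : 0 < N%:R :> R by rewrite ltr0n.
have Nc : (c * N%:R)^-1 <= 2^-1.
  rewrite lef_pV2 ?posrE ?mulr_gt0// mulrC -ler_pdivrMr//.
  by apply: ltW; rewrite truncnS_gt.
suff /(_ N (leqnn _)) [H [H' [iH HE]]] : forall k, (k <= N)%N -> exists H H' : R -> E -> E,
    isotopy H H' /\ forall (t : R) s, 0 <= t -> S s ->
      H t (f0 s) = f0 s + Num.min t (k%:R / N%:R) *: D s.
  exists H, H'; split=> // t s /andP[t0 t1] Ss; rewrite HE//.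
  by rewrite divff ?gt_eqF// min_l.
elim=> [_|k IHk kN].
  exists (fun _ x => x), (fun _ x => x); split; first exact: isotopy_id.
  by move=> t s t0 _; rewrite mul0r min_r// scale0r addr0.
have {IHk} [H [H' [iH HE]]] := IHk (ltnW kN).
set tau : R := k%:R / N%:R in HE.
have tau0 : 0 <= tau by rewrite divr_ge0.
have tau1 : 0 <= tau <= 1 by rewrite tau0 ler_pdivrMr// mul1r ler_nat ltnW.
pose f s := f0 s + tau *: D s.
have [[s0 Ss0]|S0] := pselect (S !=set0); last first.
  by exists H, H'; split=> // t s _ Ss; case: S0; exists s.
have ex x : exists s, (f @` S) x -> S s /\ f s = x.
  have [[s Ss <-]|nx] := pselect ((f @` S) x); first by exists s.
  by exists s0.
have [g gE] := choice ex.
(* By [cD], indices at the same position have the same velocity, so the velocity is a function of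
   the position. *)
have gf s : S s -> S (g (f s)) /\ D (g (f s)) = D s.
  move=> Ss; have [Sg fg] := gE (f s) (imageP _ Ss); split=> //.
  apply/eqP; rewrite -subr_eq0 -normr_le0 -(pmulr_rle0 _ c0).
  by apply: (le_trans (cD tau _ _ tau1 Sg Ss)); rewrite -!/(f _) fg subrr normr0.
have [||D' [D'E lD']] := @ext (f @` S) (fun x => D (g x)) c^-1; first by rewrite invr_ge0 ltW.
  move=> _ _ [s Ss <-] [s' Ss' <-]; rewrite !(gf _ _).2//.
  by rewrite mulrC ler_pdivlMr// mulrC cD.
(* The time spent in the current step: 0 until [tau] and constant from [tau + N^-1] on, so that the
   steps compose for all times at once. *)
pose u (t : R) := Num.max 0 (Num.min (t - tau) N%:R^-1).
have u_ge0 t : 0 <= u t by rewrite le_max lexx.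
have u_le t : u t <= N%:R^-1 by rewrite ge_max ge_min lexx orbT invr_ge0 ltW.
have [|||||J iJ] := @lipschitz_isotopy R E (fun t x => u t *: D' x) 2^-1.
- by rewrite invr_ge0.
- by rewrite invf_lt1// ltr1n.
- rewrite /u; cont; apply: (@cont_comp _ _ _ D') => //; last by cont.
  exact: lipschitz_continuous lD'.
- move=> t x x'; rewrite -scalerBr normrZ ger0_norm//.
  apply: (le_trans (ler_wpM2l (u_ge0 t) (lD' x x'))); rewrite mulrA.
  apply: ler_wpM2r => //; apply: le_trans Nc; rewrite invfM mulrC.
  by rewrite ler_wpM2l// invr_ge0 ltW.
- move=> x; rewrite /u sub0r (_ : Num.max _ _ = 0) ?scale0r//.
  by apply/max_idPl; rewrite ge_min oppr_le0 tau0.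
exists (fun t x => H t x + u t *: D' (H t x)), (fun t x => H' t (J t x)); split.
  exact: isotopy_comp iH iJ.
move=> t s t0 Ss; rewrite HE// /u.
have [tt|tt] := leP t tau.
  rewrite (_ : Num.max _ _ = 0); last by apply/max_idPl; rewrite ge_min subr_le0 tt.
  rewrite scale0r addr0; congr (_ + _ *: _); apply/esym/min_idPl.
  by apply: (le_trans tt); rewrite ler_wpM2r ?invr_ge0 ?(ltW N0)// ler_nat.
rewrite D'E; last by exists s.
rewrite (gf _ Ss).2 -addrA -scalerDl; congr (_ + _ *: _).
rewrite max_r; last by rewrite le_min subr_ge0 ltW//= invr_ge0 ltW.
rewrite /tau -natr1 mulrDl mul1r -/tau addr_minr subrKC.
by rewrite addrC.
Qed.
End LinearIsotopy.

Section CompactExtension.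
Context {R : realType} {P : normedModType R}.

(* A compact single-valued relation is the graph of a continuous function on a
   compact set, to which Tietze's theorem applies. *)
Lemma compact_relation_extension (G : set (P * R)) : compact G ->
  (forall p v w, G (p, v) -> G (p, w) -> v = w) ->
  exists D : P -> R, continuous D /\ forall p v, G (p, v) -> D p = v.
Proof.
move=> cG fG; pose A := fst @` G.
have cfst : continuous (fst : P * R -> P) by apply: cont_fst; exact: cont_id.
have csnd : continuous (snd : P * R -> R) by apply: cont_snd; exact: cont_id.
have clA (B : set (P * R)) : closed B -> closed (fst @` (G `&` B)).
  move=> clB; apply: compact_closed; first exact: norm_hausdorff.
  apply: continuous_compact; last exact: compact_closedI.
  exact: continuous_subspaceT.
have ex p : exists v, A p -> G (p, v).
  have [[[q v] Gq /= <-]|nA] := pselect (A p); first by exists v.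
  by exists 0.
have [d dG] := choice ex.
have [M [Mr MG]] := compact_bounded cG.
pose M1 : R := Num.max 1 (M + 1).
have M10 : 0 < M1 by rewrite lt_max ltr01.
have dM p : A p -> `|d p| <= M1.
  move=> Ap; have : `|(p, d p)| <= M1.
    by apply: MG; [rewrite lt_max ltrDl ltr01 orbT|exact: dG].
  by apply: le_trans; rewrite prod_normE le_max lexx orbT.
(* The preimage of a closed set is the projection of a closed part of the compact graph. *)
have cd : {within A, continuous (d : P -> R^o)}.
  apply/continuous_closedP => C clC; apply/closed_subspaceP.
  exists (fst @` (G `&` snd @^-1` C)).
    by apply: clA; apply: closed_comp => // p _; exact: csnd.
  apply/seteqP; split=> p [].
    move=> [[q v] [/= Gq Cv] /= <-] Aq; split=> //=.
    by change (C (d q)); rewrite (fG _ _ _ (dG _ Aq) Gq).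
  by move=> /= Cd Ap; split=> //; exists (p, d p) => //; split=> //; exact: dG.
have clA' : closed A by rewrite /A -(setIT G); apply: clA; exact: closedT.
have [g [gd cg _]] := continuous_bounded_extension pseudometric_normal clA' M10 cd dM.
exists g; split=> // p v Gpv.
have Ap : A p by exists (p, v).
by rewrite -gd ?inE//; apply: fG (dG _ Ap) Gpv.
Qed.
End CompactExtension.

(** * Isotopies along the coordinates *)

Section LineIsotopy.
Context {R : realType}.
Local Notation Q := (R * R)%type.

Definition clamp (t : R) : R := Num.max 0 (Num.min t 1).

Lemma clamp0 : clamp 0 = 0.
Proof. by rewrite /clamp min_l// maxxx. Qed.
Lemma clamp1 : clamp 1 = 1.
Proof. by rewrite /clamp minxx max_r. Qed.
Lemma clamp_ge0 t : 0 <= clamp t.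
Proof. by rewrite le_max lexx. Qed.
Lemma clamp_le1 t : clamp t <= 1.
Proof. by rewrite ge_max ge_min lexx orbT ler01. Qed.
Lemma clamp_id t : 0 <= t <= 1 -> clamp t = t.
Proof. by move=> /andP[t0 t1]; rewrite /clamp min_l// max_r. Qed.
Lemma clamp_le0 t : t <= 0 -> clamp t = 0.
Proof. by move=> t0; rewrite /clamp max_l// ge_min t0. Qed.
Lemma clamp_ge1 t : 1 <= t -> clamp t = 1.
Proof. by move=> t1; rewrite /clamp min_r// max_r. Qed.
Lemma clamp_le s t : s <= t -> clamp s <= clamp t.
Proof.
move=> st; have [s0|s0] := leP s 0; first by rewrite clamp_le0// clamp_ge0.
have [t1|t1] := leP 1 t; first by rewrite (clamp_ge1 t1) clamp_le1.
by rewrite !clamp_id//; flra.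
Qed.
Lemma clamp_lt1 t : t < 1 -> clamp t < 1.
Proof. by move=> t1; rewrite /clamp gt_max ltr01 gt_min t1. Qed.
Lemma cont_clamp (T : topologicalType) (f : T -> R) :
  continuous f -> continuous (fun x => clamp (f x)).
Proof. by rewrite /clamp => cf; cont. Qed.

(** [q] stands for the two other coordinates: each construction is made once, on a line with
    parameters, and then used along any of the three axes. *)
Definition line_isotopy (phi phi' : R -> Q -> R -> R) :=
  [/\ continuous (fun p : R * Q * R => phi p.1.1 p.1.2 p.2),
      continuous (fun p : R * Q * R => phi' p.1.1 p.1.2 p.2),
      (forall t q, cancel (phi t q) (phi' t q)), (forall t q, cancel (phi' t q) (phi t q))
    & forall q x, phi 0 q x = x].

Lemma line_isotopy_affine (a b : Q -> R) : continuous a -> continuous b ->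
  (forall q, 0 < a q) -> exists phi phi', line_isotopy phi phi' /\
    forall q x, phi 1 q x = a q * x + b q.
Proof.
move=> ca cb a0; pose s t q := (1 - clamp t) + clamp t * a q.
have s0 t q : 0 < s t q.
  rewrite /s; have [->|t1] := eqVneq (clamp t) 1; first by rewrite subrr add0r mul1r.
  by rewrite ltr_pwDl// ?subr_gt0 ?lt_neqAle ?t1 ?clamp_le1// mulr_ge0 ?clamp_ge0// ltW.
have sn t q : s t q != 0 by rewrite gt_eqF.
have cs : continuous (fun p : R * Q * R => s p.1.1 p.1.2).
  rewrite /s; cont.
    by apply: cont_clamp; cont.
    by apply: cont_clamp; cont.
  by apply: (@cont_comp _ _ _ a) => //; cont.
have cb' : continuous (fun p : R * Q * R => clamp p.1.1 * b p.1.2).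
  cont; first by apply: cont_clamp; cont.
  by apply: (@cont_comp _ _ _ b) => //; cont.
exists (fun t q x => s t q * x + clamp t * b q), (fun t q x => (x - clamp t * b q) / s t q).
split; first split.
- by cont.
- by cont; apply: cont_inv.
- by move=> t q x; rewrite addrK mulrC mulrA mulVf ?mul1r.
- by move=> t q x; rewrite mulrC divfK ?subrK.
- by move=> q x; rewrite /s clamp0 subr0 !mul0r !addr0 mul1r.
- by move=> q x; rewrite /s clamp1 subrr add0r !mul1r.
Qed.

Lemma line_isotopy_lipschitz (D : Q -> R -> R) (l : R) : 0 <= l -> l < 1 ->
  continuous (fun p : Q * R => D p.1 p.2) ->
  (forall q x x', `|D q x - D q x'| <= l * `|x - x'|) ->
  exists phi phi', line_isotopy phi phi' /\ forall q x, phi 1 q x = x + D q x.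
Proof.
move=> l0 l1 cD lD.
have [||J [cJ JK KJ]] := @lipschitz_perturbation_inverse R (R * Q)%type R^o
    (fun s x => clamp s.1 * D s.2 x) l l0 l1.
- cont; first by apply: cont_clamp; cont.
  by apply: (@cont_comp _ _ _ (fun p : Q * R => D p.1 p.2) (fun p : R * Q * R => (p.1.2, p.2))); cont.
- move=> s x x'; rewrite -mulrBr normrM ger0_norm ?clamp_ge0//.
  apply: le_trans (lD s.2 x x'); rewrite -[leRHS]mul1r ler_wpM2r//.
  exact: clamp_le1.
exists (fun t q x => x + clamp t * D q x), (fun t q x => J (t, q) x); split; first split.
- cont; first by apply: cont_clamp; cont.
  by apply: (@cont_comp _ _ _ (fun p : Q * R => D p.1 p.2) (fun p : R * Q * R => (p.1.2, p.2))); cont.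
- apply: (@cont_comp _ _ _ (fun p : R * Q * R => J p.1 p.2)
    (fun p : R * Q * R => ((p.1.1, p.1.2), p.2))) => //; cont.
- by move=> t q x; exact: (JK (t, q)).
- by move=> t q x; exact: (KJ (t, q)).
- by move=> q x; rewrite clamp0 mul0r addr0.
- by move=> q x; rewrite clamp1 mul1r.
Qed.

(** The half-line below [d] is stretched about [d] by the factor [1 + h q]. As [h] may be large this
    is no contractive perturbation of the identity, and the inverse is given explicitly. *)
Lemma line_isotopy_push (h : Q -> R) (d : R) : continuous h -> (forall q, 0 <= h q) ->
  exists phi phi', line_isotopy phi phi' /\
    forall q x, phi 1 q x = x - h q * Num.max 0 (d - x).
Proof.
move=> ch h0; pose s t q := 1 + clamp t * h q.
have s0 t q : 0 < s t q by rewrite ltr_pwDl// mulr_ge0// clamp_ge0.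
have sn t q : s t q != 0 by rewrite gt_eqF.
have sE t q : clamp t * h q = s t q - 1 by rewrite /s addrAC subrr add0r.
have cs : continuous (fun p : R * Q * R => s p.1.1 p.1.2).
  rewrite /s; cont; first by apply: cont_clamp; cont.
  by apply: (@cont_comp _ _ _ h) => //; cont.
exists (fun t q x => x - (s t q - 1) * Num.max 0 (d - x)),
  (fun t q x => x + (1 - (s t q)^-1) * Num.max 0 (d - x)); split; first split.
- by cont.
- by cont; apply: cont_inv.
- move=> t q x; have [xd|xd] := leP d x.
    by rewrite !(max_l (_ : d - x <= 0)) ?subr_le0// mulr0 subr0 max_l ?subr_le0// mulr0 addr0.
  rewrite (max_r (_ : 0 <= d - x)) ?subr_ge0 1?ltW//.
  have -> : d - (x - (s t q - 1) * (d - x)) = s t q * (d - x) by ring.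
  rewrite max_r; last by rewrite mulr_ge0 ?subr_ge0// ltW.
  by field.
- move=> t q x; have [xd|xd] := leP d x.
    by rewrite !(max_l (_ : d - x <= 0)) ?subr_le0// mulr0 addr0 max_l ?subr_le0// mulr0 subr0.
  rewrite (max_r (_ : 0 <= d - x)) ?subr_ge0 1?ltW//.
  have -> : d - (x + (1 - (s t q)^-1) * (d - x)) = (s t q)^-1 * (d - x) by ring.
  rewrite max_r; last by rewrite mulr_ge0 ?invr_ge0 ?subr_ge0// ltW.
  by field.
- by move=> q x; rewrite -sE clamp0 !mul0r subr0.
- by move=> q x; rewrite -sE clamp1 mul1r.
Qed.

Lemma line_isotopy_opp phi phi' : line_isotopy phi phi' ->
  line_isotopy (fun t q x => - phi t q (- x)) (fun t q x => - phi' t q (- x)).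
Proof.
move=> [c c' k k' p0]; split.
- cont; apply: (@cont_comp _ _ _ (fun p : R * Q * R => phi p.1.1 p.1.2 p.2)
    (fun p : R * Q * R => (p.1, - p.2))) => //; cont.
- cont; apply: (@cont_comp _ _ _ (fun p : R * Q * R => phi' p.1.1 p.1.2 p.2)
    (fun p : R * Q * R => (p.1, - p.2))) => //; cont.
- by move=> t q x; rewrite opprK k opprK.
- by move=> t q x; rewrite opprK k' opprK.
- by move=> q x; rewrite p0 opprK.
Qed.

Lemma line_isotopic_x phi phi' (K : set (R * R * R)) : line_isotopy phi phi' ->
  @isotopic R _ K ((fun p => (phi 1 (p.1.2, p.2) p.1.1, p.1.2, p.2)) @` K).
Proof.
move=> [c c' k k' p0].
exists (fun t p => (phi t (p.1.2, p.2) p.1.1, p.1.2, p.2)),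
  (fun t p => (phi' t (p.1.2, p.2) p.1.1, p.1.2, p.2)); split=> //; split.
- cont; apply: (@cont_comp _ _ _ (fun p : R * Q * R => phi p.1.1 p.1.2 p.2)
    (fun p : R * (R * R * R) => (p.1, (p.2.1.2, p.2.2), p.2.1.1))) => //; cont.
- cont; apply: (@cont_comp _ _ _ (fun p : R * Q * R => phi' p.1.1 p.1.2 p.2)
    (fun p : R * (R * R * R) => (p.1, (p.2.1.2, p.2.2), p.2.1.1))) => //; cont.
- by move=> t [[x y] z] /=; rewrite k.
- by move=> t [[x y] z] /=; rewrite k'.
- by move=> [[x y] z] /=; rewrite p0.
Qed.

Lemma line_isotopic_y phi phi' (K : set (R * R * R)) : line_isotopy phi phi' ->
  @isotopic R _ K ((fun p => (p.1.1, phi 1 (p.1.1, p.2) p.1.2, p.2)) @` K).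
Proof.
move=> [c c' k k' p0].
exists (fun t p => (p.1.1, phi t (p.1.1, p.2) p.1.2, p.2)),
  (fun t p => (p.1.1, phi' t (p.1.1, p.2) p.1.2, p.2)); split=> //; split.
- cont; apply: (@cont_comp _ _ _ (fun p : R * Q * R => phi p.1.1 p.1.2 p.2)
    (fun p : R * (R * R * R) => (p.1, (p.2.1.1, p.2.2), p.2.1.2))) => //; cont.
- cont; apply: (@cont_comp _ _ _ (fun p : R * Q * R => phi' p.1.1 p.1.2 p.2)
    (fun p : R * (R * R * R) => (p.1, (p.2.1.1, p.2.2), p.2.1.2))) => //; cont.
- by move=> t [[x y] z] /=; rewrite k.
- by move=> t [[x y] z] /=; rewrite k'.
- by move=> [[x y] z] /=; rewrite p0.
Qed.

Lemma line_isotopic_z phi phi' (K : set (R * R * R)) : line_isotopy phi phi' ->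
  @isotopic R _ K ((fun p => (p.1.1, p.1.2, phi 1 p.1 p.2)) @` K).
Proof.
move=> [c c' k k' p0].
exists (fun t p => (p.1.1, p.1.2, phi t p.1 p.2)),
  (fun t p => (p.1.1, p.1.2, phi' t p.1 p.2)); split=> //; split.
- cont; apply: (@cont_comp _ _ _ (fun p : R * Q * R => phi p.1.1 p.1.2 p.2)
    (fun p : R * (R * R * R) => (p.1, p.2.1, p.2.2))) => //; cont.
- cont; apply: (@cont_comp _ _ _ (fun p : R * Q * R => phi' p.1.1 p.1.2 p.2)
    (fun p : R * (R * R * R) => (p.1, p.2.1, p.2.2))) => //; cont.
- by move=> t [[x y] z] /=; rewrite k.
- by move=> t [[x y] z] /=; rewrite k'.
- by move=> [[x y] z] /=; rewrite p0.
Qed.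

End LineIsotopy.

Section CoordinateIsotopies.
Context {R : realType}.
Local Notation Q := (R * R)%type.
Implicit Types (K : set (R * R * R)).

Lemma isotopic_image_eq K (f g : R * R * R -> R * R * R) :
  (forall p, K p -> f p = g p) -> @isotopic R _ K (f @` K) -> @isotopic R _ K (g @` K).
Proof. by move=> fg; rewrite (eq_imagel fg). Qed.

Lemma affine_isotopic_x K (a b : Q -> R) : continuous a -> continuous b -> (forall q, 0 < a q) ->
  @isotopic R _ K ((fun p => (a (p.1.2, p.2) * p.1.1 + b (p.1.2, p.2), p.1.2, p.2)) @` K).
Proof.
move=> ca cb a0; have [f [f' [fi fE]]] := line_isotopy_affine ca cb a0.
by have := line_isotopic_x K fi; apply: isotopic_image_eq => p _; rewrite fE.
Qed.
Lemma affine_isotopic_y K (a b : Q -> R) : continuous a -> continuous b -> (forall q, 0 < a q) ->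
  @isotopic R _ K ((fun p => (p.1.1, a (p.1.1, p.2) * p.1.2 + b (p.1.1, p.2), p.2)) @` K).
Proof.
move=> ca cb a0; have [f [f' [fi fE]]] := line_isotopy_affine ca cb a0.
by have := line_isotopic_y K fi; apply: isotopic_image_eq => p _; rewrite fE.
Qed.
Lemma shear_isotopic_x K (b : Q -> R) : continuous b ->
  @isotopic R _ K ((fun p => (p.1.1 + b (p.1.2, p.2), p.1.2, p.2)) @` K).
Proof.
move=> cb; have := @affine_isotopic_x K (fun=> 1) b (@cont_cst _ _ _) cb (fun=> ltr01).
by apply: isotopic_image_eq => p _; rewrite mul1r.
Qed.
Lemma shear_isotopic_y K (b : Q -> R) : continuous b ->
  @isotopic R _ K ((fun p => (p.1.1, p.1.2 + b (p.1.1, p.2), p.2)) @` K).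
Proof.
move=> cb; have := @affine_isotopic_y K (fun=> 1) b (@cont_cst _ _ _) cb (fun=> ltr01).
by apply: isotopic_image_eq => p _; rewrite mul1r.
Qed.
Lemma shear_isotopic_z K (b : Q -> R) : continuous b ->
  @isotopic R _ K ((fun p => (p.1.1, p.1.2, p.2 + b p.1)) @` K).
Proof.
move=> cb; have [f [f' [fi fE]]] := @line_isotopy_affine R (fun=> 1) b (@cont_cst _ _ _) cb (fun=> ltr01).
by have := line_isotopic_z K fi; apply: isotopic_image_eq => p _; rewrite fE mul1r.
Qed.
Lemma lipschitz_isotopic_x K (D : Q -> R -> R) (l : R) : 0 <= l -> l < 1 ->
  continuous (fun p : Q * R => D p.1 p.2) ->
  (forall q x x', `|D q x - D q x'| <= l * `|x - x'|) ->
  @isotopic R _ K ((fun p => (p.1.1 + D (p.1.2, p.2) p.1.1, p.1.2, p.2)) @` K).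
Proof.
move=> l0 l1 cD lD; have [f [f' [fi fE]]] := line_isotopy_lipschitz l0 l1 cD lD.
by have := line_isotopic_x K fi; apply: isotopic_image_eq => p _; rewrite fE.
Qed.
Lemma lipschitz_isotopic_y K (D : Q -> R -> R) (l : R) : 0 <= l -> l < 1 ->
  continuous (fun p : Q * R => D p.1 p.2) ->
  (forall q x x', `|D q x - D q x'| <= l * `|x - x'|) ->
  @isotopic R _ K ((fun p => (p.1.1, p.1.2 + D (p.1.1, p.2) p.1.2, p.2)) @` K).
Proof.
move=> l0 l1 cD lD; have [f [f' [fi fE]]] := line_isotopy_lipschitz l0 l1 cD lD.
by have := line_isotopic_y K fi; apply: isotopic_image_eq => p _; rewrite fE.
Qed.
Lemma push_isotopic_z K (h : Q -> R) (d : R) : continuous h -> (forall q, 0 <= h q) ->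
  @isotopic R _ K ((fun p => (p.1.1, p.1.2, p.2 - h p.1 * Num.max 0 (d - p.2))) @` K).
Proof.
move=> ch h0; have [f [f' [fi fE]]] := line_isotopy_push d ch h0.
by have := line_isotopic_z K fi; apply: isotopic_image_eq => p _; rewrite fE.
Qed.
Lemma pull_isotopic_z K (h : Q -> R) (d : R) : continuous h -> (forall q, 0 <= h q) ->
  @isotopic R _ K ((fun p => (p.1.1, p.1.2, p.2 + h p.1 * Num.max 0 (d + p.2))) @` K).
Proof.
move=> ch h0; have [f [f' [fi fE]]] := line_isotopy_push d ch h0.
have := line_isotopic_z K (line_isotopy_opp fi); apply: isotopic_image_eq => p _.
by rewrite fE opprB !opprK addrC.
Qed.

(* A plane isotopy followed up to a time depending on the height. *)
Lemma level_isotopic K (H H' : R -> Q -> Q) (c : R -> R) : isotopy H H' -> continuous c ->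
  @isotopic R _ K ((fun p => ((H (c p.1.2) (p.1.1, p.2)).1, p.1.2, (H (c p.1.2) (p.1.1, p.2)).2)) @` K).
Proof.
move=> iH cc; pose g (q : Q) (p : R * R * R) : R * R * R := (q.1, p.1.2, q.2).
exists (fun t p => g (H (t * c p.1.2) (p.1.1, p.2)) p), (fun t p => g (H' (t * c p.1.2) (p.1.1, p.2)) p).
split; last by apply: eq_imagel => p _; rewrite /g !mul1r.
apply: (@isotopy_reparam R _ H H' _ (fun t (p : R * R * R) => t * c p.1.2)
  (fun p => (p.1.1, p.2)) g iH).
- by cont; apply: cont_comp => //; cont.
- by cont.
- by rewrite /g; cont.
- by move=> [].
- by [].
- by [].
- by move=> [[]].
- by move=> p; rewrite mul0r.
Qed.
End CoordinateIsotopies.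

(** * The closure of a one-pure braid *)

Section Segments.
Context {R : realType}.
Implicit Types (p a b : R * R * R).

Lemma pt_eq (x y z x' y' z' : R) : x = x' -> y = y' -> z = z' -> (x, y, z) = (x', y', z').
Proof. by move=> -> -> ->. Qed.

Lemma segmentP a b p : segment a b p <-> exists2 t : R, 0 <= t <= 1 &
  p = (a.1.1 + t * (b.1.1 - a.1.1), a.1.2 + t * (b.1.2 - a.1.2), a.2 + t * (b.2 - a.2)).
Proof.
have E t : (1 - t) *: a + t *: b =
    (a.1.1 + t * (b.1.1 - a.1.1), a.1.2 + t * (b.1.2 - a.1.2), a.2 + t * (b.2 - a.2)).
  by case: a => [[ax ay] az]; case: b => [[bx b_y] bz] /=; apply: pt_eq => /=; rewrite /GRing.scale /=; ring.
split=> [[t /=]|[t t01 ->]]; first by rewrite in_itv /= => t01 <-; exists t.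
by exists t => //=; rewrite in_itv.
Qed.

Lemma mid_ge (c u v t : R) : 0 <= t <= 1 -> c <= u -> c <= v -> c <= u + t * (v - u).
Proof. by move=> t01 cu cv; fnra. Qed.
Lemma mid_le (c u v t : R) : 0 <= t <= 1 -> u <= c -> v <= c -> u + t * (v - u) <= c.
Proof. by move=> t01 cu cv; fnra. Qed.

Lemma segment_x (x x' y z : R) : x <= x' ->
  segment (x, y, z) (x', y, z) = [set (u, y, z) | u in [set u | x <= u <= x']].
Proof.
move=> xx'; apply/seteqP; split=> [p /segmentP[t t01 ->] /=|_ [u /= /andP[xu ux'] <-]].
  exists (x + t * (x' - x)); last by rewrite !subrr !mulr0 !addr0.
  by rewrite /= mid_ge ?mid_le.
apply/segmentP; have [e|ne] := eqVneq x x'.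
  exists 0; rewrite ?lexx ?ler01//= !mul0r !addr0; apply: pt_eq => //.
  by apply/eqP; rewrite eq_le {1}e ux' xu.
have d0 : 0 < x' - x by rewrite subr_gt0 lt_neqAle ne.
exists ((u - x) / (x' - x)).
  by rewrite divr_ge0 ?subr_ge0//= ler_pdivrMr// mul1r lerD2r.
by rewrite /= !subrr !mulr0 !addr0 divfK ?gt_eqF// subrKC.
Qed.

Lemma segment_y (x y y' z : R) : y <= y' ->
  segment (x, y, z) (x, y', z) = [set (x, u, z) | u in [set u | y <= u <= y']].
Proof.
move=> yy'; apply/seteqP; split=> [p /segmentP[t t01 ->] /=|_ [u /= /andP[yu uy'] <-]].
  exists (y + t * (y' - y)); last by rewrite !subrr !mulr0 !addr0.
  by rewrite /= mid_ge ?mid_le.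
apply/segmentP; have [e|ne] := eqVneq y y'.
  exists 0; rewrite ?lexx ?ler01//= !mul0r !addr0; apply: pt_eq => //.
  by apply/eqP; rewrite eq_le {1}e uy' yu.
have d0 : 0 < y' - y by rewrite subr_gt0 lt_neqAle ne.
exists ((u - y) / (y' - y)).
  by rewrite divr_ge0 ?subr_ge0//= ler_pdivrMr// mul1r lerD2r.
by rewrite /= !subrr !mulr0 !addr0 divfK ?gt_eqF// subrKC.
Qed.

Lemma segment_sym a b : segment a b = segment b a.
Proof.
have sub c d p : segment c d p -> segment d c p.
  move=> /segmentP[t t01 ->]; apply/segmentP; exists (1 - t); first by flra.
  by apply: pt_eq => /=; ring.
by apply/seteqP; split=> p; exact: sub.
Qed.

Lemma segment_end a b : segment a b b.
Proof.
apply/segmentP; exists 1; first by rewrite ler01 lexx.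
by case: b => [[? ?] ?] /=; apply: pt_eq; rewrite mul1r subrKC.
Qed.

End Segments.

(** The part of the braid closure that stays in place while the passage behind the strands is
    created: it omits the first strand and the first four segments of its closing arc. *)
Definition inner_arcs {R : realType} (k : nat) : set (R * R * R) :=
  segment (k%:R, - 2^-1, 0) (k%:R, 1 + 2^-1, 0) `|`
  segment (k%:R, 1 + 2^-1, 0) (k.-1%:R, 1 + 2^-1, 0) `|`
  segment (k.-1%:R, 1 + 2^-1, 0) (k.-1%:R, 1, 0) `|`
  \bigcup_(i in [set i : 'I_k | (0 < i)%N])
    (strand (fun=> (i%:R, 0)) `|` closing_arc k i).

(* The closure of a one-pure braid whose first strand ends to the right of the
   fixed strands instead of passing behind them. *)
Definition open_closure {R : realType} (k : nat) (b0 : R) (X Z : R -> R) : set (R * R * R) :=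
  [set (X y, y, Z y) | y in [set y | b0 <= y <= 1]] `|`
  ([set (k%:R - 2^-1, y, 0) | y in [set y | - 2^-1 <= y <= b0]] `|`
  (segment (k%:R - 2^-1, - 2^-1, 0) (k%:R, - 2^-1, 0) `|` inner_arcs k)).

(** * Passing the lower end of the moving strand behind the fixed strands *)

Section Excursion.
Context {R : realType}.
Variables (k : nat) (k0 : (0 < k)%N) (b0 : R) (b00 : 0 < b0) (b01 : b0 < (1 : R)) (X Z : R -> R).
Hypotheses (cX : continuous X) (cZ : continuous Z).
Let xR : R := k%:R - 2^-1.
Hypotheses (X1 : X 1 = 0) (Z1 : Z 1 = 0) (Xb : X b0 = xR) (Zb : Z b0 = 0).
Hypothesis Xk : forall y, b0 <= y <= 1 -> X y < k%:R.
Hypothesis XZ : forall y (i : nat), b0 <= y <= 1 -> (0 < i < k)%N -> X y = i%:R -> Z y <> 0.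

Let k1 : (1 : R) <= k%:R.
Proof. by rewrite ler1n. Qed.

Ltac slra := move: b00 b01 k1; lra.
(** Four moves bring the lower end of the first strand from the abscissa [xR] to its place in the
    closure: backwards in the strip [k - 1 < x < k] ([m1]), to the left by [xR] at depth 1 ([m2]),
    forwards again near [x = 0] ([m3]); finally the image of the bottom segment is stretched onto
    three sides of a rectangle ([m4]). The other functions cut these moves off. *)
Let q (x : R) : R := Num.min (clamp (4 * (k%:R - x))) (clamp (2 * (x - (k%:R - 1)))).
Let r (y : R) : R := Num.min (clamp (2 * (b0 - y) / b0)) (clamp (2 * (y + 1))).
Let g (y : R) : R := clamp (2 - 4 * y / b0).
Let q2 (x : R) : R := clamp (1 - 8 * `|x|).
Let r2 (y : R) : R := clamp (1 - 4 * y / b0).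
Let chi (y : R) : R := clamp (- 4 * y - 1).
Let w (z : R) : R := - clamp (- z).
(** After three moves the two slanted sides of the bottom curve are the lines [x = - w / 8] and
    [x = k + (k - 1/4) * w], where [w] is the coordinate [z]. The affine map
    [x => k * (x + w / 8) / den] sends the first to 0 and the second to [k]. *)
Let den (z : R) : R := k%:R + (k%:R - 8^-1) * w z.

Let w_itv (z : R) : -1 <= w z <= 0.
Proof. by rewrite /w lerN2 clamp_le1 oppr_le0 clamp_ge0. Qed.
Let den_gt0 z : 0 < den z.
Proof. by rewrite /den; have /andP[] := w_itv z; move: k1; nra. Qed.

Let m1 (p : R * R * R) : R * R * R := (p.1.1, p.1.2, p.2 + - (q p.1.1 * r p.1.2)).
Let m2 (p : R * R * R) : R * R * R := (p.1.1 + - (xR * g p.1.2 * clamp (- p.2)), p.1.2, p.2).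
Let m3 (p : R * R * R) : R * R * R := (p.1.1, p.1.2, p.2 + q2 p.1.1 * r2 p.1.2).
Let A (u : R * R) : R := (1 - chi u.1) + chi u.1 * (k%:R / den u.2).
Let B (u : R * R) : R := chi u.1 * (k%:R * (8^-1 * w u.2) / den u.2).
Let m4 (p : R * R * R) : R * R * R := (A (p.1.2, p.2) * p.1.1 + B (p.1.2, p.2), p.1.2, p.2).

Let excursion_isotopic (K : set (R * R * R)) : @isotopic R _ K ((fun p => m4 (m3 (m2 (m1 p)))) @` K).
Proof.
have cw (T : topologicalType) (f : T -> R) : continuous f -> continuous (fun x => w (f x)).
  by move=> cf; rewrite /w; cont; apply: cont_clamp; cont.
have cchi (T : topologicalType) (f : T -> R) : continuous f -> continuous (fun x => chi (f x)).
  by move=> cf; rewrite /chi; apply: cont_clamp; cont.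
have cden : continuous (fun u : R * R => (den u.2)^-1).
  apply: cont_inv; first by move=> u; rewrite gt_eqF.
  by rewrite /den; cont; apply: cw; cont.
have -> : (fun p => m4 (m3 (m2 (m1 p)))) @` K = m4 @` (m3 @` (m2 @` (m1 @` K))).
  by rewrite !image_comp.
apply: isotopic_trans (_ : isotopic _ (m1 @` K)) _.
  apply: (@shear_isotopic_z R K (fun u => - (q u.1 * r u.2))).
  by rewrite /q /r; cont; apply: cont_clamp; cont.
apply: isotopic_trans (_ : isotopic _ (m2 @` _)) _.
  apply: (@shear_isotopic_x R _ (fun u => - (xR * g u.1 * clamp (- u.2)))).
  by rewrite /g; cont; apply: cont_clamp; cont.
apply: isotopic_trans (_ : isotopic _ (m3 @` _)) _.
  apply: (@shear_isotopic_z R _ (fun u => q2 u.1 * r2 u.2)).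
  by rewrite /q2 /r2; cont; apply: cont_clamp; cont.
apply: (@affine_isotopic_x R _ A B).
- by rewrite /A; cont; apply: cchi; cont.
- rewrite /B; cont; first by apply: cchi; cont.
  by apply: cw; cont.
- move=> [y z]; rewrite /A /=; have := clamp_ge0 (- 4 * y - 1); have := clamp_le1 (- 4 * y - 1).
  rewrite -/(chi y); have : 0 < k%:R / den z by rewrite divr_gt0// ltr0n.
  by move: (k%:R / den z) (chi y) => u v; nra.
Qed.

(** On the plane [z = 0] the moves [m2] and [m4] are the identity; the first alternative keeps the
    point out of the support of [m1], the second out of that of [m3]. *)
Let m_fixed (p : R * R * R) : p.2 = 0 -> [\/ p.1.1 <= k%:R - 1, k%:R <= p.1.1, p.1.2 <= -1 | (1 : R) <= p.1.2] ->
  (1 : R) <= p.1.1 \/ (1 : R) <= p.1.2 -> m4 (m3 (m2 (m1 p))) = p.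
Proof.
case: p => [[x y] z] /= -> H1 H2.
have qr : q x * r y = 0.
  rewrite /q /r; case: H1 => H.
  - by rewrite (@clamp_le0 _ (2 * (x - _))) ?(min_r (clamp_ge0 _)) ?mul0r//; slra.
  - by rewrite (@clamp_le0 _ (4 * _)) ?(min_l (clamp_ge0 _)) ?mul0r//; slra.
  - by rewrite (@clamp_le0 _ (2 * (y + 1))) ?(min_r (clamp_ge0 _)) ?mulr0//; slra.
  - rewrite (@clamp_le0 _ (2 * _ / _)) ?(min_l (clamp_ge0 _)) ?mulr0//.
    by rewrite pmulr_lle0 ?invr_gt0//; slra.
have q20 : q2 x * r2 y = 0.
  rewrite /q2 /r2; case: H2 => H; [rewrite clamp_le0 ?mul0r//|rewrite [X in _ * X]clamp_le0 ?mulr0//].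
    by have := ler_norm x; slra.
  by rewrite subr_le0 ler_pdivlMr//; slra.
rewrite /m1 /m2 /m3 /m4 /= qr oppr0 addr0 oppr0 clamp0 mulr0 oppr0 addr0 q20 addr0.
rewrite /A /B /den /w /= oppr0 clamp0 oppr0 !mulr0 addr0 mul0r mulr0 addr0 divff ?pnatr_eq0 -?lt0n//.
by rewrite mulr1 subrK mul1r.
Qed.

Let m_upper (x y z : R) : b0 <= y -> m4 (m3 (m2 (m1 (x, y, z)))) = (x, y, z).
Proof.
move=> yb.
have ry : r y = 0.
  rewrite /r (@clamp_le0 _ (2 * (b0 - y) / b0)) ?(min_l (clamp_ge0 _))//.
  by rewrite pmulr_lle0 ?invr_gt0//; slra.
have gy : g y = 0 by rewrite /g clamp_le0// subr_le0 ler_pdivlMr//; slra.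
have r2y : r2 y = 0 by rewrite /r2 clamp_le0// subr_le0 ler_pdivlMr//; slra.
have cy : chi y = 0 by rewrite /chi clamp_le0//; slra.
by rewrite /m1 /m2 /m3 /m4 /A /B /= ry gy r2y cy !(mulr0, mul0r, oppr0, addr0, subr0) mul1r.
Qed.

Let tx (y : R) : R := xR * (1 - g y).
Let tz (y : R) : R := - clamp (2 * (b0 - y) / b0) + r2 y.

Let xRk : xR = k%:R - 2^-1. Proof. by []. Qed.
Let q_xR : q xR = 1.
Proof. by rewrite /q !clamp_ge1 ?minxx// xRk; slra. Qed.

Let g1 y : y <= b0 / 4 -> g y = 1.
Proof.
move=> yb; rewrite /g clamp_ge1// lerBrDr -lerBrDl ler_pdivrMr//; slra.
Qed.
Let r1 (y : R) : -2^-1 <= y -> r y = clamp (2 * (b0 - y) / b0).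
Proof.
move=> y2; rewrite /r (@clamp_ge1 _ (2 * (y + 1))); last by slra.
by rewrite min_l// clamp_le1.
Qed.
Let rb1 y : y <= b0 / 2 -> clamp (2 * (b0 - y) / b0) = 1.
Proof. by move=> yb; rewrite clamp_ge1// ler_pdivlMr//; slra. Qed.
Let g0 y : b0 / 2 <= y -> g y = 0.
Proof. by move=> yb; rewrite /g clamp_le0// subr_le0 ler_pdivlMr//; slra. Qed.
Let r20 y : b0 / 4 <= y -> r2 y = 0.
Proof. by move=> yb; rewrite /r2 clamp_le0// subr_le0 ler_pdivlMr//; slra. Qed.
Let r21 (y : R) : y <= 0 -> r2 y = 1.
Proof. by move=> yb; rewrite /r2 clamp_ge1// lerBrDr -lerBrDl ler_pdivrMr//; slra. Qed.

(** The end of the strand goes back for heights in [[b0/2, b0]], left in [[b0/4, b0/2]] and forwards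
    in [[0, b0/4]]. It therefore stays a graph over the height, and from 0 downwards it stands in
    the first column. *)
Let m_tail (y : R) : -2^-1 <= y <= b0 -> m4 (m3 (m2 (m1 (xR, y, 0)))) = (tx y, y, tz y).
Proof.
move=> /andP[y2 yb]; rewrite /m1 /= q_xR mul1r add0r r1//; set c := clamp _.
have c01 : 0 <= c <= 1 by rewrite clamp_ge0 clamp_le1.
rewrite /m2 /= opprK (clamp_id c01).
have -> : xR + - (xR * g y * c) = tx y.
  rewrite /tx; have [yb2|/ltW yb2] := leP y (b0 / 2).
    by rewrite /c rb1//; ring.
  by rewrite g0//; ring.
rewrite /m3 /=.
have -> : q2 (tx y) * r2 y = r2 y.
  have [yb4|/ltW yb4] := leP y (b0 / 4); last by rewrite r20// mulr0.
  by rewrite /tx g1// subrr mulr0 /q2 normr0 mulr0 subr0 clamp1 mul1r.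
rewrite -/(tz y) /m4 /A /B /=.
have [y0|y0] := leP (- 4^-1) y.
  have -> : chi y = 0 by rewrite /chi clamp_le0//; slra.
  by apply: pt_eq => //; ring.
have -> : tx y = 0 by rewrite /tx g1; [ring|slra].
have -> : tz y = 0 by rewrite /tz rb1 ?r21; [ring|slra|slra].
by rewrite /w oppr0 clamp0 oppr0; apply: pt_eq => //; ring.
Qed.

Let m_bottom (x : R) : xR <= x <= k%:R -> let z := - q x + q2 (x - xR * q x) in
  m4 (m3 (m2 (m1 (x, - 2^-1, 0)))) = (k%:R * ((x - xR * q x) + 8^-1 * w z) / den z, - 2^-1, z).
Proof.
move=> /andP[xx xk]; rewrite /m1 /= r1// rb1; last by slra.
rewrite mulr1 add0r /m2 /= g1; last by slra.
have q01 : 0 <= q x <= 1 by rewrite /q le_min !clamp_ge0/= ge_min clamp_le1.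
rewrite opprK (clamp_id q01) mulr1 /m3 /= r21; last by slra.
rewrite mulr1 /m4 /A /B /= (_ : chi _ = 1); last by rewrite /chi clamp_ge1//; slra.
by apply: pt_eq => //; field; rewrite gt_eqF.
Qed.

Let m p := m4 (m3 (m2 (m1 p))).
Let bx (y : R) : R := X (Num.max y b0) - xR * g y.
Let bz (y : R) : R := Z (Num.max y b0) - clamp (2 * (b0 - y) / b0) + r2 y.

Let b_upper (y : R) : b0 <= y -> bx y = X y /\ bz y = Z y.
Proof.
move=> yb; rewrite /bx /bz max_l// g0 ?r20 ?clamp_le0 ?mulr0 ?subr0 ?addr0//; try slra.
by rewrite pmulr_lle0 ?invr_gt0//; slra.
Qed.
Let b_lower (y : R) : y <= b0 -> bx y = tx y /\ bz y = tz y.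
Proof.
by move=> yb; rewrite /bx /bz /tx /tz max_r// Xb Zb mulrBr mulr1 sub0r; split.
Qed.
Let t_low (y : R) : y <= 0 -> tx y = 0 /\ tz y = 0.
Proof.
by move=> y0; rewrite /tx /tz g1 ?rb1 ?r21; [split; ring|slra|slra|slra].
Qed.

Let b (i : 'I_k) (t : R) : R * R :=
  if i == 0%N :> nat then (bx (1 - t), bz (1 - t)) else (i%:R, 0).

Let xR_not_nat (i : nat) : (i < k)%N -> xR <> i%:R.
Proof.
move=> ik; rewrite xRk => e.
have : k%:R < i.+1%:R :> R by rewrite -natr1 -e; lra.
by rewrite ltr_nat ltnS leqNgt ik.
Qed.

Let b_pure : one_pure_braid b.
Proof.
have b_end : bx 0 = 0 /\ bz 0 = 0.
  by have [-> ->] := b_lower (ltW b00); apply: t_low.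
have b_start : bx 1 = 0 /\ bz 1 = 0.
  by have [-> ->] := b_upper (ltW b01).
(* By decreasing height: the hypothesis [XZ] down to [b0], then the half-integral abscissa [xR],
   then the depth 1, then the abscissa 0. *)
have bavoid y (i : nat) : 0 <= y <= 1 -> (0 < i < k)%N -> bx y = i%:R -> bz y <> 0.
  move=> /andP[y0 y1] ik; have i1 : (1 : R) <= i%:R by rewrite ler1n; case/andP: ik.
  have [yb|/ltW yb] := leP b0 y.
    by have [-> ->] := b_upper yb; apply: XZ; rewrite ?yb.
  have [-> ->] := b_lower yb; rewrite /tx /tz.
  have [yb2|/ltW yb2] := leP (b0 / 2) y.
    by rewrite g0// subr0 mulr1 => /xR_not_nat; case/andP: ik => _ /[swap] /[apply].
  have [yb4|/ltW yb4] := leP (b0 / 4) y.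
    by rewrite r20// rb1//; slra.
  by rewrite g1//; slra.
have blt y : 0 <= y <= 1 -> bx y < k%:R.
  move=> /andP[y0 y1]; have [yb|/ltW yb] := leP b0 y.
    by have [-> _] := b_upper yb; apply: Xk; rewrite yb.
  have [-> _] := b_lower yb; rewrite /tx.
  have : 0 <= g y <= 1 by rewrite clamp_ge0 clamp_le1.
  by rewrite xRk; move: k1; nra.
have cbx : continuous bx.
  rewrite /bx /g; cont; last by apply: cont_clamp; cont.
  by apply: (cont_comp cX); cont.
have cbz : continuous bz.
  rewrite /bz /r2; cont; [|by apply: cont_clamp; cont|by apply: cont_clamp; cont].
  by apply: (cont_comp cZ); cont.
split=> //; last by move=> i t i0 _; rewrite /b gtn_eqF.
split; last first.
  by move=> i; rewrite /b; case: eqP => // ->; rewrite subrr; case: b_end => -> ->.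
split.
- move=> i; apply: continuous_subspaceT; rewrite /b; case: eqP => _; last by cont.
  by cont; [apply: (cont_comp cbx)|apply: (cont_comp cbz)]; cont.
- move=> t; rewrite in_itv /= => t01 i j; rewrite /b.
  have t01' : 0 <= 1 - t <= 1 by lra.
  have side (l : 'I_k) : l != 0%N :> nat -> (bx (1 - t), bz (1 - t)) <> (l%:R, 0).
    move=> l0 [e1 e2]; apply: (bavoid _ _ t01' _ e1 e2).
    by rewrite lt0n l0 ltn_ord.
  case: eqP => [i0|/eqP i0]; case: eqP => [j0|/eqP j0].
  + by move=> _; apply: val_inj; rewrite /= i0 j0.
  + by move=> /(side _ j0).
  + by move=> /esym/(side _ i0).
  + by move=> [] /eqP; rewrite eqr_nat => /eqP e; apply: val_inj.
- move=> i t; rewrite in_itv /= => t01; rewrite /b; case: eqP => _ /=; last by rewrite ltr_nat.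
  by apply: blt; lra.
- by move=> i; rewrite /b; case: eqP => // ->; rewrite subr0; case: b_start => -> ->.
- by exists 1%g => i; rewrite perm1 /b; case: eqP => // ->; rewrite subrr; case: b_end => -> ->.
Qed.

Let inner_fixed p : inner_arcs k p -> m p = p.
Proof.
have kp : k.-1%:R = k%:R - 1 :> R by rewrite -subn1 natrB.
case=> [[[]|]|].
- move=> /segmentP[t t01 ->] /=; apply: m_fixed => /=; rewrite ?subrr ?mulr0 ?addr0//; last by left.
  by apply: Or42.
- move=> /segmentP[t t01 ->] /=; apply: m_fixed => /=; rewrite ?subrr ?mulr0 ?addr0//; [apply: Or44|right]; lra.
- move=> /segmentP[t t01 ->] /=; apply: m_fixed => /=; rewrite ?subrr ?mulr0 ?addr0//.
    by apply: Or41; rewrite kp.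
  by right; apply: mid_ge => //; lra.
- move=> [[i ik] /= i0 []].
    move=> [t _ <-] /=; apply: m_fixed => //=; last by left; rewrite ler1n.
    by apply: Or41; rewrite lerBrDr natr1 ler_nat.
  case: i i0 ik => // j _ jk; rewrite /closing_arc.
  set d : R := (k - j.+1)%:R; have d0 : 0 <= d by [].
  have d1 : j.+1%:R = k%:R - d :> R by rewrite /d natrB ?(ltnW jk)// opprB addrC subrK.
  have j1 : j%:R = k%:R - d - 1 :> R by rewrite -d1 -natr1 addrK.
  have j0 : (1 : R) <= j.+1%:R by rewrite ler1n.
  have dk : 1 <= d by rewrite /d ler1n subn_gt0.
  rewrite /polyline => -[|[|[|[|[|]]]]].
  + move=> /segmentP[t t01 ->] /=; apply: m_fixed => /=; rewrite ?subrr ?mulr0 ?addr0//; last by left.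
    by apply: Or41; rewrite d1; lra.
  + move=> /segmentP[t t01 ->] /=; apply: m_fixed => /=; rewrite ?subrr ?mulr0 ?addr0//.
      by apply: Or43; lra.
    by left; apply: mid_ge => //; slra.
  + move=> /segmentP[t t01 ->] /=; apply: m_fixed => /=; rewrite ?subrr ?mulr0 ?addr0//.
      by apply: Or42; lra.
    by left; slra.
  + move=> /segmentP[t t01 ->] /=; apply: m_fixed => /=; rewrite ?subrr ?mulr0 ?addr0//.
      by apply: Or44; lra.
    by right; lra.
  + move=> /segmentP[t t01 ->] /=; apply: m_fixed => /=; rewrite ?subrr ?mulr0 ?addr0//.
      by apply: Or41; rewrite j1; lra.
    by right; apply: mid_ge => //; lra.
  + move=> -> /=; apply: m_fixed => /=; rewrite ?subrr ?mulr0 ?addr0//.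
      by apply: Or44; lra.
    by right; lra.
Qed.

(** The three cases are the sides of the closing arc at the height -1/2: away from the viewer, to
    the right, and back to the plane [z = 0]. The first threshold is where [q2] vanishes, the second
    where [q] starts to decrease. *)
Let bottom_path (x : R) : xR <= x <= k%:R -> m (x, - 2^-1, 0) =
  if x <= xR + 8^-1 then (0, - 2^-1, - (8 * (x - xR)))
  else if x <= k%:R - 4^-1 then (k%:R * 8 * (x - xR - 8^-1), - 2^-1, - 1)
  else (k%:R, - 2^-1, - (4 * (k%:R - x))).
Proof.
move=> /andP[xx xk]; have xRk' := xRk; rewrite /m m_bottom ?xx//.
have c2 : clamp (2 * (x - (k%:R - 1))) = 1 by rewrite clamp_ge1//; lra.
case: ifP => [x8|/negbT]; last rewrite -ltNge => x8.
  have -> : q x = 1 by rewrite /q c2 clamp_ge1 ?minxx//; lra.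
  rewrite /q2 mulr1 ger0_norm; last by lra.
  rewrite clamp_id; last by lra.
  have e : -1 + (1 - 8 * (x - xR)) = - (8 * (x - xR)) by ring.
  rewrite e /w opprK clamp_id; last by lra.
  by apply: pt_eq => //; rewrite mulrN mulrA mulVf// mul1r subrr mulr0 mul0r.
case: ifP => [x4|/negbT]; last rewrite -ltNge => x4.
  have -> : q x = 1 by rewrite /q c2 clamp_ge1 ?minxx//; lra.
  rewrite /q2 mulr1 ger0_norm; last by lra.
  rewrite clamp_le0; last by lra.
  rewrite addr0 /den /w opprK clamp1.
  by apply: pt_eq => //; field; apply/eqP; lra.
have -> : q x = 4 * (k%:R - x) by rewrite /q c2 clamp_id ?min_l//; lra.
have xR0 : 0 < xR by slra.
have x'8 : 8^-1 <= x - xR * (4 * (k%:R - x)) by move: x8 x4 xRk' k1; nra.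
rewrite /q2 ger0_norm; last by lra.
rewrite clamp_le0; last by lra.
rewrite addr0; have := den_gt0 (- (4 * (k%:R - x))); rewrite /den /w opprK clamp_id; last by lra.
move=> d0; apply: pt_eq => //; rewrite xRk; field.
by apply/eqP; lra.
Qed.

Let excursion_image : m @` open_closure k b0 X Z = braid_closure b.
Proof.
have kpos : (0 < k)%N by [].
pose i0 : 'I_k := Ordinal kpos.
have arc0 p : closing_arc k 0 p -> braid_closure b p by move=> ?; exists i0 => //; right.
have str0 p : strand (b i0) p -> braid_closure b p by move=> ?; exists i0 => //; left.
have xRk' := xRk; have b00' := b00; have b01' := b01; have k1' := k1.
have inb x : xR <= x <= k%:R -> m (x, - 2^-1, 0) =
  if x <= xR + 8^-1 then (0, - 2^-1, - (8 * (x - xR)))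
  else if x <= k%:R - 4^-1 then (k%:R * 8 * (x - xR - 8^-1), - 2^-1, - 1)
  else (k%:R, - 2^-1, - (4 * (k%:R - x))) := @bottom_path x.
have Hm x : xR <= x <= k%:R -> (m @` open_closure k b0 X Z) (m (x, - 2^-1, 0)).
  move=> xx; exists (x, - 2^-1, 0) => //; right; right; left.
  by rewrite segment_x; [exists x|lra].
have Hm' p x : xR <= x <= k%:R -> (if x <= xR + 8^-1 then (0, - 2^-1, - (8 * (x - xR)))
  else if x <= k%:R - 4^-1 then (k%:R * 8 * (x - xR - 8^-1), - 2^-1, - 1)
  else (k%:R, - 2^-1, - (4 * (k%:R - x)))) = p -> (m @` open_closure k b0 X Z) p.
  by move=> xx <-; rewrite -(inb _ xx); exact: Hm.
have Cm p : inner_arcs k p -> (m @` open_closure k b0 X Z) p.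
  by move=> Cp; exists p; [right; right; right|exact: inner_fixed].
apply/seteqP; split=> p.
  move=> [p' + <-] => -[[y /= /andP[yb y1] <-]|[[y /= /andP[y2 yb] <-]|[Sp|Cp]]].
  - rewrite /m m_upper//; apply: str0; exists (1 - y); first by rewrite /= in_itv /=; lra.
    by rewrite /b /= opprB addrC subrK; have [-> ->] := b_upper yb.
  - rewrite /m m_tail ?y2//; have [y0|/ltW y0] := leP 0 y.
      apply: str0; exists (1 - y); first by rewrite /= in_itv /=; lra.
      by rewrite /b /= opprB addrC subrK; have [-> ->] := b_lower yb.
    have [-> ->] := t_low y0; apply: arc0; left; rewrite segment_sym segment_y; last by lra.
    by exists y => //=; lra.
  - move: Sp; rewrite segment_x; last by lra.
    move=> [x /= xx <-]; rewrite inb//; case: ifP => x8.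
      apply: arc0; right; left; apply/segmentP; exists (8 * (x - xR)); first by lra.
      by apply: pt_eq => /=; ring.
    case: ifP => x4.
      apply: arc0; right; right; left; rewrite segment_x//.
      exists (k%:R * 8 * (x - xR - 8^-1)) => //=.
      have : 0 <= 8 * (x - xR - 8^-1) <= 1 by lra.
      by rewrite -mulrA; nra.
    apply: arc0; right; right; right; left; apply/segmentP; exists (1 - 4 * (k%:R - x)); first by lra.
    by apply: pt_eq => /=; ring.
  - rewrite (inner_fixed Cp); case: Cp => [[[]|]|].
    + by move=> ?; apply: arc0; do 4 right; left.
    + by move=> ?; apply: arc0; do 5 right; left.
    + by move=> ?; apply: arc0; do 6 right; left.
    + move=> [i /= i0' []] ip; exists i => //; [left|by right].
      by case: ip => t t01 <-; exists t => //; rewrite /b gtn_eqF.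
move=> [i _ [[t t01 <-]|]].
- rewrite /b; case: eqP => [_|/eqP i0'] /=; last first.
    by apply: Cm; right; exists i; [rewrite /= lt0n|left; exists t].
  move: t01; rewrite /= in_itv /= => t01.
  have [yb|/ltW yb] := leP b0 (1 - t).
    have [-> ->] := b_upper yb; exists (X (1 - t), 1 - t, Z (1 - t)); last by rewrite /m m_upper.
    by left; exists (1 - t) => //=; lra.
  have [-> ->] := b_lower yb; exists (xR, 1 - t, 0); last by rewrite /m m_tail//; lra.
  by right; left; exists (1 - t) => //=; lra.
- case: (posnP i) => [->|i0']; last first.
    by move=> ip; apply: Cm; right; exists i => //; right.
  rewrite /closing_arc /polyline => -[|[|[|[|[|[|[|]]]]]]] ip.
  + move: ip; rewrite segment_sym segment_y; last by lra.
    move=> [y /= /andP[y2 y0] <-]; exists (xR, y, 0); first by right; left; exists y => //=; lra.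
    by rewrite /m m_tail; [have [-> ->] := t_low y0|lra].
  + move: ip => /segmentP[t t01 ->] /=.
    have xx : xR <= xR + t / 8 <= k%:R by lra.
    apply: Hm' xx _; rewrite ifT; last by lra.
    by apply: pt_eq => /=; field.
  + move: ip; rewrite segment_x// => -[x /= /andP[x0 xk] <-].
    have kn : k%:R != 0 :> R by rewrite gt_eqF//; lra.
    have u01 : 0 <= x / k%:R <= 1 by rewrite divr_ge0//= ler_pdivrMr ?mul1r//; lra.
    (* Corners are treated apart, because [bottom_path] attributes them to the preceding side. *)
    have [u0|u0] := eqVneq (x / k%:R) 0.
      have xx : xR <= xR + 8^-1 <= k%:R by lra.
      apply: Hm' xx _; rewrite lexx; apply: pt_eq => //; last by field.
      by apply/eqP; rewrite eq_sym; move/eqP: u0; rewrite mulf_eq0 invr_eq0 (negPf kn) orbF.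
    have u1 : 0 < x / k%:R by rewrite lt_neqAle eq_sym u0; case/andP: u01.
    have xx : xR <= xR + 8^-1 + x / k%:R / 8 <= k%:R by lra.
    apply: Hm' xx _; rewrite ifF; last by apply/negbTE; rewrite -ltNge; lra.
    rewrite ifT; last by lra.
    by apply: pt_eq => //; field.
  + move: ip => /segmentP[t t01 ->] /=.
    have xx : xR <= (k%:R - 4^-1 : R) <= (k%:R : R) by rewrite xRk; lra.
    have [t0|t0] := eqVneq t 0.
      apply: Hm' xx _; rewrite ifF; last by apply/negbTE; rewrite -ltNge xRk; lra.
      by rewrite t0 lexx; apply: pt_eq => //; rewrite ?xRk; field.
    have t0' : 0 < t by rewrite lt_neqAle eq_sym t0; case/andP: t01.
    have {}xx : xR <= (k%:R - (1 - t) / 4 : R) <= (k%:R : R) by rewrite xRk; lra.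
    apply: Hm' xx _; rewrite ifF; last by apply/negbTE; rewrite -ltNge xRk; lra.
    rewrite ifF; last by apply/negbTE; rewrite -ltNge; lra.
    by apply: pt_eq => //=; field.
  + by apply: Cm; left; left; left.
  + by apply: Cm; left; left; right.
  + by apply: Cm; left; right.
  + by apply: Cm; left; right; rewrite ip; exact: segment_end.
Qed.

Lemma open_closure_isotopic : exists b : 'I_k -> R -> R * R,
  one_pure_braid b /\ @isotopic R _ (open_closure k b0 X Z) (braid_closure b).
Proof.
by exists b; split; [exact: b_pure|rewrite -excursion_image; exact: excursion_isotopic].
Qed.
End Excursion.

(** * Moving finitely many arcs in one coordinate *)

Section Trajectories.
Context {R : realType}.

Definition trajectories {U : Type} (k : nat) (L : R) (p : nat -> R -> U) : set U :=
  [set q | exists d t, [/\ (d < k)%N, 0 <= t <= L & q = p d t]].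

Lemma compact_setU2 (U : topologicalType) (A B : set U) : compact A -> compact B -> compact (A `|` B).
Proof.
move=> cA cB; have := @bigsetU_compact U bool (fun b => if b then A else B) [:: true; false] xpredT.
by rewrite !big_cons big_nil setU0; apply=> -[].
Qed.

Lemma compact_trajectories (U : topologicalType) k L (p : nat -> R -> U) :
  (forall d, continuous (p d)) -> compact (trajectories k L p).
Proof.
move=> cp; have -> : trajectories k L p = \big[setU/set0]_(d < k) (p d @` `[0, L]).
  rewrite -(@bigcup_mkord _ k (fun d => p d @` `[0, L])); apply/seteqP; split=> q.
    by move=> [d [t [dk tL ->]]]; exists d => //; exists t => //=; rewrite in_itv.
  by move=> [d /= dk [t /= tL <-]]; exists d, t; split=> //; rewrite in_itv in tL.
apply: bigsetU_compact => d _; apply: continuous_compact; last exact: segment_compact.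
exact: continuous_subspaceT.
Qed.

Lemma image_trajectories U V k L (p : nat -> R -> U) (f : U -> V) :
  f @` trajectories k L p = trajectories k L (fun d t => f (p d t)).
Proof.
apply/seteqP; split=> q.
  by move=> [_ [d [t [dk tL ->]]] <-]; exists d, t.
by move=> [d [t [dk tL ->]]]; exists (p d t) => //; exists d, t.
Qed.

Lemma eq_trajectories U k L (p q : nat -> R -> U) :
  (forall d (t : R), (d < k)%N -> 0 <= t <= L -> p d t = q d t) -> trajectories k L p = trajectories k L q.
Proof.
move=> pq; apply/seteqP; split=> _ [d [t [dk tL ->]]]; exists d, t; split=> //; rewrite pq//.
Qed.

(** A displacement that is a function of the position in a plane extends from the compact arcs to
    the whole plane. It is forced to vanish on a rectangle, which will contain the projection of the
    rest of the knot; the arcs must not move over that strip. *)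
Lemma shear_extension k L (u v w : nat -> R -> R) (C M : R) :
  (forall d, continuous (u d)) -> (forall d, continuous (v d)) -> (forall d, continuous (w d)) ->
  (forall d d' (t t' : R), (d < k)%N -> (d' < k)%N -> 0 <= t <= L -> 0 <= t' <= L ->
     u d t = u d' t' -> v d t = v d' t' -> w d t = w d' t') ->
  (forall d (t : R), (d < k)%N -> 0 <= t <= L -> `|v d t| <= M -> w d t = 0) ->
  exists D : R * R -> R, [/\ continuous D,
    forall d (t : R), (d < k)%N -> 0 <= t <= L -> D (u d t, v d t) = w d t &
    forall a b : R, `|a| <= C -> `|b| <= M -> D (a, b) = 0].
Proof.
move=> cu cv cw uvw vw.
pose G1 := trajectories k L (fun d t => ((u d t, v d t), w d t)).
pose G2 : set (R * R * R) := (fun q : R * R => (q, 0)) @` (`[- C, C]%classic `*` `[- M, M]%classic).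
have cG : compact (G1 `|` G2).
  apply: compact_setU2; first by apply: compact_trajectories => d; cont.
  apply: continuous_compact; first by apply: continuous_subspaceT; cont.
  by apply: compact_setX; exact: segment_compact.
have norm_itv (a c : R) : (a \in `[- c, c]) = (`|a| <= c) by rewrite in_itv /= ler_norml.
have [|D [cD DE]] := compact_relation_extension cG.
- move=> p r s [[d [t [dk tL [pE ->]]]]|[q [qC qM] [qE <-]]].
    move=> [[d' [t' [d'k t'L [pE' ->]]]]|[q [/= qC qM] [qE <-]]].
      by move: pE; rewrite pE' => -[uE vE]; apply: uvw.
    by apply: vw => //; move: qM; rewrite qE pE /= norm_itv.
  move=> [[d' [t' [d'k t'L [pE' ->]]]]|[q' _ [_ <-]]] //.
  by apply/esym/vw => //; move: qM; rewrite qE pE' /= norm_itv.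
exists D; split=> // [d t dk tL|a b aC bM].
  by apply: DE; left; exists d, t.
by apply: DE; right; exists (a, b) => //; split; rewrite /= norm_itv.
Qed.

(** [B] is protected by its depth: the arcs are at rest where [|z| <= M]. Farther out the move only
    has to be well defined over [(x, z)]. *)
Lemma trajectories_move_y k L (x y z y' : nat -> R -> R) (C M : R) (B : set (R * R * R)) :
  (forall d, continuous (x d)) -> (forall d, continuous (y d)) -> (forall d, continuous (z d)) ->
  (forall d, continuous (y' d)) ->
  (forall d d' (t t' : R), (d < k)%N -> (d' < k)%N -> 0 <= t <= L -> 0 <= t' <= L ->
     x d t = x d' t' -> z d t = z d' t' -> y' d t - y d t = y' d' t' - y d' t') ->
  (forall d (t : R), (d < k)%N -> 0 <= t <= L -> `|z d t| <= M -> y' d t = y d t) ->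
  (forall p, B p -> `|p.1.1| <= C /\ `|p.2| <= M) ->
  @isotopic R _ (trajectories k L (fun d t => (x d t, y d t, z d t)) `|` B)
    (trajectories k L (fun d t => (x d t, y' d t, z d t)) `|` B).
Proof.
move=> cx cy cz cy' xz zM BM.
have [|d t dk tL zt|D [cD DE D0]] := @shear_extension k L x z (fun d t => y' d t - y d t) C M cx cz _ xz.
- by move=> d; cont.
- by rewrite zM// subrr.
have := shear_isotopic_y (trajectories k L (fun d t => (x d t, y d t, z d t)) `|` B) cD.
rewrite image_setU image_trajectories /=; congr (isotopic _ (_ `|` _)).
  by apply: eq_trajectories => d t dk tL; rewrite DE// subrKC.
rewrite -[RHS]image_id; apply: eq_imagel => -[[a b] c] /BM[/= aC cM] /=.
by rewrite D0// addr0.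
Qed.

Lemma trajectories_move_x k L (x y z x' : nat -> R -> R) (C M : R) (B : set (R * R * R)) :
  (forall d, continuous (x d)) -> (forall d, continuous (y d)) -> (forall d, continuous (z d)) ->
  (forall d, continuous (x' d)) ->
  (forall d d' (t t' : R), (d < k)%N -> (d' < k)%N -> 0 <= t <= L -> 0 <= t' <= L ->
     y d t = y d' t' -> z d t = z d' t' -> x' d t - x d t = x' d' t' - x d' t') ->
  (forall d (t : R), (d < k)%N -> 0 <= t <= L -> `|z d t| <= M -> x' d t = x d t) ->
  (forall p, B p -> `|p.1.2| <= C /\ `|p.2| <= M) ->
  @isotopic R _ (trajectories k L (fun d t => (x d t, y d t, z d t)) `|` B)
    (trajectories k L (fun d t => (x' d t, y d t, z d t)) `|` B).
Proof.
move=> cx cy cz cx' yz zM BM.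
have [|d t dk tL zt|D [cD DE D0]] := @shear_extension k L y z (fun d t => x' d t - x d t) C M cy cz _ yz.
- by move=> d; cont.
- by rewrite zM// subrr.
have := shear_isotopic_x (trajectories k L (fun d t => (x d t, y d t, z d t)) `|` B) cD.
rewrite image_setU image_trajectories /=; congr (isotopic _ (_ `|` _)).
  by apply: eq_trajectories => d t dk tL; rewrite DE// subrKC.
rewrite -[RHS]image_id; apply: eq_imagel => -[[a b] c] /BM[/= bC cM] /=.
by rewrite D0// addr0.
Qed.

(** Along the axis [z] nothing separates [B] from the arcs, which it crosses in projection; it is
    carried along by the shear, whence the explicit [D]. *)
Lemma trajectories_flatten k L (x y z : nat -> R -> R) (B : set (R * R * R)) :
  (forall d, continuous (x d)) -> (forall d, continuous (y d)) -> (forall d, continuous (z d)) ->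
  (forall d d' (t t' : R), (d < k)%N -> (d' < k)%N -> 0 <= t <= L -> 0 <= t' <= L ->
     x d t = x d' t' -> y d t = y d' t' -> z d t = z d' t') ->
  exists D : R * R -> R, [/\ continuous D,
    forall d (t : R), (d < k)%N -> 0 <= t <= L -> D (x d t, y d t) = - z d t &
    @isotopic R _ (trajectories k L (fun d t => (x d t, y d t, z d t)) `|` B)
      (trajectories k L (fun d t => (x d t, y d t, 0)) `|` (fun p => (p.1.1, p.1.2, p.2 + D p.1)) @` B)].
Proof.
move=> cx cy cz xyz.
(* With the bound -1 the protected rectangle is empty. *)
have [|||D [cD DE _]] := @shear_extension k L x y (fun d t => - z d t) 0 (-1) cx cy.
- by move=> d; cont.
- by move=> d d' t t' dk d'k tL t'L xE yE; congr (- _); apply: xyz.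
- by move=> d t _ _; rewrite leNgt (lt_le_trans _ (normr_ge0 _))// ltrN10.
exists D; split=> //.
have := shear_isotopic_z (trajectories k L (fun d t => (x d t, y d t, z d t)) `|` B) cD.
rewrite image_setU image_trajectories /=; congr (isotopic _ (_ `|` _)).
by apply: eq_trajectories => d t dk tL; rewrite DE// subrr.
Qed.
End Trajectories.

(** * Standard positions of the strands and of the closing arcs *)

Section Layout.
Context {R : realType}.

(* Abscissae of the down strands, heights and abscissae of the closing arcs; the
   arc number d runs from column d to column d + 1, counted from the right. *)
Definition colx (k d : nat) : R := if d is 0 then k%:R - 2^-1 else k%:R - d%:R.
Definition lowy (d : nat) : R := if d is 0 then - 2^-1 else - d%:R - 1.
Definition highy (d : nat) : R := if d is 0 then 1 + 2^-1 else d%:R + 2.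
Definition farx (k d : nat) : R := if d is 0 then k%:R else k%:R + d%:R + 1.

Let ltn_succ (d d' : nat) : (d < d')%N -> (d%:R + 1 <= d'%:R :> R).
Proof. by move=> dd; rewrite natr1 ler_nat. Qed.

Lemma colx_lt k d d' : (d < d')%N -> colx k d' < colx k d.
Proof.
case: d' => // d' dd; have := ltn_succ dd; rewrite /colx; case: d dd => [|d] _.
  by rewrite add0r => ?; flra.
by move=> ?; flra.
Qed.
Lemma colx_le k d d' : (d <= d')%N -> colx k d' <= colx k d.
Proof. by rewrite leq_eqVlt => /orP[/eqP ->//|/(colx_lt k)/ltW]. Qed.
Lemma colx_inj k d d' : colx k d = colx k d' -> d = d'.
Proof.
move=> e; have [/(colx_lt k)|/(colx_lt k)|//] := ltngtP d d'; by rewrite e ltxx.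
Qed.
Lemma lowy_lt d d' : (d < d')%N -> lowy d' < lowy d.
Proof.
case: d' => // d' dd; have := ltn_succ dd; rewrite /lowy; case: d dd => [|d] _.
  by rewrite add0r => ?; flra.
by move=> ?; flra.
Qed.
Lemma highy_lt d d' : (d < d')%N -> highy d < highy d'.
Proof.
case: d' => // d' dd; have := ltn_succ dd; rewrite /highy; case: d dd => [|d] _.
  by rewrite add0r => ?; flra.
by move=> ?; flra.
Qed.
Lemma farx_lt k d d' : (d < d')%N -> farx k d < farx k d'.
Proof.
case: d' => // d' dd; have := ltn_succ dd; rewrite /farx; case: d dd => [|d] _.
  by rewrite add0r => ?; flra.
by move=> ?; flra.
Qed.
Lemma lowy_lt0 d : lowy d < 0.
Proof. by case: d => [|d]; rewrite /lowy; [flra|have := ler0n R d.+1; flra]. Qed.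
Lemma highy_gt1 d : 1 < highy d.
Proof. by case: d => [|d]; rewrite /highy; [flra|have := ler0n R d.+1; flra]. Qed.
Lemma colx_farx k d d' : colx k d < farx k d'.
Proof.
have c : colx k d < k%:R.
  by case: d => [|d]; rewrite /colx; [flra|have := ltr0Sn R d; flra].
by apply: (lt_le_trans c); case: d' => [|d']; rewrite /farx//; have := ler0n R d'.+1; flra.
Qed.

(** An arc is parametrized by [[0, 7]]: down its column until 2, then one unit each along the
    bottom, up the far side and along the top, then down the next column from 5 on. The two units at
    either end leave room to get away from the last arc and then to adjust the height before the
    abscissa moves. *)
Lemma layout_clamps (t : R) : 0 <= t <= 7 -> let u := Num.min t (7 - t) in
  [\/ t <= 2 /\ [/\ clamp (t - 2) = 0, clamp (t - 3) = 0, clamp (t - 4) = 0 &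
        [/\ Num.min u 2 = t, clamp (u - 2) = 0 & clamp (u - 1) = clamp (t - 1)]],
      2 < t < 3 /\ [/\ clamp (t - 2) = t - 2, clamp (t - 3) = 0, clamp (t - 4) = 0 &
        [/\ Num.min u 2 = 2, clamp (u - 2) = t - 2 & clamp (u - 1) = 1]],
      3 <= t <= 4 /\ [/\ clamp (t - 2) = 1, clamp (t - 3) = t - 3, clamp (t - 4) = 0 &
        [/\ Num.min u 2 = 2, clamp (u - 2) = 1 & clamp (u - 1) = 1]] |
      4 < t < 5 /\ [/\ clamp (t - 2) = 1, clamp (t - 3) = 1, clamp (t - 4) = t - 4 &
        [/\ Num.min u 2 = 2, clamp (u - 2) = 5 - t & clamp (u - 1) = 1]] \/
      5 <= t /\ [/\ clamp (t - 2) = 1, clamp (t - 3) = 1, clamp (t - 4) = 1 &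
        [/\ Num.min u 2 = 7 - t, clamp (u - 2) = 0 & clamp (u - 1) = clamp (6 - t)]] ].
Proof.
move=> t07 u; have [t2|t2] := leP t 2.
  have uE : u = t by rewrite /u min_l//; flra.
  apply: Or41; split=> //; rewrite uE; split; [rewrite clamp_le0|rewrite clamp_le0|rewrite clamp_le0|]; try flra.
  by split; [rewrite min_l|rewrite clamp_le0|]; flra.
have [t3|t3] := ltP t 3.
  have uE : u = t by rewrite /u min_l//; flra.
  apply: Or42; split; first by rewrite /=; flra.
  rewrite uE; split; [rewrite clamp_id|rewrite clamp_le0|rewrite clamp_le0|
    split; [apply: min_r|rewrite clamp_id|rewrite clamp_ge1]]; flra.
have [t4|t4] := leP t 4.
  have uE : 3 <= u by rewrite /u le_min; flra.
  apply: Or43; split; first by rewrite /=; flra.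
  split; [rewrite clamp_ge1|rewrite clamp_id|rewrite clamp_le0|
    split; [apply: min_r|rewrite clamp_ge1|rewrite clamp_ge1]]; flra.
have uE : u = 7 - t by rewrite /u min_r//; flra.
have [t5|t5] := ltP t 5.
  apply: Or44; left; split; first by rewrite /=; flra.
  rewrite uE; split; [rewrite clamp_ge1|rewrite clamp_ge1|rewrite clamp_id|
    split; [apply: min_r|rewrite clamp_id|rewrite clamp_ge1]]; flra.
apply: Or44; right; split; first by rewrite /=; flra.
rewrite uE; split; [rewrite clamp_ge1|rewrite clamp_ge1|rewrite clamp_ge1|
  split; [apply: min_l|rewrite clamp_le0|congr clamp]]; flra.
Qed.

(* Position of the arcs above the down strands: vertical for t <= 2 and for
   5 <= t, moving to the left in between. *)
Definition staircase (k : nat) (x : nat -> R -> R) :=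
  [/\ forall d (t : R), (d < k)%N -> 0 <= t <= 2 -> x d t = colx k d,
      forall d (t : R), (d < k)%N -> 5 <= t <= 7 -> x d t = colx k d.+1 &
      forall d (t t' : R), (d < k)%N -> 2 <= t -> t < t' -> t' <= 5 -> x d t' < x d t].

Lemma staircase_mid k x d (t : R) : staircase k x -> (d < k)%N -> 2 < t < 5 ->
  colx k d.+1 < x d t < colx k d.
Proof.
move=> [x2 x5 xm] dk /andP[t2 t5]; rewrite -(x5 d 5) ?lexx//=; last by flra.
rewrite -(x2 d 2) ?lexx//=; last by flra.
by rewrite !xm//; flra.
Qed.

(** Between the times 2 and 5 an arc lies strictly between two consecutive columns, where no other
    arc goes. Only vertical parts can share an abscissa: those of a single arc, or those of two
    consecutive arcs on their common column. *)
Lemma staircase_eq k x d d' (t t' : R) : staircase k x -> (d < k)%N -> (d' < k)%N ->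
  0 <= t <= 7 -> 0 <= t' <= 7 -> x d t = x d' t' ->
  [\/ d = d' /\ t = t', d = d' /\ t <= 2 /\ t' <= 2, d = d' /\ 5 <= t /\ 5 <= t' |
    (d = d'.+1 /\ t <= 2 /\ 5 <= t') \/ (d' = d.+1 /\ t' <= 2 /\ 5 <= t)].
Proof.
move=> sx dk d'k t07 t'07 xE; have [x2 x5 xm] := sx.
have sep e e' (s : R) : (e' < k)%N -> 2 < s < 5 -> x e' s <> colx k e.
  move=> e'k s25; have := staircase_mid sx e'k s25 => /andP[s1 s2] sE.
  have [ee|ee] := leqP e e'; first by have := colx_le k ee; flra.
  by have := colx_le k ee; flra.
have reg (s : R) : 0 <= s <= 7 -> [\/ 0 <= s <= 2, 2 < s < 5 | 5 <= s <= 7].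
  move=> s07; have [s2|s2] := leP s 2; first by apply: Or31; flra.
  have [s5|s5] := ltP s 5; [apply: Or32|apply: Or33]; flra.
case: (reg t t07) => ht; case: (reg t' t'07) => ht'.
- rewrite !x2// in xE; apply: Or42; split; [exact: colx_inj xE|flra].
- by case: (sep d d' t' d'k ht'); rewrite -xE x2.
- by rewrite x2// x5// in xE; apply: Or44; left; split; [exact: colx_inj xE|flra].
- by case: (sep d' d t dk ht); rewrite xE x2.
- have dd : d = d'.
    have /andP[a1 a2] := staircase_mid sx dk ht; have /andP[b1 b2] := staircase_mid sx d'k ht'.
    by have [dd|dd|//] := ltngtP d d'; exfalso; have := colx_le k dd; flra.
  apply: Or41; split=> //; subst d'; have [tt|tt|//] := ltgtP t t'.
    by have : x d t' < x d t by [apply: xm => //; flra]; rewrite xE ltxx.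
  by have : x d t < x d t' by [apply: xm => //; flra]; rewrite xE ltxx.
- by case: (sep d'.+1 d t dk ht); rewrite xE x5.
- rewrite x5// x2// in xE; apply: Or44; right; split; last by flra.
  by apply/esym; exact: colx_inj xE.
- by case: (sep d.+1 d' t' d'k ht'); rewrite -xE x5.
- rewrite !x5// in xE; apply: Or43; split; last by flra.
  by have [] := colx_inj xE.
Qed.
End Layout.

Section ArcBoxes.
Context {R : realType}.

(** [eta d] is the height at which the column [d] is divided between the end of the arc [d - 1] and
    the start of the arc [d]. *)
Definition arc_boxes (k : nat) (eta : nat -> R) : set (R * R * R) :=
  [set p | p.2 = 0 /\ exists2 d, (d < k)%N &
    [\/ p.1.1 = colx k d /\ lowy d <= p.1.2 <= eta d,
        p.1.2 = lowy d /\ colx k d <= p.1.1 <= farx k d,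
        p.1.1 = farx k d /\ lowy d <= p.1.2 <= highy d |
        (p.1.2 = highy d /\ colx k d.+1 <= p.1.1 <= farx k d) \/
        (p.1.1 = colx k d.+1 /\ eta d.+1 <= p.1.2 <= highy d)]].

(** For [0 < d < k] the column [d] between the heights 0 and 1 is a fixed strand, reassembled from
    the end of one arc and the start of the next. Above [b1] the column [k] belongs to the moving
    strand, so [X] and [Z] have to vanish there. *)
Lemma arc_boxes_closure (k : nat) (eta : nat -> R) (b0 b1 : R) (X Z : R -> R) : (0 < k)%N ->
  (forall d, (d <= k)%N -> 0 < eta d < 1) -> eta 0%N = b0 -> eta k = b1 -> b0 <= b1 ->
  (forall v, b1 <= v -> X v = 0 /\ Z v = 0) ->
  arc_boxes k eta `|` [set (X v, v, Z v) | v in [set v | b0 <= v <= b1]] = open_closure k b0 X Z.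
Proof.
move=> k0 e01 eb0 eb1 b01 XZ1.
have b0_01 : 0 < b0 < 1 by rewrite -eb0 e01.
have b1_01 : 0 < b1 < 1 by rewrite -eb1 e01.
have kp : k.-1%:R = k%:R - 1 :> R by rewrite -subn1 natrB.
have k1 : (1 : R) <= k%:R by rewrite ler1n.
(* The down strand [i] is the column number [k - i]. *)
have inner (i : 'I_k) (p : R * R * R) : (0 < i)%N ->
    strand (fun=> (i%:R, 0)) p \/ closing_arc k i p -> inner_arcs k p.
  by move=> i0 ip; right; exists i.
have idx d : (0 < d < k)%N -> exists2 i : 'I_k, (0 < i)%N &
    [/\ i%:R = k%:R - d%:R :> R, i%:R = colx k d :> R & (k - i)%:R = d%:R :> R].
  move=> /andP[d0 dk]; have ik : (k - d < k)%N by rewrite ltn_subrL d0.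
  exists (Ordinal ik); rewrite /= ?subn_gt0//.
  have E : (k - d)%:R = k%:R - d%:R :> R by rewrite natrB// ltnW.
  by rewrite /= subKn ?(ltnW dk)//; split=> //; rewrite E; case: (d) d0.
have arcE (i : 'I_k) d : (0 < i)%N -> i%:R = k%:R - d%:R :> R -> (k - i)%:R = d%:R :> R ->
  closing_arc k i = polyline ((k%:R - d%:R : R), 0, 0)
    [:: (k%:R - d%:R, - d%:R - 1, 0); (k%:R + d%:R + 1, - d%:R - 1, 0);
        (k%:R + d%:R + 1, d%:R + 2, 0); (k%:R - d%:R - 1, d%:R + 2, 0); (k%:R - d%:R - 1, 1, 0)].
  case: i => -[|j] //= jk _ ij dj; rewrite /closing_arc dj ij.
  by have -> : j%:R = k%:R - d%:R - 1 :> R by rewrite -ij -natr1 addrK.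
apply/seteqP; split=> p.
  move=> [[p20 [d dk H]]|[v /= /andP[v0 v1] <-]]; last first.
    by left; exists v => //=; rewrite v0 (le_trans v1)//; flra.
  case: p p20 H => [[px py] pz] /= -> H.
  have e1 := e01 d (ltnW dk); have e2 := e01 d.+1 dk.
  have [d0|d0] := posnP d.
    subst d; rewrite /= in H e1 e2; rewrite eb0 in H.
    case: H => [[-> py1]|[-> px1]|[-> py1]|[[-> px1]|[-> py1]]].
    - by right; left; exists py.
    - by right; right; left; rewrite segment_x; [exists px|flra].
    - by right; right; right; left; left; left; rewrite segment_y; [exists py|flra].
    - right; right; right; left; left; right; rewrite segment_sym kp segment_x; last by flra.
      by exists px.
    - have [y1|/ltW y1] := leP 1 py.
        right; right; right; left; right; rewrite segment_sym kp segment_y; last by flra.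
        by exists py => //=; flra.
      have [k1'|k1'] := eqVneq k 1%N.
        left; exists py => /=; first by rewrite k1' in eb1; flra.
        have [|-> ->] := XZ1 py; first by rewrite k1' in eb1; flra.
        by rewrite k1' subrr.
      have [|i i0 [iE _ _]] := idx 1%N; first by rewrite /= ltn_neqAle eq_sym k1'.
      right; right; right; apply: (inner i) => //; left.
      by exists (1 - py); [rewrite /= in_itv /=; flra|rewrite iE /=; apply: pt_eq => //; ring].
  have [i i0 [iE _ dE]] := idx d (introT andP (conj d0 dk)).
  have dd : (1 : R) <= d%:R by rewrite ler1n.
  have [colE lowE highE farE] : [/\ colx k d = k%:R - d%:R :> R, lowy d = - d%:R - 1 :> R,
      highy d = d%:R + 2 :> R & farx k d = k%:R + d%:R + 1 :> R] by case: (d) d0.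
  have col1E : k%:R - d.+1%:R = k%:R - d%:R - 1 :> R by rewrite -natr1; ring.
  rewrite colE lowE highE farE col1E in H.
  case: H => [[-> py1]|[-> px1]|[-> py1]|[[-> px1]|[-> py1]]].
  - do 3 right; apply: (inner i) => //; have [y0|/ltW y0] := leP 0 py.
      left; exists (1 - py); first by rewrite /= in_itv /=; flra.
      by rewrite iE /=; apply: pt_eq => //; ring.
    right; rewrite (arcE _ _ i0 iE dE) /=; left; rewrite segment_sym segment_y; last by flra.
    by exists py => //=; flra.
  - do 3 right; apply: (inner i) => //; right; rewrite (arcE _ _ i0 iE dE) /=; right; left.
    by rewrite segment_x; [exists px|flra].
  - do 3 right; apply: (inner i) => //; right; rewrite (arcE _ _ i0 iE dE) /=; do 2 right; left.
    by rewrite segment_y; [exists py|flra].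
  - do 3 right; apply: (inner i) => //; right; rewrite (arcE _ _ i0 iE dE) /=; do 3 right; left.
    by rewrite segment_sym segment_x; [exists px|flra].
  - have [y1|/ltW y1] := leP 1 py.
      do 3 right; apply: (inner i) => //; right; rewrite (arcE _ _ i0 iE dE) /=; do 4 right; left.
      by rewrite segment_sym segment_y; [exists py => //=; flra|flra].
    have [k1'|dk1] := eqVneq d.+1 k.
      left; exists py => /=; first by rewrite k1' in e2 py1; flra.
      have [|-> ->] := XZ1 py; first by rewrite k1' in py1; flra.
      by apply: pt_eq => //; rewrite -k1' -natr1; ring.
    have [|i' i0' [iE' _ _]] := idx d.+1; first by rewrite /= ltn_neqAle dk1.
    do 3 right; apply: (inner i') => //; left.
    exists (1 - py); first by rewrite /= in_itv /=; flra.
    by rewrite iE' /= -[d.+1%:R]natr1; apply: pt_eq => //; ring.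
move=> op; suff : arc_boxes k eta p \/ exists2 v, b0 <= v <= b1 & p = (X v, v, Z v).
  by case=> [|[v vb ->]]; [left|right; exists v].
have box0 (a b : R) : [\/ a = k%:R - 2^-1 /\ - 2^-1 <= b <= b0,
        b = - 2^-1 /\ k%:R - 2^-1 <= a <= k%:R,
        a = k%:R /\ - 2^-1 <= b <= 1 + 2^-1 |
        (b = 1 + 2^-1 /\ k%:R - 1 <= a <= k%:R) \/
        (a = k%:R - 1 /\ eta 1%N <= b <= 1 + 2^-1)] -> arc_boxes k eta (a, b, 0).
  by move=> H; split=> //; exists 0%N => //=; rewrite eb0.
have boxd d (a b : R) : (0 < d < k)%N -> [\/ a = k%:R - d%:R /\ - d%:R - 1 <= b <= eta d,
        b = - d%:R - 1 /\ k%:R - d%:R <= a <= k%:R + d%:R + 1,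
        a = k%:R + d%:R + 1 /\ - d%:R - 1 <= b <= d%:R + 2 |
        (b = d%:R + 2 /\ k%:R - d%:R - 1 <= a <= k%:R + d%:R + 1) \/
        (a = k%:R - d%:R - 1 /\ eta d.+1 <= b <= d%:R + 2)] -> arc_boxes k eta (a, b, 0).
  move=> /andP[]; case: d => // d _ dk H; split=> //; exists d.+1 => //=.
  have -> : k%:R - d.+2%:R = k%:R - d.+1%:R - 1 :> R by rewrite -[d.+2%:R]natr1 opprD addrA.
  exact: H.
case: op => [[v /= v01 <-]|[[v /= v01 <-]|[Sp|Ip]]].
- have [vb1|/ltW vb1] := leP v b1; first by right; exists v => //; case/andP: v01 => ->.
  have [-> ->] := XZ1 v vb1; left.
  have [k1'|k1'] := eqVneq k 1%N.
    by apply: box0; apply: Or44; right; move: eb1; rewrite k1' subrr => ->; flra.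
  have kk : (0 < k.-1 < k)%N by rewrite ltn_predL k0 andbT -subn1 subn_gt0 ltn_neqAle eq_sym k1'.
  apply: (boxd _ _ _ kk); apply: Or44; right; rewrite prednK// eb1 kp.
  by split; [ring|flra].
- by left; apply: box0; apply: Or41.
- left; move: Sp; rewrite segment_x; last by flra.
  by move=> [u /= u01 <-]; apply: box0; apply: Or42.
left; case: Ip => [[[]|]|].
- rewrite segment_y; last by flra.
  by move=> [u /= u01 <-]; apply: box0; apply: Or43.
- rewrite segment_sym kp segment_x; last by flra.
  by move=> [u /= u01 <-]; apply: box0; apply: Or44; left.
- rewrite segment_sym kp segment_y; last by flra.
  have := e01 1%N k0 => e1 [u /= u01 <-]; apply: box0; apply: Or44; right; flra.
move=> [i /= i0 ip]; pose d := (k - i)%N.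
have dk : (0 < d < k)%N by rewrite subn_gt0 ltn_ord ltn_subrL i0 k0.
have dE : (k - i)%:R = d%:R :> R by [].
have iE : i%:R = k%:R - d%:R :> R by rewrite /d natrB ?(ltnW (ltn_ord i))// opprB addrC subrK.
have ed : 0 < eta d < 1 by apply: e01; case/andP: dk => _ /ltnW.
have ed1 : 0 < eta d.+1 < 1 by apply: e01; case/andP: dk.
have dd : (1 : R) <= d%:R by rewrite ler1n; case/andP: dk.
case: ip => [[t t01 <-]|].
  rewrite /= in_itv /= in t01; rewrite iE /=.
  have [te|/ltW te] := leP (1 - t) (eta d).
    by apply: (boxd _ _ _ dk); apply: Or41; split=> //; flra.
  have [d1|d1] := eqVneq d 1%N.
    by apply: box0; apply: Or44; right; rewrite d1 in te *; split=> //; flra.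
  have dk' : (0 < d.-1 < k)%N.
    case/andP: dk => d0' dk; rewrite -subn1 subn_gt0 ltn_neqAle eq_sym d1 d0' /=.
    by rewrite (leq_ltn_trans _ dk)// leq_subr.
  have d1E : d.-1%:R = d%:R - 1 :> R by rewrite -subn1 natrB//; case/andP: dk.
  apply: (boxd _ _ _ dk'); apply: Or44; right; rewrite prednK; last by case/andP: dk.
  by rewrite d1E; split; [ring|flra].
rewrite (arcE _ _ i0 iE dE) /= => -[|[|[|[|[|]]]]].
- rewrite segment_sym segment_y; last by flra.
  by move=> [u /= u01 <-]; apply: (boxd _ _ _ dk); apply: Or41; split=> //; flra.
- rewrite segment_x; last by flra.
  by move=> [u /= u01 <-]; apply: (boxd _ _ _ dk); apply: Or42.
- rewrite segment_y; last by flra.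
  by move=> [u /= u01 <-]; apply: (boxd _ _ _ dk); apply: Or43.
- rewrite segment_sym segment_x; last by flra.
  by move=> [u /= u01 <-]; apply: (boxd _ _ _ dk); apply: Or44; left.
- rewrite segment_sym segment_y; last by flra.
  by move=> [u /= u01 <-]; apply: (boxd _ _ _ dk); apply: Or44; right; split=> //; flra.
- by move=> ->; apply: (boxd _ _ _ dk); apply: Or44; right; split=> //; flra.
Qed.
End ArcBoxes.

Section ClosingArcs.
Context {R : realType}.
Implicit Types (M : R) (y : R -> R) (x : nat -> R -> R).

(** The distance from the arc [d] to the plane [z = 0]. Up to [M] the arc keeps its place, out of
    the way of the last arc; its height is adjusted from the depth [M] on, by means of [weight], and
    its abscissa from [2 * M] on. The plateau [(3 + d) * M] differs from arc to arc. *)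
Definition depth (M : R) (d : nat) (t : R) : R :=
  M * Num.min (Num.min t (7 - t)) 2 + (1 + d%:R) * M * clamp (Num.min t (7 - t) - 2).

Definition weight (t : R) : R := clamp (Num.min t (7 - t) - 1).

Lemma depth_start M d (t : R) : 0 <= t <= 2 -> depth M d t = M * t /\ weight t = clamp (t - 1).
Proof.
move=> t02; have t07 : 0 <= t <= 7 by flra.
rewrite /depth /weight; case: (layout_clamps t07) => [[_ [_ _ _ [-> -> ->]]]|[]|[]|[[]|[]]]; try by move=> *; exfalso; flra.
by rewrite mulr0 addr0.
Qed.
Lemma depth_end M d (t : R) : 5 <= t <= 7 -> depth M d t = M * (7 - t) /\ weight t = clamp (6 - t).
Proof.
move=> t02; have t07 : 0 <= t <= 7 by flra.
rewrite /depth /weight; case: (layout_clamps t07) => [[]|[]|[]|[[]|[_ [_ _ _ [-> -> ->]]]]]; try by move=> *; exfalso; flra.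
by rewrite mulr0 addr0.
Qed.
Lemma depth_left M d (t : R) : 2 < t < 3 -> depth M d t = M * 2 + (1 + d%:R) * M * (t - 2) /\ weight t = 1.
Proof.
move=> t02; have t07 : 0 <= t <= 7 by flra.
rewrite /depth /weight; case: (layout_clamps t07) => [[]|[_ [_ _ _ [-> -> ->]]]|[]|[[]|[]]] //; by move=> *; exfalso; flra.
Qed.
Lemma depth_plateau M d (t : R) : 3 <= t <= 4 -> depth M d t = M * 2 + (1 + d%:R) * M /\ weight t = 1.
Proof.
move=> t02; have t07 : 0 <= t <= 7 by flra.
rewrite /depth /weight; case: (layout_clamps t07) => [[]|[]|[_ [_ _ _ [-> -> ->]]]|[[]|[]]]; try by move=> *; exfalso; flra.
by rewrite mulr1.
Qed.
Lemma depth_right M d (t : R) : 4 < t < 5 -> depth M d t = M * 2 + (1 + d%:R) * M * (5 - t) /\ weight t = 1.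
Proof.
move=> t02; have t07 : 0 <= t <= 7 by flra.
rewrite /depth /weight; case: (layout_clamps t07) => [[]|[]|[]|[[_ [_ _ _ [-> -> ->]]]|[]]] //; by move=> *; exfalso; flra.
Qed.

Lemma depth_cases M d (t : R) : 0 < M -> 0 <= t <= 7 ->
  [\/ [/\ 0 <= t <= 2, depth M d t = M * t & weight t = clamp (t - 1)],
      [/\ 2 < t < 5, 2 * M < depth M d t & weight t = 1] |
      [/\ 5 <= t <= 7, depth M d t = M * (7 - t) & weight t = clamp (6 - t)]].
Proof.
move=> M0 t07; have dM : 0 < (1 + d%:R) * M by rewrite mulr_gt0// ltr_pwDl.
have [t2|t2] := leP t 2.
  by have [-> ->] := @depth_start M d t (introT andP (conj (elimTF andP t07).1 t2)); apply: Or31; split=> //; flra.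
have [t5|t5] := leP 5 t.
  have h : 5 <= t <= 7 by flra.
  by have [-> ->] := depth_end M d h; apply: Or33; split=> //; flra.
apply: Or32; split; first by flra.
  have [t3|t3] := ltP t 3; first by rewrite (depth_left _ _ _).1; [fnra|flra].
  have [t4|t4] := leP t 4; first by rewrite (depth_plateau _ _ _).1; [fnra|flra].
  by rewrite (depth_right _ _ _).1; [fnra|flra].
have [t3|t3] := ltP t 3; first by rewrite (depth_left M d _).2//; flra.
have [t4|t4] := leP t 4; first by rewrite (depth_plateau M d _).2//; flra.
by rewrite (depth_right M d _).2//; flra.
Qed.

Lemma depth_ge0 M d (t : R) : 0 < M -> 0 <= t <= 7 -> 0 <= depth M d t.
Proof. by move=> M0 /(depth_cases d M0)[[h -> _]|[h1 h2 _]|[h -> _]]; fnra. Qed.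

Lemma depth_le M d (t : R) : 0 < M -> 0 <= t <= 7 -> depth M d t <= M ->
  weight t = 0 /\ (t <= 2 \/ 5 <= t).
Proof.
move=> M0 /(depth_cases d M0)[[h -> ->]|[h1 h2 _]|[h -> ->]].
- move=> tM; have t1 : t <= 1 by fnra.
  by rewrite clamp_le0; [split=> //; left|]; flra.
- by move=> ?; exfalso; flra.
- move=> tM; have t1 : 6 <= t by fnra.
  by rewrite clamp_le0; [split=> //; right|]; flra.
Qed.

Definition arcx (k d : nat) (t : R) : R :=
  colx k d * (1 - clamp (t - 2)) + farx k d * (clamp (t - 2) - clamp (t - 4)) + colx k d.+1 * clamp (t - 4).
Definition arcy (y : R -> R) (d : nat) (t : R) : R :=
  (1 - weight t) * y t + weight t * (lowy d + (highy d - lowy d) * clamp (t - 3)).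

Lemma arc_left k y d (t : R) : 0 <= t <= 2 ->
  arcx k d t = colx k d /\ arcy y d t = (1 - clamp (t - 1)) * y t + clamp (t - 1) * lowy d.
Proof.
move=> /andP[t0 t2]; have uE : Num.min t (7 - t) = t by apply: min_l; flra.
rewrite /arcx /arcy /weight uE (@clamp_le0 _ (t - 2)) ?(@clamp_le0 _ (t - 4)) ?(@clamp_le0 _ (t - 3)); [by split; ring|flra..].
Qed.
Lemma arc_right k y d (t : R) : 5 <= t <= 7 ->
  arcx k d t = colx k d.+1 /\ arcy y d t = (1 - clamp (6 - t)) * y t + clamp (6 - t) * highy d.
Proof.
move=> /andP[t5 t7]; have uE : Num.min t (7 - t) - 1 = 6 - t by rewrite min_r; flra.
rewrite /arcx /arcy /weight uE (@clamp_ge1 _ (t - 2)) ?(@clamp_ge1 _ (t - 4)) ?(@clamp_ge1 _ (t - 3)); [by split; ring|flra..].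
Qed.
Lemma arc_middle k y d (t : R) : 2 < t < 5 ->
  [\/ [/\ t < 3, arcx k d t = colx k d + (farx k d - colx k d) * (t - 2) & arcy y d t = lowy d],
      [/\ 3 <= t <= 4, arcx k d t = farx k d & arcy y d t = lowy d + (highy d - lowy d) * (t - 3)] |
      [/\ 4 < t, arcx k d t = colx k d.+1 + (farx k d - colx k d.+1) * (5 - t) & arcy y d t = highy d]].
Proof.
move=> /andP[t2 t5]; rewrite /arcx /arcy /weight (@clamp_ge1 _ (_ - 1)) ?subrr; last by rewrite lerBrDr le_min; flra.
have [t3|t3] := ltP t 3.
  apply: Or31; rewrite (@clamp_id _ (t - 2)) ?(@clamp_le0 _ (t - 4)) ?(@clamp_le0 _ (t - 3)); [by split=> //; ring|flra..].
have [t4|t4] := leP t 4.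
  apply: Or32; rewrite (@clamp_ge1 _ (t - 2)) ?(@clamp_le0 _ (t - 4)) ?(@clamp_id _ (t - 3)); [by split=> //; ring|flra..].
apply: Or33; rewrite (@clamp_ge1 _ (t - 2)) ?(@clamp_id _ (t - 4)) ?(@clamp_ge1 _ (t - 3)); [by split=> //; ring|flra..].
Qed.

Lemma arcx_side k x d (t : R) : staircase k x -> (d < k)%N -> 0 <= t <= 7 -> t <= 2 \/ 5 <= t ->
  arcx k d t = x d t.
Proof.
move=> [x2 x5 _] dk /andP[t0 t7] [h|h].
  by rewrite (arc_left k id d _).1 ?x2// t0.
by rewrite (arc_right k id d _).1 ?x5// h.
Qed.

Let arcy_far y d (t : R) : 2 < t < 5 ->
  [\/ t < 3 /\ arcy y d t = lowy d, 3 <= t <= 4 /\ arcy y d t = lowy d + (highy d - lowy d) * (t - 3) |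
      4 < t /\ arcy y d t = highy d].
Proof. by move=> /(arc_middle 0 y d)[[? _ ?]|[? _ ?]|[? _ ?]]; [apply: Or31|apply: Or32|apply: Or33]. Qed.

Let mu (t : R) : R := Num.min 1 (Num.min (t - 2) (5 - t)).
Let mu_left (t : R) : t <= 3 -> mu t = t - 2.
Proof. by move=> h; rewrite /mu [Num.min (t - 2) _]min_l ?min_r//; flra. Qed.
Let mu_plateau (t : R) : 3 <= t <= 4 -> mu t = 1.
Proof. by move=> h; rewrite /mu min_l// le_min; flra. Qed.
Let mu_right (t : R) : 4 <= t -> mu t = 5 - t.
Proof. by move=> h; rewrite /mu [Num.min (t - 2) _]min_r ?min_r//; flra. Qed.
Let mu_le1 (t : R) : mu t <= 1.
Proof. by rewrite /mu ge_min lexx. Qed.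

Let depth_far M d (t : R) : 0 < M -> 2 < t < 5 -> depth M d t = M * 2 + (1 + d%:R) * M * mu t.
Proof.
move=> M0 t25; have [t3|t3] := ltP t 3; first by rewrite (depth_left M d _).1 ?mu_left//; flra.
have [t4|t4] := leP t 4; first by rewrite (depth_plateau M d _).1 ?mu_plateau ?mulr1//; flra.
by rewrite (depth_right M d _).1 ?mu_right//; flra.
Qed.

(** On distinct arcs, equal depths force the arc of larger index off its plateau. It is then at its
    lowest or highest level, which is outside the range of the other arc. *)
Lemma arc_height_depth_inj M y y' d d' (t t' : R) : 0 < M -> 2 < t < 5 -> 2 < t' < 5 ->
  arcy y d t = arcy y' d' t' -> depth M d t = depth M d' t' -> d = d' /\ t = t'.
Proof.
move=> M0 h h'; rewrite !depth_far// => yy /addrI; rewrite ![_ * M]mulrC -!mulrA => /mulfI.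
have /[swap]/[apply] : M != 0 by rewrite gt_eqF.
have L0 := @lowy_lt0 R d; have L0' := @lowy_lt0 R d'; have H0 := @highy_gt1 R d; have H0' := @highy_gt1 R d'.
have D0 := ler0n R d; have D0' := ler0n R d'.
have lt_nat (e e' : nat) : (e < e')%N -> e%:R + 1 <= e'%:R :> R by rewrite natr1 ler_nat.
have mid_bounds e (s : R) : 3 <= s <= 4 -> lowy e <= lowy e + (highy e - lowy e) * (s - 3) <= highy e.
  have := @lowy_lt0 R e; have := @highy_gt1 R e; move: (lowy e) (highy e); clear => *; apply/andP; split; fnra.
have [dd|dd|dd] := ltngtP d d'; last first.
- subst d'; move=> /mulfI e; have {}e : mu t = mu t' by apply: e; rewrite gt_eqF; flra.
  split=> //; move: yy e.
  case: (arcy_far y d h) => -[q ->]; case: (arcy_far y' d h') => -[q' ->] yE; try by exfalso; fnra.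
  + by rewrite !mu_left; flra.
  + by rewrite mu_left ?mu_plateau; flra.
  + by rewrite mu_plateau ?mu_left; flra.
  + by have hl : 0 < highy d - lowy d :> R by [flra]; fnra.
  + by rewrite mu_plateau ?mu_right; flra.
  + by rewrite mu_right ?mu_plateau; flra.
  + by rewrite !mu_right; flra.
- have L := @lowy_lt R _ _ dd; have H := @highy_lt R _ _ dd; have dl := lt_nat _ _ dd.
  have a : 0 <= (1 + d'%:R) * (1 - mu t') by apply: mulr_ge0; have := mu_le1 t'; flra.
  move: yy; case: (arcy_far y d h) => -[q ->]; [|by rewrite (mu_plateau q) => _ c; exfalso; flra|];
    case: (arcy_far y' d' h') => -[q' ->] yE _; try (have b' := mid_bounds d' t' q'); exfalso; flra.
- have L := @lowy_lt R _ _ dd; have H := @highy_lt R _ _ dd; have dl := lt_nat _ _ dd.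
  have a : 0 <= (1 + d%:R) * (1 - mu t) by apply: mulr_ge0; have := mu_le1 t; flra.
  move: yy; case: (arcy_far y' d' h') => -[q' ->]; [|by rewrite (mu_plateau q') => _ c; exfalso; flra|];
    case: (arcy_far y d h) => -[q ->] yE _; try (have b := mid_bounds d t q); exfalso; flra.
Qed.

End ClosingArcs.

Section ArcsInjectivity.
Context {R : realType}.
Implicit Types (M : R) (y : R -> R) (x : nat -> R -> R).
Lemma arc_pieces k (y : R -> R) e (s : R) :
  (forall t : R, 0 <= t <= 7 -> 0 < y t < 1) ->
  (forall t t' : R, 0 <= t -> t < t' -> t' <= 2 -> y t' < y t) ->
  (forall t t' : R, 5 <= t -> t < t' -> t' <= 7 -> y t' < y t) -> 0 <= s <= 7 ->
    [\/ [/\ s <= 2, arcx k e s = colx k e & lowy e <= arcy y e s <= y 0],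
        [/\ 2 < s < 3, arcx k e s = colx k e + (farx k e - colx k e) * (s - 2) & arcy y e s = lowy e],
        [/\ 3 <= s <= 4, arcx k e s = farx k e & arcy y e s = lowy e + (highy e - lowy e) * (s - 3)] |
        [/\ 4 < s < 5, arcx k e s = colx k e.+1 + (farx k e - colx k e.+1) * (5 - s) & arcy y e s = highy e] \/
        [/\ 5 <= s, arcx k e s = colx k e.+1 & y 7 <= arcy y e s <= highy e]].
Proof.
  move=> y01 yA yF s07; have ys := y01 s s07; have /andP[s0 s7] := s07.
  have [s2|s2] := leP s 2.
    have [-> ->] := arc_left k y e (introT andP (conj s0 s2)).
    have ys0 := y01 0 (introT andP (conj (lexx 0) (ler0n R 7))).
    apply: Or41; split=> //; have L0 := @lowy_lt0 R e.
    have c1 := clamp_ge0 (s - 1); have c2 := clamp_le1 (s - 1).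
    have ys1 : y s <= y 0.
      by have [->//|s0'] := eqVneq s 0; apply/ltW/yA => //; rewrite lt_neqAle eq_sym s0'.
    by move: ys ys0 ys1 c1 c2 L0; clear; move: (clamp _) (y s) (y 0) (lowy e) => *; fnra.
  have [s5|s5] := leP 5 s.
    have [-> ->] := arc_right k y e (introT andP (conj s5 s7)).
    have ys7 := y01 7 (introT andP (conj (ler0n R 7) (lexx 7))).
    apply: Or44; right; split=> //; have H0 := @highy_gt1 R e.
    have c1 := clamp_ge0 (6 - s); have c2 := clamp_le1 (6 - s).
    have ys1 : y 7 <= y s.
      by have [->//|s0'] := eqVneq s 7; apply/ltW/yF => //; rewrite lt_neqAle s0'.
    by move: ys ys7 ys1 c1 c2 H0; clear; move: (clamp _) (y s) (y 7) (highy e) => *; fnra.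
  case: (arc_middle k y e (introT andP (conj s2 s5))) => [[h -> ->]|[h -> ->]|[h -> ->]].
  - by apply: Or42; split=> //; rewrite s2.
  - by apply: Or43.
  - by apply: Or44; left; split=> //; rewrite h.
Qed.

(* The planar projection of the final arcs only meets itself at the ends of
   consecutive arcs, where the depth vanishes. *)
Lemma arc_plane_depth_inj k (y : nat -> R -> R) M d d' (t t' : R) : 0 < M ->
  (forall d (t : R), (d < k)%N -> 0 <= t <= 7 -> 0 < y d t < 1) ->
  (forall d (t t' : R), (d < k)%N -> 0 <= t -> t < t' -> t' <= 2 -> y d t' < y d t) ->
  (forall d (t t' : R), (d < k)%N -> 5 <= t -> t < t' -> t' <= 7 -> y d t' < y d t) ->
  (forall d, (d.+1 < k)%N -> y d 7 = y d.+1 0) ->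
  (d < k)%N -> (d' < k)%N -> 0 <= t <= 7 -> 0 <= t' <= 7 ->
  arcx k d t = arcx k d' t' -> arcy (y d) d t = arcy (y d') d' t' ->
  (d = d' /\ t = t') \/ (depth M d t = 0 /\ depth M d' t' = 0).
Proof.
move=> M0 y01 yA yF y70.
wlog dd : d d' t t' / (d < d')%N || ((d == d') && (t <= t')).
  move=> H dk d'k t07 t'07 xE yE.
  have H1 := H d d' t t' _ dk d'k t07 t'07 xE yE.
  have H2 := H d' d t' t _ d'k dk t'07 t07 (esym xE) (esym yE).
  have [dd|dd|dd] := ltngtP d d'.
  - by apply: H1; rewrite dd.
  - by case: H2 => [|[-> ->]|[? ?]]; [rewrite dd|left|right].
  - have [tt|/ltW tt] := leP t t'; first by apply: H1; rewrite dd eqxx tt orbT.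
    by case: H2 => [|[-> ->]|[? ?]]; [rewrite dd eqxx tt orbT|left|right].
move=> dk d'k t07 t'07 xE yE.
have startA e (s s' : R) : (e < k)%N -> 0 <= s -> s < s' -> s' <= 2 ->
    arcy (y e) e s' < arcy (y e) e s.
  move=> ek s0 ss s2.
  have s07 : 0 <= s <= 7 by clear -s0 ss s2; flra.
  have s'07 : 0 <= s' <= 7 by clear -s0 ss s2; flra.
  have a1 := yA e s s' ek s0 ss s2; have a2 := y01 e s ek s07; have a3 := y01 e s' ek s'07.
  rewrite (arc_left k _ e _).2; last by clear -s0 ss s2; flra.
  rewrite (arc_left k _ e _).2; last by clear -s0 ss s2; flra.
  have L := @lowy_lt0 R e.
  have c1 := clamp_ge0 (s - 1); have c2 := clamp_le1 (s' - 1).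
  have c3 : clamp (s - 1) <= clamp (s' - 1) by apply: clamp_le; clear -ss; flra.
  have c4 : clamp (s - 1) < 1 by apply: clamp_lt1; clear -ss s2; flra.
  by move: a1 a2 a3 L c1 c2 c3 c4; clear; move: (clamp _) (clamp _) (y e s) (y e s') (lowy e) => *; fnra.
have endF e (s s' : R) : (e < k)%N -> 5 <= s -> s < s' -> s' <= 7 ->
    arcy (y e) e s' < arcy (y e) e s.
  move=> ek s0 ss s2.
  have s07 : 0 <= s <= 7 by clear -s0 ss s2; flra.
  have s'07 : 0 <= s' <= 7 by clear -s0 ss s2; flra.
  have a1 := yF e s s' ek s0 ss s2; have a2 := y01 e s ek s07; have a3 := y01 e s' ek s'07.
  rewrite (arc_right k _ e _).2; last by clear -s0 ss s2; flra.
  rewrite (arc_right k _ e _).2; last by clear -s0 ss s2; flra.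
  have L := @highy_gt1 R e.
  have c1 := clamp_ge0 (6 - s'); have c2 := clamp_le1 (6 - s).
  have c3 : clamp (6 - s') <= clamp (6 - s) by apply: clamp_le; clear -ss; flra.
  have c4 : clamp (6 - s') < 1 by apply: clamp_lt1; clear -s0 ss; flra.
  by move: a1 a2 a3 L c1 c2 c3 c4; clear; move: (clamp _) (clamp _) (y e s) (y e s') (highy e) => *; fnra.
have box e s (ek : (e < k)%N) := @arc_pieces k (y e) e s (fun u => y01 e u ek) (fun u v => yA e u v ek) (fun u v => yF e u v ek).
have /andP[t0 t7] := t07; have /andP[t'0 t'7] := t'07.
have Y1 := y01 d 0 dk (introT andP (conj (lexx 0) (ler0n R 7))).
have Y3 := y01 d 7 dk (introT andP (conj (ler0n R 7) (lexx 7))).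
have L0 := @lowy_lt0 R d; have H0 := @highy_gt1 R d.
have F0 := @colx_farx R k d d; have F3 := @colx_farx R k d.+1 d.
case/orP: dd => [dlt|/andP[/eqP dE tt]]; last first.
  subst d'; left; split=> //.
  have C4 := @colx_lt R k d d.+1 (ltnSn d).
  have A1 := startA d t t' dk t0.
  have B1 := fun a b => endF d t t' dk a b t'7.
  move: (box d t dk t07) (box d t' dk t'07); rewrite -xE -yE.
  move: A1 B1; rewrite -yE ltxx => A1 B1.
  have {A1} A1 : t' <= 2 -> t = t'.
    by move=> t2; apply/eqP; rewrite eq_le tt leNgt; apply/negP => lt; have := A1 lt t2.
  have {B1} B1 : 5 <= t -> t = t'.
    by move=> t2; apply/eqP; rewrite eq_le tt leNgt; apply/negP => lt; have := B1 t2 lt.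
  clear -tt Y1 Y3 L0 H0 C4 F0 F3 A1 B1.
  have S1 : farx k d - colx k d != 0 :> R by rewrite subr_eq0 gt_eqF.
  have S2 : farx k d - colx k d.+1 != 0 :> R by rewrite subr_eq0 gt_eqF.
  have S3 : highy d - lowy d != 0 :> R by rewrite subr_eq0 gt_eqF//; flra.
  have P1 (s : R) : 2 < s -> 0 < (farx k d - colx k d) * (s - 2) by move=> ?; rewrite mulr_gt0// subr_gt0.
  have P2 (s : R) : s < 5 -> 0 < (farx k d - colx k d.+1) * (5 - s) by move=> ?; rewrite mulr_gt0// subr_gt0.
  have P3 (s : R) : s < 3 -> (farx k d - colx k d) * (s - 2) < farx k d - colx k d.
    by move=> ?; rewrite -[ltRHS]mulr1 ltr_pM2l ?subr_gt0//; flra.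
  have P4 (s : R) : 4 < s -> (farx k d - colx k d.+1) * (5 - s) < farx k d - colx k d.+1.
    by move=> ?; rewrite -[ltRHS]mulr1 ltr_pM2l ?subr_gt0//; flra.
  move: (arcx k d t) (arcy (y d) d t) => u v.
  case=> [[h a b]|[h a b]|[h a b]|[[h a b]|[h a b]]].
  - case=> [[h' _ _]|[/andP[h' _] a' _]|[_ a' _]|[[h' _ b']|[_ a' _]]]; first exact: A1; exfalso.
    + by move: (P1 _ h') a a'; clear; flra.
    + by move: a a' F0; clear; flra.
    + by move: b b' Y1 H0; clear; flra.
    + by move: a a' C4; clear; flra.
  - case/andP: h => h1 h2.
    case=> [[h' _ _]|[_ a' _]|[_ a' _]|[[_ _ b']|[_ a' _]]].
    + by exfalso; move: h1 h' tt; clear; flra.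
    + by move: a'; rewrite a => /addrI/(mulfI S1)/addIr.
    + by exfalso; move: (P3 _ h2) a a'; clear; flra.
    + by exfalso; move: b b' L0 H0; clear; flra.
    + by exfalso; move: (P1 _ h1) a a' C4; clear; flra.
  - case=> [[h' _ _]|[/andP[h1 h2] a' _]|[_ _ b']|[[/andP[h1 h2] a' _]|[_ a' _]]].
    + by exfalso; move: h h' tt; clear; flra.
    + by exfalso; move: h h2 tt; clear; flra.
    + by move: b'; rewrite b => /addrI/(mulfI S3)/addIr.
    + by exfalso; move: (P4 _ h1) a a'; clear; flra.
    + by exfalso; move: a a' F3; clear; flra.
  - case/andP: h => h1 h2; case=> [[h' _ _]|[/andP[_ h'] _ _]|[h' _ _]|[[_ a' _]|[_ a' _]]].
    + by exfalso; move: h1 h' tt; clear; flra.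
    + by exfalso; move: h1 h' tt; clear; flra.
    + by exfalso; move: h1 h' tt; clear; flra.
    + by move: a'; rewrite a => /addrI/(mulfI S2)/addrI/oppr_inj.
    + by exfalso; move: (P2 _ h2) a a'; clear; flra.
  - by move=> _; apply: B1.
have Y2 := y01 d' 0 d'k (introT andP (conj (lexx 0) (ler0n R 7))).
have Y4 := y01 d' 7 d'k (introT andP (conj (ler0n R 7) (lexx 7))).
(* Both arcs descend strictly along the common column, so a common point at the height that
   separates them is the end of one and the start of the other. *)
have last_end : 5 <= t -> t' <= 2 -> d'= d.+1 -> arcy (y d) d t = y d 7 -> arcy (y d) d t = y d' 0 ->
    depth M d t = 0 /\ depth M d' t' = 0.
  move=> t5 t2 dd e1 e2.
  have [t7'|t7'] := ltP t 7.
    exfalso; have := endF d t 7 dk t5 t7' (lexx 7); rewrite e1 (arc_right k _ d _).2; last by clear; flra.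
    by rewrite (@clamp_le0 _ (6 - 7)) ?subr0 ?mul1r ?mul0r ?addr0 ?ltxx//; clear; flra.
  have [t0'|t0'] := ltP 0 t'.
    exfalso; have := startA d' 0 t' d'k (lexx 0) t0' t2; rewrite -yE e2 (arc_left k _ d' _).2; last by clear; flra.
    by rewrite (@clamp_le0 _ (0 - 1)) ?subr0 ?mul1r ?mul0r ?addr0 ?ltxx//; clear; flra.
  have -> : t = 7 by apply/eqP; rewrite eq_le t7.
  have -> : t' = 0 by apply/eqP; rewrite eq_le t'0 andbT.
  by rewrite (depth_end M d _).1 ?(depth_start M d' _).1 ?subrr ?mulr0//; clear; flra.
have y7 := y70 d.
right; move: (box d t dk t07) (box d' t' d'k t'07) last_end; rewrite -xE -yE.
have L : lowy d' < lowy d :> R by exact: lowy_lt.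
have H : highy d < highy d' :> R by exact: highy_lt.
have F : farx k d < farx k d' :> R by exact: farx_lt.
have C1 : colx k d' < colx k d :> R by exact: colx_lt.
have C2 : colx k d' <= colx k d.+1 :> R by exact: colx_le.
have C3 : colx k d'.+1 < colx k d.+1 :> R by exact: colx_lt.
have C4 : colx k d.+1 < colx k d :> R by exact: colx_lt.
have C5 : colx k d'.+1 < colx k d' :> R by exact: colx_lt.
have F5 := @colx_farx R k d' d'; have F6 := @colx_farx R k d'.+1 d'.
have L0' := @lowy_lt0 R d'; have H0' := @highy_gt1 R d'.
have dd0 : colx k d' = colx k d.+1 :> R -> d' = d.+1 by exact: colx_inj.
clear -Y1 Y2 Y3 Y4 L H F C1 C2 C3 C4 C5 F0 F3 F5 F6 L0 H0 L0' H0' dd0 y7 d'k.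
have in1 (a b s : R) : a < b -> 0 < s < 1 -> a < a + (b - a) * s < b by clear; move=> *; fnra.
have in2 (a b s : R) : a < b -> 0 <= s <= 1 -> a <= a + (b - a) * s <= b by clear; move=> *; fnra.
have LH : lowy d < highy d :> R by flra.
have LH' : lowy d' < highy d' :> R by flra.
move: (arcx k d t) (arcy (y d) d t) => u v.
case=> [[_ a b]|[h a b]|[h a b]|[[h a b]|[h a b]]].
- case=> [[_ a' _]|[_ _ b']|[_ a' _]|[[_ _ b']|[_ a' _]]] _; exfalso.
  + by move: a a' C1; clear; flra.
  + by move: b b' L; clear; flra.
  + by move: a a' F F0; clear; flra.
  + by move: b b' H H0 Y1; clear; flra.
  + by move: a a' C1 C5; clear; flra.
- have {}a : colx k d < u < farx k d by rewrite a; apply: in1 => //; clear -h; flra.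
  case=> [[_ a' _]|[_ _ b']|[_ a' _]|[[_ _ b']|[_ a' _]]] _; exfalso.
  + by move: a a' C1; clear; flra.
  + by move: b b' L; clear; flra.
  + by move: a a' F; clear; flra.
  + by move: b b' H LH; clear; flra.
  + by move: a a' C1 C5; clear; flra.
- have {}b : lowy d <= v <= highy d by rewrite b; apply: in2 => //; clear -h; flra.
  case=> [[_ a' _]|[_ _ b']|[_ a' _]|[[_ _ b']|[_ a' _]]] _; exfalso.
  + by move: a a' F0 C1; clear; flra.
  + by move: b b' L; clear; flra.
  + by move: a a' F; clear; flra.
  + by move: b b' H; clear; flra.
  + by move: a a' C1 C5 F0; clear; flra.
- have {}a : colx k d.+1 < u < farx k d.
    by rewrite a; apply: in1 => //; clear -h; flra.
  case=> [[_ a' _]|[_ _ b']|[_ a' _]|[[_ _ b']|[_ a' _]]] _; exfalso.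
  + by move: a a' C2; clear; flra.
  + by move: b b' L LH; clear; flra.
  + by move: a a' F; clear; flra.
  + by move: b b' H; clear; flra.
  + by move: a a' C2 C5; clear; flra.
- case=> [[h' a' b']|[_ _ b']|[_ a' _]|[[_ _ b']|[_ a' _]]]; last first.
  + by exfalso; move: a a' C3; clear; flra.
  + by exfalso; move: b b' H; clear; flra.
  + by exfalso; move: a a' F F3; clear; flra.
  + by exfalso; move: b b' L0' Y3; clear; flra.
  move=> le; have dd : d' = d.+1 by apply: dd0; rewrite -a -a'.
  have y7' : y d 7 = y d' 0 by rewrite y7 -?dd.
  by apply: le => //; clear -y7' b b'; flra.
Qed.
End ArcsInjectivity.

Section ArcsBoxes.
Context {R : realType}.

Lemma IVT_exists (f : R -> R) (a b v : R) : continuous f -> a <= b ->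
  f b <= v <= f a \/ f a <= v <= f b -> exists2 t, a <= t <= b & f t = v.
Proof.
move=> cf ab v01; have [|t tab <-] := @IVT R f a b v ab (continuous_subspaceT cf).
  by rewrite ge_min le_max; case: v01 => /andP[-> ->]; rewrite ?orbT.
by exists t; rewrite // in_itv in tab.
Qed.

Lemma continuous_arcx k d : continuous (@arcx R k d).
Proof. by rewrite /arcx; cont; apply: cont_clamp; cont. Qed.
Lemma continuous_arcy (y : R -> R) d : continuous y -> continuous (arcy y d).
Proof. by move=> cy; rewrite /arcy /weight; cont; first [exact: cy | by apply: cont_clamp; cont]. Qed.

(** That each side of a rectangular arc is covered follows from the intermediate value theorem
    between the times of its two corners. *)
Lemma trajectories_arcs k (y : nat -> R -> R) (eta : nat -> R) : 
  (forall d, continuous (y d)) ->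
  (forall d (t : R), (d < k)%N -> 0 <= t <= 7 -> 0 < y d t < 1) ->
  (forall d (t t' : R), (d < k)%N -> 0 <= t -> t < t' -> t' <= 2 -> y d t' < y d t) ->
  (forall d (t t' : R), (d < k)%N -> 5 <= t -> t < t' -> t' <= 7 -> y d t' < y d t) ->
  (forall d, (d < k)%N -> y d 0 = eta d /\ y d 7 = eta d.+1) ->
  trajectories k 7 (fun d t => (arcx k d t, arcy (y d) d t, 0)) = arc_boxes k eta.
Proof.
move=> cy y01 yA yF yE; apply/seteqP; split=> [_ [d [t [dk t07 ->]]]|[[u v] w] /= [/= -> [d dk /= H]]].
  split=> //; exists d => //=; rewrite -(yE d dk).1 -(yE d dk).2.
  have L0 := @lowy_lt0 R d; have H0 := @highy_gt1 R d.
  have F0 := @colx_farx R k d d; have F3 := @colx_farx R k d.+1 d.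
  have in1 (a b s : R) : a < b -> 0 <= s <= 1 -> a <= a + (b - a) * s <= b by clear; move=> *; fnra.
  case: (@arc_pieces R k (y d) d t) => //.
  - by move=> s; apply: y01.
  - by move=> s s'; apply: yA.
  - by move=> s s'; apply: yF.
  - by move=> [_ -> ->]; apply: Or41.
  - by move=> [h -> ->]; apply: Or42; split=> //; apply: in1 => //; clear -h; flra.
  - by move=> [h -> ->]; apply: Or43; split=> //; apply: in1; [flra|clear -h; flra].
  - move=> [[h -> ->]|[_ -> h]]; first by apply: Or44; left; split=> //; apply: in1 => //; clear -h; flra.
    by apply: Or44; right.
have cX := @continuous_arcx k d; have cY := @continuous_arcy (y d) d (cy d).
have [x0 _] := arc_left k (y d) d (introT andP (conj (lexx 0) (ler0n R 2))).
have [x2 y2] := arc_left k (y d) d (introT andP (conj (ler0n R 2) (lexx 2))).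
have /(arc_right k (y d) d)[x5 y5] : 5 <= (5 : R) <= 7 by clear; flra.
have /(arc_left k (y d) d)[_ y0] : 0 <= (0 : R) <= 2 by clear; flra.
have /(arc_right k (y d) d)[_ y7] : 5 <= (7 : R) <= 7 by clear; flra.
have x3 : arcx k d 3 = farx k d :> R.
  have /(arc_middle k (y d) d)[] : 2 < (3 : R) < 5 by clear; flra.
  - by move=> [h _ _]; exfalso; clear -h; flra.
  - by move=> [_ -> _].
  - by move=> [h _ _]; exfalso; clear -h; flra.
have y3 : arcy (y d) d 3 = lowy d.
  have /(arc_middle k (y d) d)[] : 2 < (3 : R) < 5 by clear; flra.
  - by move=> [h _ _]; exfalso; clear -h; flra.
  - by move=> [_ _ ->]; rewrite subrr mulr0 addr0.
  - by move=> [h _ _]; exfalso; clear -h; flra.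
have [x4 y4] : arcx k d 4 = farx k d :> R /\ arcy (y d) d 4 = highy d.
  have /(arc_middle k (y d) d)[] : 2 < (4 : R) < 5 by clear; flra.
  - by move=> [h _ _]; exfalso; clear -h; flra.
  - by move=> [_ -> ->]; split=> //; ring.
  - by move=> [h _ _]; exfalso; clear -h; flra.
have m1 : clamp (2 - 1 : R) = 1 by apply: clamp_ge1; clear; flra.
have m2 : clamp (0 - 1 : R) = 0 by apply: clamp_le0; clear; flra.
have m3 : clamp (6 - 5 : R) = 1 by apply: clamp_ge1; clear; flra.
have m4 : clamp (6 - 7 : R) = 0 by apply: clamp_le0; clear; flra.
move: y0 y2 y5 y7; rewrite m1 m2 m3 m4 !subr0 subrr !mul1r !mul0r !addr0 !add0r => y0 y2 y5 y7.
have in07 (t a b : R) : a <= t <= b -> 0 <= a -> b <= 7 -> 0 <= t <= 7 by clear; flra.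
have ex (t : R) : 0 <= t <= 7 -> arcx k d t = u -> arcy (y d) d t = v ->
    trajectories k 7 (fun d t => (arcx k d t, arcy (y d) d t, (0 : R))) (u, v, 0 : R).
  by move=> t07 <- <-; exists d, t; split.
have le7 a b : (a <= b)%N -> a%:R <= b%:R :> R by rewrite ler_nat.
case: H => [[uE h]|[vE h]|[uE h]|[[vE h]|[uE h]]].
- have [||t t2 tE] := @IVT_exists (arcy (y d) d) 0 2 v cY; first exact: ler0n.
    by left; rewrite y2 y0 (yE d dk).1.
  by apply: (ex t) => //; [apply: in07 t2 _ _; rewrite ?le7|rewrite (arc_left _ (y d) _ t2).1].
- have [||t t2 tE] := @IVT_exists (arcx k d) 2 3 u cX; first by rewrite le7.
    by right; rewrite x2 x3.
  apply: (ex t) => //; first by apply: in07 t2 _ _; rewrite ?le7.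
  have [t3|t3] := eqVneq t 3; first by rewrite t3 y3.
  have [->|t2'] := eqVneq t 2; first by rewrite y2 vE.
  have /(arc_middle k (y d) d)[] : 2 < t < 5.
    by rewrite lt_neqAle eq_sym t2' (elimTF andP t2).1/= (le_lt_trans (elimTF andP t2).2)// ltr_nat.
  + by move=> [_ _ ->].
  + by move=> [h3 _ _]; exfalso; case/eqP: t3; apply/eqP; rewrite eq_le (elimTF andP t2).2 (elimTF andP h3).1.
  + by move=> [h3 _ _]; exfalso; clear -h3 t2; flra.
- have [||t t2 tE] := @IVT_exists (arcy (y d) d) 3 4 v cY; first by rewrite le7.
    by right; rewrite y3 y4.
  apply: (ex t) => //; first by apply: in07 t2 _ _; rewrite ?le7.
  have /(arc_middle k (y d) d)[] : 2 < t < 5 by clear -t2; flra.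
  + by move=> [h3 _ _]; exfalso; clear -h3 t2; flra.
  + by move=> [_ -> _].
  + by move=> [h3 _ _]; exfalso; clear -h3 t2; flra.
- have [||t t2 tE] := @IVT_exists (arcx k d) 4 5 u cX; first by rewrite le7.
    by left; rewrite x4 x5.
  apply: (ex t) => //; first by apply: in07 t2 _ _; rewrite ?le7.
  have [t3|t3] := eqVneq t 4; first by rewrite t3 y4.
  have [->|t2'] := eqVneq t 5; first by rewrite y5 vE.
  have /(arc_middle k (y d) d)[] : 2 < t < 5.
    by rewrite (lt_le_trans _ (elimTF andP t2).1) ?ltr_nat//= lt_neqAle t2' (elimTF andP t2).2.
  + by move=> [h3 _ _]; exfalso; clear -h3 t2; flra.
  + by move=> [h3 _ _]; exfalso; case/eqP: t3; apply/eqP; rewrite eq_le (elimTF andP t2).1 (elimTF andP h3).2.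
  + by move=> [_ _ ->].
- have [||t t2 tE] := @IVT_exists (arcy (y d) d) 5 7 v cY; first by rewrite le7.
    by left; rewrite y5 y7 (yE d dk).2.
  by apply: (ex t) => //; [apply: in07 t2 _ _; rewrite ?le7|rewrite (arc_right _ (y d) _ t2).1].
Qed.
End ArcsBoxes.

Section Staircase.
Context {R : realType}.

(** Once the arcs are alternately in front of and behind the plane [z = 0], three shears suffice: of
    the height over [(x, z)], of the abscissa over [(y, z)], and the flattening over [(x, y)].
    Consecutive arcs share a column, and the first shear is well defined because they have opposite
    signs. *)
Lemma staircase_isotopic (k : nat) (sg : nat -> R) (x y : nat -> R -> R) (eta : nat -> R)
    (X Z : R -> R) (M C b0 b1 : R) : (0 < k)%N ->
  (forall d, sg d = 1 \/ sg d = -1) -> (forall d, (d.+1 < k)%N -> sg d.+1 = - sg d) ->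
  (forall d, continuous (x d)) -> (forall d, continuous (y d)) -> staircase k x ->
  (forall d (t : R), (d < k)%N -> 0 <= t <= 7 -> 0 < y d t < 1) ->
  (forall d (t t' : R), (d < k)%N -> 0 <= t -> t < t' -> t' <= 2 -> y d t' < y d t) ->
  (forall d (t t' : R), (d < k)%N -> 5 <= t -> t < t' -> t' <= 7 -> y d t' < y d t) ->
  (forall d, (d < k)%N -> y d 0 = eta d /\ y d 7 = eta d.+1) -> eta 0%N = b0 -> eta k = b1 ->
  b0 <= b1 -> 0 < M -> continuous X -> continuous Z ->
  (forall v, b0 <= v <= b1 -> [/\ `|Z v| <= M, `|X v| <= C & X v < k%:R]) ->
  X b0 = k%:R - 2^-1 -> Z b0 = 0 -> X b1 = 0 -> Z b1 = 0 ->
  (forall d (t : R) v, (d < k)%N -> 0 <= t <= 7 -> b0 <= v <= b1 -> x d t = X v -> y d t = v ->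
     sg d * depth M d t = Z v -> v = b0 \/ v = b1) ->
  exists b : 'I_k -> R -> R * R, one_pure_braid b /\
    @isotopic R _ (trajectories k 7 (fun d t => (x d t, y d t, sg d * depth M d t)) `|`
      [set (X v, v, Z v) | v in [set v | b0 <= v <= b1]]) (braid_closure b).
Proof.
move=> k0 sg1 sgS cx cy sx y01 yA yF yE eb0 eb1 b01 M0 cX cZ BM Xb0 Zb0 Xb1 Zb1 disj.
have [x2 x5 xm] := sx.
pose z d (t : R) : R := sg d * depth M d t.
have cz d : continuous (z d) by rewrite /z /depth; cont; apply: cont_clamp; cont.
have cy1 d : continuous (arcy (y d) d) by exact: continuous_arcy.
have cx1 d : continuous (@arcx R k d) by exact: continuous_arcx.
have eta01 d : (d <= k)%N -> 0 < eta d < 1.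
  case: d => [_|d dk]; first by rewrite -(yE 0%N k0).1; apply: y01 => //; flra.
  by rewrite -(yE d dk).2; apply: y01 => //; flra.
have zabs d (t : R) : 0 <= t <= 7 -> `|z d t| = depth M d t.
  move=> /(depth_ge0 d M0) d0; rewrite /z normrM (ger0_norm d0).
  by case: (sg1 d) => ->; rewrite ?normrN normr1 mul1r.
have E1 : @isotopic R _ (trajectories k 7 (fun d t => (x d t, y d t, z d t)) `|`
      [set (X v, v, Z v) | v in [set v | b0 <= v <= b1]])
    (trajectories k 7 (fun d t => (x d t, arcy (y d) d t, z d t)) `|`
      [set (X v, v, Z v) | v in [set v | b0 <= v <= b1]]).
  apply: (@trajectories_move_y R k 7 x y z (fun d => arcy (y d) d) C M) => //.
  - move=> d d' t t' dk d'k t07 t'07 xE zE.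
    have dE : depth M d t = depth M d' t' by rewrite -!zabs// zE.
    case: (staircase_eq sx dk d'k t07 t'07 xE) => [[-> ->]//|[dd [t2 t2']]|[dd [t5 t5']]|H].
    + suff -> : t = t' by rewrite dd.
      have [e1 _] := @depth_start R M d t (introT andP (conj (elimTF andP t07).1 t2)).
      have [e2 _] := @depth_start R M d' t' (introT andP (conj (elimTF andP t'07).1 t2')).
      by move: dE; rewrite e1 e2 => /mulfI; apply; rewrite gt_eqF.
    + suff -> : t = t' by rewrite dd.
      have [e1 _] := @depth_end R M d t (introT andP (conj t5 (elimTF andP t07).2)).
      have [e2 _] := @depth_end R M d' t' (introT andP (conj t5' (elimTF andP t'07).2)).
      by move: dE; rewrite e1 e2 => /mulfI e; apply/oppr_inj/(addrI 7)/e; rewrite gt_eqF.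
    (* Consecutive arcs over their common column lie on opposite sides, so the same [z] means depth
       0, where neither moves. *)
    + have sgN : sg d = - sg d'.
        case: H => [[dd _]|[dd _]]; first by rewrite dd sgS// -dd.
        by rewrite dd sgS ?opprK// -dd.
      have z0 : depth M d t = 0.
        by move: zE; rewrite /z sgN -dE; have := sg1 d'; clear; move=> []-> ?; flra.
      have [w0 _] := @depth_le R M d t M0 t07 (eq_ind_r (fun u => u <= M) (ltW M0) z0).
      have z0' : depth M d' t' = 0 by rewrite -dE.
      have [w0' _] := @depth_le R M d' t' M0 t'07 (eq_ind_r (fun u => u <= M) (ltW M0) z0').
      by rewrite /arcy w0 w0'; ring.
  - move=> d t dk t07; rewrite zabs// => /(depth_le M0 t07)[w0 _].
    by rewrite /arcy w0; ring.
  - by move=> _ [v /= /BM[? ? _] <-].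
have reg d (t : R) : 0 <= t <= 7 -> t <= 2 \/ 5 <= t -> `|z d t| <= 2 * M.
  move=> t07 H; rewrite zabs//; case: (depth_cases d M0 t07) => [[h -> _]|[h _ _]|[h -> _]].
  - by clear -h M0; fnra.
  - by exfalso; case: H h; clear; flra.
  - by clear -h M0; fnra.
have E2 : @isotopic R _ (trajectories k 7 (fun d t => (x d t, arcy (y d) d t, z d t)) `|`
      [set (X v, v, Z v) | v in [set v | b0 <= v <= b1]])
    (trajectories k 7 (fun d t => (arcx k d t, arcy (y d) d t, z d t)) `|`
      [set (X v, v, Z v) | v in [set v | b0 <= v <= b1]]).
  apply: (@trajectories_move_x _ k 7 x (fun d => arcy (y d) d) z (arcx k) 1 M) => //.
  - move=> d d' t t' dk d'k t07 t'07 yy zE.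
    have side e (s : R) : (e < k)%N -> 0 <= s <= 7 -> s <= 2 \/ 5 <= s -> arcx k e s - x e s = 0.
      by move=> ek s07 hs; rewrite (arcx_side sx)// subrr.
    have cs (s : R) : 0 <= s <= 7 -> (s <= 2 \/ 5 <= s) \/ 2 < s < 5.
      move=> _; have [?|?] := leP s 2; first by left; left.
      by have [?|?] := leP 5 s; [left; right|right].
    have far e (s : R) : 2 < s < 5 -> 0 <= s <= 7 -> 2 * M < `|z e s|.
      move=> s25 s07; rewrite zabs//; case: (depth_cases e M0 s07) => [[h _ _]|[_ h _]|[h _ _]] //; exfalso; clear -h s25; flra.
    case: (cs t t07) => ht; case: (cs t' t'07) => ht'.
    + by rewrite !side.
    + by exfalso; have := far d' t' ht' t'07; have := reg d t t07 ht; rewrite zE; clear; flra.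
    + by exfalso; have := far d t ht t07; have := reg d' t' t'07 ht'; rewrite zE; clear; flra.
    + have dE : depth M d t = depth M d' t' by rewrite -!zabs// zE.
      by have [-> ->] := arc_height_depth_inj M0 ht ht' yy dE.
  - by move=> d t dk t07; rewrite zabs// => /(depth_le M0 t07)[_ H]; exact: arcx_side sx dk t07 H.
  - move=> _ [v /= vb <-] /=; split; last by case: (BM v vb).
    have v0 : 0 < b0 by rewrite -eb0; case/andP: (eta01 0%N isT).
    have v1 : b1 < 1 by rewrite -eb1; case/andP: (eta01 k (leqnn k)).
    by rewrite ler_norml; clear -vb v0 v1; flra.
have y70 d : (d.+1 < k)%N -> y d 7 = y d.+1 0.
  by move=> dk; rewrite (yE d (ltnW dk)).2 (yE _ dk).1.
have [|D [cD DE E3]] := @trajectories_flatten R k 7 (arcx k) (fun d => arcy (y d) d) z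
    [set (X v, v, Z v) | v in [set v | b0 <= v <= b1]] cx1 cy1 cz.
  move=> d d' t t' dk d'k t07 t'07 xE' yE'.
  have [[-> ->]//|[e1 e2]] := arc_plane_depth_inj M0 y01 yA yF y70 dk d'k t07 t'07 xE' yE'.
  by rewrite /z e1 e2 !mulr0.
(* The last arc has been sheared by [D]. Both functions are frozen above [b1], where the moving
   strand follows the column [k]. *)
pose Xb v := X (Num.min v b1); pose Zb v := Z (Num.min v b1) + D (X (Num.min v b1), Num.min v b1).
have cmin : continuous (fun v : R => Num.min v b1) by cont.
have cXb : continuous Xb by apply: (@cont_comp _ _ _ X (fun v => Num.min v b1)).
have cZb : continuous Zb.
  have c1 : continuous (fun v => Z v + D (X v, v)).
    by cont; apply: (@cont_comp _ _ _ D (fun v => (X v, v))) => //; cont.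
  exact: (@cont_comp _ _ _ (fun v => Z v + D (X v, v)) (fun v => Num.min v b1)).
have Dside d (t : R) : (d < k)%N -> 0 <= t <= 7 -> depth M d t <= M ->
    D (x d t, y d t) = - z d t.
  move=> dk t07 /(depth_le M0 t07)[w0 side].
  rewrite -(DE d t dk t07) -(arcx_side sx dk t07 side) /arcy w0; congr (D (_, _)); by clear; ring.
have le07 : 0 <= (0:R) <= 7 /\ 0 <= (7:R) <= 7 by clear; split; flra.
have D0 : D (X b0, b0) = 0.
  have [w0 _] := @depth_start R M 0 0 (introT andP (conj (lexx 0) (ler0n R 2))).
  have [a1 a2] := arc_left k (y 0%N) 0 (introT andP (conj (lexx 0) (ler0n R 2))).
  suff -> : (X b0, b0) = (arcx k 0 0, arcy (y 0%N) 0 0) by rewrite (DE 0%N 0 k0 le07.1) /z w0 !mulr0 oppr0.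
  rewrite a1 a2 clamp_le0; last by clear; flra.
  by rewrite (yE 0%N k0).1 eb0 Xb0 subr0 mul1r mul0r addr0.
have kk : (k.-1 < k)%N by rewrite prednK.
have D1 : D (X b1, b1) = 0.
  have h57 : 5 <= (7 : R) <= 7 by clear; flra.
  have [w0 _] := @depth_end R M k.-1 7 h57.
  have [a1 a2] := arc_right k (y k.-1) k.-1 h57.
  suff -> : (X b1, b1) = (arcx k k.-1 7, arcy (y k.-1) k.-1 7) by rewrite (DE _ 7 kk le07.2) /z w0 subrr !mulr0 oppr0.
  rewrite a1 a2 clamp_le0; last by clear; flra.
  rewrite (yE _ kk).2 prednK// eb1 Xb1 subr0 mul1r mul0r addr0; congr (_, _).
  by case: (k) k0 => // n _; rewrite /colx subrr.
have b00 : 0 < b0 by rewrite -eb0; case/andP: (eta01 0%N isT).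
have b11 : b1 < 1 by rewrite -eb1; case/andP: (eta01 k (leqnn k)).
have b0E : Num.min b0 b1 = b0 by apply: min_l.
have E4 : arc_boxes k eta `|` [set (Xb v, v, Zb v) | v in [set v | b0 <= v <= b1]] = open_closure k b0 Xb Zb.
  apply: (@arc_boxes_closure R k eta b0 b1 Xb Zb) => // v b1v.
  by rewrite /Xb /Zb min_r// D1 Zb1 addr0.
have [|||||||b [ob ib]] := @open_closure_isotopic R k k0 b0 b00 _ Xb Zb cXb cZb.
- exact: le_lt_trans b01 b11.
- by rewrite /Xb min_r ?Xb1// ltW.
- by rewrite /Zb min_r ?D1 ?Zb1 ?addr0// ltW.
- by rewrite /Xb b0E.
- by rewrite /Zb b0E Zb0 add0r D0.
- move=> v /andP[v0 v1]; rewrite /Xb; have [] // := BM (Num.min v b1).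
  by rewrite le_min v0 b01/= ge_min lexx orbT.
- move=> v i /andP[v0 v1] /andP[i0 ik] Xi Zi.
  have [vb|vb] := leP b1 v.
    by move: Xi; rewrite /Xb min_r// Xb1 => /esym/eqP; rewrite pnatr_eq0 => /eqP i00; rewrite i00 in i0.
  have vE : Num.min v b1 = v by apply/min_l/ltW.
  move: Xi Zi; rewrite /Xb /Zb vE => Xi Zi.
  pose d := (k - i)%N.
  have dk : (d < k)%N by rewrite /d ltn_subrL i0.
  have d0 : (0 < d)%N by rewrite /d subn_gt0.
  have d'k : (d.-1 < k)%N by rewrite prednK// ltnW.
  have colE : colx k d = X v.
    have -> : colx k d = k%:R - d%:R by case: (d) d0.
    by rewrite Xi /d natrB ?(ltnW ik)//; clear; ring.
  have Zv : `|Z v| <= M by case: (BM v); rewrite // v0 ltW.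
  (* If the sheared arc met a fixed strand, the last arc would have met the corresponding arc before
     the flattening. *)
  have zZ e (s : R) : (e < k)%N -> 0 <= s <= 7 -> arcx k e s = X v -> arcy (y e) e s = v -> False.
    move=> ek s07 ax ay.
    have zz : z e s = Z v.
      by have := DE e s ek s07; rewrite ax ay => /eqP; rewrite -addr_eq0 => /eqP e1; move: Zi; move: e1; clear; flra.
    have dM : depth M e s <= M by rewrite -zabs// zz.
    have [w0 side] := depth_le M0 s07 dM.
    have [vb0|vb1] : v = b0 \/ v = b1.
      apply: (disj e s v) => //; first by rewrite v0 ltW.
        by rewrite -(arcx_side sx).
      by move: ay; rewrite /arcy w0 => <-; clear; ring.
    + move: Xi; rewrite vb0 Xb0 => hk; have : (2 * k)%N = (2 * i + 1)%N.
        by apply/eqP; rewrite -(eqr_nat R) natrD !natrM; apply/eqP; clear -hk; flra.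
      by move/(congr1 odd); rewrite oddD !oddM.
    + by move: vb; rewrite vb1 ltxx.
  have /andP[n0 n1] := eta01 d (ltnW dk).
  (* Up to [eta d] the column is covered by the start of the arc [d], above it by the end of the arc
     [d - 1]. *)
  have [vd|vd] := leP v (eta d).
    have [||t t2 tE] := @IVT_exists R (arcy (y d) d) 0 2 v (cy1 d); first exact: ler0n.
      left; rewrite (arc_left k (y d) d _).2; last by clear; flra.
      rewrite (arc_left k (y d) d _).2; last by clear; flra.
      rewrite (@clamp_ge1 _ (2 - 1)) ?(@clamp_le0 _ (0 - 1)); try by clear; flra.
      by rewrite (yE d dk).1 subrr subr0 !mul1r !mul0r add0r addr0 vd andbT (le_trans (ltW (@lowy_lt0 R d)))// (le_trans (ltW b00)).
    apply: (zZ d t) => //; first by clear -t2; flra.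
    by rewrite (arc_left k (y d) d t2).1.
  have [||t t2 tE] := @IVT_exists R (arcy (y d.-1) d.-1) 5 7 v (cy1 d.-1); first by rewrite ler_nat.
    left; rewrite (arc_right k (y d.-1) d.-1 _).2; last by clear; flra.
    rewrite (arc_right k (y d.-1) d.-1 _).2; last by clear; flra.
    rewrite (@clamp_ge1 _ (6 - 5)) ?(@clamp_le0 _ (6 - 7)); try by clear; flra.
    rewrite (yE d.-1 d'k).2 prednK// subrr subr0 !mul1r !mul0r add0r addr0 (ltW vd)/=.
    by rewrite (le_trans v1)// ltW// highy_gt1.
  apply: (zZ d.-1 t) => //; first by clear -t2; flra.
  by rewrite (arc_right k (y d.-1) d.-1 t2).1 prednK.
exists b; split=> //; apply: isotopic_trans E1 _; apply: isotopic_trans E2 _; apply: isotopic_trans E3 _.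
rewrite (trajectories_arcs cy y01 yA yF yE).
suff -> : [set ((p.1.1, p.1.2, p.2 + D p.1) : R * R * R) | p in [set (X v, v, Z v) | v in [set v | b0 <= v <= b1]]] =
    [set (Xb v, v, Zb v) | v in [set v | b0 <= v <= b1]] by rewrite E4.
rewrite image_comp; apply: eq_imagel => v /= /andP[_ v1].
by rewrite /Xb /Zb min_l.
Qed.
End Staircase.

(** * From parallel columns to the graph of a function *)

Section PushBlocks.
Context {R : realType}.

Lemma signed_push_isotopic_z (K : set (R * R * R)) (h : R * R -> R) (d e : R) : e = 1 \/ e = -1 ->
  continuous h -> (forall q, 0 <= h q) ->
  @isotopic R _ K ((fun p => (p.1.1, p.1.2, p.2 + e * h p.1 * Num.max 0 (d + e * p.2))) @` K).
Proof.
move=> [->|->] ch h0.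
  apply: isotopic_image_eq (pull_isotopic_z K d ch h0) => p _; apply: pt_eq => //=; by rewrite !mul1r.
apply: isotopic_image_eq (push_isotopic_z K d ch h0) => p _; apply: pt_eq => //=.
by rewrite !mulN1r mulNr.
Qed.

(** The map [z => z + e * h * max 0 (d + e * z)] fixes the half-space [e * z <= - d] and shifts the
    plane [z = 0] by [e * h * d]. With [h = w / d] the arcs move by [w] towards the side [e], while
    the last arc, wherever it is over a moving arc, lies in the fixed half-space. *)
Lemma signed_push_trajectories k L (x y z w : nat -> R -> R) (X Z : R -> R) (b0 b1 d e : R) :
  e = 1 \/ e = -1 -> 0 < d ->
  (forall i, continuous (x i)) -> (forall i, continuous (y i)) -> (forall i, continuous (w i)) ->
  continuous X -> continuous Z ->
  (forall i (t : R), (i < k)%N -> 0 <= t <= L -> 0 <= w i t) ->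
  (forall i j (t s : R), (i < k)%N -> (j < k)%N -> 0 <= t <= L -> 0 <= s <= L ->
     x i t = x j s -> y i t = y j s -> w i t = w j s) ->
  (forall i (t : R), (i < k)%N -> 0 <= t <= L -> w i t = 0 \/ z i t = 0) ->
  (forall i (t : R) v, (i < k)%N -> 0 <= t <= L -> b0 <= v <= b1 -> x i t = X v -> y i t = v ->
     e * Z v < - d \/ w i t = 0) ->
  @isotopic R _ (trajectories k L (fun i t => (x i t, y i t, z i t)) `|`
      [set (X v, v, Z v) | v in [set v | b0 <= v <= b1]])
    (trajectories k L (fun i t => (x i t, y i t, z i t + e * w i t)) `|`
      [set (X v, v, Z v) | v in [set v | b0 <= v <= b1]]).
Proof.
move=> e1 d0 cx cy cw cX cZ w0 winj wz cross.
pose G : set ((R * R) * R) := trajectories k L (fun i t => ((x i t, y i t), w i t / d)) `|`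
  [set ((X v, v), 0) | v in [set v | b0 <= v <= b1] `&` [set v | - d <= e * Z v]].
have e2 : e * e = 1 by case: e1 => ->; ring.
have [||h [ch hE]] := @compact_relation_extension R (R * R)%type G.
- apply: compact_setU2; first by apply: compact_trajectories => i; cont.
  apply: continuous_compact; first by apply: continuous_subspaceT; cont.
  apply: compact_closedI; first by have := @segment_compact R b0 b1; rewrite set_itvcc.
  apply: (@closed_comp _ _ (fun v => e * Z v) [set u | - d <= u]); last exact: closed_ge.
  by move=> v _; have cz : continuous (fun v => e * Z v) by [cont]; exact: cz.
- have AB i (t : R) v : (i < k)%N -> 0 <= t <= L -> b0 <= v <= b1 -> - d <= e * Z v ->
      x i t = X v -> y i t = v -> w i t / d = 0.
    move=> ik tL vb Zv xE yE; case: (cross i t v) => // [Zv'|->]; last by rewrite mul0r.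
    by move: Zv; rewrite leNgt Zv'.
  move=> [p q] a b [[i [t [ik tL [-> -> ->]]]]|[v /= [vb Zv] [<- <- <-]]] [[j [s [jk sL [pE qE ->]]]]|[v' /= [vb' Zv'] [pE qE <-]]] //.
  + by rewrite (winj i j t s).
  + by apply: (AB i t v').
  + by apply/esym; apply: (AB j s v).
pose h' q := Num.max 0 (h q).
have ch' : continuous h' by rewrite /h'; cont; apply: (@cont_comp _ _ _ h id) => //; cont.
have := @signed_push_isotopic_z (trajectories k L (fun i t => (x i t, y i t, z i t)) `|`
      [set (X v, v, Z v) | v in [set v | b0 <= v <= b1]]) h' d e e1 ch' (fun q => ltac:(by rewrite /h' le_max lexx)).
rewrite image_setU image_trajectories image_comp /=.
set A1 := trajectories _ _ _; set A2 := trajectories _ _ _; set B1 := image _ _; set B2 := image _ _.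
suff -> : A2 = trajectories k L (fun i t => (x i t, y i t, z i t + e * w i t)).
  suff -> : B2 = [set (X v, v, Z v) | v in [set v | b0 <= v <= b1]] by [].
  apply: eq_imagel => v vb /=; apply: pt_eq => //=.
  have [Zv|Zv] := leP (- d) (e * Z v).
    by rewrite /h' (hE _ 0) ?maxxx ?mulr0 ?mul0r ?addr0//; right; exists v.
  by rewrite max_l ?mulr0 ?addr0//; clear -Zv; flra.
apply: eq_trajectories => i t ik tL; apply: pt_eq => //=.
have -> : h' (x i t, y i t) = w i t / d.
  rewrite /h' (hE _ (w i t / d)); first by rewrite max_r// divr_ge0 ?w0// ltW.
  by left; exists i, t.
case: (wz i t ik tL) => ->; first by rewrite mul0r !mulr0 !mul0r.
by rewrite mulr0 addr0 (max_r (ltW d0)); field; rewrite gt_eqF.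
Qed.

Lemma staircase_planar_inj k (x y : nat -> R -> R) d d' (t t' : R) M : staircase k x ->
  (forall d (t t' : R), (d < k)%N -> 0 <= t -> t < t' -> t' <= 2 -> y d t' < y d t) ->
  (forall d (t t' : R), (d < k)%N -> 5 <= t -> t < t' -> t' <= 7 -> y d t' < y d t) ->
  (forall d, (d.+1 < k)%N -> y d 7 = y d.+1 0) ->
  (d < k)%N -> (d' < k)%N -> 0 <= t <= 7 -> 0 <= t' <= 7 ->
  x d t = x d' t' -> y d t = y d' t' ->
  (d = d' /\ t = t') \/ (depth M d t = 0 /\ depth M d' t' = 0).
Proof.
move=> sx yA yF y70 dk d'k t07 t'07 xE yE; have /andP[t0 t7] := t07; have /andP[t'0 t'7] := t'07.
have adj e (s s' : R) : (e.+1 < k)%N -> 0 <= s -> s <= 2 -> 5 <= s' -> s' <= 7 -> y e.+1 s = y e s' ->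
    depth M e.+1 s = 0 /\ depth M e s' = 0.
  move=> ek s0 s2 s5 s7 ss.
  have a1 : y e.+1 s <= y e.+1 0.
    by have [->//|ne] := eqVneq s 0; apply/ltW/yA => //; rewrite lt_neqAle eq_sym ne.
  have a2 : y e 7 <= y e s'.
    by have [->//|ne] := eqVneq s' 7; apply/ltW/yF => //; [exact: ltnW|rewrite lt_neqAle ne].
  have a3 := y70 e ek.
  have sE : s = 0.
    apply/eqP; rewrite eq_le s0 andbT leNgt; apply/negP => lt; have := yA _ _ _ ek (lexx 0) lt s2.
    by move: a1 a2 a3 ss; clear; flra.
  have s'E : s' = 7.
    apply/eqP; rewrite eq_le s7 leNgt; apply/negP => lt; have := yF _ _ _ (ltnW ek) s5 lt (lexx 7).
    by move: a1 a2 a3 ss; clear; flra.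
  by rewrite sE s'E (depth_start _ _ _).1 ?(depth_end _ _ _).1 ?subrr ?mulr0//; clear; flra.
case: (staircase_eq sx dk d'k t07 t'07 xE) => [//|[dd [t2 t2']]|[dd [t5 t5']]|[[dd [t2 t5']]|[dd [t2' t5]]]]; first by left.
- subst d'; left; split=> //; have [lt|lt|//] := ltgtP t t'; exfalso.
    by have := yA _ _ _ dk t0 lt t2'; rewrite yE ltxx.
  by have := yA _ _ _ dk t'0 lt t2; rewrite yE ltxx.
- subst d'; left; split=> //; have [lt|lt|//] := ltgtP t t'; exfalso.
    by have := yF _ _ _ dk t5 lt t'7; rewrite yE ltxx.
  by have := yF _ _ _ dk t5' lt t7; rewrite yE ltxx.
- by subst d; right; apply: adj.
- by subst d'; right; have [] := adj d t' t d'k t'0 t2' t5 t7 (esym yE).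
Qed.

(** Each block is pushed to the side [sg d], away from the last arc at their crossings; the blocks
    of sign 1 are pushed before the others. *)
Lemma blocks_isotopic (k : nat) (sg : nat -> R) (x y : nat -> R -> R) (eta : nat -> R)
    (X Z : R -> R) (C b0 b1 del : R) : (0 < k)%N ->
  (forall d, sg d = 1 \/ sg d = -1) -> (forall d, (d.+1 < k)%N -> sg d.+1 = - sg d) ->
  (forall d, continuous (x d)) -> (forall d, continuous (y d)) -> staircase k x ->
  (forall d (t : R), (d < k)%N -> 0 <= t <= 7 -> 0 < y d t < 1) ->
  (forall d (t t' : R), (d < k)%N -> 0 <= t -> t < t' -> t' <= 2 -> y d t' < y d t) ->
  (forall d (t t' : R), (d < k)%N -> 5 <= t -> t < t' -> t' <= 7 -> y d t' < y d t) ->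
  (forall d, (d < k)%N -> y d 0 = eta d /\ y d 7 = eta d.+1) -> eta 0%N = b0 -> eta k = b1 ->
  b0 <= b1 -> 0 < del -> continuous X -> continuous Z ->
  (forall v, b0 <= v <= b1 -> [/\ `|Z v| <= C, `|X v| <= C & X v < k%:R]) ->
  X b0 = k%:R - 2^-1 -> Z b0 = 0 -> X b1 = 0 -> Z b1 = 0 ->
  (forall d (t : R) v, (d < k)%N -> 0 <= t <= 7 -> b0 <= v <= b1 -> x d t = X v -> y d t = v ->
     sg d * Z v < - del \/ v = b0 \/ v = b1) ->
  exists b : 'I_k -> R -> R * R, one_pure_braid b /\
    @isotopic R _ (trajectories k 7 (fun d t => (x d t, y d t, 0)) `|`
      [set (X v, v, Z v) | v in [set v | b0 <= v <= b1]]) (braid_closure b).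
Proof.
move=> k0 sg1 sgS cx cy sx y01 yA yF yE eb0 eb1 b01 del0 cX cZ BM Xb0 Zb0 Xb1 Zb1 cross.
pose M := Num.max 1 C.
have M0 : 0 < M by rewrite lt_max ltr01.
have [||b [ob ib]] := @staircase_isotopic R k sg x y eta X Z M C b0 b1 k0 sg1 sgS cx cy sx y01 yA yF yE eb0 eb1 b01 M0 cX cZ _ Xb0 Zb0 Xb1 Zb1 _.
- by move=> v vb; case: (BM v vb) => zC xC xk; split=> //; rewrite /M le_max zC orbT.
- move=> d t v dk t07 vb xE yE' zE; case: (cross d t v dk t07 vb xE yE') => // neg; exfalso.
  have := depth_ge0 d M0 t07; move: neg; rewrite -zE mulrA; case: (sg1 d) => -> ; move: del0; clear; fnra.
exists b; split=> //; apply: isotopic_trans ib.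
have cd d : continuous (depth M d) by rewrite /depth; cont; apply: cont_clamp; cont.
have y70 d : (d.+1 < k)%N -> y d 7 = y d.+1 0.
  by move=> dk; rewrite (yE d (ltnW dk)).2 (yE _ dk).1.
have yA' d (t : R) : (d < k)%N -> 0 <= t <= 7 -> x d t = X b0 -> y d t = b0 -> depth M d t = 0.
  move=> dk t07 xE yE'; have h0 : 0 <= (0:R) <= 7 by clear; flra.
  have x0 : x 0%N 0 = X b0 by have [e1 _ _] := sx; rewrite e1 ?Xb0//; clear; flra.
  have [[-> ->]|[-> _]//] := staircase_planar_inj M sx yA yF y70 dk k0 t07 h0 (etrans xE (esym x0)) (etrans yE' (esym (etrans (yE 0%N k0).1 eb0))).
  by rewrite (depth_start _ _ _).1 ?mulr0//; clear; flra.
have kk : (k.-1 < k)%N by rewrite prednK.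
have yF' d (t : R) : (d < k)%N -> 0 <= t <= 7 -> x d t = X b1 -> y d t = b1 -> depth M d t = 0.
  move=> dk t07 xE yE'; have h0 : 0 <= (7:R) <= 7 by clear; flra.
  have x0 : x k.-1 7 = X b1.
    have [_ e1 _] := sx; rewrite e1 ?Xb1 ?prednK//; last by clear; flra.
    by case: (k) k0 => // n _; rewrite /colx subrr.
  have y0 : y k.-1 7 = b1 by rewrite (yE _ kk).2 prednK.
  have [[-> ->]|[-> _]//] := staircase_planar_inj M sx yA yF y70 dk kk t07 h0 (etrans xE (esym x0)) (etrans yE' (esym y0)).
  by rewrite (depth_end _ _ _).1 ?subrr ?mulr0//; clear; flra.
pose w e d (t : R) := (if e == sg d then depth M d t else 0).
have cw e d : continuous (w e d) by rewrite /w; case: (e == sg d); [exact: cd|cont].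
have w0 e d (t : R) : (d < k)%N -> 0 <= t <= 7 -> 0 <= w e d t.
  by move=> dk t07; rewrite /w; case: ifP => // _; exact: depth_ge0.
have winj e i j (t s : R) : (i < k)%N -> (j < k)%N -> 0 <= t <= 7 -> 0 <= s <= 7 ->
     x i t = x j s -> y i t = y j s -> w e i t = w e j s.
  move=> ik jk t07 s07 xE yE'; have [[-> ->]//|[e1 e2]] := staircase_planar_inj M sx yA yF y70 ik jk t07 s07 xE yE'.
  by rewrite /w e1 e2; do 2 case: ifP => // _.
have wc e i (t : R) v : (i < k)%N -> 0 <= t <= 7 -> b0 <= v <= b1 -> x i t = X v -> y i t = v ->
     e * Z v < - del \/ w e i t = 0.
  move=> ik t07 vb xE yE'; rewrite /w; case: eqP => [->|_]; last by right.
  case: (cross i t v ik t07 vb xE yE') => [?|[vE|vE]]; [by left|right|right].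
    by apply: yA' => //; rewrite -vE.
  by apply: yF' => //; rewrite -vE.
have wN (d : nat) : (-1 == sg d) = ~~ (1 == sg d) :> bool.
  by case: (sg1 d) => ->; rewrite ?eqxx; [rewrite eq_sym|]; case: eqP => //= ?; exfalso; flra.
have p1 := @signed_push_trajectories k 7 x y (fun _ _ => 0) (w 1) X Z b0 b1 del 1
  (or_introl erefl) del0 cx cy (cw 1) cX cZ (w0 1) (winj 1) (fun _ _ _ _ => or_intror erefl) (wc 1).
have p2 := @signed_push_trajectories k 7 x y (fun d t => 0 + 1 * w 1 d t) (w (-1)) X Z b0 b1 del (-1)
  (or_intror erefl) del0 cx cy (cw (-1)) cX cZ (w0 (-1)) (winj (-1)) _ (wc (-1)).
apply: isotopic_trans p1 _; apply: eq_ind_r (fun A => isotopic _ (A `|` _)) (p2 _) _ _ .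
  by move=> d t _ _; rewrite /w wN; case: (1 == sg d); [left|right; rewrite mulr0 addr0].
apply: eq_trajectories => d t dk t07; apply: pt_eq => //=; rewrite /w wN.
by case: (sg1 d) => ->; rewrite ?eqxx /= ?mulr0 ?addr0 ?add0r//; case: eqP => [h|_] /=; [exfalso; flra|rewrite mulr0 add0r].
Qed.
End PushBlocks.

(** * Cutting an interval into blocks of constant crossing side *)

Section AlternatingPartition.
Context {R : realType}.
Implicit Types (C : set R) (s : R -> R).

(** The breakpoints [sigma], from right to left, are where columns will cut the row of poles. [s]
    prescribes the side at the crossings [C], and the sides of consecutive blocks alternate because
    consecutive closing arcs have to be on opposite sides. *)
Definition alternating_blocks C s (xR a : R) := exists (k : nat) (sigma sg : nat -> R),
  [/\ (0 < k)%N, (forall d, sg d = 1 \/ sg d = -1), (forall d, (d.+1 < k)%N -> sg d.+1 = - sg d),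
      (sigma 0%N = xR /\ sigma k = a) &
  [/\ (forall d, (d < k)%N -> sigma d.+1 < sigma d), (forall d, (0 < d < k)%N -> ~ C (sigma d)) &
      (forall d c, (d < k)%N -> C c -> sigma d.+1 <= c <= sigma d -> s c = sg d)]].

(** A stretch of the same side lengthens the last block. A stretch of the other side starts a new
    block, and then the breakpoint [a] cannot be a crossing, for it would have both sides. *)
Lemma alternating_blocks_extend C s (xR a a' e : R) : e = 1 \/ e = -1 -> alternating_blocks C s xR a -> a' < a ->
  (forall c, C c -> a' <= c <= a -> s c = e) -> alternating_blocks C s xR a'.
Proof.
move=> e1 [k [sigma [sg [k0 sg1 sgS [s0 sk] [sd sC sE]]]]] aa ce.
have [se|se] := eqVneq (sg k.-1) e.
  exists k, (fun d => if (d < k)%N then sigma d else a'), sg; split=> //.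
    by rewrite k0 ltnn.
  split.
  - move=> d dk; rewrite dk; case: ifP => dk'; first exact: sd.
    have dE : d.+1 = k by apply/eqP; rewrite eqn_leq dk leqNgt dk'.
    by apply: lt_trans (sd d dk); rewrite dE sk.
  - by move=> d /andP[d0 dk]; rewrite dk; apply: sC; rewrite d0.
  - move=> d c dk cC; rewrite dk; case: ifP => dk'; first exact: sE.
    have dE : d.+1 = k by apply/eqP; rewrite eqn_leq dk leqNgt dk'.
    move=> /andP[c1 c2]; have [ca|ca] := leP c a.
      by rewrite (ce c)// -?se ?c1 ?ca// -dE.
    by apply: sE => //; rewrite c2 dE sk ltW.
have naC : ~ C a.
  move=> aC; case/eqP: se; rewrite -(ce a)// ?lexx ?ltW// -(sE k.-1 a)//; first by rewrite prednK.
  by rewrite prednK// sk lexx -sk -[in sigma k](prednK k0) ltW// sd ?prednK.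
exists k.+1, (fun d => if (d <= k)%N then sigma d else a'), (fun d => if (d < k)%N then sg d else e); split=> //.
- by move=> d; case: ifP.
- move=> d; rewrite ltnS => dk; rewrite dk; case: ifP => dk'; first exact: sgS.
  have dE : d.+1 = k by apply/eqP; rewrite eqn_leq dk leqNgt dk'.
  have dE' : d = k.-1 by rewrite -dE.
  move: se; rewrite -dE'; case: (sg1 d) => ->; case: e1 => ->; rewrite ?opprK ?eqxx//.
- by rewrite s0 ltnn.
- split.
  + move=> d; rewrite ltnS => dk; rewrite dk; case: ifP => dk'; first exact: sd.
    have -> : d = k by apply/eqP; rewrite eqn_leq dk leqNgt dk'.
    by rewrite sk.
  + move=> d /andP[d0]; rewrite ltnS => dk; rewrite dk.
    move: dk; rewrite leq_eqVlt => /orP[/eqP ->|dk]; first by rewrite sk.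
    by apply: sC; rewrite d0.
  + move=> d c; rewrite ltnS => dk cC; rewrite dk; case: ifP => dk'; first exact: sE.
    have -> : d = k by apply/eqP; rewrite eqn_leq dk leqNgt dk'.
    by rewrite sk; apply: ce.
Qed.

(* Real induction, from the right to the left. *)
Lemma alternating_partition C s (xL xR : R) : xL < xR ->
  (forall x, xL <= x <= xR -> exists eps e : R, [/\ 0 < eps, e = 1 \/ e = -1 &
     forall c, C c -> `|c - x| < eps -> s c = e]) ->
  alternating_blocks C s xR xL.
Proof.
move=> LR loc.
pose E := [set a | xL <= a < xR /\ alternating_blocks C s xR a].
have [|ep [e [ep0 e1 eE]]] := loc xR; first by rewrite lexx ltW.
have E0 : E !=set0.
  pose a := Num.max xL (xR - ep / 2).
  have aR : a < xR by rewrite gt_max LR /=; move: ep0; clear; flra.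
  exists a; split; first by rewrite le_max lexx.
  exists 1%N, (fun d => if d is 0%N then xR else a), (fun=> e); split=> //.
  split=> [[|//] _|[|//]|[|//] c _ cC /andP[c1 c2]]//.
  apply: eE => //; have : xR - ep / 2 <= c by apply: le_trans c1; rewrite le_max lexx orbT.
  by move: c2 ep0; clear => ? ? ?; rewrite ler0_norm; flra.
have Elb : has_lbound E by exists xL => a [/andP[]].
have Einf : has_inf E by [].
pose m := inf E.
have mL : xL <= m by apply: lb_le_inf => // a [/andP[]].
have mR : m < xR by have [a Ea] := E0; apply: (le_lt_trans (ge_inf Elb Ea)); case: Ea => /andP[].
have [|ep' [e' [ep0' e1' eE']]] := loc m; first by rewrite mL ltW.
have [a Ea am] := @inf_adherent R E ep' ep0' Einf.
have ma : m <= a by exact: ge_inf.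
have [/andP[aL aR] ga] := Ea.
have [aE|aE] := eqVneq a xL; first by rewrite -aE.
have aL' : xL < a by rewrite lt_neqAle eq_sym aE.
(* This endpoint would be below the infimum [m] if it were not [xL] itself. *)
pose a' := Num.max xL (m - ep' / 2).
have a'm : a' <= m by rewrite ge_max mL; move: ep0'; clear; flra.
have a'a : a' < a.
  rewrite lt_neqAle (le_trans a'm ma) andbT; apply/eqP => h.
  have : a' = m by apply/eqP; rewrite eq_le a'm h.
  have [xm|xm] := leP xL (m - ep' / 2); last by move=> h'; move: aL'; rewrite -h /a' max_l ?ltxx// ltW.
  by rewrite /a' max_r//; move: ep0'; clear; flra.
have ga' : alternating_blocks C s xR a'.
  apply: (alternating_blocks_extend e1' ga a'a) => c cC /andP[c1 c2]; apply: eE' => //.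
  have : m - ep' / 2 <= c by apply: le_trans c1; rewrite le_max lexx orbT.
  by move: c2 am ep0'; rewrite -/m ltr_norml; clear => *; flra.
have ma' : m <= a'.
  by apply: ge_inf => //; split=> //; rewrite le_max lexx (lt_trans a'a).
suff -> : xL = a' by [].
rewrite /a'; have [xm|xm] := leP xL (m - ep' / 2); last by [].
by exfalso; move: ma'; rewrite /a' max_r// => h; move: ep0' h; clear; flra.
Qed.
End AlternatingPartition.

(** * Giving a graph vertical segments at the columns *)

Section GraphMoves.
Context {R : realType}.

Lemma image_fixed (T : Type) (f : T -> T) (A : set T) : (forall p, A p -> f p = p) -> f @` A = A.
Proof.
move=> h; apply/seteqP; split=> [_ [p Ap <-]|p Ap]; first by rewrite h.
by exists p; rewrite ?h.
Qed.

Lemma common_radius (k : nat) (P : nat -> R -> Prop) :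
  (forall j, (j < k)%N -> exists2 r, 0 < r & forall r', 0 < r' <= r -> P j r') ->
  exists2 r, 0 < r & forall r' j, (j < k)%N -> 0 < r' <= r -> P j r'.
Proof.
elim: k => [_|k IH H]; first by exists 1.
have [|r r0 Pr] := IH; first by move=> j jk; apply: H; exact: ltnW.
have [r1 r10 Pr1] := H k (ltnSn k).
exists (Num.min r r1); first by rewrite lt_min r0.
move=> r' j; rewrite ltnS leq_eqVlt le_min => /orP[/eqP ->|jk] /andP[r'0 /andP[a b]].
  by apply: Pr1; rewrite r'0.
by apply: Pr => //; rewrite r'0.
Qed.

Lemma tent_lipschitz (D c r x x' : R) : 0 < r ->
  `|D * Num.max 0 (1 - `|x - c| / r) - D * Num.max 0 (1 - `|x' - c| / r)| <= `|D| / r * `|x - x'|.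
Proof.
move=> r0; rewrite -mulrBr normrM -mulrA ler_wpM2l//.
have h (u v : R) : `|Num.max 0 u - Num.max 0 v| <= `|u - v|.
    have := ler_norm (u - v); have := ler_norm (v - u); rewrite [`|v - u|]distrC => h1 h2.
    by rewrite ler_norml; case: (leP 0 u) => hu; case: (leP 0 v) => hv; flra.
apply: (le_trans (h _ _)); rewrite (_ : _ - _ = (`|x' - c| - `|x - c|) / r); last by field; rewrite gt_eqF.
rewrite normrM (gtr0_norm (_ : 0 < r^-1)) ?invr_gt0// mulrC; apply: ler_wpM2l; first by rewrite invr_ge0 ltW.
by apply: (le_trans (ler_dist_dist _ _)); rewrite distrC (_ : x - c - (x' - c) = x - x')//; ring.
Qed.

(** The displacement [F1 - F] is spread over the heights by a tent of radius [r] around the graph.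
    As it is at most [r / 2], the Lipschitz constant is at most 1/2, and points farther than [r]
    from the graph stay in place. *)
Lemma graph_move_isotopic (F F1 : R -> R) (I : set R) (B : set (R * R * R)) (r : R) : 0 < r ->
  continuous F -> continuous F1 -> (forall x, `|F1 x - F x| <= r / 2) ->
  (forall p, B p -> F1 p.1.1 = F p.1.1 \/ r <= `|p.1.2 - F p.1.1|) ->
  @isotopic R _ ([set (x, F x, 0) | x in I] `|` B) ([set (x, F1 x, 0) | x in I] `|` B).
Proof.
move=> r0 cF cF1 FF BF.
pose D (q : R * R) (y : R) := (F1 q.1 - F q.1) * Num.max 0 (1 - `|y - F q.1| / r).
have r10 : 0 <= r^-1 by rewrite invr_ge0 ltW.
have := @lipschitz_isotopic_y R ([set (x, F x, 0) | x in I] `|` B) D 2^-1.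
case => //.
- by flra.
- rewrite /D; cont; try by apply: (@cont_comp _ _ _ F (fun p : R * R * R => p.1.1)) => //; cont.
  by apply: (@cont_comp _ _ _ F1 (fun p : R * R * R => p.1.1)) => //; cont.
- move=> q x x'; apply: (le_trans (tent_lipschitz _ _ _ _ r0)); rewrite ler_wpM2r//.
  by rewrite ler_pdivrMr//; have := FF q.1; clear; flra.
rewrite image_setU image_comp => H [H' [iH HH]]; exists H, H'; split=> //; rewrite HH; congr (_ `|` _).
  by apply: eq_imagel => x _ /=; rewrite /D subrr normr0 mul0r subr0 (max_r ler01) mulr1; apply: pt_eq => //=; ring.
apply: image_fixed => -[[a b] c] /BF/= Bp; congr (_, _, _); rewrite /D /=.
case: Bp => [->|h]; first by rewrite subrr mul0r addr0.
by rewrite max_l ?mulr0 ?addr0// subr_le0 ler_pdivlMr// mul1r.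
Qed.
End GraphMoves.

Section Jumps.
Context {R : realType}.

(** [w + dent rho w] vanishes for [|w| <= rho / 2] and then has slope 2 until it rejoins [w] at
    distance [rho]. Applied to the abscissa along a graph of slope 1, it creates a vertical segment
    of height [rho]. *)
Definition dent (rho w : R) : R :=
  - Num.max (- Num.max 0 (rho - `|w|)) (Num.min w (Num.max 0 (rho - `|w|))).

Lemma dent_near (rho w : R) : `|w| <= rho / 2 -> dent rho w = - w.
Proof.
rewrite ler_norml /dent => h; have n : `|w| <= rho / 2 by rewrite ler_norml.
rewrite (max_r (_ : 0 <= rho - `|w|)); last by move: n h; move: (`|w|) => u; clear; flra.
have := ler_norm w; have := ler_norm (- w); rewrite normrN; move: (`|w|) n => u n h1 h2.
by rewrite min_l ?max_r//; flra.
Qed.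
Lemma dent_right (rho w : R) : rho / 2 <= w <= rho -> dent rho w = w - rho.
Proof.
move=> h; rewrite /dent ger0_norm; last by flra.
by rewrite (max_r (_ : 0 <= rho - w)) ?min_r ?max_r; try flra.
Qed.
Lemma dent_left (rho w : R) : - rho <= w <= - (rho / 2) -> dent rho w = w + rho.
Proof.
move=> h; rewrite /dent ler0_norm; last by flra.
by rewrite (max_r (_ : 0 <= rho - - w)) ?min_l ?max_l; try flra.
Qed.
Lemma dent_far (rho w : R) : rho <= `|w| -> dent rho w = 0.
Proof.
move=> h; rewrite /dent (max_l (_ : rho - `|w| <= 0)) ?subr_le0// oppr0.
by rewrite (_ : Num.max 0 _ = 0) ?oppr0//; case: (leP w 0) => hw; rewrite max_l.
Qed.
Lemma dent_le (rho w : R) : 0 < rho -> `|dent rho w| <= rho / 2.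
Proof.
move=> r0; have [h|h] := leP `|w| (rho / 2); first by rewrite dent_near// normrN.
have [h'|h'] := leP rho `|w|; first by rewrite dent_far// normr0; flra.
move: h h'; have [w0|w0] := leP 0 w.
  by rewrite ger0_norm// => h h'; rewrite dent_right ?ler_norml; flra.
by rewrite ltr0_norm// => h h'; rewrite dent_left ?ler_norml; flra.
Qed.
Lemma continuous_dent rho : continuous (dent rho).
Proof. by rewrite /dent; cont. Qed.

Section BumpSum.
Variables (k : nat) (psi : nat -> R -> R).
Hypothesis psi0 : forall j x, 2^-1 <= `|x - j%:R| -> psi j x = 0.

Lemma bump_sum_near (i : nat) (x : R) : (0 < i < k)%N -> `|x - i%:R| < 2^-1 ->
  \sum_(1 <= j < k) psi j x = psi i x.
Proof.
move=> ik xi; rewrite (bigD1_seq i) ?mem_index_iota ?iota_uniq//= big1_seq ?addr0// => j /andP[ji _].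
apply: psi0; have : 1 <= `|i%:R - j%:R| :> R.
  have [lt|lt] : (i < j)%N \/ (j < i)%N by case: (ltngtP i j) ji => // *; [left|right].
    by rewrite distrC -natrB ?(ltnW lt)// normr_nat ler1n subn_gt0.
  by rewrite -natrB ?(ltnW lt)// normr_nat ler1n subn_gt0.
have := ler_distD x i%:R j%:R; move: xi; rewrite [`|i%:R - x|]distrC.
by move: (`|_|) (`|_|) (`|_|) => a b c; flra.
Qed.

Lemma bump_sum_far (x : R) : (forall i, (0 < i < k)%N -> psi i x = 0) ->
  \sum_(1 <= j < k) psi j x = 0.
Proof. by move=> h; rewrite big_nat; apply: big1 => i; exact: h. Qed.

(** The bumps have disjoint supports, so two points involve at most two of them, whence the factor
    2. *)
Lemma bump_sum_lipschitz (l : R) : 0 <= l ->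
  (forall j x x', `|psi j x - psi j x'| <= l * `|x - x'|) ->
  forall x x', `|\sum_(1 <= j < k) psi j x - \sum_(1 <= j < k) psi j x'| <= 2 * l * `|x - x'|.
Proof.
move=> l0 pl x x'.
have act (u : R) : (exists2 i, (0 < i < k)%N & `|u - i%:R| < 2^-1) \/ forall i, (0 < i < k)%N -> psi i u = 0.
  case: (pselect (exists2 i, (0 < i < k)%N & `|u - i%:R| < 2^-1)) => [|n]; first by left.
  right=> i ik; apply: psi0; rewrite leNgt; apply/negP => lt; apply: n; by exists i.
have one (i : nat) (u u' : R) : l * `|u - u'| <= 2 * l * `|u - u'|.
  by rewrite -mulrA ler_peMl ?ler1n// mulr_ge0.
case: (act x) => [[i ik xi]|x0]; case: (act x') => [[i' ik' xi']|x0'].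
- rewrite (bump_sum_near ik xi) (bump_sum_near ik' xi').
  have [->|ne] := eqVneq i i'; first by apply: le_trans (pl _ _ _) _; exact: one.
  have far (a b : nat) (u : R) : a != b -> (0 < a < k)%N -> `|u - b%:R| < 2^-1 -> psi a u = 0.
    move=> ab ak ub; apply: psi0; have : 1 <= `|b%:R - a%:R| :> R.
      have [lt|lt] : (a < b)%N \/ (b < a)%N by case: (ltngtP a b) ab => // *; [left|right].
        by rewrite -natrB ?(ltnW lt)// normr_nat ler1n subn_gt0.
      by rewrite distrC -natrB ?(ltnW lt)// normr_nat ler1n subn_gt0.
    have := ler_distD u b%:R a%:R; move: ub; rewrite [`|b%:R - u|]distrC.
    by move: (`|_|) (`|_|) (`|_|) => p q r; flra.
  rewrite (_ : _ - _ = (psi i x - psi i x') + (psi i' x - psi i' x')); last first.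
    by rewrite (far i i' x')// (far i' i x) 1?eq_sym//; ring.
  apply: (le_trans (ler_normD _ _)); rewrite -mulrA mulr_natl mulr2n lerD//.
- by rewrite (bump_sum_near ik xi) (bump_sum_far x0') -(x0' i ik); apply: le_trans (pl _ _ _) _; exact: one.
- by rewrite (bump_sum_near ik' xi') (bump_sum_far x0) -(x0 i' ik'); apply: le_trans (pl _ _ _) _; exact: one.
- by rewrite !bump_sum_far// subrr normr0 !mulr_ge0.
Qed.
End BumpSum.

Lemma cont_sum (T : topologicalType) (k : nat) (f : nat -> T -> R) :
  (forall j, continuous (f j)) -> continuous (fun x => \sum_(1 <= j < k) f j x).
Proof.
move=> cf; elim: k => [|k IH]; first by under eq_fun do rewrite big_geq//; exact: cont_cst.
case: k IH => [|k] IH; first by under eq_fun do rewrite big_geq//; exact: cont_cst.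
by under eq_fun do rewrite big_nat_recr//=; apply: cont_add => //; exact: cf.
Qed.

(** At height [y], a tent of radius [2 * rho] around the point of the line of slope 1 through
    [(j, Y j)] is shifted by [dent]. Since [dent] is at most [rho / 2], each term has Lipschitz
    constant 1/4 in [x]. *)
Definition jump (k : nat) (rho : R) (Y : nat -> R) (x y : R) : R :=
  \sum_(1 <= j < k) dent rho (y - Y j) * Num.max 0 (1 - `|x - (j%:R + (y - Y j))| / (2 * rho)).

Let jump_term (rho : R) Y j (x y : R) : 0 < rho -> rho <= `|y - Y j| \/ 3 * rho <= `|x - j%:R| ->
  dent rho (y - Y j) * Num.max 0 (1 - `|x - (j%:R + (y - Y j))| / (2 * rho)) = 0.
Proof.
move=> r0; have [h _|lt] := leP rho `|y - Y j|; first by rewrite dent_far ?mul0r.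
case=> // h; rewrite max_l ?mulr0// subr_le0 ler_pdivlMr ?mulr_gt0// mul1r.
rewrite (_ : x - _ = (x - j%:R) - (y - Y j)); last by ring.
have := ler_distD (y - Y j) (x - j%:R) 0; rewrite !subr0.
by move: h lt; move: (`|_|) (`|_|) (`|_|) => *; flra.
Qed.

Lemma jump_far k (rho : R) Y (x y : R) : 0 < rho ->
  (forall j, (0 < j < k)%N -> rho <= `|y - Y j| \/ 3 * rho <= `|x - j%:R|) -> jump k rho Y x y = 0.
Proof. by move=> r0 h; rewrite /jump big_nat; apply: big1 => j jk; apply: jump_term => //; exact: h. Qed.

Lemma jump_near k (rho : R) Y (x : R) j : 0 < rho -> 6 * rho <= 1 -> (0 < j < k)%N -> `|x - j%:R| < 3 * rho ->
  jump k rho Y x (Y j + (x - j%:R)) = dent rho (x - j%:R).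
Proof.
move=> r0 r1 jk xj; pose y := Y j + (x - j%:R); have yE : y - Y j = x - j%:R by rewrite /y; ring.
pose psi i u := dent rho (y - Y i) * Num.max 0 (1 - `|u - (i%:R + (y - Y i))| / (2 * rho)).
rewrite -/y (_ : jump k rho Y x y = \sum_(1 <= i < k) psi i x)// (bump_sum_near _ jk); last by flra.
  by rewrite /psi yE (_ : x - (_ + _) = 0) ?normr0 ?mul0r ?subr0 ?max_r ?mulr1//; ring.
by move=> i u h; apply: jump_term => //; right; flra.
Qed.

Lemma jump_isotopic k (rho : R) Y (F : R -> R) (I : set R) (B : set (R * R * R)) :
  0 < rho -> 6 * rho <= 1 ->
  (forall p j, B p -> (0 < j < k)%N -> rho <= `|p.1.2 - Y j| \/ 3 * rho <= `|p.1.1 - j%:R|) ->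
  @isotopic R _ ([set (x, F x, 0) | x in I] `|` B)
    ([set (x + jump k rho Y x (F x), F x, 0) | x in I] `|` B).
Proof.
move=> r0 r1 BY.
have := @lipschitz_isotopic_x R ([set (x, F x, 0) | x in I] `|` B) (fun q x => jump k rho Y x q.1) 2^-1.
case => //.
- by flra.
- apply: cont_sum => j; cont; last by apply: (@cont_comp _ _ _ (dent rho)) => //; [exact: continuous_dent|cont].
- move=> q x x'; have -> : 2^-1 = 2 * 4^-1 :> R by flra.
  apply: (@bump_sum_lipschitz k (fun j u => dent rho (q.1 - Y j) * Num.max 0 (1 - `|u - (j%:R + (q.1 - Y j))| / (2 * rho)))); last first.
  + move=> j u u'; apply: (le_trans (tent_lipschitz _ _ _ _ _)); first by rewrite mulr_gt0.
    rewrite ler_wpM2r// ler_pdivrMr ?mulr_gt0//; have := dent_le (q.1 - Y j) r0; flra.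
  + by flra.
  + by move=> j u h; apply: jump_term => //; right; flra.
rewrite image_setU image_comp => H [H' [iH HH]]; exists H, H'; split=> //; rewrite HH; congr (_ `|` _).
apply: image_fixed => -[[a b] c] Bp /=; congr (_, _, _).
by rewrite jump_far ?addr0// => j jk; exact: (BY _ _ Bp).
Qed.
End Jumps.

Arguments colx : simpl never.
Section BlockGraphs.
Context {R : realType}.

(** The functions [Psi d] of neighbouring blocks need not agree at their common column; two vertical
    segments that meet at the height [eta] fill the gap and become part of the strand there. *)
Definition block_graphs (k : nat) (Psi : nat -> R -> R) (eta : nat -> R) : set (R * R * R) :=
  [set p | p.2 = 0 /\ exists2 d, (d < k)%N &
    [\/ p.1.1 = colx k d /\ Psi d (colx k d) <= p.1.2 <= eta d,
        colx k d.+1 <= p.1.1 <= colx k d /\ p.1.2 = Psi d p.1.1 |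
        p.1.1 = colx k d.+1 /\ eta d.+1 <= p.1.2 <= Psi d (colx k d.+1)]].

(** The times 2 and 5, between which the abscissa moves, are those of [staircase]. *)
Definition blockx (k d : nat) (t : R) : R := colx k d + (colx k d.+1 - colx k d) * clamp ((t - 2) / 3).
Definition blocky k (Psi : nat -> R -> R) (eta : nat -> R) d (t : R) : R :=
  Psi d (blockx k d t) + (1 - clamp (t / 2)) * (eta d - Psi d (colx k d))
    + clamp ((t - 5) / 2) * (eta d.+1 - Psi d (colx k d.+1)).

Lemma block_start k Psi eta d (t : R) : 0 <= t <= 2 ->
  blockx k d t = colx k d /\ blocky k Psi eta d t = t / 2 * Psi d (colx k d) + (1 - t / 2) * eta d.
Proof.
move=> h; have xE : blockx k d t = colx k d by rewrite /blockx clamp_le0 ?mulr0 ?addr0//; flra.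
rewrite /blocky xE clamp_id ?(@clamp_le0 _ ((t - 5) / 2)); [by split=> //; ring|flra..].
Qed.
Lemma block_middle k Psi eta d (t : R) : 2 <= t <= 5 ->
  blocky k Psi eta d t = Psi d (blockx k d t) /\ blockx k d t = colx k d + (colx k d.+1 - colx k d) * ((t - 2) / 3).
Proof.
move=> h; rewrite /blocky (@clamp_ge1 _ (t / 2)) ?(@clamp_le0 _ ((t - 5) / 2)); [|flra..].
rewrite /blockx clamp_id; last by flra.
by split=> //; ring.
Qed.
Lemma block_end k Psi eta d (t : R) : 5 <= t <= 7 ->
  blockx k d t = colx k d.+1 /\
  blocky k Psi eta d t = (7 - t) / 2 * Psi d (colx k d.+1) + (1 - (7 - t) / 2) * eta d.+1.
Proof.
move=> h; have xE : blockx k d t = colx k d.+1 by rewrite /blockx clamp_ge1 ?mulr1; flra.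
rewrite /blocky xE (@clamp_ge1 _ (t / 2)) ?(@clamp_id _ ((t - 5) / 2)); [by split=> //; field|flra..].
Qed.

Lemma trajectories_blocks k Psi eta :
  (forall d, (d < k)%N -> Psi d (colx k d) < eta d /\ eta d.+1 < Psi d (colx k d.+1)) ->
  trajectories k 7 (fun d t => (blockx k d t, blocky k Psi eta d t, 0 : R)) = block_graphs k Psi eta.
Proof.
move=> Pe; have conv (a b s : R) : a < b -> 0 <= s <= 1 -> a <= s * a + (1 - s) * b <= b by move=> *; fnra.
have conv' (a b s : R) : b < a -> 0 <= s <= 1 -> b <= s * a + (1 - s) * b <= a by move=> *; fnra.
apply/seteqP; split=> [_ [d [t [dk t07 ->]]]|[[u v] w] /= [/= -> [d dk /= H]]].
  split=> //; exists d => //=; have [P1 P2] := Pe d dk.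
  have [t2|t2] := leP t 2.
    have h2 : 0 <= t <= 2 by flra.
    by have [-> ->] := block_start k Psi eta d h2; apply: Or31; split=> //; apply: conv => //; flra.
  have [t5|t5] := leP t 5.
    have h2 : 2 <= t <= 5 by flra.
    have [-> ->] := block_middle k Psi eta d h2; apply: Or32; split=> //.
    have C := @colx_lt R k d d.+1 (ltnSn d); have : 0 <= (t - 2) / 3 <= 1 by flra.
    by move: C; clear; move: (colx k d) (colx k d.+1) (_ / 3) => a b c *; fnra.
  have h2 : 5 <= t <= 7 by flra.
  by have [-> ->] := block_end k Psi eta d h2; apply: Or33; split=> //; apply: conv' => //; flra.
have [P1 P2] := Pe d dk; have C := @colx_lt R k d d.+1 (ltnSn d).
case: H => -[h1 h2].
- pose t := 2 * ((eta d - v) / (eta d - Psi d (colx k d))).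
  have den : 0 < eta d - Psi d (colx k d) by flra.
  have t02 : 0 <= t <= 2.
    suff : 0 <= (eta d - v) / (eta d - Psi d (colx k d)) <= 1 by rewrite /t; flra.
    by rewrite divr_ge0 ?ler_pdivrMr ?mul1r//; flra.
  exists d, t; split=> //; first by flra.
  have [-> ->] := block_start k Psi eta d t02; rewrite h1; congr (_, _, _).
  by rewrite /t; field; rewrite gt_eqF.
- pose t := 2 + 3 * ((colx k d - u) / (colx k d - colx k d.+1)).
  have den : 0 < colx k d - colx k d.+1 :> R by flra.
  have t25 : 2 <= t <= 5.
    suff : 0 <= (colx k d - u) / (colx k d - colx k d.+1) <= 1 by rewrite /t; flra.
    have cE : colx k d.+1 = k%:R - d.+1%:R :> R by [].
    by rewrite divr_ge0 ?ler_pdivrMr ?mul1r//; flra.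
  exists d, t; split=> //; first by flra.
  have [-> xE] := block_middle k Psi eta d t25.
  have -> : blockx k d t = u by rewrite xE /t; field; rewrite gt_eqF.
  by rewrite h2.
- pose t := 7 - 2 * ((v - eta d.+1) / (Psi d (colx k d.+1) - eta d.+1)).
  have den : 0 < Psi d (colx k d.+1) - eta d.+1 by flra.
  have t57 : 5 <= t <= 7.
    suff : 0 <= (v - eta d.+1) / (Psi d (colx k d.+1) - eta d.+1) <= 1 by rewrite /t; flra.
    by rewrite divr_ge0 ?ler_pdivrMr ?mul1r//; move: h2; rewrite /colx; flra.
  exists d, t; split=> //; first by flra.
  have [-> ->] := block_end k Psi eta d t57; rewrite h1; congr (_, _, _).
  by rewrite /t; field; rewrite gt_eqF.
Qed.

Lemma block_graphs_isotopic (k : nat) (sg : nat -> R) (Psi : nat -> R -> R) (eta : nat -> R)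
    (X Z : R -> R) (C b0 b1 del : R) : (0 < k)%N ->
  (forall d, sg d = 1 \/ sg d = -1) -> (forall d, (d.+1 < k)%N -> sg d.+1 = - sg d) ->
  (forall d, continuous (Psi d)) ->
  (forall d x, (d < k)%N -> colx k d.+1 <= x <= colx k d -> 0 < Psi d x < 1) ->
  (forall d, (d <= k)%N -> 0 < eta d < 1) ->
  (forall d, (d < k)%N -> Psi d (colx k d) < eta d /\ eta d.+1 < Psi d (colx k d.+1)) ->
  eta 0%N = b0 -> eta k = b1 ->
  b0 <= b1 -> 0 < del -> continuous X -> continuous Z ->
  (forall v, b0 <= v <= b1 -> [/\ `|Z v| <= C, `|X v| <= C & X v < k%:R]) ->
  X b0 = k%:R - 2^-1 -> Z b0 = 0 -> X b1 = 0 -> Z b1 = 0 ->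
  (forall d x, (d < k)%N -> colx k d.+1 <= x <= colx k d -> b0 <= Psi d x <= b1 -> X (Psi d x) = x ->
     sg d * Z (Psi d x) < - del) ->
  (forall d (v : R), (d < k)%N -> b0 <= v <= b1 ->
     (X v = colx k d /\ Psi d (colx k d) <= v <= eta d) \/
     (X v = colx k d.+1 /\ eta d.+1 <= v <= Psi d (colx k d.+1)) -> v = b0 \/ v = b1) ->
  exists b : 'I_k -> R -> R * R, one_pure_braid b /\
    @isotopic R _ (block_graphs k Psi eta `|`
      [set (X v, v, Z v) | v in [set v | b0 <= v <= b1]]) (braid_closure b).
Proof.
move=> k0 sg1 sgS cP P01 e01 Pe e0 ek b01 del0 cX cZ BM Xb0 Zb0 Xb1 Zb1 cross vert.
rewrite -trajectories_blocks//.
have cbx d : continuous (@blockx k d) by rewrite /blockx; cont; apply: cont_clamp; cont.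
have col_in d : (@colx R k d.+1 <= @colx R k d.+1 <= @colx R k d) /\ (@colx R k d.+1 <= @colx R k d <= @colx R k d).
  by have /ltW h := @colx_lt R k d d.+1 (ltnSn d); rewrite !lexx h.
have conv (a b s : R) : 0 < a < 1 -> 0 < b < 1 -> 0 <= s <= 1 -> 0 < s * a + (1 - s) * b < 1.
  by clear; move=> /andP[? ?] /andP[? ?] /andP[? ?]; have [?|?] := leP s 2^-1; apply/andP; split; fnra.
have reg (t : R) : 0 <= t <= 7 -> [\/ 0 <= t <= 2, 2 <= t <= 5 | 5 <= t <= 7].
  move=> t07; have [t2|t2] := leP t 2; first by apply: Or31; flra.
  by have [t5|t5] := leP t 5; [apply: Or32|apply: Or33]; flra.
have mid d (t : R) : 2 <= t <= 5 -> colx k d.+1 <= blockx k d t <= colx k d.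
  move=> t25; have [_ ->] := block_middle k Psi eta d t25.
  have CC := @colx_lt R k d d.+1 (ltnSn d); have : 0 <= (t - 2) / 3 <= 1 by flra.
  by move: CC; clear; move: (colx k d) (colx k d.+1) (_ / 3) => a b c *; fnra.
apply: (@blocks_isotopic R k sg (blockx k) (blocky k Psi eta) eta X Z C b0 b1 del) => //.
- move=> d; rewrite /blocky; cont; try by apply: cont_clamp; cont.
  by apply: (@cont_comp _ _ _ (Psi d) (blockx k d)).
- split.
  + by move=> d t dk h; have [] := block_start k Psi eta d h.
  + by move=> d t dk h; have [] := block_end k Psi eta d h.
  + move=> d t t' dk t2 tt t5.
    have h1 : 2 <= t <= 5 by flra.
    have h2 : 2 <= t' <= 5 by flra.
    have [_ ->] := block_middle k Psi eta d h1; have [_ ->] := block_middle k Psi eta d h2.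
    have CC := @colx_lt R k d d.+1 (ltnSn d).
    by move: CC tt; clear; move: (colx k d) (colx k d.+1) => a b CC tt; fnra.
- move=> d t dk /reg[h|h|h].
  + have [_ ->] := block_start k Psi eta d h; apply: conv; last by flra.
      by apply: P01 => //; case: (col_in d).
    by apply: e01; exact: ltnW.
  + have [-> _] := block_middle k Psi eta d h; apply: P01 => //; exact: mid.
  + have [_ ->] := block_end k Psi eta d h; apply: conv; last by flra.
      by apply: P01 => //; case: (col_in d).
    exact: e01.
- move=> d t t' dk t0 tt t2; have [P1 _] := Pe d dk.
  have h1 : 0 <= t <= 2 by flra.
  have h2 : 0 <= t' <= 2 by flra.
  have [_ ->] := block_start k Psi eta d h1; have [_ ->] := block_start k Psi eta d h2.
  by move: P1 tt; clear; move: (Psi _ _) (eta d) => a b P1 tt; fnra.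
- move=> d t t' dk t0 tt t2; have [_ P1] := Pe d dk.
  have h1 : 5 <= t <= 7 by flra.
  have h2 : 5 <= t' <= 7 by flra.
  have [_ ->] := block_end k Psi eta d h1; have [_ ->] := block_end k Psi eta d h2.
  by move: P1 tt; clear; move: (Psi _ _) (eta d.+1) => a b P1 tt; fnra.
- move=> d dk; split.
    by have [|_ ->] := @block_start k Psi eta d 0; [flra|rewrite mul0r mul0r add0r subr0 mul1r].
  by have [|_ ->] := @block_end k Psi eta d 7; [flra|rewrite subrr !mul0r add0r subr0 mul1r].
- move=> d t v dk t07 vb xE yE; have [P1 P2] := Pe d dk; case: (reg t t07) => h.
  + move: xE yE; have [-> ->] := block_start k Psi eta d h => xE yE; right.
    apply: (vert d v dk vb); left; split=> //; rewrite -yE.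
    by move: P1; clear -h; move: (Psi _ _) (eta d) => a b; fnra.
  + move: xE yE; have [-> _] := block_middle k Psi eta d h => xE yE; left; rewrite -yE.
    by apply: cross => //; [exact: mid|rewrite yE|rewrite yE].
  + move: xE yE; have [-> ->] := block_end k Psi eta d h => xE yE; right.
    apply: (vert d v dk vb); right; split=> //; rewrite -yE.
    by move: P2; clear -h; move: (Psi _ _) (eta d.+1) => a b; fnra.
Qed.
End BlockGraphs.

Section Columns.
Context {R : realType}.

Lemma continuous_eps (F : R -> R) (x e : R) : continuous F -> 0 < e ->
  exists2 d, 0 < d & forall u, `|u - x| < d -> `|F u - F x| < e.
Proof.
move=> cF e0; have /cvgrPdist_lt /(_ e e0) := cF x; rewrite near_nbhs => /nbhs_ballP[d /= d0 H].
by exists d => // u ux; rewrite distrC; apply: H; rewrite /ball /= distrC.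
Qed.

Lemma positive_min (f : R -> R) (a b : R) : continuous f -> a <= b -> (forall v, a <= v <= b -> 0 < f v) ->
  exists2 m, 0 < m & forall v, a <= v <= b -> m <= f v.
Proof.
move=> cf ab f0; have [c cab cm] := EVT_min ab (continuous_subspaceT cf).
by exists (f c) => [|v vab]; [apply: f0; rewrite in_itv in cab|apply: cm; rewrite in_itv].
Qed.

Lemma colxE k d : (0 < d <= k)%N -> colx k d = (k - d)%N%:R :> R.
Proof. by case: d => // d /andP[_ dk]; rewrite natrB. Qed.

Lemma colx_gap k d : 2^-1 <= colx k d - colx k d.+1 :> R.
Proof.
by case: d => [|d]; rewrite /colx; [flra|rewrite -[d.+2%:R]natr1; flra].
Qed.

Lemma colx_find k n (x : R) : (0 < n)%N -> colx k n <= x <= colx k 0 ->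
  exists2 d, (d < n)%N & colx k d.+1 <= x <= colx k d.
Proof.
elim: n => // -[|n] IH _ h; first by exists 0%N.
have [xn|xn] := leP (colx k n.+1) x.
  by have [//||d dn H] := IH; [case/andP: h => _ ->; rewrite xn|exists d => //; exact: ltnW].
by exists n.+1 => //; case/andP: h => -> _; rewrite ltW.
Qed.

(** The row crosses each interior column at one point, while the closure has a vertical strand
    there. Near the column the graph is first given the slope 1, then the crossing is spread into a
    vertical segment. The slope is positive because the arcs, run from right to left, go down along
    the columns. *)
Lemma columns_isotopic (k : nat) (sg : nat -> R) (F X Z : R -> R) (C b0 b1 del : R) : (0 < k)%N ->
  (forall d, sg d = 1 \/ sg d = -1) -> (forall d, (d.+1 < k)%N -> sg d.+1 = - sg d) ->
  continuous F -> (forall x, 0 <= x <= k%:R - 2^-1 -> 0 < F x < 1) ->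
  F (k%:R - 2^-1) < b0 -> b0 <= b1 -> b1 < F 0 -> 0 < del -> continuous X -> continuous Z ->
  (forall v, b0 <= v <= b1 -> [/\ `|Z v| <= C, `|X v| <= C & X v < k%:R]) ->
  X b0 = k%:R - 2^-1 -> Z b0 = 0 -> X b1 = 0 -> Z b1 = 0 ->
  (forall d x, (d < k)%N -> colx k d.+1 <= x <= colx k d -> b0 <= F x <= b1 -> X (F x) = x ->
     sg d * Z (F x) < - del) ->
  (forall j : nat, (0 < j < k)%N -> b0 <= F j%:R <= b1 -> X (F j%:R) <> j%:R) ->
  exists b : 'I_k -> R -> R * R, one_pure_braid b /\
    @isotopic R _ ([set (x, F x, 0) | x in [set x | 0 <= x <= k%:R - 2^-1]] `|`
      ([set (k%:R - 2^-1, y, 0) | y in [set y | F (k%:R - 2^-1) <= y <= b0]] `|`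
       [set (0, y, 0) | y in [set y | b1 <= y <= F 0]] `|`
       [set (X v, v, Z v) | v in [set v | b0 <= v <= b1]])) (braid_closure b).
Proof.
move=> k0 sg1 sgS cF F01 FR b01 FL del0 cX cZ BM Xb0 Zb0 Xb1 Zb1 cross nocross.
have k1 : 1 <= k%:R :> R by rewrite ler1n.
have jk1 j : (0 < j < k)%N -> 1 <= j%:R :> R /\ j%:R <= k%:R - 1 :> R.
  by case/andP => j0 jk; rewrite ler1n j0 lerBrDr natr1 ler_nat.
(* By compactness: where the last arc is within [r] of a column, its height differs by [2 * r] at
   least from that of the crossing, and the modifications of the graph will take place in
   between. *)
have [r r0 rP] : exists2 r : R, 0 < r & forall j, (0 < j < k)%N -> 2 * r < F j%:R < 1 - 2 * r /\
    forall v, b0 <= v <= b1 -> `|X v - j%:R| < r -> 2 * r <= `|v - F j%:R|.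
  have [|r r0 rP] := @common_radius R k (fun j (r : R) => (0 < j < k)%N -> 2 * r < F j%:R < 1 - 2 * r /\
      forall v, b0 <= v <= b1 -> `|X v - j%:R| < r -> 2 * r <= `|v - F j%:R|).
    move=> j jk; have [j0|j0] := posnP j; first by exists 1 => // r' _; rewrite j0.
    have j0k : (0 < j < k)%N by rewrite j0.
    have [j1 j2] := jk1 j j0k.
    have Fj : 0 < F j%:R < 1 by apply: F01; clear -j1 j2; flra.
    have cmax : continuous (fun v => Num.max `|X v - j%:R| `|v - F j%:R|) by cont.
    have [|m m0 mP] := positive_min cmax b01.
      move=> v vb; rewrite lt_max !normr_gt0 !subr_eq0; apply/orP.
      have [XE|] := eqVneq (X v) j%:R; last by left.
      right; apply/eqP => vE; apply: (nocross j j0k); rewrite -vE//.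
    exists (Num.min (m / 2) (Num.min (F j%:R / 4) ((1 - F j%:R) / 4))).
      by rewrite !lt_min; clear -m0 Fj; flra.
    move=> r' /andP[r'0]; rewrite !le_min => /and3P[rm rF rF'] _; split; first by clear -r'0 rF rF'; flra.
    move=> v vb Xv; rewrite leNgt; apply/negP => lt; have := mP v vb; rewrite leNgt => /negP; apply.
    by rewrite gt_max; clear -rm Xv lt r'0; apply/andP; split; flra.
  by exists r => // j jk; apply: rP => //; [case/andP: jk|rewrite r0 lexx].
(* The graph is modified within [6 * rho] of the columns. There [F] varies by less than [r / 8];
   [24 * rho <= r] keeps the change of height below [r / 2], and [16 * rho <= 1] keeps the
   neighbourhoods of distinct columns apart. *)
have [rho [rho0 rhor rho1 rhoP]] : exists rho : R, [/\ 0 < rho, 24 * rho <= r, 16 * rho <= 1 &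
    forall j x, (0 < j < k)%N -> `|x - j%:R| <= 6 * rho -> `|F x - F j%:R| < r / 8].
  have [|rh rh0 rhP] := @common_radius R k (fun j rho => forall x, `|x - j%:R| <= 6 * rho -> `|F x - F j%:R| < r / 8).
    move=> j jk; have [|d d0 dP] := @continuous_eps F j%:R (r / 8) cF; first by clear -r0; flra.
    exists (d / 7) => [|r' r'd x xj]; first by clear -d0; flra.
    by apply: dP; move: xj r'd d0; clear; move: (`|_|) => *; flra.
  exists (Num.min rh (Num.min (r / 24) 16^-1)); split.
  - by rewrite !lt_min rh0; clear -r0; flra.
  - have : Num.min rh (Num.min (r / 24) 16^-1) <= r / 24 by rewrite !ge_min lexx orbT.
    by move: (Num.min _ _) => w; clear; flra.
  - have : Num.min rh (Num.min (r / 24) 16^-1) <= 16^-1 by rewrite !ge_min lexx !orbT.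
    by move: (Num.min _ _) => w; clear; flra.
  - move=> j x /andP[j0 jk]; apply: rhP => //.
    by rewrite ge_min lexx !lt_min rh0 /=; clear -r0; flra.
(* The sum [T] is [x - j] within [3 * rho] of the column [j] and 0 beyond [6 * rho] of all columns.
   Hence [F1] is the line of slope 1 through [(j, F j)] close to [j], and [F] away from the
   columns. *)
pose tau (u : R) := u * clamp (2 - `|u| / (3 * rho)).
have tau_near u : `|u| <= 3 * rho -> tau u = u.
  move=> h; rewrite /tau clamp_ge1 ?mulr1//.
  suff : `|u| / (3 * rho) <= 1 by clear; flra.
  by rewrite ler_pdivrMr ?mul1r//; clear -rho0; flra.
have tau_far u : 6 * rho <= `|u| -> tau u = 0.
  move=> h; rewrite /tau clamp_le0 ?mulr0//.
  suff : 2 <= `|u| / (3 * rho) by clear; flra.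
  by rewrite ler_pdivlMr; clear -rho0 h; flra.
have tau_le u : `|tau u| <= `|u| /\ `|u - tau u| <= `|u|.
  rewrite /tau; have := clamp_ge0 (2 - `|u| / (3 * rho)); have := clamp_le1 (2 - `|u| / (3 * rho)).
  move: (clamp _) => c c1 c0; rewrite (_ : u - u * c = u * (1 - c)) ?normrM; last by clear; ring.
  rewrite (ger0_norm c0) (@ger0_norm _ (1 - c)) ?subr_ge0//.
  by have := normr_ge0 u; move: (`|u|) => w w0; clear -w0 c1 c0; split; fnra.
pose T x := \sum_(1 <= j < k) tau (x - j%:R).
have cT : continuous T.
  apply: (@cont_sum R R k (fun j x => tau (x - j%:R))) => j; rewrite /tau; cont; apply: cont_clamp; cont.
have psi0 (j : nat) (x : R) : 2^-1 <= `|x - j%:R| -> tau (x - j%:R) = 0.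
  by move=> h; apply: tau_far; move: h; clear -rho1; move: (`|_|) => *; flra.
have Tnear j x : (0 < j < k)%N -> `|x - j%:R| < 6 * rho -> T x = tau (x - j%:R).
  move=> jk xj; apply: (@bump_sum_near R k (fun j x => tau (x - j%:R)) psi0 j x jk).
  by move: xj; clear -rho1; move: (`|_|) => *; flra.
have Tfar x : (forall j, (0 < j < k)%N -> 6 * rho <= `|x - j%:R|) -> T x = 0.
  by move=> h; apply: (@bump_sum_far R k (fun j x => tau (x - j%:R))) => j jk; apply: tau_far; exact: h.
have dich x : (exists2 j, (0 < j < k)%N & `|x - j%:R| < 6 * rho) \/ forall j, (0 < j < k)%N -> 6 * rho <= `|x - j%:R|.
  case: (pselect (exists2 j, (0 < j < k)%N & `|x - j%:R| < 6 * rho)) => [|n]; first by left.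
  by right=> j jk; rewrite leNgt; apply/negP => lt; apply: n; exists j.
pose F1 x := F (x - T x) + T x.
have cF1 : continuous F1.
  by rewrite /F1; cont; apply: (@cont_comp _ _ _ F (fun x => x - T x)) => //; cont.
have F1n j x : (0 < j < k)%N -> `|x - j%:R| <= 3 * rho -> F1 x = F j%:R + (x - j%:R).
  move=> jk xj; rewrite /F1 (Tnear j) ?tau_near//; last by move: xj; clear -rho0; move: (`|_|) => *; flra.
  by rewrite (_ : x - (x - _) = j%:R)//; clear; ring.
have F1m j x : (0 < j < k)%N -> `|x - j%:R| < 6 * rho -> `|F1 x - F j%:R| < 3 * r / 8 /\ `|F1 x - F x| <= r / 2.
  move=> jk xj; rewrite /F1 (Tnear j)//; have [t1 t2] := tau_le (x - j%:R).
  have t3 : `|x - tau (x - j%:R) - j%:R| <= 6 * rho.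
    rewrite (_ : _ - j%:R = x - j%:R - tau (x - j%:R)); last by clear; ring.
    by move: t2 xj; clear; move: (`|_|) (`|_|) => *; flra.
  have t4 := le_lt_trans t1 xj; have := rhoP j _ jk t3; have := rhoP j x jk (ltW xj); move: t4; clear -rhor.
  clearbody tau; move: (F (x - tau (x - j%:R))) (F j%:R) (F x) => a b c; move: (tau (x - j%:R)) => d.
  by rewrite !ltr_norml !ler_norml => h1 h2 h3; split; flra.
have F1f x : (forall j, (0 < j < k)%N -> 6 * rho <= `|x - j%:R|) -> F1 x = F x.
  by move=> h; rewrite /F1 Tfar// subr0 addr0.
have FF1 x : `|F1 x - F x| <= r / 2.
  case: (dich x) => [[j jk xj]|h]; first by case: (F1m j x jk xj).
  by rewrite F1f// subrr normr0; clear -r0; flra.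
have endsfar j : (0 < j < k)%N -> (2^-1 : R) <= `|(k%:R : R) - 2^-1 - j%:R| /\ (2^-1 : R) <= `|(0 : R) - j%:R|.
  move=> jk; have [j1 j2] := jk1 j jk; split.
    by rewrite ger0_norm; clear -j1 j2; flra.
  by rewrite ler0_norm; clear -j1 j2; flra.
have endsfar6 : F1 (k%:R - 2^-1) = F (k%:R - 2^-1) /\ F1 0 = F 0.
  by split; apply: F1f => j jk; have [h1 h2] := endsfar j jk; move: h1 h2; clear -rho1; move: (`|_|) (`|_|) => *; flra.
set Eset := _ `|` [set (0, y, 0) | y in _]; set Bset := [set (X v, v, Z v) | v in _].
have E1 : @isotopic R _ ([set (x, F x, 0) | x in [set x | 0 <= x <= k%:R - 2^-1]] `|` (Eset `|` Bset))
    ([set (x, F1 x, 0) | x in [set x | 0 <= x <= k%:R - 2^-1]] `|` (Eset `|` Bset)).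
  apply: (@graph_move_isotopic R F F1 _ _ r r0) => // p [[[y _ <-]|[y _ <-]]|[v vb <-]] /=.
  - by left; case: endsfar6.
  - by left; case: endsfar6.
  - case: (dich (X v)) => [[j jk xj]|h]; last by left; exact: F1f.
    right; have [_ /(_ v vb)] := rP j jk; have := rhoP j _ jk (ltW xj).
    have -> : `|X v - j%:R| < r by move: xj; clear -rhor rho0; move: (`|_|) => *; flra.
    move=> h1 /(_ isT) h2; have := ler_distD (F (X v)) v (F j%:R); move: h1 h2; clear -r0.
    by move: (`|_|) (`|_|) (`|_|) => *; flra.
pose Y j := F j%:R.
have rho6 : 6 * rho <= 1 by clear -rho1 rho0; flra.
have [|H2 [H2' [iH2 HH2]]] := @jump_isotopic R k rho Y F1 [set x | 0 <= x <= k%:R - 2^-1] (Eset `|` Bset) rho0 rho6.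
  move=> p j [[[y _ <-]|[y _ <-]]|[v vb <-]] jk /=.
  - by right; have [h _] := endsfar j jk; move: h; clear -rho1 rho0; move: (`|_|) => *; flra.
  - by right; have [_ h] := endsfar j jk; move: h; clear -rho1 rho0; move: (`|_|) => *; flra.
  - have [h|h] := leP (3 * rho) `|X v - j%:R|; first by right.
    left; have [_ /(_ v vb)] := rP j jk; have -> : `|X v - j%:R| < r by move: h; clear -rhor rho0; move: (`|_|) => *; flra.
    by move=> /(_ isT); rewrite /Y; clear -rhor rho0; move: (`|_|) => *; flra.
have {H2 H2' iH2 HH2} E2 := ex_intro (fun H => exists H', isotopy H H' /\ H 1 @` _ = _) H2 (ex_intro _ H2' (conj iH2 HH2)).
(* Solving [x = j + u + dent rho u] for [rho / 2 <= |u| <= rho] gives [u = (x - j + rho) / 2] to the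
   right of a column and [u = (x - j - rho) / 2] to its left. [rr] and [ll] are the absolute
   differences from [u = x - j]. *)
pose rr d (x : R) : R := if (d.+1 < k)%N then 2^-1 * Num.max 0 (rho - (x - colx k d.+1)) else 0.
pose ll d (x : R) : R := if (0 < d)%N then 2^-1 * Num.max 0 (rho - (colx k d - x)) else 0.
pose Psi d x := F1 x + rr d x - ll d x.
pose eta d := if d is 0%N then b0 else if (d < k)%N then F (colx k d) else b1.
have cPsi d : continuous (Psi d).
  by rewrite /Psi /rr /ll; case: (d.+1 < k)%N; case: (0 < d)%N; cont.
have gap d := @colx_gap k d.
have colj d : (0 < d < k)%N -> exists2 j, (0 < j < k)%N & colx k d = j%:R :> R.
  move=> /andP[d0 dk]; exists (k - d)%N; first by rewrite subn_gt0 dk ltn_subrL d0 (leq_trans _ dk).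
  by rewrite colxE// d0 ltnW.
have colk0 : colx k k = 0 :> R by rewrite colxE ?k0 ?leqnn// subnn.
have dk1 d : (d < k)%N -> (d.+1 < k)%N = false -> d.+1 = k.
  by move=> a b; apply/eqP; rewrite eqn_leq a leqNgt b.
have Psi_far d x : ((0 < d)%N -> rho <= colx k d - x) -> ((d.+1 < k)%N -> rho <= x - colx k d.+1) -> Psi d x = F1 x.
  move=> h1 h2; rewrite /Psi /rr /ll; case: ifP => c1; case: ifP => c2; rewrite ?max_l ?subr_le0 ?mulr0 ?addr0 ?subr0//; first [exact: h1|exact: h2].
have Psi_right d x j : (0 < d < k)%N -> colx k d = j%:R :> R -> (0 < j < k)%N -> 0 <= colx k d - x <= rho ->
    Psi d x = F j%:R - (rho + (j%:R - x)) / 2.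
  move=> /andP[d0 dk] cj jk; have gd := gap d; move=> h.
  have rr0 : rr d x = 0.
    rewrite /rr; case: ifP => // _; rewrite max_l ?mulr0// subr_le0; clear -gd h rho1; flra.
  rewrite /Psi rr0 /ll d0 cj; rewrite cj in h.
  rewrite (F1n j)//; last by rewrite ler_norml; clear -h rho0; flra.
  rewrite (@max_r _ _ 0 (rho - (j%:R - x))) ?subr_ge0; last by case/andP: h.
  by clear; field.
have Psi_left d x j : (d.+1 < k)%N -> colx k d.+1 = j%:R :> R -> (0 < j < k)%N -> 0 <= x - colx k d.+1 <= rho ->
    Psi d x = F j%:R + (rho + (x - j%:R)) / 2.
  move=> dk cj jk; have gd := gap d; move=> h.
  have ll0 : ll d x = 0.
    rewrite /ll; case: ifP => // _; rewrite max_l ?mulr0// subr_le0; clear -gd h rho1; flra.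
  rewrite /Psi ll0 /rr dk cj; rewrite cj in h.
  rewrite (F1n j)//; last by rewrite ler_norml; clear -h rho0; flra.
  rewrite (@max_r _ _ 0 (rho - (x - j%:R))) ?subr_ge0; last by case/andP: h.
  by clear; field.
have split3 d x : (d < k)%N -> colx k d.+1 <= x <= colx k d ->
    [\/ (0 < d < k)%N /\ 0 <= colx k d - x < rho, (d.+1 < k)%N /\ 0 <= x - colx k d.+1 < rho |
      ((0 < d)%N -> rho <= colx k d - x) /\ ((d.+1 < k)%N -> rho <= x - colx k d.+1)].
  move=> dk /andP[h1 h2]; have [c1|c1] := boolP ((0 < d)%N && (colx k d - x < rho)).
    by case/andP: c1 => d0 c1; apply: Or31; rewrite d0 dk subr_ge0 h2.
  have [c2|c2] := boolP ((d.+1 < k)%N && (x - colx k d.+1 < rho)).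
    by case/andP: c2 => d0 c2; apply: Or32; rewrite d0 subr_ge0 h1.
  apply: Or33; split=> c; rewrite leNgt; apply/negP => lt; first by rewrite c lt in c1.
  by rewrite c lt in c2.
have Psi_case d x : (d < k)%N -> colx k d.+1 <= x <= colx k d ->
    (exists j, [/\ (0 < j < k)%N, `|x - j%:R| < 6 * rho & `|Psi d x - F j%:R| < r]) \/ Psi d x = F x.
  move=> dk xd; case: (split3 d x dk xd) => [[d0 h]|[d0 h]|[h1 h2]].
  - left; have [j jk cj] := colj d d0; exists j; have h' : 0 <= colx k d - x <= rho by clear -h; flra.
    rewrite (Psi_right d x j)//; rewrite cj in h; split=> //; first by rewrite ltr_norml; clear -h rho0; flra.
    by rewrite ltr_norml; clear -h rho0 rhor; flra.
  - left; have [j jk cj] := colj d.+1 d0; exists j; have h' : 0 <= x - colx k d.+1 <= rho by clear -h; flra.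
    rewrite (Psi_left d x j)//; rewrite cj in h; split=> //; first by rewrite ltr_norml; clear -h rho0; flra.
    by rewrite ltr_norml; clear -h rho0 rhor; flra.
  - rewrite Psi_far//; case: (dich x) => [[j jk xj]|h]; last by right; exact: F1f.
    left; exists j; split=> //; have [h _] := F1m j x jk xj.
    by move: h; clear -r0; move: (`|_|) => *; flra.
have col0 : colx k 0 = k%:R - 2^-1 :> R by [].
have col_end0 : Psi 0%N (colx k 0) = F (k%:R - 2^-1).
  rewrite Psi_far//; first by rewrite col0; case: endsfar6.
  by have g0 := gap 0%N; clear -g0 rho1; flra.
have col_endk d : d.+1 = k -> Psi d (colx k d.+1) = F 0.
  move=> dE; rewrite Psi_far; first by rewrite dE colk0; case: endsfar6.
    by move=> _; have g0 := gap d; clear -g0 rho1; flra.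
  by rewrite dE ltnn.
have eta_in d : (0 < d < k)%N -> eta d = F (colx k d) by case: d => // d /= dk; rewrite /eta dk.
have Pcr d j : (0 < d < k)%N -> colx k d = j%:R :> R -> (0 < j < k)%N -> Psi d (colx k d) = F j%:R - rho / 2.
  by move=> dk cj jk; rewrite (Psi_right d _ j)// ?cj ?subrr ?addr0// lexx ltW.
have Pcl d j : (d.+1 < k)%N -> colx k d.+1 = j%:R :> R -> (0 < j < k)%N -> Psi d (colx k d.+1) = F j%:R + rho / 2.
  by move=> dk cj jk; rewrite (Psi_left d _ j)// ?cj ?subrr ?addr0// lexx ltW.
have etak : eta k = b1 by rewrite /eta; case: (k) k0 => // n _; rewrite ltnn.
have eta0 : eta 0%N = b0 by [].
clearbody eta; set G1 := [set (x + jump k rho Y x (F1 x), F1 x, 0) | x in _] in E2.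
have img j u : (0 < j < k)%N -> `|u| <= rho -> G1 (j%:R + u + dent rho u, F j%:R + u, 0).
  move=> jk ur; have [j1 j2] := jk1 j jk; exists (j%:R + u) => /=.
    by move: ur; rewrite ler_norml; clear -j1 j2 rho1 rho0; flra.
  have e : j%:R + u - j%:R = u by clear; ring.
  have uj : `|j%:R + u - j%:R| < 3 * rho by rewrite e; move: ur; clear -rho0; move: (`|_|) => *; flra.
  rewrite (F1n j) ?(ltW uj)//.
  by have := @jump_near R k rho Y (j%:R + u) j rho0 rho6 jk uj; rewrite /Y => ->; rewrite e.
have jump0 x : (forall j, (0 < j < k)%N -> rho <= `|x - j%:R|) -> jump k rho Y x (F1 x) = 0.
  move=> h; case: (pselect (exists2 j, (0 < j < k)%N & `|x - j%:R| < 3 * rho)) => [[j jk xj]|n].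
    by rewrite (F1n j) ?(ltW xj)//; have := @jump_near R k rho Y x j rho0 rho6 jk xj; rewrite /Y => ->; rewrite dent_far//; exact: h.
  apply: jump_far => // j jk; right; rewrite leNgt; apply/negP => lt; apply: n; by exists j.
have bdist d x : (d < k)%N -> colx k d.+1 <= x <= colx k d -> ((0 < d)%N -> rho <= colx k d - x) ->
    ((d.+1 < k)%N -> rho <= x - colx k d.+1) -> forall j, (0 < j < k)%N -> rho <= `|x - j%:R|.
  move=> dk xd h1 h2 j /andP[j0 jk].
  have jE : j%:R = colx k (k - j) :> R by rewrite colxE ?subKn ?subn_gt0 ?jk ?leq_subr// ltnW.
  rewrite jE; have [le|lt] := leqP (k - j) d.
    have d0 : (0 < d)%N by apply: leq_trans le; rewrite subn_gt0.
    have := h1 d0; have := @colx_le R k _ _ le => a b; rewrite distrC; apply: le_trans (ler_norm _).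
    by clear -a b; flra.
  have dk' : (d.+1 < k)%N by apply: leq_ltn_trans lt _; rewrite ltn_subrL j0 (leq_trans _ jk).
  have := h2 dk'; have := @colx_le R k _ _ lt => a b; apply: le_trans (ler_norm _).
  by clear -a b; flra.
have SE : G1 `|` Eset = block_graphs k Psi eta.
  apply/seteqP; split.
  - move=> _ [[x /= x01 <-]|[[y /= yb <-]|[y /= yb <-]]].
    + split=> //=; have [|d dk xd] := @colx_find k k x k0; first by rewrite colk0 col0.
      exists d => //; case: (split3 d x dk xd) => [[d0 h]|[d0 h]|[h1 h2]].
      * have [j jk cj] := colj d d0; pose s := j%:R - x.
        rewrite cj -/s in h.
        have xE : x = j%:R + - s by rewrite /s; clear; ring.
        have sr : `|x - j%:R| < 3 * rho by rewrite distrC -/s ger0_norm; clear -h rho0; flra.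
        have sE : x - j%:R = - s by rewrite /s; clear; ring.
        rewrite (F1n j) ?(ltW sr)//; have := @jump_near R k rho Y x j rho0 rho6 jk sr; rewrite /Y => ->; rewrite sE.
        have [sh|sh] := leP s (rho / 2).
          apply: Or31; rewrite dent_near ?normrN ?ger0_norm//; last by clear -h; flra.
          rewrite opprK xE subrK cj; split=> //; rewrite (eta_in d d0) -cj (Pcr d j)// cj.
          by clear -sh h; flra.
        apply: Or32; rewrite dent_left; last by clear -sh h; flra.
        have h' : colx k d.+1 <= x + (- s + rho) <= colx k d.
          by have g := gap d; rewrite cj in g *; clearbody s; clear -sh h rho1 g xE; flra.
        split=> //; rewrite (Psi_right d _ j)// ?cj; first by rewrite xE; clear; field.
        by rewrite xE; clear -sh h; flra.
      * have [j jk cj] := colj d.+1 d0; pose s := x - j%:R.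
        rewrite cj -/s in h.
        have xE : x = j%:R + s by rewrite /s; clear; ring.
        have sr : `|x - j%:R| < 3 * rho by rewrite -/s ger0_norm; clear -h rho0; flra.
        rewrite (F1n j) ?(ltW sr)//; have := @jump_near R k rho Y x j rho0 rho6 jk sr; rewrite /Y => ->; rewrite -/s.
        have [sh|sh] := leP s (rho / 2).
          apply: Or33; rewrite dent_near ?ger0_norm//; last by clear -h; flra.
          rewrite xE addrK cj; split=> //; rewrite (eta_in d.+1 d0) -cj (Pcl d j)// cj.
          by clear -sh h; flra.
        apply: Or32; rewrite dent_right; last by clear -sh h; flra.
        have h' : colx k d.+1 <= x + (s - rho) <= colx k d.
          by have g := gap d; rewrite cj in g *; clearbody s; clear -sh h rho1 g xE; flra.
        split=> //; rewrite (Psi_left d _ j)// ?cj; first by rewrite xE; clear; field.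
        by rewrite xE; clear -sh h; flra.
      * rewrite jump0 ?addr0; last exact: (bdist d).
        by apply: Or32; rewrite Psi_far.
    + by split=> //; exists 0%N => //=; apply: Or31; rewrite col_end0 eta0.
    + split=> //; exists k.-1 => /=; first by rewrite prednK.
      by apply: Or33; rewrite col_endk ?prednK// etak colk0.
  - move=> [[u v] w] [/= -> [d dk H]]; case: H => -[h1 h2] /=.
    + have [d0|d0] := posnP d.
        right; left; exists v; last by rewrite h1 d0 -col0.
        by move: h2; rewrite d0 col_end0 eta0.
      have d0k : (0 < d < k)%N by rewrite d0.
      have [j jk cj] := colj d d0k; left; rewrite h1.
      move: h2; rewrite (eta_in d d0k) (Pcr d j)// cj => h2.
      have := img j (v - F j%:R) jk; rewrite dent_near; last by rewrite ler_norml; clear -h2 rho0; flra.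
      by rewrite addrK [F _ + _]addrC subrK; apply; rewrite ler_norml; clear -h2 rho0; flra.
    + left; case: (split3 d u dk h1) => [[d0 h]|[d0 h]|[h3 h4]].
      * have [j jk cj] := colj d d0; rewrite h2 (Psi_right d u j)//; last by clear -h; flra.
        rewrite cj in h; have := img j (- (rho + (j%:R - u)) / 2) jk.
        rewrite dent_left; last by clear -h; flra.
        have -> : j%:R + - (rho + (j%:R - u)) / 2 + (- (rho + (j%:R - u)) / 2 + rho) = u by clear; field.
        by rewrite mulNr; apply; rewrite normrN ger0_norm; clear -h rho0; flra.
      * have [j jk cj] := colj d.+1 d0; rewrite h2 (Psi_left d u j)//; last by clear -h; flra.
        rewrite cj in h; have := img j ((rho + (u - j%:R)) / 2) jk.
        rewrite dent_right; last by clear -h; flra.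
        have -> : j%:R + (rho + (u - j%:R)) / 2 + ((rho + (u - j%:R)) / 2 - rho) = u by clear; field.
        by apply; rewrite ger0_norm; clear -h rho0; flra.
      * exists u => /=; last by rewrite jump0 ?addr0 ?h2 ?Psi_far//; exact: (bdist d).
        have c1 := @colx_le R k d.+1 k dk; have c2 := @colx_le R k 0 d (leq0n d).
        by rewrite colk0 col0 in c1 c2; clear -c1 c2 h1; flra.
    + have [d0|d0] := boolP (d.+1 < k)%N; last first.
        have dE : d.+1 = k by apply: dk1 => //; exact: negbTE.
        right; right; exists v; last by rewrite h1 dE colk0.
        by move: h2; rewrite col_endk// dE etak.
      have [j jk cj] := colj d.+1 d0; left; rewrite h1.
      move: h2; rewrite (eta_in d.+1 d0) (Pcl d j)// cj => h2.
      have := img j (v - F j%:R) jk; rewrite dent_near; last by rewrite ler_norml; clear -h2 rho0; flra.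
      by rewrite addrK [F _ + _]addrC subrK; apply; rewrite ler_norml; clear -h2 rho0; flra.
have Psi01 d x : (d < k)%N -> colx k d.+1 <= x <= colx k d -> 0 < Psi d x < 1.
  move=> dk xd; have c1 := @colx_le R k d.+1 k dk; have c2 := @colx_le R k 0 d (leq0n d).
  rewrite colk0 col0 in c1 c2.
  case: (Psi_case d x dk xd) => [[j [jk xj]]|->]; last by apply: F01; clear -c1 c2 xd; flra.
  by have [a _] := rP j jk; rewrite ltr_norml; clear -a r0; flra.
have [||||b [ob ib]] := @block_graphs_isotopic R k sg Psi eta X Z C b0 b1 del k0 sg1 sgS cPsi Psi01 _ _ eta0 etak b01 del0 cX cZ BM Xb0 Zb0 Xb1 Zb1.
- have FR0 : 0 < F (k%:R - 2^-1).
    have /andP[] // : 0 < F (k%:R - 2^-1) < 1 by apply: F01; clear -k1; flra.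
  have FL1 : F 0 < 1.
    have /andP[] // : 0 < F 0 < 1 by apply: F01; clear -k1; flra.
  move=> d dk; have [->|d0] := posnP d; first by rewrite eta0; clear -FR0 FR FL1 FL b01; flra.
  have [dk'|dk'] := boolP (d < k)%N.
    rewrite eta_in ?d0//; apply: F01.
    have c1 := @colx_le R k d k dk; have c2 := @colx_le R k 0 d (leq0n d).
    by rewrite colk0 col0 in c1 c2; rewrite c1 c2.
  have -> : d = k by apply/eqP; rewrite eqn_leq dk leqNgt.
  by rewrite etak; clear -FR0 FR FL1 FL b01; flra.
- move=> d dk; split.
    have [->|d0] := posnP d; first by rewrite col_end0 eta0.
    have d0k : (0 < d < k)%N by rewrite d0.
    have [j jk cj] := colj d d0k; rewrite eta_in// (Pcr d j)// cj; clear -rho0; flra.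
  have [d0|d0] := boolP (d.+1 < k)%N; last first.
    have dE : d.+1 = k by apply: dk1 => //; exact: negbTE.
    by rewrite col_endk// dE etak.
  by have [j jk cj] := colj d.+1 d0; rewrite eta_in// (Pcl d j)// cj; clear -rho0; flra.
- move=> d x dk xd vb Xx; case: (Psi_case d x dk xd) => [[j [jk xj pj]]|FE].
    exfalso; have [_ /(_ _ vb)] := rP j jk; rewrite Xx.
    have -> : `|x - j%:R| < r by move: xj; clear -rhor rho0; move: (`|_|) => *; flra.
    by move=> /(_ isT); move: pj; clear -r0; move: (`|_|) => *; flra.
  by rewrite FE in vb Xx *; apply: (cross d x).
- move=> d v dk vb; have bad j : (0 < j < k)%N -> X v = j%:R -> `|v - F j%:R| <= rho -> False.
    move=> jk Xv; have [_ /(_ _ vb)] := rP j jk; rewrite Xv subrr normr0 => /(_ r0).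
    by clear -rhor rho0; move: (`|_|) => *; flra.
  case=> -[Xv vP].
    have [d0|d0] := posnP d.
      by left; move: vP vb; rewrite d0 eta0; clear => *; apply/eqP; rewrite eq_le; flra.
    exfalso; have d0k : (0 < d < k)%N by rewrite d0.
    have [j jk cj] := colj d d0k; apply: (bad j jk); first by rewrite Xv.
    move: vP; rewrite eta_in// (Pcr d j)// cj => vP; by rewrite ler_norml; clear -vP rho0; flra.
  have [d0|d0] := boolP (d.+1 < k)%N; last first.
    have dE : d.+1 = k by apply: dk1 => //; exact: negbTE.
    by right; move: vP vb; rewrite dE etak; clear => *; apply/eqP; rewrite eq_le; flra.
  exfalso; have [j jk cj] := colj d.+1 d0; apply: (bad j jk); first by rewrite Xv.
  by move: vP; rewrite eta_in// (Pcl d j)// cj => vP; rewrite ler_norml; clear -vP rho0; flra.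
exists b; split=> //; apply: isotopic_trans E1 _; apply: isotopic_trans E2 _.
by rewrite setUA SE.
Qed.
End Columns.

(** * From a graph over an arbitrary interval to the standard columns *)

Section GraphKnots.
Context {R : realType}.

Lemma hinge_isotopic_x (K : set (R * R * R)) (c m : R) : 0 < m ->
  @isotopic R _ K ((fun p => (p.1.1 + (m - 1) * Num.min 0 (p.1.1 - c), p.1.2, p.2)) @` K).
Proof.
move=> m0; have minE x : Num.min 0 (x - c) = - Num.max 0 (c - x).
  by case: (leP 0 (x - c)) => h; [rewrite max_l ?oppr0|rewrite max_r]; flra.
have [m1|m1] := leP 1 m.
  have [|phi [phi' [lp E]]] := @line_isotopy_push R (fun=> m - 1) c (@cont_cst _ _ _); first by move=> _; rewrite subr_ge0.
  apply: isotopic_image_eq (line_isotopic_x K lp) => p _ /=; rewrite E minE; congr (_, _, _).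
  by rewrite mulrN.
have [||||phi [phi' [lp E]]] := @line_isotopy_lipschitz R (fun _ x => (m - 1) * Num.min 0 (x - c)) (1 - m) _ _ _ _.
- by rewrite subr_ge0 ltW.
- flra.
- cont.
- move=> _ x x'; have e : 0 <= 1 - m by flra.
  rewrite -mulrBr normrM distrC (ger0_norm e); apply: ler_wpM2l => //.
  have := ler_norm (x - x'); have := ler_norm (x' - x); rewrite [`|x' - x|]distrC ler_norml.
  by case: (leP 0 (x - c)) => ?; case: (leP 0 (x' - c)) => ?; flra.
by apply: isotopic_image_eq (line_isotopic_x K lp) => p _ /=; rewrite E.
Qed.

(** A piecewise linear map is built breakpoint by breakpoint: a hinge at [q n], which fixes
    everything to the right of it, brings the next point to its place. *)
Lemma increasing_interpolation (n : nat) (p q : nat -> R) :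
  (forall i, (i < n)%N -> p i.+1 < p i) -> (forall i, (i < n)%N -> q i.+1 < q i) ->
  exists phi psi : R -> R, [/\ continuous phi, continuous psi, cancel phi psi, cancel psi phi &
    [/\ forall x y, x < y -> phi x < phi y, forall i, (i <= n)%N -> phi (p i) = q i &
        forall K, @isotopic R _ K ((fun u : R * R * R => (phi u.1.1, u.1.2, u.2)) @` K)]].
Proof.
elim: n => [_ _|n IH pn qn].
  exists (fun x => x + (q 0%N - p 0%N)), (fun x => x - (q 0%N - p 0%N)); split; [cont|cont|move=> x|move=> x|].
  - by rewrite addrK.
  - by rewrite subrK.
  - split=> [x y|i|K]; first by rewrite ltrD2r.
      by rewrite leqn0 => /eqP ->; rewrite addrC subrK.
    exact: (@shear_isotopic_x R K (fun=> q 0%N - p 0%N) (@cont_cst _ _ _)).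
have [i|i|phi [psi [cphi cpsi k1 k2 [mono interp iso]]]] := IH; first by move=> /ltnW/pn.
  by move=> /ltnW/qn.
pose c := q n; pose u := phi (p n.+1).
have uc : u < c by rewrite /c -(interp n)//; apply/mono/pn.
have qc : q n.+1 < c by exact: qn.
pose m := (c - q n.+1) / (c - u).
have m0 : 0 < m by rewrite divr_gt0// subr_gt0.
pose g (m x : R) := x + (m - 1) * Num.min 0 (x - c).
have gle (l x : R) : x <= c -> g l x = c + l * (x - c).
  by move=> h; rewrite /g min_r ?subr_le0//; ring.
have gge (l x : R) : c <= x -> g l x = x.
  by move=> h; rewrite /g min_l ?subr_ge0// mulr0 addr0.
have gK (l l' x : R) : 0 < l -> l' * l = 1 -> g l' (g l x) = x.
  move=> l0 ll; have [h|h] := leP x c; last by rewrite !gge ?gge// ltW.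
  rewrite (gle l)// gle ?gerDl ?pmulr_rle0 ?subr_le0//.
  by rewrite addrAC subrr add0r mulrA ll mul1r addrC subrK.
have cg l : continuous (g l) by rewrite /g; cont.
exists (fun x => g m (phi x)), (fun x => psi (g m^-1 x)); split.
- exact: (@cont_comp _ _ _ (g m) phi).
- exact: (@cont_comp _ _ _ psi (g m^-1)).
- by move=> x; rewrite gK ?k1// mulVf// gt_eqF.
- by move=> x; rewrite k2 gK ?invr_gt0// mulfV// gt_eqF.
- split=> [x y|i|K].
  + move=> /mono; move: (phi x) (phi y) => a b ab.
    have [ac|ac] := leP a c; have [bc|bc] := leP b c.
    * by rewrite !gle// ltrD2l ltr_pM2l// ltrD2r.
    * rewrite gle// (gge m b) ?(ltW bc)//; have : m * (a - c) <= 0 by rewrite pmulr_rle0// subr_le0.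
      by move: bc; clear; flra.
    * by exfalso; flra.
    * by rewrite !gge// ltW.
  + rewrite leq_eqVlt => /orP[/eqP ->|]; last first.
      rewrite ltnS => iN; rewrite interp// gge// /c.
      elim: n i iN qn {IH pn mono interp iso c u uc qc m m0 g gle gge gK cg k1 k2 cphi cpsi phi psi} => [|n IHn] i.
        by rewrite leqn0 => /eqP ->.
      move=> iN qn; move: iN; rewrite leq_eqVlt => /orP[/eqP ->//|]; rewrite ltnS => iN.
      by apply: le_trans (ltW (qn n _)) (IHn i iN _) => // j jn; apply: qn; exact: ltnW.
    rewrite gle ?ltW// /m -/u; field.
    by rewrite subr_eq0 gt_eqF.
  + apply: isotopic_trans (iso K) _; have := hinge_isotopic_x ((fun u => (phi u.1.1, u.1.2, u.2)) @` K) c m0.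
    by rewrite image_comp.
Qed.

Lemma graph_knot_isotopic (F X Z : R -> R) (xL xR b0 b1 : R) :
  continuous F -> continuous X -> continuous Z -> xL < xR -> F xR < b0 -> b0 <= b1 -> b1 < F xL ->
  X b0 = xR -> Z b0 = 0 -> X b1 = xL -> Z b1 = 0 ->
  (forall x, xL <= x <= xR -> b0 <= F x <= b1 -> X (F x) = x -> Z (F x) <> 0) ->
  exists (k : nat) (b : 'I_k -> R -> R * R), one_pure_braid b /\
    @isotopic R _ ([set (x, F x, 0) | x in [set x | xL <= x <= xR]] `|`
      ([set (xR, y, 0) | y in [set y | F xR <= y <= b0]] `|`
       [set (xL, y, 0) | y in [set y | b1 <= y <= F xL]] `|`
       [set (X v, v, Z v) | v in [set v | b0 <= v <= b1]])) (braid_closure b).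
Proof.
move=> cF cX cZ LR FR b01 FL Xb0 Zb0 Xb1 Zb1 cross.
pose C0 := [set x | [/\ xL <= x <= xR, b0 <= F x <= b1 & X (F x) = x]].
(* The side to which the graph is pushed at a crossing: away from the last arc. *)
pose s c : R := if Z (F c) < 0 then 1 else -1.
have cXF : continuous (fun x => X (F x)) by apply: (@cont_comp _ _ _ X F).
have cZF : continuous (fun x => Z (F x)) by apply: (@cont_comp _ _ _ Z F).
(* This sum could vanish only where the graph meets the last arc, so it has a positive minimum; at a
   crossing it reduces to [|Z|], which gives the uniform gap [m]. *)
have cphi : continuous (fun x => `|Z (F x)| + `|X (F x) - x| + Num.max 0 (b0 - F x) + Num.max 0 (F x - b1)) by cont.
have [|m m0 mP] := positive_min cphi (ltW LR).
  move=> x xLR; have n1 := normr_ge0 (Z (F x)); have n2 := normr_ge0 (X (F x) - x).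
  have n3 : 0 <= Num.max 0 (b0 - F x) by rewrite le_max lexx.
  have n4 : 0 <= Num.max 0 (F x - b1) by rewrite le_max lexx.
  have [h|h] := boolP (b0 <= F x <= b1); last first.
    move: h; rewrite negb_and -!ltNge => /orP[h|h].
      have e : 0 <= b0 - F x by rewrite subr_ge0 ltW.
      by move: n1 n2 n4; rewrite (max_r e); move: h; clear => *; flra.
    have e : 0 <= F x - b1 by rewrite subr_ge0 ltW.
    by move: n1 n2 n3; rewrite (max_r e); move: h; clear => *; flra.
  have [XE|XE] := eqVneq (X (F x)) x.
    have : 0 < `|Z (F x)| by rewrite normr_gt0; apply/eqP; exact: cross.
    by move: n2 n3 n4; clear => *; flra.
  have : 0 < `|X (F x) - x| by rewrite normr_gt0 subr_eq0.
  by move: n1 n3 n4; clear => *; flra.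
have C0m x : C0 x -> m <= `|Z (F x)|.
  move=> [xLR /andP[h1 h2] XE]; have := mP x xLR; rewrite XE subrr normr0.
  by rewrite (max_l (_ : b0 - F x <= 0)) ?subr_le0// (max_l (_ : F x - b1 <= 0)) ?subr_le0// !addr0.
have [|k [sig [sg [k0 sg1 sgS [sig0 sigk] [sigd sigC sigs]]]]] := @alternating_partition R C0 s xL xR LR.
  move=> x xLR; have [Z0|Z0] := eqVneq (Z (F x)) 0.
    have [d d0 dP] := continuous_eps x cZF m0.
    exists d, 1; split=> //; first by left.
    move=> c /C0m cm cx; have := dP c cx; rewrite Z0 subr0 => h.
    by exfalso; move: h; rewrite ltNge cm.
  have [|d d0 dP] := @continuous_eps _ (fun x => Z (F x)) x `|Z (F x)| cZF; first by rewrite normr_gt0.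
  exists d, (s x); split=> //; first by rewrite /s; case: ifP; [left|right].
  move=> c _ cx; have := dP c cx; rewrite /s ltr_norml; move: Z0; clear.
  move: (Z (F x)) (Z (F c)) => a b a0; have [a1|a1] := ltP a 0.
    by rewrite ltr0_norm// => /andP[h1 h2]; case: ifP => // /negbT; rewrite -leNgt; flra.
  by rewrite ger0_norm// => /andP[h1 h2]; case: ifP => // h3; flra.
have [cM|M0 _ M0P] := @EVT_max R (fun x => `|F x|) xL xR (ltW LR); first by apply: continuous_subspaceT; cont.
have [cM|M1 _ M1P] := @EVT_max R (fun v => `|X v|) b0 b1 b01; first by apply: continuous_subspaceT; cont.
have [cM|M2 _ M2P] := @EVT_max R (fun v => `|Z v|) b0 b1 b01; first by apply: continuous_subspaceT; cont.
pose M := `|F M0| + 1.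
have M_gt0 : 0 < M by rewrite ltr_wpDl.
have FM x : xL <= x <= xR -> - M < F x < M.
  by move=> xLR; rewrite -ltr_norml; apply: le_lt_trans (M0P x _) _; rewrite ?in_itv// ltrDl.
pose top := Num.max `|X M1| xR + 1.
have topR : xR < top by rewrite /top; apply: le_lt_trans (_ : _ <= Num.max `|X M1| xR) _; rewrite ?le_max ?lexx ?orbT// ltrDl.
have topX v : b0 <= v <= b1 -> X v < top.
  move=> vb; apply: le_lt_trans (ler_norm _) _; apply: le_lt_trans (M1P v _) _; rewrite ?in_itv//.
  by rewrite /top; apply: le_lt_trans (_ : _ <= Num.max `|X M1| xR) _; rewrite ?le_max ?lexx// ltrDl.
(* The extra breakpoint [top], to the right of the row and of the last arc, is sent to [k - 1/4],
   which keeps the moving strand in the half-space [x < k]. *)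
pose p i := if i is j.+1 then sig j else top.
pose q i := if i is j.+1 then colx k j else k%:R - 4^-1 : R.
have [||phi [psi [cph cps k1 k2 [mono interp iso]]]] := @increasing_interpolation k.+1 p q.
- by case=> [_|i /sigd//]; rewrite /p sig0.
- by case=> [_|i _]; rewrite /q; [rewrite /colx; flra|exact: colx_lt].
have phis d : (d <= k)%N -> phi (sig d) = colx k d by move=> dk; rewrite (interp d.+1).
have phitop : phi top = k%:R - 4^-1 by rewrite (interp 0%N).
have colk0 : colx k k = 0 :> R by rewrite colxE ?k0 ?leqnn// subnn.
have col0 : colx k 0 = k%:R - 2^-1 :> R by [].
have phiR : phi xR = k%:R - 2^-1 by rewrite -sig0 phis// col0.
have phiL : phi xL = 0 by rewrite -sigk phis// colk0.
have monole x y : x <= y -> phi x <= phi y.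
  by rewrite le_eqVlt => /orP[/eqP ->//|/mono/ltW].
have psile x y : x <= y -> psi x <= psi y.
  move=> xy; rewrite leNgt; apply/negP => /mono; rewrite !k2 ltNge xy//.
pose ym (y : R) := (y + M) / (2 * M); pose yi (y : R) := y * (2 * M) - M.
have yK : cancel ym yi by move=> y; rewrite /ym /yi; field; rewrite gt_eqF.
have yK' : cancel yi ym by move=> y; rewrite /ym /yi; field; rewrite gt_eqF.
have cyi : continuous yi by rewrite /yi; cont.
have cym : continuous ym by rewrite /ym; cont.
have ymle x y : (ym x <= ym y) = (x <= y).
  by rewrite /ym ler_pM2r ?invr_gt0 ?mulr_gt0// lerD2r.
have ymlt x y : (ym x < ym y) = (x < y).
  by rewrite /ym ltr_pM2r ?invr_gt0 ?mulr_gt0// ltrD2r.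
pose F' x := ym (F (psi x)); pose X' v := phi (X (yi v)); pose Z' v := Z (yi v).
have psi0 : psi 0 = xL by rewrite -phiL k1.
have psik : psi (k%:R - 2^-1) = xR by rewrite -phiR k1.
have [|||||||||||||||b [ob ib]] := @columns_isotopic R k sg F' X' Z' (`|Z M2| + `|phi (- top)| + k%:R) (ym b0) (ym b1) (m / 2) k0 sg1 sgS.
- by apply: (@cont_comp _ _ _ ym (fun x => F (psi x))) => //; exact: (@cont_comp _ _ _ F psi).
- move=> x /andP[x0 xk]; rewrite /F'; have : - M < F (psi x) < M.
    by apply: FM; rewrite -psi0 -psik !psile.
  move=> /andP[h1 h2]; rewrite divr_gt0 ?mulr_gt0//=; last by move: h1; clear; flra.
  by rewrite ltr_pdivrMr ?mulr_gt0// mul1r; move: h2; clear; flra.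
- by rewrite /F' psik ymlt.
- by rewrite ymle.
- by rewrite /F' psi0 ymlt.
- by rewrite divr_gt0.
- by apply: (@cont_comp _ _ _ phi (fun v => X (yi v))) => //; exact: (@cont_comp _ _ _ X yi).
- exact: (@cont_comp _ _ _ Z yi).
- move=> v vb; have vb' : b0 <= yi v <= b1 by rewrite -!(ymle _ (yi v)) -(ymle (yi v)) yK'.
  have xk : X' v < k%:R - 4^-1 by rewrite /X' -phitop; apply/mono/topX.
  have xl : phi (- top) <= X' v.
    apply: monole; rewrite lerNl; apply: le_trans (_ : `|X (yi v)| <= _); first by rewrite -normrN ler_norm.
    by apply: le_trans (M1P (yi v) _) _; rewrite ?in_itv// /top; apply: le_trans (_ : _ <= Num.max `|X M1| xR) _; rewrite ?le_max ?lexx// lerDl.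
  have zb : `|Z' v| <= `|Z M2| by apply: (M2P (yi v)); rewrite in_itv.
  have n1 := normr_ge0 (phi (- top)); have n2 := normr_ge0 (Z M2); have n3 := ler_norm (- phi (- top)).
  rewrite normrN in n3; have n4 := ler0n R k; split.
  + by move: zb n1 n4; clear; flra.
  + by rewrite ler_norml; move: xk xl n1 n2 n3 n4; clear => *; flra.
  + by move: xk; clear; flra.
- by rewrite /X' yK Xb0 phiR.
- by rewrite /Z' yK.
- by rewrite /X' yK Xb1 phiL.
- by rewrite /Z' yK.
- move=> d x dk xd; rewrite /F' /X' /Z' !ymle yK => Fb XE.
  have xE : X (F (psi x)) = psi x by rewrite -[LHS]k1 XE.
  have pd : sig d.+1 <= psi x <= sig d.
    by case/andP: xd => h1 h2; rewrite -(k1 (sig d.+1)) -(k1 (sig d)) !phis ?(ltnW dk)// !psile.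
  have c1 : 0 <= x by case/andP: xd => h _; apply: le_trans h; rewrite -colk0; exact: colx_le.
  have c2 : x <= k%:R - 2^-1 by case/andP: xd => _ h; apply: (le_trans h); rewrite -col0; exact: colx_le.
  have CC : C0 (psi x) by split=> //; rewrite -psi0 -psik !psile.
  have := C0m _ CC; rewrite -(sigs d (psi x) dk CC pd) /s; move: m0; clear.
  move: (Z _) => z m0; case: ifP => [z0|/negbT]; first by rewrite ltr0_norm//; flra.
  by rewrite -leNgt => z0; rewrite ger0_norm//; flra.
- move=> j /andP[j0 jk]; rewrite /F' /X' !ymle yK => Fb XE.
  have dk : (0 < k - j < k)%N by rewrite subn_gt0 jk ltn_subrL j0 k0.
  have pE : psi j%:R = sig (k - j)%N.
    by rewrite -[RHS]k1 phis ?leq_subr// colxE ?subKn ?(ltnW jk)// subn_gt0 jk leq_subr.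
  apply: (sigC _ dk); rewrite -pE; split=> //; last by rewrite -[LHS]k1 XE.
  rewrite -psi0 -psik !psile//.
  have : j%:R + 1 <= k%:R :> R by rewrite natr1 ler_nat.
  by clear; flra.
exists k, b; split=> //; apply: isotopic_trans (iso _) _.
have ia := @affine_isotopic_y R ((fun u : R * R * R => (phi u.1.1, u.1.2, u.2)) @`
  ([set (x, F x, 0) | x in [set x | xL <= x <= xR]] `|`
      ([set (xR, y, 0) | y in [set y | F xR <= y <= b0]] `|`
       [set (xL, y, 0) | y in [set y | b1 <= y <= F xL]] `|`
       [set (X v, v, Z v) | v in [set v | b0 <= v <= b1]])))
  (fun=> (2 * M)^-1) (fun=> 2^-1) (@cont_cst _ _ _) (@cont_cst _ _ _) (fun=> ltac:(by rewrite invr_gt0 mulr_gt0)).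
apply: isotopic_trans ia _; rewrite image_comp !image_setU.
have yE y : (2 * M)^-1 * y + 2^-1 = ym y by rewrite /ym; field; rewrite gt_eqF.
have bij (A B : set R) (f : R -> R) g (h h' : R -> R * R * R) : cancel f g -> cancel g f ->
    (forall x, A x -> B (f x) /\ h' (f x) = h x) -> (forall y, B y -> A (g y)) -> h @` A = h' @` B.
  move=> fk gk AB BA; apply/seteqP; split=> [_ [x /AB[Bx <-] <-]|_ [y By <-]]; first by exists (f x).
  by exists (g y); [exact: BA|case: (AB _ (BA y By)); rewrite gk].
apply: (eq_ind_r (fun S => @isotopic R _ S _) ib); rewrite !image_comp; congr (_ `|` (_ `|` _ `|` _)).
- apply: (bij _ _ phi psi) => //= x /andP[h1 h2].
    split; first by rewrite -phiL -phiR !monole.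
    by rewrite /F' k1 yE.
  by rewrite -psi0 -psik !psile.
- apply: (bij _ _ ym yi) => //= y; rewrite /F' psik.
    by move=> h; rewrite !ymle phiR yE.
  by rewrite -!(ymle _ (yi y)) -(ymle (yi y)) yK'.
- apply: (bij _ _ ym yi) => //= y; rewrite /F' psi0.
    by move=> h; rewrite !ymle phiL yE.
  by rewrite -!(ymle _ (yi y)) -(ymle (yi y)) yK'.
- apply: (bij _ _ ym yi) => //= y.
    by move=> h; rewrite !ymle yE /X' /Z' yK.
  by rewrite -!(ymle _ (yi y)) -(ymle (yi y)) yK'.
Qed.
End GraphKnots.

(** * Knots made of vertical poles and horizontal segments *)

Section PoleCurves.
Context {R : realType}.
Local Notation Q := (R * R)%type.
Implicit Types (p q : nat -> Q) (hh : nat -> R).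

Definition level_point (q : Q) (y : R) : R * R * R := (q.1, y, q.2).

(** A path through the points [w i] that pauses for a unit of time after each step. Heights use the
    offset 0 and places the offset 1, so that they move alternately. *)
Definition ramps {V : lmodType R} (o : R) (n : nat) (w : nat -> V) (s : R) : V :=
  w 0%N + \sum_(0 <= i < n) clamp (s - (2 * i%:R + o)) *: (w i.+1 - w i).

Lemma ramps_before {V : lmodType R} (o : R) n (w : nat -> V) (s : R) j : (j <= n)%N ->
  2 * j%:R + o - 1 <= s <= 2 * j%:R + o -> ramps o n w s = w j.
Proof.
move=> jn /andP[s1 s2]; rewrite /ramps (big_cat_nat (n := j))//=.
have -> : \sum_(j <= i < n) clamp (s - (2 * i%:R + o)) *: (w i.+1 - w i) = 0.
  rewrite big_nat; apply: big1 => i /andP[ji _]; rewrite clamp_le0 ?scale0r//.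
  have : j%:R <= i%:R :> R by rewrite ler_nat.
  by flra.
rewrite addr0.
rewrite big_nat (eq_bigr (fun i => w i.+1 - w i)) => [|i /andP[_ ij]]; last first.
  rewrite clamp_ge1 ?scale1r//; have : i%:R + 1 <= j%:R :> R by rewrite natr1 ler_nat.
  by flra.
by rewrite -big_nat telescope_sumr// addrC subrK.
Qed.

Lemma ramps_during {V : lmodType R} (o : R) n (w : nat -> V) (s : R) j : (j < n)%N ->
  2 * j%:R + o <= s <= 2 * j%:R + o + 1 ->
  ramps o n w s = (1 - (s - (2 * j%:R + o))) *: w j + (s - (2 * j%:R + o)) *: w j.+1.
Proof.
move=> jn /andP[s1 s2]; rewrite /ramps (big_cat_nat (n := j)) ?(ltnW jn)//= (big_ltn jn).
have -> : \sum_(j.+1 <= i < n) clamp (s - (2 * i%:R + o)) *: (w i.+1 - w i) = 0.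
  rewrite big_nat; apply: big1 => i /andP[ji _]; rewrite clamp_le0 ?scale0r//.
  have : j%:R + 1 <= i%:R :> R by rewrite natr1 ler_nat.
  by flra.
rewrite addr0.
rewrite big_nat (eq_bigr (fun i => w i.+1 - w i)) => [|i /andP[_ ij]]; last first.
  rewrite clamp_ge1 ?scale1r//; have : i%:R + 1 <= j%:R :> R by rewrite natr1 ler_nat.
  by flra.
rewrite -big_nat telescope_sumr// addrA [w 0%N + _]addrC subrK clamp_id; last by flra.
by move: (s - (2 * j%:R + o)) => a; rewrite scalerBr scalerBl scale1r addrA addrAC.
Qed.

Lemma cont_ramps {V : normedModType R} (o : R) n (w : nat -> V) : continuous (ramps o n w).
Proof.
rewrite /ramps; apply: cont_add; first exact: cont_cst.
elim: n => [|n IH]; first by under eq_fun do rewrite big_geq//; exact: cont_cst.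
under eq_fun do rewrite big_nat_recr//=.
by apply: cont_add => //; cont; apply: cont_clamp; cont.
Qed.

Definition pole_height (m : nat) hh (s : R) : R := ramps 0 m.+1 (hh : nat -> R^o) s.
Definition pole_place (m : nat) q (s : R) : Q := ramps 1 m q s.

Lemma pole_curve_cases m hh q (s : R) : 0 <= s <= 2 * m%:R + 1 ->
  (exists i t, [/\ (i <= m)%N, 0 <= t <= 1, s = 2 * i%:R + t,
     pole_height m hh s = (1 - t) * hh i + t * hh i.+1 & pole_place m q s = q i]) \/
  (exists i t, [/\ (i < m)%N, 0 <= t <= 1, s = 2 * i%:R + 1 + t,
     pole_height m hh s = hh i.+1 & pole_place m q s = (1 - t) *: q i + t *: q i.+1]).
Proof.
move=> s0.
suff [i [im [h|[im' h]]]] : exists i, (i <= m)%N /\ (2 * i%:R <= s <= 2 * i%:R + 1 \/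
    (i < m)%N /\ 2 * i%:R + 1 <= s <= 2 * i%:R + 2).
- left; exists i, (s - 2 * i%:R); split=> //; [flra|flra| |].
  + by rewrite /pole_height (@ramps_during R^o _ _ _ _ i) ?addr0//.
  + by rewrite /pole_place (@ramps_before _ _ _ _ _ i)//; flra.
- right; exists i, (s - 2 * i%:R - 1); split=> //; [flra|flra| |].
  + rewrite /pole_height (@ramps_before R^o _ _ _ _ i.+1)//.
    by rewrite -natr1; flra.
  + rewrite /pole_place (@ramps_during _ _ _ _ _ i)//; last by flra.
    by congr (_ *: _ + _ *: _); ring.
elim: m s0 {q hh} => [|m IH] s0; first by exists 0%N; split=> //; left; flra.
have [h|h] := leP s (2 * m%:R + 1).
  have [|i [im H]] := IH; first by case/andP: s0 => -> _.
  by exists i; split; [exact: leqW|case: H => [?|[? ?]]; [left|right; split=> //; exact: leqW]].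
have [h'|h'] := leP s (2 * m%:R + 2).
  by exists m; split=> //; right; split=> //; flra.
by exists m.+1; split=> //; left; move: s0; rewrite -natr1; flra.
Qed.

(** The pole [i], for [i <= m], goes from the height [hh i] to [hh i.+1] and is joined to the next
    pole by a horizontal segment. The last arc [beta] is a graph over the heights in [[0, 1]]. *)
Definition pole_knot m hh q (beta : R -> Q) : set (R * R * R) :=
  [set level_point (pole_place m q s) (pole_height m hh s) | s in [set s | 0 <= s <= 2 * m%:R + 1]] `|`
  [set level_point (beta v) v | v in [set v | 0 <= v <= 1]].

Definition pole_disjoint m hh q (beta : R -> Q) := forall s v : R, 0 <= s <= 2 * m%:R + 1 -> 0 <= v <= 1 ->
  pole_place m q s = beta v -> pole_height m hh s = v -> s = 0 \/ s = 2 * m%:R + 1.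

Lemma pole_ends m hh q : hh 0%N = 0 -> hh m.+1 = 1 ->
  [/\ pole_height m hh 0 = 0, pole_place m q 0 = q 0%N, pole_height m hh (2 * m%:R + 1) = 1 &
      pole_place m q (2 * m%:R + 1) = q m].
Proof.
move=> h0 h1; split.
- by rewrite /pole_height (@ramps_before R^o _ _ _ _ 0%N)//; flra.
- by rewrite /pole_place (@ramps_before _ _ _ _ _ 0%N)//; flra.
- by rewrite /pole_height (@ramps_before R^o _ _ _ _ m.+1)// -natr1; flra.
- by rewrite /pole_place (@ramps_before _ _ _ _ _ m)//; flra.
Qed.

(** A move that preserves levels keeps the last arc a graph over the height, and keeps it off the
    poles because it is injective on each level. *)
Lemma level_isotopic_poles m hh q q' (beta : R -> Q) (H H' : R -> Q -> Q) (c : R -> R) :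
  isotopy H H' -> continuous c -> continuous beta -> hh 0%N = 0 -> hh m.+1 = 1 ->
  beta 0 = q 0%N -> beta 1 = q m -> pole_disjoint m hh q beta ->
  (forall i (t : R), (i <= m)%N -> 0 <= t <= 1 -> H (c ((1 - t) * hh i + t * hh i.+1)) (q i) = q' i) ->
  (forall i (t : R), (i < m)%N -> 0 <= t <= 1 ->
     H (c (hh i.+1)) ((1 - t) *: q i + t *: q i.+1) = (1 - t) *: q' i + t *: q' i.+1) ->
  exists beta' : R -> Q, [/\ continuous beta', beta' 0 = q' 0%N, beta' 1 = q' m, pole_disjoint m hh q' beta' &
    @isotopic R _ (pole_knot m hh q beta) (pole_knot m hh q' beta')].
Proof.
move=> iH cc cb h0 h1 b0 b1 dis Hq Ha; have [cH _ kH _ _] := iH.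
have mapE s : 0 <= s <= 2 * m%:R + 1 -> H (c (pole_height m hh s)) (pole_place m q s) = pole_place m q' s.
  move=> s0; case: (pole_curve_cases hh q s0) => -[i [t [im t01 sE -> ->]]].
    by rewrite Hq// sE /pole_place (@ramps_before _ _ _ _ _ i)//; flra.
  rewrite Ha// sE /pole_place (@ramps_during _ _ _ _ _ i)//; last by flra.
  by congr (_ *: _ + _ *: _); ring.
have [hs0 ps0 hs1 ps1] := pole_ends q h0 h1; have [_ ps0' _ ps1'] := pole_ends q' h0 h1.
have m0 := ler0n R m.
exists (fun v => H (c v) (beta v)); split.
- apply: (@cont_comp _ _ _ (fun p : R * Q => H p.1 p.2) (fun v => (c v, beta v))) => //; cont.
- by have := mapE 0; rewrite hs0 ps0 ps0' b0; apply; flra.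
- by have := mapE (2 * m%:R + 1); rewrite hs1 ps1 ps1' b1; apply; flra.
- move=> s v s0 v0 pE hE; apply: (dis s v) => //.
  by move: pE; rewrite -mapE// hE => /(can_inj (kH _)).
- have := level_isotopic (pole_knot m hh q beta) iH cc.
  rewrite /pole_knot image_setU !image_comp => L.
  apply: (eq_ind_r (fun S => isotopic _ S) L); congr (_ `|` _); apply: eq_imagel => s s0.
    by rewrite /comp /level_point -mapE//; case: (pole_place m q s).
  by rewrite /comp /level_point; case: (beta s).
Qed.
End PoleCurves.

HB.instance Definition _ (K : numFieldType) (U V : completeNormedModType K) :=
  Uniform_isComplete.Build (U * V)%type (@prod_complete U V).

(** * Gathering the poles in a row *)

Section Contraction.
Context {R : realType}.
Local Notation Q := (R * R)%type.

(* Position of the poles once the first ones have been gathered along the second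
   coordinate next to the pole number a. *)
Definition gathered (p : nat -> Q) (rho : R) (a i : nat) : Q :=
  if (i <= a)%N then p a + (0, (a%:R - i%:R) * rho) else p i.

(* A vertical row together with a segment D starting at its lower end, contracted
   by moving the row along D: the distances stay bounded below. *)
Lemma hinge_bound (D : Q) (rho t del u : R) : 0 < rho -> D.1 != 0 -> 0 <= t <= 1 -> 0 <= del -> 0 <= u ->
  Num.min (rho / 2) (`|D.1| * rho / (2 * (`|D.2| + rho))) * del <=
    `|(del * (1 - t) * D.1, del * ((1 - t) * D.2 - t * rho) - u) : Q|.
Proof.
move=> r0 D1 t01 d0 u0; rewrite prod_normE /= le_max; set A := `|D.2| + rho.
have n2 := normr_ge0 D.2; have A0 : 0 < A by rewrite /A; flra.
have n1 : 0 < `|D.1| by rewrite normr_gt0.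
have [h|h] := leP ((1 - t) * A) (rho / 2); apply/orP; [right|left].
  apply: (@le_trans _ _ (rho / 2 * del)); first by rewrite ler_wpM2r// ge_min lexx.
  have := ler_norm (- (del * ((1 - t) * D.2 - t * rho) - u)); rewrite normrN; apply: le_trans.
  have : rho / 2 <= - ((1 - t) * D.2 - t * rho).
    have := ler_norm D.2; move: h t01 r0; rewrite /A; clear; move: D.2 (`|_|) => *; fnra.
  by move: d0 u0; clear; move: (_ - t * rho) => w *; fnra.
apply: (@le_trans _ _ (`|D.1| * rho / (2 * A) * del)); first by rewrite ler_wpM2r// ge_min lexx orbT.
rewrite !normrM (ger0_norm d0) (@ger0_norm _ (1 - t)); last by flra.
rewrite (_ : `|D.1| * rho / (2 * A) * del = rho / (2 * A) * (`|D.1| * del)); last by ring.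
rewrite (_ : del * (1 - t) * `|D.1| = (1 - t) * (`|D.1| * del)); last by ring.
by apply: ler_wpM2r; [rewrite mulr_ge0// ltW|rewrite ler_pdivrMr ?mulr_gt0//; flra].
Qed.

(** The row slides along the segment from [p a] to [p a.+1] while that segment shrinks to its end.
    Earlier horizontal segments are at smaller absolute heights and belong to the row. Later ones
    are at [a + 3] or beyond and must not move; later poles may cross the moving levels, so they are
    kept fixed by the plane isotopy. *)
Lemma contraction_step (m a : nat) (hh : nat -> R) (p : nat -> Q) (rho : R) (beta : R -> Q) :
  (a < m)%N -> hh 0%N = 0 -> hh m.+1 = 1 -> (forall i, (i < m)%N -> `|hh i.+1| = i%:R + 2) ->
  0 < rho -> (p a).1 != (p a.+1).1 ->
  (forall j (s : R), (a.+1 < j <= m)%N -> 0 <= s <= 1 -> (m%:R + 2) * rho <= `|(1 - s) *: p a + s *: p a.+1 - p j|) ->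
  continuous beta -> beta 0 = gathered p rho a 0 -> beta 1 = gathered p rho a m ->
  pole_disjoint m hh (gathered p rho a) beta ->
  exists beta' : R -> Q, [/\ continuous beta', beta' 0 = gathered p rho a.+1 0, beta' 1 = gathered p rho a.+1 m,
    pole_disjoint m hh (gathered p rho a.+1) beta' &
    @isotopic R _ (pole_knot m hh (gathered p rho a) beta) (pole_knot m hh (gathered p rho a.+1) beta')].
Proof.
move=> am h0 h1 hhE r0 pa far cb b0 b1 dis.
pose D := p a.+1 - p a; pose T : Q := D + (0, rho).
have D1 : D.1 != 0 by rewrite /D /= subr_eq0 eq_sym.
(* The points whose motion is prescribed: the row for [s] in [[-a, 0]], the shrinking segment for
   [s] in [[0, 1]], and the later poles, which are fixed. *)
pose S : set (R + nat) := [set i | match i with inl s => - a%:R <= s <= 1 | inr j => (a.+1 < j <= m)%N end].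
pose f0 (i : R + nat) : Q := match i with inl s => p a + (0, Num.max 0 (- s) * rho) + clamp s *: D | inr j => p j end.
pose dd (i : R + nat) : Q := match i with inl s => (1 - clamp s) *: T | inr j => 0 end.
pose kap := Num.min (rho / 2) (`|D.1| * rho / (2 * (`|D.2| + rho))).
have n1 : 0 < `|D.1| by rewrite normr_gt0.
have n2 := normr_ge0 D.2.
have kap0 : 0 < kap.
  by rewrite lt_min !divr_gt0 ?mulr_gt0//; clear -n2 r0; flra.
have kapr : kap <= rho / 2 by rewrite ge_min lexx.
pose c := kap / (`|T| + 1).
have T0 := normr_ge0 T.
have T1 : 0 < `|T| + 1 by clear -T0; flra.
have c0 : 0 < c by rewrite divr_gt0.
have cT (x : R) : 0 <= x -> c * (x * `|T|) <= kap * x.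
  move=> x0; rewrite /c mulrC -mulrA [X in _ <= X]mulrC ler_wpM2l// mulrCA.
  rewrite -[X in _ <= X]mulr1; apply: ler_wpM2l; first exact: ltW.
  by rewrite ler_pdivrMr// mul1r; clear -T0; flra.
have main (t s s' : R) : 0 <= t <= 1 -> clamp s' <= clamp s ->
   c * `|dd (inl s) - dd (inl s')| <= `|(f0 (inl s) + t *: dd (inl s)) - (f0 (inl s') + t *: dd (inl s'))|.
  move=> t01 ss; have [se|se] := eqVneq (clamp s') (clamp s).
    by rewrite /dd se subrr normr0 mulr0.
  have s0 : 0 < s.
    rewrite ltNge; apply/negP => sn; move: ss se; rewrite (clamp_le0 sn) => h.
    by rewrite eq_le h clamp_ge0.
  pose del := clamp s - clamp s'; have del0 : 0 <= del by rewrite subr_ge0.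
  have -> : dd (inl s) - dd (inl s') = - del *: T.
    by rewrite /dd -scalerBl; congr (_ *: _); rewrite /del; ring.
  rewrite normrZ normrN (ger0_norm del0); apply: le_trans (cT del del0) _.
  have m0 : Num.max 0 (- s) = 0 by apply/max_l; rewrite oppr_le0 ltW.
  have -> : f0 (inl s) + t *: dd (inl s) - (f0 (inl s') + t *: dd (inl s')) =
      (del * (1 - t) * D.1, del * ((1 - t) * D.2 - t * rho) - Num.max 0 (- s') * rho).
    rewrite /f0 /dd m0 /T; apply/pair_equal_spec; split=> /=; rewrite /del -?/(_ *: _).
      by rewrite /GRing.scale /=; ring.
    by rewrite /GRing.scale /=; ring.
  by apply: hinge_bound => //; rewrite mulr_ge0 ?(ltW r0)// le_max lexx.
have mix (t s : R) j : 0 <= t <= 1 -> - a%:R <= s <= 1 -> (a.+1 < j <= m)%N ->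
   c * `|dd (inl s)| <= `|(f0 (inl s) + t *: dd (inl s)) - p j|.
  move=> t01 sS jm; have c1 := clamp_ge0 s; have c2 := clamp_le1 s.
  apply: (@le_trans _ _ rho).
    rewrite /dd normrZ ger0_norm ?subr_ge0//; apply: le_trans (cT _ _) _; first by rewrite subr_ge0.
    by clear -c1 c2 kap0 kapr r0; fnra.
  pose w := clamp s + t * (1 - clamp s).
  have w01 : 0 <= w <= 1 by rewrite /w; move: (clamp s) c1 c2 => u c1 c2; clear -c1 c2 t01; fnra.
  have := far j w jm w01.
  (* The place in the row and the vertical part of the motion take a point away from the original
     segment by at most [m + 1] spacings, one less than the clearance granted by [far]. *)
  pose e := Num.max 0 (- s) + t * (1 - clamp s).
  have e0 : 0 <= e <= m%:R + 1.
    have ma : a%:R + 1 <= m%:R :> R by rewrite natr1 ler_nat.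
    have : 0 <= Num.max 0 (- s) <= a%:R by rewrite le_max lexx ge_max ler0n /=; clear -sS; flra.
    by rewrite /e; move: (Num.max _ _) (clamp s) c1 c2 => b u c1 c2; clear -c1 c2 t01 ma; fnra.
  have -> : f0 (inl s) + t *: dd (inl s) - p j = ((1 - w) *: p a + w *: p a.+1 - p j) + (0, e * rho).
    rewrite /f0 /dd /w /e /T /D; apply/pair_equal_spec; split=> /=; rewrite /GRing.scale /=; ring.
  move: (_ - p j) => v h; have := ler_normB (v + (0, e * rho)) ((0, e * rho) : Q).
  rewrite addrK; have -> : `|(0, e * rho) : Q| = e * rho.
    by rewrite prod_normE /= normr0 max_r// ger0_norm// mulr_ge0 ?(ltW r0)//; case/andP: e0.
  by move: h; move: (`|v|) (`|_ + _|) => x y; clear -e0 r0; fnra.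
have LIN : forall (t : R) s s', 0 <= t <= 1 -> S s -> S s' ->
     c * `|dd s - dd s'| <= `|(f0 s + t *: dd s) - (f0 s' + t *: dd s')|.
  move=> t [s|j] [s'|j'] t01 Ss Ss'.
  - have [ss|/ltW ss] := leP (clamp s') (clamp s); first exact: main.
    by rewrite distrC [X in _ <= X]distrC; apply: main.
  - rewrite (_ : dd (inr j') = 0)// (_ : f0 (inr j') = p j')// subr0 scaler0 addr0.
    exact: mix.
  - rewrite distrC [X in _ <= X]distrC (_ : dd (inr j) = 0)// (_ : f0 (inr j) = p j)// subr0 scaler0 addr0.
    exact: mix.
  - by rewrite /= subrr normr0 mulr0.
have [H [H' [iH HE]]] := @linear_isotopy R (R * R)%type (@lipschitz_extendable_plane R) _ S f0 dd c c0 LIN.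
have H0 x : H 0 x = x by case: iH.
have am1 : a%:R + 1 <= m%:R :> R by rewrite natr1 ler_nat.
(* Full motion up to the height [a + 2] of the contracted segment, none from the height [a + 3] of
   the next one on. *)
pose cut (y : R) := clamp (a%:R + 3 - `|y|).
have cut01 y : 0 <= cut y <= 1 by rewrite clamp_ge0 clamp_le1.
have cut1 y : `|y| <= a%:R + 2 -> cut y = 1 by move=> h; rewrite /cut clamp_ge1//; flra.
have ccut : continuous cut by rewrite /cut; apply: cont_clamp; cont.
have rowE i : (i <= a)%N -> gathered p rho a i = f0 (inl (i%:R - a%:R)).
  move=> ia; have : i%:R <= a%:R :> R by rewrite ler_nat.
  by move=> h; rewrite /gathered ia /f0 opprB max_r ?subr_ge0// clamp_le0 ?subr_le0// scale0r addr0.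
have rowE' i : (i <= a)%N -> gathered p rho a.+1 i = gathered p rho a i + T.
  move=> ia; rewrite /gathered ia (leqW ia) /T /D; apply/pair_equal_spec; split=> /=; first by ring.
  by rewrite -natr1; ring.
have Srow (i : nat) : (i <= a)%N -> S (inl (i%:R - a%:R)).
  move=> ia; have i0 := ler0n R i; have ia' : i%:R <= a%:R :> R by rewrite ler_nat.
  by rewrite /S /=; clear -i0 ia'; flra.
have ddrow i : (i <= a)%N -> dd (inl (i%:R - a%:R)) = T.
  by move=> ia; rewrite /dd clamp_le0 ?subr0 ?scale1r// subr_le0 ler_nat.
have fixE t : 0 <= t <= 1 -> H t (p a.+1) = p a.+1.
  move=> t01; have S1 : S (inl 1) by rewrite /S /=; have := ler0n R a; clear; flra.
  have fE : f0 (inl 1) = p a.+1.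
    by rewrite /f0 clamp1 scale1r (max_l (_ : -1 <= 0)) ?oppr_le0// mul0r addr0 /D addrC subrK.
  by rewrite -{1}fE HE// fE /dd clamp1 subrr scale0r scaler0 addr0.
have fixj t j : 0 <= t <= 1 -> (a < j <= m)%N -> H t (p j) = p j.
  move=> t01 /andP[aj jm]; move: aj; rewrite leq_eqVlt => /orP[/eqP <-|aj]; first exact: fixE.
  by rewrite -[p j]/(f0 (inr j)) HE//= ?scaler0 ?addr0// /S /= aj.
have gj i : (a < i)%N -> gathered p rho a i = p i by rewrite /gathered ltnNge => /negbTE ->.
have gj' i : (a < i)%N -> gathered p rho a.+1 i = p i.
  rewrite /gathered; case: ifP => // ia ai; have -> : i = a.+1 by apply/eqP; rewrite eqn_leq ia.
  by rewrite subrr mul0r addr0.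
have hle i : (i <= a.+1)%N -> `|hh i| <= a%:R + 2.
  case: i => [_|i ia]; first by rewrite h0 normr0; have := ler0n R a; flra.
  by rewrite hhE; [rewrite lerD2r ler_nat|exact: leq_ltn_trans am].
have hge i : (a < i)%N -> (i < m)%N -> cut (hh i.+1) = 0.
  move=> ai im; rewrite /cut hhE// clamp_le0//; have : a%:R + 1 <= i%:R :> R by rewrite natr1 ler_nat.
  by flra.
apply: (@level_isotopic_poles R m hh _ _ beta H H' cut) => //.
- move=> i t im t01; have [ia|ai] := leqP i a; last first.
    by rewrite gj// gj'// fixj// ai.
  rewrite rowE' ?rowE// cut1 ?HE ?ddrow ?scale1r//; first by rewrite lexx ler01.
    exact: Srow.
  have := hle i (leqW ia); have := hle i.+1 ia; rewrite !ler_norml; clear -t01 => *; apply/andP; split; fnra.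
- move=> i t im t01; have [ia|ai] := ltnP a i.
    by rewrite hge// H0 !gj ?gj' ?(leqW ia).
  rewrite cut1; last exact: hle.
  move: ai; rewrite leq_eqVlt => /orP[/eqP ->|ia].
    rewrite (gj a.+1)// (gj' a.+1)// (rowE' a (leqnn a)) {1 2}/gathered leqnn subrr mul0r.
    have -> : (1 - t) *: (p a + (0, 0)) + t *: p a.+1 = f0 (inl t).
      rewrite /f0 clamp_id// (max_l (_ : - t <= 0)) ?oppr_le0; last by case/andP: t01.
      by rewrite mul0r /D; apply/pair_equal_spec; split=> /=; rewrite /GRing.scale /=; ring.
    rewrite HE; [|by rewrite lexx ler01|by rewrite /S /=; have := ler0n R a; flra].
    rewrite /f0 /dd clamp_id// (max_l (_ : - t <= 0)) ?oppr_le0; last by case/andP: t01.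
    by rewrite scale1r mul0r /T /D; apply/pair_equal_spec; split=> /=; rewrite /GRing.scale /=; ring.
  pose s : R := i%:R + t - a%:R.
  have ia1 : i%:R + 1 <= a%:R :> R by rewrite natr1 ler_nat.
  have i0 := ler0n R i.
  have fE : (1 - t) *: gathered p rho a i + t *: gathered p rho a i.+1 = f0 (inl s).
    rewrite /gathered (ltnW ia) ia /f0 max_r; last by rewrite /s; flra.
    rewrite clamp_le0; last by rewrite /s; flra.
    by rewrite scale0r /s -natr1; apply/pair_equal_spec; split=> /=; rewrite /GRing.scale /=; ring.
  rewrite rowE' ?rowE' ?(ltnW ia)// fE HE; [|by rewrite lexx ler01|by rewrite /S /= /s; flra].
  rewrite -fE /dd clamp_le0; last by rewrite /s; flra.
  rewrite subr0 !scale1r; apply/pair_equal_spec; split=> /=; rewrite /GRing.scale /=; ring.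
Qed.
End Contraction.

(** * A row of poles as the graph of a function *)

Section PoleKnots.
Context {R : realType}.
Local Notation Q := (R * R)%type.

Lemma segment_set_compact (a b : R) : compact [set s : R | a <= s <= b].
Proof. by have := @segment_compact R a b; rewrite set_itvcc. Qed.

Lemma curve_shear (P : normedModType R) (L : R) (u : R -> P) (w : R -> R) : continuous u -> continuous w ->
  (forall s s', 0 <= s <= L -> 0 <= s' <= L -> u s = u s' -> w s = w s') ->
  exists2 D : P -> R, continuous D & forall s, 0 <= s <= L -> D (u s) = w s.
Proof.
move=> cu cw inj.
have [||D [cD DE]] := @compact_relation_extension R P [set (u s, w s) | s in [set s | 0 <= s <= L]].
- apply: continuous_compact; first by apply: continuous_subspaceT; cont.
  exact: segment_set_compact.
- by move=> p v v' [s sL [<- <-]] [s' s'L [uE <-]]; apply: inj.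
by exists D => // s sL; apply: DE; exists s.
Qed.

Lemma clip_eq (a b s s' : R) : a < b -> Num.min (Num.max s a) b = Num.min (Num.max s' a) b ->
  [\/ s = s', s <= a /\ s' <= a | b <= s /\ b <= s'].
Proof.
move=> ab; have [sa|sa] := leP s a; have [s'a|s'a] := leP s' a; first by move=> _; apply: Or32.
- rewrite (min_l (ltW ab)); have [s'b|s'b] := leP s' b => e; first by exfalso; flra.
  by exfalso; flra.
- rewrite (min_l (ltW ab)); have [s'b|s'b] := leP s b => e; first by exfalso; flra.
  by exfalso; flra.
- have [sb|sb] := leP s b; have [s'b|s'b] := leP s' b => e; [exact: Or31|apply: Or33; flra|apply: Or33; flra|apply: Or33; flra].
Qed.

(** The gathered poles lie in a plane of constant abscissa, where [(Y, z)] determines the parameter.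
    A shear can therefore make the abscissa the opposite of the parameter, which turns the curve
    into a graph between its end poles, and a second shear flattens it. The last arc undergoes both
    shears and becomes [X], [Z]. *)
Lemma row_isotopic (m : nat) (hh : nat -> R) (p : nat -> Q) (rho : R) (beta : R -> Q) :
  (0 < m)%N -> 0 < rho -> hh 0%N = 0 -> hh m.+1 = 1 -> hh 1%N < 0 -> 1 < hh m ->
  (forall i, (i < m)%N -> `|hh i.+1| = i%:R + 2) ->
  continuous beta -> beta 0 = gathered p rho m 0 -> beta 1 = gathered p rho m m ->
  pole_disjoint m hh (gathered p rho m) beta ->
  exists (k : nat) (b : 'I_k -> R -> R * R), one_pure_braid b /\
    @isotopic R _ (pole_knot m hh (gathered p rho m) beta) (braid_closure b).
Proof.
move=> m0 r0 h0 h1 hneg hpos hhE cb b0 b1 dis.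
set q := gathered p rho m in b0 b1 dis *.
pose L : R := 2 * m%:R + 1.
have m1 : 1 <= m%:R :> R by rewrite ler1n.
have qE i : (i <= m)%N -> q i = ((p m).1, (p m).2 + (m%:R - i%:R) * rho).
  by move=> im; rewrite /q /gathered im; apply/pair_equal_spec; split=> //=; rewrite addr0.
have hinj i j : (i < m)%N -> (j < m)%N -> hh i.+1 = hh j.+1 -> i = j.
  move=> im jm /(congr1 Num.norm); rewrite !hhE// => /addIr/eqP; rewrite eqr_nat => /eqP; done.
have hne i : (i <= m)%N -> hh i.+1 - hh i != 0.
  move=> im; rewrite subr_eq0; case: i im => [|i] im; first by rewrite h0 lt_eqF.
  move: im; rewrite leq_eqVlt => /orP[/eqP iE|im]; first by rewrite iE h1 lt_eqF.
  by apply/eqP => /(hinj _ _ im (ltnW im))/eqP; rewrite gtn_eqF.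
pose Y s := pole_height m hh s; pose z s := (pole_place m q s).2.
have cY : continuous Y by exact: (@cont_ramps R R^o).
have cpl : continuous (pole_place m q) by exact: cont_ramps.
have cz : continuous z by rewrite /z; cont.
have cases s : 0 <= s <= L -> exists i t, [/\ 0 <= t <= 1, (pole_place m q s).1 = (p m).1 &
    [/\ (i <= m)%N, s = 2 * i%:R + t, Y s = hh i + t * (hh i.+1 - hh i) & z s = (p m).2 + (m%:R - i%:R) * rho] \/
    [/\ (i < m)%N, s = 2 * i%:R + 1 + t, Y s = hh i.+1 & z s = (p m).2 + (m%:R - (i%:R + t)) * rho]].
  move=> /(pole_curve_cases hh q)[] [i [t [im t01 sE YE pE]]]; exists i, t; split=> //.
  - by rewrite pE qE.
  - by left; split=> //; [rewrite /Y YE; ring|rewrite /z pE qE].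
  - by rewrite pE !qE ?(ltnW im)//= /GRing.scale /=; ring.
  - right; split=> //; rewrite /z pE !qE ?(ltnW im)//= /GRing.scale /= -natr1; ring.
have zi (a b : R) : (p m).2 + (m%:R - a) * rho = (p m).2 + (m%:R - b) * rho -> a = b.
  by move=> /addrI /mulIf; rewrite gt_eqF// => /(_ isT) /addrI /oppr_inj.
have nat01 (i j : nat) (t : R) : 0 <= t <= 1 -> i%:R = j%:R + t :> R -> (i = j /\ t = 0) \/ (i = j.+1 /\ t = 1).
  move=> t01 e; have : (j <= i)%N by rewrite -(ler_nat R); flra.
  rewrite leq_eqVlt => /orP[/eqP ij|ij]; first by left; subst j; split=> //; flra.
  have : (i <= j.+1)%N by rewrite -(ler_nat R) -natr1; flra.
  move=> ij'; right; have ijE : i = j.+1 by apply/eqP; rewrite eqn_leq ij' ij.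
  by split=> //; move: e; rewrite ijE -natr1; flra.
have polearc i j (t t' : R) : (i <= m)%N -> (j < m)%N -> 0 <= t' <= 1 -> hh i + t * (hh i.+1 - hh i) = hh j.+1 ->
    i%:R = j%:R + t' :> R -> 2 * i%:R + t = 2 * j%:R + 1 + t'.
  move=> im jm t01 hE /nat01[]// [ijE tE]; rewrite tE.
    subst j; have : (t - 1) * (hh i.+1 - hh i) = 0 by rewrite mulrBl mul1r; flra.
    by move/eqP; rewrite mulf_eq0 (negbTE (hne i im)) orbF => /eqP; flra.
  subst i; have : t * (hh j.+2 - hh j.+1) = 0 by flra.
  by move/eqP; rewrite mulf_eq0 (negbTE (hne j.+1 im)) orbF => /eqP ->; rewrite -natr1; flra.
have inj s s' : 0 <= s <= L -> 0 <= s' <= L -> (Y s, z s) = (Y s', z s') -> s = s'.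
  move=> sL s'L [YE zE]; have [i [t [t01 _ H]]] := cases s sL; have [j [t' [t'01 _ H']]] := cases s' s'L.
  case: H => -[im sE Yi zs]; case: H' => -[jm s'E Yj zs']; move: YE zE; rewrite Yi Yj zs zs' => YE /zi zE; rewrite sE s'E.
  - have ijE : i = j by apply/eqP; rewrite -(eqr_nat R) zE.
    subst j; move: YE => /addrI/mulIf; rewrite hne// => /(_ isT) ->//.
  - exact: polearc.
  - by apply/esym; apply: polearc => //.
  - by move: zE; rewrite (hinj i j im jm YE) => /addrI ->.
(* The parameter is clipped so that the first and last poles stay vertical: they are the end
   segments of [graph_knot_isotopic]. Along each of them [z] is constant, so the second shear is
   well defined in spite of the clipping. *)
pose x' (s : R) : R := - Num.min (Num.max s 1) (2 * m%:R).
have cx' : continuous x' by rewrite /x'; cont.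
have x'mid s : 1 <= s <= 2 * m%:R -> x' s = - s.
  by move=> /andP[s1 s2]; rewrite /x' (max_l s1) (min_l s2).
have x'lo s : s <= 1 -> x' s = -1 by move=> h; rewrite /x' (max_r h) min_l//; flra.
have x'hi s : 2 * m%:R <= s -> x' s = - (2 * m%:R) by move=> h; rewrite /x' max_l ?min_r//; flra.
have [b cbb bE] := @curve_shear (R * R)%type L (fun s => (Y s, z s)) (fun s => x' s - (p m).1) ltac:(cont) ltac:(cont)
  (fun s s' a c e => congr1 (fun s => x' s - (p m).1) (inj s s' a c e)).
have zlo s : 0 <= s <= 1 -> z s = (p m).2 + m%:R * rho.
  by move=> h; rewrite /z /pole_place (@ramps_before R _ _ _ _ _ 0%N) ?qE//= ?subr0//; flra.
have zhi s : 2 * m%:R <= s <= L -> z s = (p m).2.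
  by move=> h; rewrite /z /pole_place (@ramps_before R _ _ _ _ _ m) ?qE//= ?subrr ?mul0r ?addr0//; move: h; rewrite /L; flra.
have [s s' sL s'L [xE YE]|b2 cb2 b2E] := @curve_shear (R * R)%type L (fun s => (x' s, Y s)) (fun s => - z s) ltac:(cont) ltac:(cont).
  have [->//|[s1 s1']|[s1 s1']] := @clip_eq 1 (2 * m%:R) s s' ltac:(clear -m1; flra) (oppr_inj xE).
    by rewrite !zlo ?s1 ?s1' ?andbT//; [case/andP: s'L|case/andP: sL].
  by rewrite !zhi ?s1 ?s1'//=; [case/andP: s'L|case/andP: sL].
pose X v := (beta v).1 + b (v, (beta v).2).
pose Z v := (beta v).2 + b2 (X v, v).
have cX : continuous X by rewrite /X; cont; apply: (@cont_comp _ _ _ b) => //; cont.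
have cZ : continuous Z by rewrite /Z; cont; apply: (@cont_comp _ _ _ b2) => //; cont.
have [hs0 ps0 hs1 ps1] := pole_ends q h0 h1.
have place s : 0 <= s <= L -> pole_place m q s = ((p m).1, z s).
  by move=> sL; have [i [t [_ e _]]] := cases s sL; rewrite -e /z -surjective_pairing.
have L0 : 0 <= (0:R) <= L by rewrite /L; flra.
have LL : 0 <= L <= L by rewrite /L; flra.
have XE s : 0 <= s <= L -> pole_place m q s = beta (Y s) -> X (Y s) = x' s /\ Z (Y s) = 0.
  move=> sL e; have XE : X (Y s) = x' s by rewrite /X -e place//= bE//; ring.
  by split=> //; rewrite /Z XE b2E// -e place//= subrr.
have [X0 Z0] : X 0 = -1 /\ Z 0 = 0.
  by have := XE 0 L0; rewrite /Y hs0 x'lo// ps0 b0; apply.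
have [X1 Z1] : X 1 = - (2 * m%:R) /\ Z 1 = 0.
  by have := XE L LL; rewrite /Y hs1 x'hi ?ps1 ?b1; [apply|rewrite /L; flra].
have Y1 : Y 1 = hh 1%N by rewrite /Y /pole_height (@ramps_before R R^o _ _ _ _ 1%N)//; flra.
have Y2 : Y (2 * m%:R) = hh m.
  by rewrite /Y /pole_height (@ramps_before R R^o _ _ _ _ m)//; flra.
have Ylo s : 0 <= s <= 1 -> Y s = s * hh 1%N.
  move=> h; rewrite /Y /pole_height (@ramps_during R R^o _ _ _ _ 0%N)//; last by flra.
  by rewrite h0 scaler0 add0r mulr0 addr0 subr0.
have Yhi s : 2 * m%:R <= s <= L -> Y s = (1 - (s - 2 * m%:R)) * hh m + (s - 2 * m%:R).
  move=> h; rewrite /Y /pole_height (@ramps_during R R^o _ _ _ _ m)//; last by move: h; rewrite /L; flra.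
  by rewrite h1 addr0 -[X in _ = _ + X]mulr1.
have [|||||k [br [ob ib]]] := @graph_knot_isotopic R (fun x => Y (- x)) X Z (- (2 * m%:R)) (-1) 0 1 _ cX cZ _ _ ler01 _ X0 Z0 X1 Z1.
- by apply: (@cont_comp _ _ _ Y) => //; cont.
- by flra.
- by rewrite opprK Y1.
- by rewrite opprK Y2.
- move=> x xb vb XF ZF; set s := - x in vb XF ZF.
  have sL : 0 <= s <= L by rewrite /L /s; flra.
  have s12 : 1 <= s <= 2 * m%:R by rewrite /s; flra.
  have x'E : x' s = x by rewrite x'mid// /s opprK.
  have z1 : (beta (Y s)).2 = z s.
    by move: ZF; rewrite /Z XF -x'E b2E//; flra.
  have x1 : (beta (Y s)).1 = (p m).1.
    by move: XF; rewrite /X z1 bE// x'E; flra.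
  have := dis s (Y s) sL vb; rewrite place// -x1 -z1 -surjective_pairing => /(_ erefl erefl).
  by rewrite /L in sL *; case=> e; flra.
exists k, br; split=> //; apply: isotopic_trans (shear_isotopic_x _ cbb) _.
apply: isotopic_trans (shear_isotopic_z _ cb2) _.
apply: (eq_ind_r (fun S => isotopic S _) ib).
rewrite /pole_knot !image_setU !image_comp setUA; congr (_ `|` _).
have pt3 s : 0 <= s <= L -> ((fun p0 : R * R * R => (p0.1.1, p0.1.2, p0.2 + b2 p0.1)) \o
    (fun p0 : R * R * R => (p0.1.1 + b (p0.1.2, p0.2), p0.1.2, p0.2)) \o
    (fun s => level_point (pole_place m q s) (pole_height m hh s))) s = (x' s, Y s, 0).
  move=> sL; rewrite /comp place// /level_point; cbn [fst snd].
  rewrite (bE s sL) addrC subrK (b2E s sL) addrN; done.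
transitivity [set (x' s, Y s, (0 : R)) | s in [set s | 0 <= s <= L]]; first by apply: eq_imagel => s sL; exact: pt3.
apply/seteqP; split=> [_ [s /= sL <-]|_ [[x /= xb <-]|[[y /= yb <-]|[y /= yb <-]]]].
- have [s1|s1] := leP s 1.
    right; left; exists (Y s); last by rewrite x'lo.
    rewrite opprK Y1 Ylo; last by rewrite s1 (elimTF andP sL).1.
    by move: hneg; clear -sL s1; move: (hh 1%N) => *; fnra.
  have [s2|s2] := leP s (2 * m%:R).
    by left; exists (- s); rewrite ?opprK ?x'mid//=; flra.
  right; right; exists (Y s); last by rewrite x'hi// ltW.
  have s2L : 2 * m%:R <= s <= L by rewrite (ltW s2) (elimTF andP sL).2.
  rewrite opprK Y2 Yhi//; move: hpos s2L; rewrite /L; clear; move: (hh m) (m%:R) => *; fnra.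
- exists (- x) => /=; first by rewrite /L; flra.
  by rewrite x'mid ?opprK//; flra.
- have [|t t01 tE] := @IVT_exists R Y 0 1 y cY ler01.
    by left; rewrite /Y hs0 -/(Y 1) Y1; move: yb; rewrite opprK Y1.
  exists t => /=; first by move: t01; rewrite /L; flra.
  by rewrite tE x'lo//; case/andP: t01.
- have [||t t01 tE] := @IVT_exists R Y (2 * m%:R) L y cY; first by rewrite /L; flra.
    by left; rewrite Y2 /Y hs1; move: yb; rewrite opprK Y2.
  exists t => /=; first by move: t01; rewrite /L; flra.
  by rewrite tE x'hi//; case/andP: t01.
Qed.

Lemma pole_knot_isotopic (m : nat) (hh : nat -> R) (p : nat -> Q) (beta : R -> Q) :
  (0 < m)%N -> hh 0%N = 0 -> hh m.+1 = 1 -> hh 1%N < 0 -> 1 < hh m ->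
  (forall i, (i < m)%N -> `|hh i.+1| = i%:R + 2) ->
  (forall i, (i < m)%N -> (p i).1 != (p i.+1).1) ->
  (forall i j (s : R), (i < m)%N -> (i.+1 < j <= m)%N -> 0 <= s <= 1 -> (1 - s) *: p i + s *: p i.+1 <> p j) ->
  continuous beta -> beta 0 = p 0%N -> beta 1 = p m -> pole_disjoint m hh p beta ->
  exists (k : nat) (b : 'I_k -> R -> R * R), one_pure_braid b /\
    @isotopic R _ (pole_knot m hh p beta) (braid_closure b).
Proof.
move=> m0 h0 h1 hneg hpos hhE pne psep cb b0 b1 dis.
have [rho rho0 rhoP] : exists2 rho : R, 0 < rho & forall i j (s : R), (i < m)%N -> (i.+1 < j <= m)%N -> 0 <= s <= 1 ->
    (m%:R + 2) * rho <= `|(1 - s) *: p i + s *: p i.+1 - p j|.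
  have [|r r0 rP] := @common_radius R m (fun i r => forall j (s : R), (i.+1 < j <= m)%N -> 0 <= s <= 1 ->
      (m%:R + 2) * r <= `|(1 - s) *: p i + s *: p i.+1 - p j|).
    move=> i im; have [|r r0 rP] := @common_radius R m.+1 (fun j r => forall s : R, (i.+1 < j <= m)%N -> 0 <= s <= 1 ->
        (m%:R + 2) * r <= `|(1 - s) *: p i + s *: p i.+1 - p j|).
      move=> j _; have [ij|ij] := boolP (i.+1 < j <= m)%N; last by exists 1.
      have cf : continuous (fun s : R => `|(1 - s) *: p i + s *: p i.+1 - p j|) by cont.
      have [|e e0 eP] := positive_min cf (ler01 : (0 : R) <= 1).
        by move=> s s01; rewrite normr_gt0 subr_eq0; apply/eqP/psep.
      have m2 : 0 < m%:R + 2 :> R by have := ler0n R m; flra.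
      exists (e / (m%:R + 2)); first by rewrite divr_gt0.
      move=> r' /andP[_ r'e] s _ /eP; apply: le_trans.
      by rewrite mulrC -ler_pdivlMr.
    exists r => // r' r'r j s jm; apply: (rP r' j) => //.
    by case/andP: jm.
  by exists r => // i j s im; apply: (rP r i) => //; rewrite r0 lexx.
have ind : forall a, (a <= m)%N -> exists beta' : R -> Q, [/\ continuous beta', beta' 0 = gathered p rho a 0,
    beta' 1 = gathered p rho a m, pole_disjoint m hh (gathered p rho a) beta' &
    @isotopic R _ (pole_knot m hh p beta) (pole_knot m hh (gathered p rho a) beta')].
  elim=> [_|a IH am].
    have -> : gathered p rho 0 = p.
      apply/funext => -[|i] //; rewrite /gathered /= subrr mul0r -[(0, 0)]/(0 : Q) addr0//.
    by exists beta; split=> //; exact: isotopic_refl.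
  have [be [cbe be0 be1 dbe ibe]] := IH (ltnW am).
  have [j s jm s01|be' [cbe' be0' be1' dbe' ibe']] := @contraction_step R m a hh p rho be am h0 h1 hhE rho0 (pne a am) _ cbe be0 be1 dbe.
    exact: rhoP.
  by exists be'; split=> //; exact: isotopic_trans ibe ibe'.
have [be [cbe be0 be1 dbe ibe]] := ind m (leqnn m).
have [k [b [ob ib]]] := row_isotopic m0 rho0 h0 h1 hneg hpos hhE cbe be0 be1 dbe.
by exists k, b; split=> //; exact: isotopic_trans ibe ib.
Qed.
End PoleKnots.

(** * Isotopies of polygons *)

Section PolygonFamilies.
Context {R : realType}.

Lemma compact_positive_min (T : topologicalType) (K : set T) (f : T -> R) : compact K -> continuous f ->
  (forall x, K x -> 0 < f x) -> exists2 m, 0 < m & forall x, K x -> m <= f x.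
Proof.
move=> cK cf f0; have [[x0 Kx0]|nK] := pselect (exists x, K x); last first.
  by exists 1 => // x Kx; exfalso; apply: nK; exists x.
have [|x Kx xP] := @compact_EVT_min T R f K _ cK (continuous_subspaceT cf); first by exists x0.
by exists (f x) => [|y Ky]; [apply: f0; rewrite inE in Kx|apply: xP; rewrite inE].
Qed.

Lemma find_piece (N : nat) (u : R) : (0 < N)%N -> 0 <= u <= N%:R -> exists2 k, (k < N)%N & 0 <= u - k%:R <= 1.
Proof.
elim: N => // -[|M] IH _ uN; first by exists 0%N => //; rewrite subr0.
have [uM|uM] := leP u M.+1%:R.
  by have [//||k kM kP] := IH; [case/andP: uN => ->|exists k => //; exact: leqW].
by exists M.+1 => //; move: uN; rewrite -[M.+2%:R]natr1; flra.
Qed.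

(** The parameters [N] and 0 give the same vertex of a closed polygon; injectivity is expressed
    through the representative below [N]. *)
Definition wrap (N : nat) (s : R) : R := if s == N%:R then 0 else s.

Lemma wrap_next_sep N k l (s s' : R) : (2 < N)%N -> (k < N)%N -> (l < N)%N -> (k.+1 = l \/ (k.+1 = N /\ l = 0%N)) ->
  0 <= s <= 1 -> 0 <= s' <= 1 -> s = 1 \/ s' = 1 -> wrap N (k%:R + (1 - s)) <> wrap N (l%:R + s').
Proof.
move=> N2 kN lN kl s01 s'01 one; rewrite /wrap; have k0 := ler0n R k.
have N3 : 3 <= N%:R :> R by rewrite ler_nat.
have lt1 (j : nat) : (j < N)%N -> j%:R + 1 <= N%:R :> R by move=> jN; rewrite natr1 ler_nat.
case: kl => [klE|[kE l0]].
  have lE : l%:R = k%:R + 1 :> R by rewrite -klE -natr1.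
  have k2 : k%:R + 2 <= N%:R :> R by have := lt1 l lN; rewrite lE; flra.
  by rewrite lE; case: eqP => e1; case: eqP => e2 e; case: one => one; flra.
have kE' : k%:R = N%:R - 1 :> R by rewrite -kE -natr1; ring.
by rewrite l0 kE'; case: eqP => e1; case: eqP => e2 e; case: one => one; flra.
Qed.

Lemma wrap_disjoint N k l (s s' : R) : (k < N)%N -> (l < N)%N -> k <> l ->
  ~ (k.+1 = l \/ (k.+1 = N /\ l = 0%N)) -> ~ (l.+1 = k \/ (l.+1 = N /\ k = 0%N)) ->
  0 <= s <= 1 -> 0 <= s' <= 1 -> wrap N (k%:R + s) <> wrap N (l%:R + s').
Proof.
move=> kN lN kl n1 n2 s01 s'01; rewrite /wrap.
have wlt i j : (i < j)%N -> i.+1 <> j -> i%:R + 2 <= j%:R :> R.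
  move=> ij ne; have e : i.+2%:R = i%:R + 2 :> R by rewrite -addn2 natrD.
  by rewrite -e ler_nat ltn_neqAle ij andbT; apply/eqP.
have lt1 (j : nat) : (j < N)%N -> j%:R + 1 <= N%:R :> R by move=> jN; rewrite natr1 ler_nat.
have k0 := ler0n R k; have l0 := ler0n R l; have kN1 := lt1 k kN; have lN1 := lt1 l lN.
have wend i : i%:R + 1 = N%:R :> R -> i.+1 = N by rewrite natr1 => /eqP; rewrite eqr_nat => /eqP.
have wzero i : i%:R = 0 :> R -> i = 0%N by move=> /eqP; rewrite pnatr_eq0 => /eqP.
case: eqP => e1; case: eqP => e2.
- have kE : k.+1 = N by apply: wend; flra.
  have lE : l.+1 = N by apply: wend; flra.
  by move=> _; apply: kl; move: lE; rewrite -kE => -[].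
- by move=> e; apply: n1; right; split; [apply: wend; flra|apply: wzero; flra].
- by move=> e; apply: n2; right; split; [apply: wend; flra|apply: wzero; flra].
- move=> e; case: (ltngtP k l) kl => // [lt|lt] _.
    by have := wlt k l lt (fun h => n1 (or_introl h)); flra.
  by have := wlt l k lt (fun h => n2 (or_introl h)); flra.
Qed.

Context {E : completeNormedModType R}.
Hypothesis ext : lipschitz_extendable E.

Definition linear_pieces (N : nat) (f : R -> E) := forall k (s : R), (k < N)%N -> 0 <= s <= 1 ->
  f (k%:R + s) = (1 - s) *: f k%:R + s *: f k.+1%:R.

Lemma conv_line (a b : E) (s : R) : (1 - s) *: a + s *: b = a + s *: (b - a).
Proof. by rewrite scalerBl scale1r scalerBr -addrA [- _ + _]addrC. Qed.
Lemma conv_line_rev (a b : E) (s : R) : (1 - (1 - s)) *: a + (1 - s) *: b = b + s *: (a - b).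
Proof. by rewrite subKr addrC conv_line. Qed.
Lemma sub_line (a x y : E) (s s' : R) : a + s *: x - (a + s' *: y) = s *: x - s' *: y.
Proof. by rewrite opprD addrACA subrr add0r. Qed.

(** For edges without a common vertex, compactness bounds the distance below at all times. On a
    single edge both sides of the estimate are proportional to [|s - s'|]. For adjacent edges the
    difference is homogeneous in the distances to the common vertex, so it is enough to bound it
    where the larger one is 1, which is again compactness. *)
Lemma polygon_family_lipschitz (N : nat) (f0 D : R -> E) : (2 < N)%N ->
  linear_pieces N f0 -> linear_pieces N D -> f0 N%:R = f0 0 -> D N%:R = D 0 ->
  (forall t s s' : R, 0 <= t <= 1 -> 0 <= s < N%:R -> 0 <= s' < N%:R ->
     f0 s + t *: D s = f0 s' + t *: D s' -> s = s') ->
  exists2 c : R, 0 < c & forall (t : R) s s', 0 <= t <= 1 -> 0 <= s <= N%:R -> 0 <= s' <= N%:R ->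
     c * `|D s - D s'| <= `|(f0 s + t *: D s) - (f0 s' + t *: D s')|.
Proof.
move=> N2 lf lD fN DN inj; pose F t s := f0 s + t *: D s.
have N0 : 0 < N%:R :> R by rewrite ltr0n (ltn_trans _ N2).
have N3 : 3 <= N%:R :> R by rewrite ler_nat.
have lt1 (k : nat) : (k < N)%N -> k%:R + 1 <= N%:R :> R by move=> kN; rewrite natr1 ler_nat.
have lF t k (s : R) : (k < N)%N -> 0 <= s <= 1 -> F t (k%:R + s) = (1 - s) *: F t k%:R + s *: F t k.+1%:R.
  move=> kN s01; rewrite /F lf// lD// !scalerDr !scalerA addrACA; congr (_ + (_ + _)); by rewrite mulrC.
have FN t : F t N%:R = F t 0 by rewrite /F fN DN.
pose red := wrap N.
have inj' t s s' : 0 <= t <= 1 -> 0 <= s <= N%:R -> 0 <= s' <= N%:R -> F t s = F t s' -> red s = red s'.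
  move=> t01 sN s'N Fss.
  have Fr u : F t (red u) = F t u by rewrite /red /wrap; case: eqP => // ->.
  have rr u : 0 <= u <= N%:R -> 0 <= red u < N%:R.
    rewrite /red /wrap; case: eqP => [_|/eqP ne /andP[u0 u1]]; first by rewrite lexx.
    by rewrite u0 lt_neqAle ne.
  by apply: (inj t) => //; [exact: rr|exact: rr|rewrite -/(F t _) -/(F t _) !Fr].
have D_bound (c e x : R) : 0 < e -> 0 <= x -> c <= e / (x + 1) -> c * x <= e.
  move=> e0 x0; rewrite ler_pdivlMr; last by flra.
  by move=> h; have [c0|c0] := leP 0 c; fnra.
have box : compact ([set p : R * (R * R) | [/\ 0 <= p.1 <= 1, 0 <= p.2.1 <= 1 & 0 <= p.2.2 <= 1]]).
  have c1 := @segment_set_compact R 0 1; have := compact_setX c1 (compact_setX c1 c1).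
  by congr compact; apply/seteqP; split=> [p [a [b c]]|p [a b c]]; split.
pose G (a b : nat) (t s : R) := (1 - s) *: F t a%:R + s *: F t b%:R.
have cG a b (T : topologicalType) (u v : T -> R) : continuous u -> continuous v -> continuous (fun x => G a b (u x) (v x)).
  by move=> cu cv; rewrite /G /F; cont.
have disjoint k l : (k < N)%N -> (l < N)%N -> (forall s s' : R, 0 <= s <= 1 -> 0 <= s' <= 1 -> red (k%:R + s) <> red (l%:R + s')) ->
    exists2 c : R, 0 < c & forall c', 0 < c' <= c -> forall t s s' : R, 0 <= t <= 1 -> 0 <= s <= 1 -> 0 <= s' <= 1 ->
      c' * `|D (k%:R + s) - D (l%:R + s')| <= `|F t (k%:R + s) - F t (l%:R + s')|.
  move=> kN lN ne.
  have cf : continuous (fun p : R * (R * R) => `|G k k.+1 p.1 p.2.1 - G l l.+1 p.1 p.2.2|).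
    by cont; apply: cG; cont.
  have [|m m0 mP] := compact_positive_min box cf.
    move=> p [t01 s01 s'01]; rewrite normr_gt0 subr_eq0; apply/eqP; rewrite /G -!lF// => /(inj' _ _ _ t01) e.
    apply: (ne p.2.1 p.2.2) => //; apply: e; have := lt1 k kN; have := lt1 l lN; have := ler0n R k; have := ler0n R l; flra.
  pose b := `|D k%:R| + `|D k.+1%:R| + (`|D l%:R| + `|D l.+1%:R|).
  have b0 : 0 <= b by rewrite !addr_ge0.
  have Db j (s : R) : (j < N)%N -> 0 <= s <= 1 -> `|D (j%:R + s)| <= `|D j%:R| + `|D j.+1%:R|.
    move=> jN s01; rewrite lD//; apply: le_trans (ler_normD _ _) _; rewrite !normrZ.
    rewrite (@ger0_norm _ (1 - s)) ?(@ger0_norm _ s); try flra.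
    by have := normr_ge0 (D j%:R); have := normr_ge0 (D j.+1%:R); fnra.
  exists (m / (b + 1)); first by rewrite divr_gt0//; flra.
  move=> c' /andP[c'0 c'm] t s s' t01 s01 s'01.
  apply: le_trans (_ : m <= _); last first.
    by have := mP (t, (s, s')) (And3 t01 s01 s'01); rewrite /G /= -!lF.
  apply: le_trans (D_bound c' m b m0 b0 c'm); rewrite ler_pM2l//.
  by apply: le_trans (ler_normB _ _) _; apply: lerD; exact: Db.
have same k : (k < N)%N -> exists2 c : R, 0 < c & forall c', 0 < c' <= c -> forall t s s' : R, 0 <= t <= 1 -> 0 <= s <= 1 -> 0 <= s' <= 1 ->
      c' * `|D (k%:R + s) - D (k%:R + s')| <= `|F t (k%:R + s) - F t (k%:R + s')|.
  move=> kN; have cf : continuous (fun t : R => `|F t k.+1%:R - F t k%:R|) by rewrite /F; cont.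
  have [|m m0 mP] := compact_positive_min (@segment_set_compact R 0 1) cf.
    move=> t t01; rewrite normr_gt0 subr_eq0; apply/eqP => /(inj' _ _ _ t01) e.
    have := lt1 k kN; have := ler0n R k => k0 k1.
    have {}e : red k.+1%:R = red k%:R by apply: e; rewrite -?natr1; flra.
    move: e; rewrite /red /wrap eqr_nat [k%:R == _]eqr_nat (ltn_eqF kN); case: eqP => [kE|_] /eqP.
      rewrite eq_sym pnatr_eq0 => /eqP k00; move: N2; rewrite -kE k00//.
    by rewrite eqr_nat gtn_eqF.
  have b0 := normr_ge0 (D k.+1%:R - D k%:R).
  exists (m / (`|D k.+1%:R - D k%:R| + 1)); first by rewrite divr_gt0//; flra.
  move=> c' /andP[c'0 c'm] t s s' t01 s01 s'01; rewrite lD// lD// lF// lF//.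
  rewrite !conv_line !sub_line -!scalerBl !normrZ mulrCA; apply: ler_wpM2l => //.
  by apply: le_trans (D_bound c' m _ m0 b0 c'm) _; exact: mP.
(* The first edge is run backwards, so that both edges start at the common vertex. *)
have corner k l : (k < N)%N -> (l < N)%N -> F 0 k.+1%:R = F 0 l%:R -> D k.+1%:R = D l%:R ->
    (forall s s' : R, 0 <= s <= 1 -> 0 <= s' <= 1 -> s = 1 \/ s' = 1 -> red (k%:R + (1 - s)) <> red (l%:R + s')) ->
    exists2 c : R, 0 < c & forall c', 0 < c' <= c -> forall t s s' : R, 0 <= t <= 1 -> 0 <= s <= 1 -> 0 <= s' <= 1 ->
      c' * `|D (k%:R + s) - D (l%:R + s')| <= `|F t (k%:R + s) - F t (l%:R + s')|.
  move=> kN lN F0 D0 ne.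
  have Fkl t : F t k.+1%:R = F t l%:R by move: F0; rewrite /F !scale0r !addr0 D0 => ->.
  pose A t := F t k%:R - F t k.+1%:R; pose B t := F t l.+1%:R - F t l%:R.
  have diffE t (s s' : R) : 0 <= s <= 1 -> 0 <= s' <= 1 ->
      F t (k%:R + (1 - s)) - F t (l%:R + s') = s *: A t - s' *: B t.
    move=> s01 s'01; have r01 : 0 <= 1 - s <= 1 by clear -s01; flra.
    by rewrite (lF t k)// (lF t l)// conv_line_rev conv_line /A /B Fkl sub_line.
  have cf : continuous (fun p : R * (R * R) => `|p.2.1 *: A p.1 - p.2.2 *: B p.1|) by rewrite /A /B /F; cont.
  have pos (p : R * (R * R)) : [/\ 0 <= p.1 <= 1, 0 <= p.2.1 <= 1 & 0 <= p.2.2 <= 1] -> p.2.1 = 1 \/ p.2.2 = 1 ->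
      0 < `|p.2.1 *: A p.1 - p.2.2 *: B p.1|.
    move=> [t01 s01 s'01] one; rewrite -diffE// normr_gt0 subr_eq0; apply/eqP => /(inj' _ _ _ t01) e.
    apply: (ne p.2.1 p.2.2) => //; apply: e; have := lt1 k kN; have := lt1 l lN; have := ler0n R k; have := ler0n R l; flra.
  have cK : compact ([set p : R * (R * R) | [/\ 0 <= p.1 <= 1, 0 <= p.2.1 <= 1 & 0 <= p.2.2 <= 1]] `&`
      [set p | Num.max p.2.1 p.2.2 = 1]).
    apply: compact_closedI => //; apply: (@closed_comp _ _ (fun p : R * (R * R) => Num.max p.2.1 p.2.2) [set 1]).
      by move=> p _; have cm : continuous (fun p : R * (R * R) => Num.max p.2.1 p.2.2) by [cont]; exact: cm.
    exact: closed_eq.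
  have [|m m0 mP] := compact_positive_min cK cf.
    move=> p [pb pm]; apply: pos => //; move: pm => /=.
    by case: (leP p.2.1 p.2.2) => _ ->; [right|left].
  have bound t (s s' : R) : 0 <= t <= 1 -> 0 <= s <= 1 -> 0 <= s' <= 1 -> m * Num.max s s' <= `|s *: A t - s' *: B t|.
    move=> t01 s01 s'01; have [w0|w0] := eqVneq (Num.max s s') 0; first by rewrite w0 mulr0.
    pose w := Num.max s s'; have sw : s <= w by rewrite le_max lexx.
    have s'w : s' <= w by rewrite le_max lexx orbT.
    have w1 : 0 < w by rewrite lt_neqAle eq_sym w0 /=; apply: le_trans sw; case/andP: s01.
    have := mP (t, (s / w, s' / w)); rewrite /= -/w => h.
    have {}h : m <= `|(s / w) *: A t - (s' / w) *: B t|.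
      apply: h; split=> /=; first by split=> //; rewrite ?divr_ge0 ?ler_pdivrMr ?mul1r ?(ltW w1)//; case/andP: s01; case/andP: s'01.
      have [ss|ss] := leP s s'.
        by rewrite max_r ?ler_pM2r ?invr_gt0// /w max_r// divff// gt_eqF// -[s'](max_r ss).
      by rewrite max_l ?ler_pM2r ?invr_gt0 ?(ltW ss)// /w max_l ?(ltW ss)// divff// gt_eqF// -[s](max_l (ltW ss)).
    have e : s *: A t - s' *: B t = w *: ((s / w) *: A t - (s' / w) *: B t).
      by move: (A t) (B t) => a b; rewrite [RHS]scalerBr !scalerA ![w * _]mulrC !divfK// gt_eqF.
    by rewrite -/w e normrZ (gtr0_norm w1) mulrC; apply: ler_wpM2l => //; exact: ltW.
  pose bA := `|D k%:R - D k.+1%:R| + `|D l.+1%:R - D l%:R|.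
  have b0 : 0 <= bA by rewrite addr_ge0.
  exists (m / (bA + 1)); first by rewrite divr_gt0//; flra.
  move=> c' /andP[c'0 c'm] t s s' t01 s01 s'01; pose r := 1 - s.
  have r01 : 0 <= r <= 1 by rewrite /r; flra.
  have -> : s = 1 - r by rewrite /r; ring.
  rewrite diffE//; apply: le_trans (bound t r s' t01 r01 s'01).
  have -> : D (k%:R + (1 - r)) - D (l%:R + s') = r *: (D k%:R - D k.+1%:R) - s' *: (D l.+1%:R - D l%:R).
    have q01 : 0 <= 1 - r <= 1 by clear -r01; flra.
    by rewrite (lD k)// (lD l)// conv_line_rev conv_line D0 sub_line.
  apply: le_trans (_ : c' * (bA * Num.max r s') <= _); last first.
    rewrite mulrA; apply: ler_wpM2r; last exact: D_bound.
    by rewrite le_max; case/andP: r01 => ->.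
  rewrite ler_pM2l// /bA mulrDl; apply: le_trans (ler_normB _ _) _; rewrite !normrZ.
  rewrite (ger0_norm (_ : 0 <= r)) ?(ger0_norm (_ : 0 <= s')); [|by case/andP: s'01|by case/andP: r01].
  by rewrite ![_ * `|_|]mulrC; apply: lerD; apply: ler_wpM2l; rewrite ?normr_ge0// le_max lexx ?orbT.
have corner' k l : (k < N)%N -> (l < N)%N -> (k.+1 = l \/ (k.+1 = N /\ l = 0%N)) ->
    exists2 c : R, 0 < c & forall c', 0 < c' <= c -> forall t s s' : R, 0 <= t <= 1 -> 0 <= s <= 1 -> 0 <= s' <= 1 ->
      c' * `|D (k%:R + s) - D (l%:R + s')| <= `|F t (k%:R + s) - F t (l%:R + s')|.
  move=> kN lN kl; apply: corner => //; last by move=> s s'; exact: wrap_next_sep.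
    by case: kl => [->//|[-> ->]]; rewrite FN.
  by case: kl => [->//|[-> ->]].
have pair k l : (k < N)%N -> (l < N)%N ->
    exists2 c : R, 0 < c & forall c', 0 < c' <= c -> forall t s s' : R, 0 <= t <= 1 -> 0 <= s <= 1 -> 0 <= s' <= 1 ->
      c' * `|D (k%:R + s) - D (l%:R + s')| <= `|F t (k%:R + s) - F t (l%:R + s')|.
  move=> kN lN; have [<-|kl] := eqVneq k l; first exact: same.
  have [|n1] := pselect (k.+1 = l \/ (k.+1 = N /\ l = 0%N)); first exact: corner'.
  have [h|n2] := pselect (l.+1 = k \/ (l.+1 = N /\ k = 0%N)).
    have [c c0 cP] := corner' l k lN kN h; exists c => // c' c'c t s s' t01 s01 s'01.
    by rewrite distrC [X in _ <= X]distrC; exact: cP.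
  by apply: disjoint => // s s'; apply: wrap_disjoint => //; apply/eqP.
have [|c c0 cP] := @common_radius R N (fun k c => forall l, (l < N)%N -> forall t s s' : R, 0 <= t <= 1 -> 0 <= s <= 1 -> 0 <= s' <= 1 ->
      c * `|D (k%:R + s) - D (l%:R + s')| <= `|F t (k%:R + s) - F t (l%:R + s')|).
  move=> k kN; have [|c c0 cP] := @common_radius R N (fun l c => forall t s s' : R, 0 <= t <= 1 -> 0 <= s <= 1 -> 0 <= s' <= 1 ->
      c * `|D (k%:R + s) - D (l%:R + s')| <= `|F t (k%:R + s) - F t (l%:R + s')|).
    by move=> l lN; exact: pair.
  by exists c => // c' c'c l lN; exact: cP.
exists c => // t s s' t01 sN s'N.
have Np : (0 < N)%N by exact: ltn_trans N2.
have [k kN kP] := find_piece Np sN; have [l lN lP] := find_piece Np s'N.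
have := cP c k kN; rewrite c0 lexx => /(_ isT l lN t _ _ t01 kP lP).
by rewrite !(addrC _%:R) !subrK.
Qed.

Lemma polygon_isotopy (N : nat) (f0 D : R -> E) : (2 < N)%N ->
  linear_pieces N f0 -> linear_pieces N D -> f0 N%:R = f0 0 -> D N%:R = D 0 ->
  (forall t s s' : R, 0 <= t <= 1 -> 0 <= s < N%:R -> 0 <= s' < N%:R ->
     f0 s + t *: D s = f0 s' + t *: D s' -> s = s') ->
  @isotopic R _ (f0 @` [set s | 0 <= s <= N%:R]) ((fun s => f0 s + D s) @` [set s | 0 <= s <= N%:R]).
Proof.
move=> N2 lf lD fN DN inj; have [c c0 cP] := polygon_family_lipschitz N2 lf lD fN DN inj.
have [H [H' [iH HE]]] := @linear_isotopy R E ext R [set s | 0 <= s <= N%:R] f0 D c c0 cP.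
exists H, H'; split=> //; rewrite image_comp; apply: eq_imagel => s sN /=.
by rewrite HE ?scale1r// lexx ler01.
Qed.
End PolygonFamilies.

(** * Generic projections *)

Section GenericDirection.
Context {R : realType}.
Local Notation Q := (R * R)%type.
Local Notation E := (R * R * R)%type.

(** [A] has dense interior, in a form that suits finite intersections. *)
Definition generic (A : set Q) := forall (w : Q) (e : R), 0 < e ->
  exists w' (r : R), [/\ 0 < r, `|w' - w| + r <= e & forall v, `|v - w'| < r -> A v].

Lemma genericI (A B : set Q) : generic A -> generic B -> generic (A `&` B).
Proof.
move=> gA gB w e e0; have [w1 [r1 [r10 h1 A1]]] := gA w e e0.
have [w2 [r2 [r20 h2 B2]]] := gB w1 r1 r10; exists w2, r2; split=> //.
  by have := ler_distD w1 w2 w; flra.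
move=> v vr; split; last exact: B2.
by apply: A1; have := ler_distD w2 v w1; flra.
Qed.

Lemma generic_forall (n : nat) (A : nat -> set Q) : (forall i, (i < n)%N -> generic (A i)) ->
  generic [set w | forall i, (i < n)%N -> A i w].
Proof.
elim: n => [_ w e e0|n IH H]; first by exists w, e; rewrite subrr normr0 add0r.
have := genericI (IH (fun i h => H i (leqW h))) (H n (ltnSn n)); congr generic.
apply/seteqP; split=> w; first by move=> [h1 h2] i; rewrite ltnS leq_eqVlt => /orP[/eqP ->|/h1].
by move=> h; split=> [i im|]; apply: h => //; exact: leqW.
Qed.

Lemma generic_sub (A B : set Q) : A `<=` B -> generic A -> generic B.
Proof. by move=> AB gA w e /(gA w)[w' [r [? ? h]]]; exists w', r; split=> // v /h/AB. Qed.

(** The linear form of coefficients [n] evaluated on the direction of projection [(w.1, 1, w.2)]. *)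
Definition linf (n : E) (w : Q) : R := n.1.1 * w.1 + n.1.2 + n.2 * w.2.

Lemma generic_linf (n : E) : n != 0 -> generic [set w | linf n w != 0].
Proof.
move=> n0 w e e0; have nd : `|n.1.1| + `|n.2| + 1 > 0 by rewrite ltr_wpDl// addr_ge0.
have [w' [w'e w'0]] : exists w' : Q, `|w' - w| <= e / 2 /\ linf n w' != 0.
  have [l0|l0] := eqVneq (linf n w) 0; last by exists w; rewrite subrr normr0; split=> //; flra.
  have e2 : `|e / 2| = e / 2 by rewrite ger0_norm; flra.
  have [n1|n1] := eqVneq n.1.1 0; last first.
    exists (w + (e / 2, 0)); rewrite addrC addKr prod_normE /= normr0 e2 max_l ?lexx; last by flra.
    split=> //; rewrite (_ : linf n _ = linf n w + n.1.1 * (e / 2)); last by rewrite /linf /=; ring.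
    by rewrite l0 add0r mulf_neq0// gt_eqF// divr_gt0.
  have [n2|n2] := eqVneq n.2 0; last first.
    exists (w + (0, e / 2)); rewrite addrC addKr prod_normE /= normr0 e2 max_r ?lexx; last by flra.
    split=> //; rewrite (_ : linf n _ = linf n w + n.2 * (e / 2)); last by rewrite /linf /=; ring.
    by rewrite l0 add0r mulf_neq0// gt_eqF// divr_gt0.
  exfalso; move: l0; rewrite /linf n1 n2 !mul0r add0r addr0 => n3; case/eqP: n0.
  by move: n n1 n2 n3 {nd} => [[a b] c] /= -> -> ->.
have l0 : 0 < `|linf n w'| by rewrite normr_gt0.
exists w', (Num.min (e / 2) (`|linf n w'| / (`|n.1.1| + `|n.2| + 1))); split.
- by rewrite lt_min !divr_gt0.
- have : Num.min (e / 2) (`|linf n w'| / (`|n.1.1| + `|n.2| + 1)) <= e / 2 by rewrite ge_min lexx.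
  by move: (Num.min _ _) => x; flra.
- move=> v; rewrite lt_min => /andP[_]; rewrite ltr_pdivlMr// => vr; apply/eqP => lv.
  have : `|linf n w'| <= `|v - w'| * (`|n.1.1| + `|n.2| + 1).
    rewrite (_ : linf n w' = n.1.1 * (w'.1 - v.1) + n.2 * (w'.2 - v.2)); last by move: lv; rewrite /linf; flra.
    apply: le_trans (ler_normD _ _) _; rewrite !normrM.
    have a1 : `|w'.1 - v.1| <= `|v - w'| by rewrite distrC prod_normE le_max /= lexx.
    have a2 : `|w'.2 - v.2| <= `|v - w'| by rewrite distrC prod_normE le_max /= lexx orbT.
    have := normr_ge0 n.1.1; have := normr_ge0 n.2; have := normr_ge0 (v - w').
    by move: a1 a2; move: (`|_|) (`|_|) (`|_|) (`|_|) (`|_|) => *; fnra.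
  by rewrite leNgt vr.
Qed.

(** The projection along [(w.1, 1, w.2)] onto the plane [y = 0]. *)
Definition proj (w : Q) (p : E) : Q := (p.1.1 - w.1 * p.1.2, p.2 - w.2 * p.1.2).
(** The cross product of [b] and [a], in the order for which [cross2_proj] holds without a sign. *)
Definition crs (a b : E) : E := (a.2 * b.1.2 - a.1.2 * b.2, a.1.1 * b.2 - a.2 * b.1.1, a.1.2 * b.1.1 - a.1.1 * b.1.2).
Definition cross2 (a b : Q) : R := a.1 * b.2 - a.2 * b.1.

Lemma cross2_proj w a b : cross2 (proj w a) (proj w b) = linf (crs a b) w.
Proof. by rewrite /cross2 /proj /linf /crs /=; ring. Qed.
Lemma projD w a b : proj w (a + b) = proj w a + proj w b.
Proof. by rewrite /proj; apply/pair_equal_spec; split=> /=; ring. Qed.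
Lemma projB w a b : proj w (a - b) = proj w a - proj w b.
Proof. by rewrite /proj; apply/pair_equal_spec; split=> /=; ring. Qed.
Lemma projZ w (c : R) a : proj w (c *: a) = c *: proj w a.
Proof. by rewrite /proj; apply/pair_equal_spec; split=> /=; rewrite /GRing.scale /=; ring. Qed.
Lemma cross2D a b c : cross2 (a + b) c = cross2 a c + cross2 b c.
Proof. by rewrite /cross2 /=; ring. Qed.
Lemma cross2Z (x : R) a c : cross2 (x *: a) c = x * cross2 a c.
Proof. by rewrite /cross2 /= /GRing.scale /=; ring. Qed.
Lemma cross2vv a : cross2 a a = 0.
Proof. by rewrite /cross2; ring. Qed.

Lemma crs_eq0 a b : b != 0 -> crs a b = 0 -> exists x : R, a = x *: b.
Proof.
case: a b => [[a1 a2] a3] [[b1 b2] b3] b0 /= [h1 h2 h3].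
have [b10|b10] := eqVneq b1 0; last first.
  exists (a1 / b1); congr (_, _, _); rewrite /GRing.scale /=.
  - by rewrite divfK.
  - by apply: (mulfI b10); rewrite mulrA mulrCA divff// mulr1; flra.
  - by apply: (mulfI b10); rewrite mulrA mulrCA divff// mulr1; flra.
have [b20|b20] := eqVneq b2 0; last first.
  exists (a2 / b2); congr (_, _, _); rewrite /GRing.scale /=.
  - by apply: (mulfI b20); rewrite mulrA mulrCA divff// mulr1; flra.
  - by rewrite divfK.
  - by apply: (mulfI b20); rewrite mulrA mulrCA divff// mulr1; flra.
have b30 : b3 != 0 by apply: contraNneq b0 => b30; rewrite b10 b20 b30.
exists (a3 / b3); congr (_, _, _); rewrite /GRing.scale /=.
- by apply: (mulfI b30); rewrite mulrA mulrCA divff// mulr1; flra.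
- by apply: (mulfI b30); rewrite mulrA mulrCA divff// mulr1; flra.
- by rewrite divfK.
Qed.

Lemma generic_proj d : d != 0 -> generic [set w | proj w d != 0].
Proof.
move=> d0; have [n [n0 H]] : exists n : E, n != 0 /\ forall w, linf n w != 0 -> proj w d != 0.
  case: d d0 => [[d1 d2] d3] d0.
  have [y0|y0] := eqVneq d2 0; last first.
    exists (- d2, d1, 0); split.
      by apply: contra y0 => /eqP[/eqP]; rewrite oppr_eq0.
    move=> w; apply: contra => /eqP[/= h _]; apply/eqP; rewrite /linf /=; flra.
  exists (0, 1, 0); split; first by apply/eqP => -[/eqP]; rewrite oner_eq0.
  move=> w _; apply: contra d0 => /eqP[/= h1 h2]; rewrite y0 in h1 h2 *; apply/eqP; congr (_, _, _); flra.
by apply: generic_sub (generic_linf n0) => w; exact: H.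
Qed.
End GenericDirection.

Section RegularProjection.
Context {R : realType}.
Local Notation Q := (R * R)%type.
Local Notation E := (R * R * R)%type.
Implicit Types (n i j k : nat) (g : R -> E) (w : Q).

Definition simple_polygon n g := [/\ linear_pieces n g, g n%:R = g 0 &
  forall s s' : R, 0 <= s < n%:R -> 0 <= s' < n%:R -> g s = g s' -> s = s'].
Definition edge g i : E := g i.+1%:R - g i%:R.

Lemma edgeE n g i (s : R) : simple_polygon n g -> (i < n)%N -> 0 <= s < 1 -> g (i%:R + s) = g i%:R + s *: edge g i.
Proof. by move=> [lg _ _] ilt /andP[s0 s1]; rewrite lg// ?s0 ?ltW// conv_line. Qed.

Lemma piece_lt n i (s : R) : (i < n)%N -> 0 <= s < 1 -> 0 <= i%:R + s < n%:R.
Proof. by move=> ilt s01; have : i%:R + 1 <= n%:R :> R by [rewrite natr1 ler_nat]; have := ler0n R i; flra. Qed.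

Lemma floor_piece n (u : R) : 0 <= u < n%:R -> exists i (s : R), [/\ (i < n)%N, 0 <= s < 1 & u = i%:R + s].
Proof.
move=> /andP[u0 un]; have /andP[h1 h2] := truncn_itv u0; exists (Num.truncn u), (u - (Num.truncn u)%:R).
split; last by ring.
- by rewrite -(ltr_nat R); apply: le_lt_trans un.
- by move: h2; rewrite -natr1; flra.
Qed.

Lemma edge_neq0 n g i : simple_polygon n g -> (i < n)%N -> edge g i != 0.
Proof.
have h2 : 0 <= (2^-1 : R) < 1 by flra.
have h0 : 0 <= (0 : R) < 1 by flra.
move=> sg ilt; apply/eqP => d0; have [_ _ inj] := sg; have := inj _ _ (piece_lt ilt h2) (piece_lt ilt h0).
by rewrite !(edgeE sg)// d0 !scaler0 => /(_ erefl); flra.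
Qed.

(** No edge is projected to a point, and projecting creates no alignment: a vertex off the line of
    an edge stays off it, and edges that are not parallel stay so. Each of these finitely many
    conditions is generic. *)
Definition regular n g w := [/\ forall i, (i < n)%N -> proj w (edge g i) != 0,
  forall k, (k < n)%N -> forall i, (i < n)%N -> crs (g k%:R - g i%:R) (edge g i) != 0 -> linf (crs (g k%:R - g i%:R) (edge g i)) w != 0 &
  forall k, (k < n)%N -> forall i, (i < n)%N -> crs (edge g k) (edge g i) != 0 -> linf (crs (edge g k) (edge g i)) w != 0].

Lemma generic_regular n g : simple_polygon n g -> generic [set w | regular n g w].
Proof.
move=> sg.
have G1 : generic [set w | forall i, (i < n)%N -> proj w (edge g i) != 0].
  by apply: generic_forall => i ilt; apply: generic_proj; exact: edge_neq0 ilt.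
have cond (c : E) : generic [set w | c != 0 -> linf c w != 0].
  have [->|c0] := eqVneq c 0; first by move=> w e e0; exists w, e; rewrite subrr normr0 add0r.
  by apply: generic_sub (generic_linf c0) => w /= h _.
have pairs (c : nat -> nat -> E) : generic [set w | forall k, (k < n)%N -> forall i, (i < n)%N -> c k i != 0 -> linf (c k i) w != 0].
  by apply: generic_forall => k _; apply: generic_forall => i _; exact: cond.
have := genericI G1 (genericI (pairs (fun k i => crs (g k%:R - g i%:R) (edge g i)))
  (pairs (fun k i => crs (edge g k) (edge g i)))).
by apply: generic_sub => w [? [? ?]].
Qed.

Lemma scaler_plane_eq0 (x : R) (a : Q) : a != 0 -> x *: a = 0 -> x = 0.
Proof. by move=> a0 /eqP; rewrite scaler_eq0 (negPf a0) orbF => /eqP. Qed.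

(** By regularity an alignment seen in the projection holds in space; the ratio is the same because
    the edge is not projected to 0. *)
Lemma on_line n g w i j (x : R) : simple_polygon n g -> regular n g w -> (i < n)%N -> (j < n)%N ->
  proj w (g i%:R - g j%:R) = x *: proj w (edge g j) -> g i%:R - g j%:R = x *: edge g j.
Proof.
move=> sg [r1 r2 r3] ilt jlt e.
have : linf (crs (g i%:R - g j%:R) (edge g j)) w = 0 by rewrite -cross2_proj e cross2Z cross2vv mulr0.
move=> l0; have c0 : crs (g i%:R - g j%:R) (edge g j) = 0.
  by apply/eqP; apply: contraT => /(r2 i ilt j jlt); rewrite l0 eqxx.
have [z zE] := crs_eq0 (edge_neq0 sg jlt) c0; rewrite zE; congr (_ *: _).
apply/eqP; rewrite -subr_eq0; apply/eqP; apply: (scaler_plane_eq0 (r1 j jlt)).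
by rewrite scalerBl -e zE projZ subrr.
Qed.

Definition crossing n g w (s t : R) :=
  [/\ 0 <= s < n%:R, 0 <= t < n%:R, s <> t & proj w (g s) = proj w (g t)].

(** Parallel edges whose projections meet would lie on one line of space, on which the projection is
    injective. *)
Lemma crossing_edges n g w i j (s t : R) : simple_polygon n g -> regular n g w -> (i < n)%N -> (j < n)%N ->
  0 <= s < 1 -> 0 <= t < 1 -> crossing n g w (i%:R + s) (j%:R + t) ->
  cross2 (proj w (edge g i)) (proj w (edge g j)) != 0.
Proof.
move=> sg rg ilt jlt s01 t01 [h1 h2 ne e]; have [r1 r2 r3] := rg; apply/negP => /eqP c0; apply: ne.
have [_ _ inj] := sg; apply: inj => //.
have [x xE] : exists x : R, edge g i = x *: edge g j.
  apply: crs_eq0 (edge_neq0 sg jlt) _; apply/eqP; apply: contraT => /(r3 i ilt j jlt).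
  by rewrite -cross2_proj c0 eqxx.
have := @on_line n g w i j (t - s * x) sg rg ilt jlt; rewrite !(edgeE sg)// in e *.
move=> h; apply/eqP; rewrite -subr_eq0; apply/eqP.
rewrite opprD addrACA h; first by rewrite xE scalerA -!scalerBl -scalerDl addrA subrK subrr scale0r.
move: e; rewrite xE scalerA projB; move: (edge g j) => q; rewrite !projD !projZ.
move: (proj w (g i%:R)) (proj w q) (proj w (g j%:R)) => [a1 a2] [b1 b2] [d1 d2].
move=> /pair_equal_spec[/=]; rewrite /GRing.scale /= => p1 p2.
by apply/pair_equal_spec; split=> /=; rewrite /GRing.scale /=; flra.
Qed.

(** A vertex seen on an edge is, by [on_line], on that edge in space at the very point seen, against
    simplicity. *)
Lemma crossing_nat n g w k (s t : R) : simple_polygon n g -> regular n g w -> crossing n g w s t -> s <> k%:R.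
Proof.
move=> sg rg [h1 h2 ne e] sk; have [_ _ inj] := sg.
have kn : (k < n)%N by move: h1; rewrite sk ltr_nat => /andP[].
apply: ne; apply: inj => //; move: h2 e; rewrite sk => /floor_piece[j [tau [jn tau01 ->]]].
rewrite (edgeE sg)// => e; have := @on_line n g w k j tau sg rg kn jn.
rewrite projB e projD projZ addrC addKr => /(_ erefl) <-.
by rewrite addrC subrK.
Qed.

Lemma crossing_unique n g w i j (s t s' t' : R) : simple_polygon n g -> regular n g w -> (i < n)%N -> (j < n)%N ->
  0 <= s < 1 -> 0 <= t < 1 -> 0 <= s' < 1 -> 0 <= t' < 1 ->
  crossing n g w (i%:R + s) (j%:R + t) -> crossing n g w (i%:R + s') (j%:R + t') -> s = s' /\ t = t'.
Proof.
move=> sg rg ilt jlt s01 t01 s01' t01' c1 c2; have nz := crossing_edges sg rg ilt jlt s01 t01 c1.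
have [r1 _ _] := rg; have [_ _ _ e1] := c1; have [_ _ _ e2] := c2.
have e : (s - s') *: proj w (edge g i) = (t - t') *: proj w (edge g j).
  move: e1 e2; rewrite !(edgeE sg)//; move: (edge g i) (edge g j) => p q; rewrite !projD !projZ.
  move: (proj w p) (proj w q) (proj w (g i%:R)) (proj w (g j%:R)) => [a1 a2] [b1 b2] [c3 c4] [d1 d2].
  move=> /pair_equal_spec[/=]; rewrite /GRing.scale /= => p1 p2 /pair_equal_spec[/=]; rewrite /GRing.scale /= => p3 p4.
  by apply/pair_equal_spec; split=> /=; rewrite /GRing.scale /=; flra.
have ss : s = s'.
  have := congr1 (fun v => cross2 v (proj w (edge g j))) e; rewrite !cross2Z cross2vv mulr0 => /eqP.
  by rewrite mulf_eq0 (negPf nz) orbF subr_eq0 => /eqP.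
split=> //; move: e; rewrite ss subrr scale0r => /esym/(scaler_plane_eq0 (r1 j jlt))/eqP.
by rewrite subr_eq0 => /eqP.
Qed.

Lemma crossing_isolated n g w (c : R) : simple_polygon n g -> regular n g w ->
  exists2 r : R, 0 < r & forall s t, crossing n g w s t -> s <> c -> r <= `|s - c|.
Proof.
move=> sg rg.
pose P i j (r : R) := forall s t : R, 0 <= s < 1 -> 0 <= t < 1 -> crossing n g w (i%:R + s) (j%:R + t) ->
  i%:R + s <> c -> r <= `|i%:R + s - c|.
have [|r r0 rP] := @common_radius R n (fun i r => forall j, (j < n)%N -> P i j r).
  move=> i ilt; have [|r r0 rP] := @common_radius R n (P i).
    move=> j jlt; have [[s [t [s01 t01 cr ne]]]|no] := pselect (exists s t : R,
        [/\ 0 <= s < 1, 0 <= t < 1, crossing n g w (i%:R + s) (j%:R + t) & i%:R + s <> c]).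
      exists (`|i%:R + s - c|); first by rewrite normr_gt0 subr_eq0; exact/eqP.
      move=> r' /andP[_ r'r] s' t' s01' t01' cr' _.
      by have [<- _] := crossing_unique sg rg ilt jlt s01 t01 s01' t01' cr cr'.
    by exists 1 => // r' _ s t s01 t01 cr ne; exfalso; apply: no; exists s, t.
  by exists r => // r' r'r j jlt; exact: rP.
exists r => // s t cr ne; have [h1 h2 _ _] := cr.
have [i [x [ilt x01 sE]]] := floor_piece h1; have [j [y [jlt y01 tE]]] := floor_piece h2; rewrite sE tE in cr ne *.
by apply: (rP r i ilt _ j jlt) cr ne => //; rewrite r0 lexx.
Qed.

Definition triple n g w (i j k : nat) := exists s t u : R, [/\ 0 <= s < 1, 0 <= t < 1, 0 <= u < 1 &
  [/\ crossing n g w (i%:R + s) (j%:R + t), crossing n g w (i%:R + s) (k%:R + u) & j%:R + t <> k%:R + u]].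

Lemma proj_inj w (a b : E) : proj w a = proj w b -> a.1.2 = b.1.2 -> a = b.
Proof.
case: a b => [[a1 a2] a3] [[b1 b2] b3] /pair_equal_spec[/= h1 h2] h3; rewrite h3 in h1 h2 *.
by congr (_, _, _); flra.
Qed.

Lemma proj_shift w (D : Q) (e : R) (p : E) : proj (w + e *: D) p = proj w p - (e * p.1.2) *: D.
Proof. by rewrite /proj; apply/pair_equal_spec; split=> /=; rewrite /GRing.scale /=; ring. Qed.

(* Moving the direction of projection by a multiple of the image of the edge i
   moves the three strands at a triple point along that edge by amounts
   proportional to their distinct heights. *)
Lemma generic_no_triple n g i j k : simple_polygon n g -> (i < n)%N -> (j < n)%N -> (k < n)%N ->
  generic [set w | ~ triple n g w i j k].
Proof.
move=> sg ilt jlt klt w e e0; have [w0 [r0 [r00 wr reg]]] := generic_regular sg w e0.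
have [[w1 [w1r tr1]]|no] := pselect (exists w1, `|w1 - w0| < r0 /\ triple n g w1 i j k); last first.
  by exists w0, r0; split=> // v vr tr; apply: no; exists v.
(* At a crossing of the edges [i] and [l] one has [A l v = s * B l v], where [s] is the parameter on
   the edge [i]. At a triple point [s] is common to both crossings, so [A j * B k - A k * B j]
   vanishes; this being a continuous function of the direction, one direction where it is nonzero
   suffices. *)
pose A l v := linf (crs (g l%:R - g i%:R) (edge g l)) v; pose B l v := linf (crs (edge g i) (edge g l)) v.
have tq v : triple n g v i j k -> A j v * B k v - A k v * B j v = 0.
  move=> [s [t [u [s01 t01 u01 [[_ _ _ h1] [_ _ _ h2] _]]]]].
  have AB l (x : R) : (l < n)%N -> 0 <= x < 1 -> proj v (g (i%:R + s)) = proj v (g (l%:R + x)) -> A l v = s * B l v.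
    move=> llt x01; rewrite !(edgeE sg)// /A /B -!cross2_proj projB.
    move: (edge g i) (edge g l) => p q; rewrite !projD !projZ.
    move: (proj v (g i%:R)) (proj v p) (proj v (g l%:R)) (proj v q) => [a1 a2] [b1 b2] [c3 c4] [d1 d2].
    move=> /pair_equal_spec[/=]; rewrite /GRing.scale /= => p1 p2; rewrite /cross2 /=.
    have -> : c3 = a1 + s * b1 - x * d1 by move: p1; clear; flra.
    have -> : c4 = a2 + s * b2 - x * d2 by move: p2; clear; flra.
    ring.
  by rewrite (AB j t)// (AB k u)//; ring.
have [s [t [u [s01 t01 u01 [c1 c2 ne]]]]] := tr1.
(* [ep] is small enough for [w2] to stay among the regular directions. *)
have rg1 := reg _ w1r; pose D := proj w1 (edge g i); pose ep := (r0 - `|w1 - w0|) / (2 * (`|D| + 1)).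
have D0 : 0 <= `|D| by [].
have ep0 : 0 < ep by rewrite /ep divr_gt0//; flra.
have epD : ep * `|D| < r0 - `|w1 - w0|.
  have : ep * (2 * (`|D| + 1)) = r0 - `|w1 - w0| by rewrite /ep divfK//; apply: lt0r_neq0; flra.
  by move: ep0 D0 w1r; move: (ep) (`|D|) (`|w1 - w0|) => *; fnra.
pose w2 := w1 + ep *: D.
have w2r : `|w2 - w0| < r0.
  apply: (@le_lt_trans _ _ (`|ep *: D| + `|w1 - w0|)).
    by rewrite /w2 addrAC [_ + ep *: D]addrC; exact: ler_normD.
  by rewrite normrZ gtr0_norm//; flra.
have rg2 := reg _ w2r.
have Bne l (x : R) : (l < n)%N -> 0 <= x < 1 -> crossing n g w1 (i%:R + s) (l%:R + x) -> B l w2 != 0.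
  move=> llt x01 cr; have := crossing_edges sg rg1 ilt llt s01 x01 cr; rewrite cross2_proj => lne.
  have [_ _ r3] := rg2; apply: (r3 i ilt l llt); apply: contra lne => /eqP ->.
  by rewrite /linf /= !mul0r !addr0 eqxx.
have Bj := Bne j t jlt t01 c1; have Bk := Bne k u klt u01 c2.
have q0 : A j w2 * B k w2 - A k w2 * B j w2 != 0.
  have yz : (g (j%:R + t)).1.2 - (g (k%:R + u)).1.2 != 0.
    rewrite subr_eq0; apply/eqP => yz; apply: ne; have [_ _ inj] := sg.
    apply: inj; [exact: piece_lt|exact: piece_lt|apply: (proj_inj (w := w1)) yz].
    by have [_ _ _ <-] := c1; have [_ _ _ <-] := c2.
  pose lam := 1 - ep * (edge g i).1.2; pose C l := cross2 D (proj w2 (edge g l)).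
  have Di : proj w2 (edge g i) = lam *: D by rewrite proj_shift -/D /lam scalerBl scale1r.
  have BC l : B l w2 = lam * C l by rewrite /B -cross2_proj Di cross2Z.
  have AC l (x : R) : (l < n)%N -> 0 <= x < 1 -> proj w1 (g (i%:R + s)) = proj w1 (g (l%:R + x)) ->
      A l w2 = (s * lam - ep * ((g (l%:R + x)).1.2 - (g (i%:R + s)).1.2)) * C l.
    move=> llt x01 h; rewrite /A -cross2_proj /C.
    have -> : g l%:R - g i%:R = (g (l%:R + x) - g (i%:R + s)) + s *: edge g i + (- x) *: edge g l.
      rewrite !(edgeE sg)//; move: (g _) (g _) (edge g _) (edge g _) => p q p' q'.
      rewrite scaleNr; move: (x *: q') (s *: p') => a b.
      by rewrite opprD addrA -[_ - b + b]addrA addNr addr0 addrAC addrK.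
    rewrite projD cross2D [proj _ (_ + s *: _)]projD cross2D !projZ !cross2Z cross2vv mulr0 addr0 Di cross2Z.
    rewrite {1}/w2 proj_shift projB h subrr sub0r -scaleNr cross2Z /=; ring.
  have -> : A j w2 * B k w2 - A k w2 * B j w2 = - ep * C j * (lam * C k) * ((g (j%:R + t)).1.2 - (g (k%:R + u)).1.2).
    have [_ _ _ h1] := c1; have [_ _ _ h2] := c2.
    by rewrite (AC j t)// (AC k u)// !BC; ring.
  apply: mulf_neq0 => //; apply: mulf_neq0; last by rewrite -BC.
  apply: mulf_neq0; first by rewrite oppr_eq0 gt_eqF.
  by apply: contra Bj; rewrite BC => /eqP ->; rewrite mulr0.
have cq : continuous (fun v : Q => A j v * B k v - A k v * B j v) by rewrite /A /B /linf; cont.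
have [r1 r10 r1P] : exists2 r : R, 0 < r & forall v, `|v - w2| < r -> A j v * B k v - A k v * B j v != 0.
  have := cq w2 [set x | x != 0]; rewrite /= => /(_ _)/nbhs_ballP[|r r0' rP].
    by apply: open_nbhs_nbhs; split=> //; exact: open_neq.
  by exists r => // v vr; apply: rP; rewrite -ball_normE /= distrC.
exists w2, (Num.min r1 (r0 - `|w2 - w0|)); split.
- by rewrite lt_min r10 subr_gt0.
- have : Num.min r1 (r0 - `|w2 - w0|) <= r0 - `|w2 - w0| by rewrite ge_min lexx orbT.
  by have := ler_distD w0 w2 w; move: (Num.min _ _) => x; flra.
- by move=> v; rewrite lt_min => /andP[vr _] /tq h; have := r1P v vr; rewrite h eqxx.
Qed.

Lemma regular_projection n g : simple_polygon n g -> exists w, regular n g w /\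
  forall s t t', crossing n g w s t -> crossing n g w s t' -> t = t'.
Proof.
move=> sg.
have G : generic [set w | forall i, (i < n)%N -> forall j, (j < n)%N -> forall k, (k < n)%N -> ~ triple n g w i j k].
  apply: generic_forall => i ilt; apply: generic_forall => j jlt; apply: generic_forall => k klt.
  exact: generic_no_triple.
have [w [r [r0 _ H]]] := genericI (generic_regular sg) G (0, 0) ltr01.
have [rg nt] := H w ltac:(by rewrite subrr normr0).
exists w; split=> // s t t' c1 c2; apply: contrapT => ne.
have [h1 h2 _ _] := c1; have [_ h3 _ _] := c2.
have [i [x [ilt x01 sE]]] := floor_piece h1; have [j [y [jlt y01 tE]]] := floor_piece h2.
have [k [z [klt z01 uE]]] := floor_piece h3; subst s t t'.
by apply: (nt i ilt j jlt k klt); exists x, y, z; split.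
Qed.
End RegularProjection.

(** * Knot diagrams, and their pieces above or below the earlier parts *)

Section Diagrams.
Context {R : realType}.
Local Notation Q := (R * R)%type.
Implicit Types (n : nat) (P : R -> Q) (Y : R -> R).

Definition double n P (s t : R) := [/\ 0 <= s < n%:R, 0 <= t < n%:R, s <> t & P s = P t].

(** [P] is the projection of the knot and [Y] its height. The first coordinate of [P] has to vary
    along each edge because the row of gathered poles extends along the second one. *)
Definition diagram n P Y :=
  [/\ linear_pieces n P, linear_pieces n (Y : R -> R^o), P n%:R = P 0, Y n%:R = Y 0 &
    forall i, (i < n)%N -> (P i%:R).1 != (P i.+1%:R).1] /\
  [/\ forall s t, double n P s t -> Y s != Y t,
      forall s t k, double n P s t -> s <> k%:R,
      forall s t t', double n P s t -> double n P s t' -> t = t' &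
      forall c : R, exists2 r : R, 0 < r & forall s t, double n P s t -> s <> c -> r <= `|s - c|].

(** Each [d i] excludes at most one value of [c], so all small positive values are allowed. *)
Lemma tilt_exists n (d : nat -> Q) : (forall i, (i < n)%N -> d i != 0) ->
  exists c : R, forall i, (i < n)%N -> (d i).1 + c * (d i).2 != 0.
Proof.
move=> d0.
have [|r r0 rP] := @common_radius R n (fun i c => (d i).1 + c * (d i).2 != 0); last first.
  by exists r => i ilt; apply: rP => //; rewrite r0 lexx.
move=> i /d0; case: (d i) => a b ab /=.
have [a0|a0] := eqVneq a 0.
  exists 1 => // c /andP[c0 _]; rewrite a0 add0r; apply: mulf_neq0; first by rewrite gt_eqF.
  by apply: contra ab => /eqP ->; rewrite a0.
have na : 0 < `|a| by rewrite normr_gt0.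
have nb : 0 <= `|b| by [].
exists (`|a| / (2 * (`|b| + 1))); first by rewrite divr_gt0//; flra.
move=> c /andP[c0]; rewrite ler_pdivlMr; last by flra.
move=> ca; apply/eqP => e; have : `|a| = c * `|b|.
  by rewrite (_ : a = - (c * b)) ?normrN ?normrM ?(gtr0_norm c0)//; flra.
by move: na nb c0 ca; move: (`|a|) (`|b|) => *; fnra.
Qed.

Lemma diagram_exists n (g : R -> R * R * R) : simple_polygon n g -> exists P Y, diagram n P Y /\
  @isotopic R _ (g @` [set s | 0 <= s <= n%:R]) ((fun s => level_point (P s) (Y s)) @` [set s | 0 <= s <= n%:R]).
Proof.
move=> sg; have [w [rg uq]] := regular_projection sg.
have [|c cP] := @tilt_exists n (fun i => proj w (edge g i)); first by case: rg.
pose P s : Q := ((proj w (g s)).1 + c * (proj w (g s)).2, (proj w (g s)).2); pose Y s := (g s).1.2.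
have PE s t : P s = P t -> proj w (g s) = proj w (g t).
  rewrite /P; case: (proj w _) (proj w _) => [a b] [a' b'] /pair_equal_spec[/= h1 h2].
  by rewrite h2 in h1 *; congr (_, _); flra.
have dc s t : double n P s t -> crossing n g w s t by case=> h1 h2 h3 /PE.
have [lg gn inj] := sg.
exists P, Y; split; first (split; split).
- move=> k s kn s01; rewrite /P lg//; case: (g k%:R) (g k.+1%:R) => [[a1 a2] a3] [[b1 b2] b3].
  by rewrite /proj; apply/pair_equal_spec; split=> /=; rewrite /GRing.scale /=; ring.
- by move=> k s kn s01; rewrite /Y lg.
- by rewrite /P gn.
- by rewrite /Y gn.
- move=> i ilt; rewrite eq_sym -subr_eq0; have := cP i ilt; rewrite /P /edge projB /=.
  by congr (is_true (_ != 0)); ring.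
- move=> s t /dc[h1 h2 ne e]; apply/eqP => Yst; apply: ne; apply: inj => //; exact: proj_inj e Yst.
- by move=> s t k /dc; exact: crossing_nat.
- by move=> s t t' /dc d1 /dc d2; exact: uq d1 d2.
- move=> x; have [r r0 rP] := crossing_isolated x sg rg; exists r => // s t /dc; exact: rP.
have c1 : continuous (fun q : Q => - (w.1 * q.1)) by cont.
have c2 : continuous (fun q : Q => - (w.2 * q.2)) by cont.
have c3 : continuous (fun q : Q => c * q.2) by cont.
have := isotopic_trans (shear_isotopic_x (g @` [set s | 0 <= s <= n%:R]) c1)
  (isotopic_trans (shear_isotopic_z _ c2) (shear_isotopic_x _ c3)).
by rewrite !image_comp; congr isotopic; apply: eq_imagel => s _.
Qed.

Definition good_piece n P Y (x y e : R) := [/\ x < y,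
  exists2 k, (k < n)%N & k%:R <= x /\ y <= k.+1%:R, e = 1 \/ e = -1,
  forall t, ~ double n P x t /\ ~ double n P y t &
  forall s t, x <= s <= y -> t < s -> double n P s t -> 0 < e * (Y s - Y t)].

(** The sign -1 of the first piece puts the first horizontal segment below the height 0, where the
    last arc begins. *)
Definition chain n P Y (a : R) (m : nat) (u e : nat -> R) :=
  [/\ (0 < m)%N, u 0%N = 0, u m = a, e 0%N = -1 & forall i, (i < m)%N -> good_piece n P Y (u i) (u i.+1) (e i)].

Lemma chain_extend n P Y a m u e (b eps : R) : chain n P Y a m u e -> good_piece n P Y a b eps ->
  exists u' e', [/\ chain n P Y b m.+1 u' e', u' m = a & e' m = eps].
Proof.
move=> [m0 u0 um e0 H] G.
exists (fun i => if (i <= m)%N then u i else b), (fun i => if (i < m)%N then e i else eps).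
rewrite leqnn ltnn um; split=> //; split; rewrite ?ltnn ?m0//.
move=> i im1; have /orP[/eqP ->|im] : (i == m) || (i < m)%N by rewrite -leq_eqVlt.
  by rewrite leqnn ltnn um.
by rewrite (ltnW im) im; exact: H.
Qed.

(** Near [c] the only possible double point is [c], and so is the only possible vertex. If [c] is
    double it is not a vertex, and one piece of the appropriate sign runs across it; otherwise the
    pieces break at [c]. *)
Lemma chain_local n P Y (c : R) : diagram n P Y -> 0 < c < n%:R -> exists2 r : R, 0 < r &
  (forall z t : R, `|z - c| < r -> z <> c -> ~ double n P z t) /\
  forall x y : R, c - r < x < y -> y < c + r -> (forall t, ~ double n P x t) -> (forall t, ~ double n P y t) ->
    (exists m u e, chain n P Y x m u e) -> exists m u e, chain n P Y y m u e.
Proof.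
move=> [_ [d1 d2 d3 d4]] /andP[c0 cn]; have [r r0 rP] := d4 c.
have [|i [s [ilt s01 cE]]] := @floor_piece R n c; first by rewrite ltW.
have iS : i.+1%:R = i%:R + 1 :> R by rewrite natr1.
have nodbl (z t : R) : `|z - c| < r -> z <> c -> ~ double n P z t.
  by move=> zr zc /rP/(_ zc); rewrite leNgt zr.
have near (z : R) r' : r' <= r -> c - r' < z < c + r' -> `|z - c| < r by move=> *; rewrite ltr_norml; flra.
have [[t0 dt0]|nc] := pselect (exists t, double n P c t).
  have s0 : 0 < s.
    rewrite lt_neqAle eq_sym; move: s01 => /andP[-> _]; rewrite andbT; apply/eqP => s0.
    by apply: (d2 c t0 i dt0); rewrite cE s0 addr0.
  pose r' := Num.min r (Num.min s (1 - s)).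
  have r'r : r' <= r by rewrite ge_min lexx.
  have r's : r' <= s by rewrite !ge_min lexx orbT.
  have r's1 : r' <= 1 - s by rewrite !ge_min lexx !orbT.
  exists r'; first by rewrite !lt_min r0 s0 subr_gt0; case/andP: s01.
  split=> [z t zr|x y xr yr nx ny [m [u [e ch]]]]; first by apply: nodbl; exact: lt_le_trans r'r.
  pose eps : R := if Y t0 < Y c then 1 else -1.
  have G : good_piece n P Y x y eps.
    split.
    - by case/andP: xr.
    - by exists i => //; rewrite iS; move: cE r's r's1 xr yr; flra.
    - by rewrite /eps; case: ifP => _; [left|right].
    - by move=> t; split.
    - move=> z t xz tz dz; have zc : z = c.
        apply: contrapT => zc; apply: (nodbl z t _ zc dz); apply: near r'r _.
        by move: xr xz yr => /andP[? ?] /andP[? ?] ?; apply/andP; split; flra.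
      rewrite zc in dz *; rewrite (d3 _ _ _ dz dt0) /eps.
      by have := d1 _ _ dt0; rewrite neq_lt => /orP[h|h]; rewrite ?h ?(lt_gtF h); flra.
  by have [u' [e' [ch' _ _]]] := chain_extend ch G; exists m.+1, u', e'.
have [k [kn kc kr]] : exists k, [/\ (k < n)%N, c <= k.+1%:R & k%:R < c].
  have [s0|s0] := eqVneq s 0; last first.
    by exists i; rewrite iS; split=> //; move: s0 s01 cE => /eqP s0 /andP[]; rewrite le_eqVlt eq_sym => /orP[/eqP/s0//|]; flra.
  have i0 : (0 < i)%N by rewrite -(ltr_nat R); move: c0; rewrite cE s0 addr0.
  exists i.-1; split; [exact: leq_ltn_trans (leq_pred i) ilt| |]; rewrite cE s0 addr0.
    by rewrite prednK.
  by rewrite ltr_nat prednK.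
pose r' := Num.min r (Num.min (c - k%:R) (1 - s)).
have r'r : r' <= r by rewrite ge_min lexx.
have r's : r' <= c - k%:R by rewrite !ge_min lexx orbT.
have r's1 : r' <= 1 - s by rewrite !ge_min lexx !orbT.
exists r'; first by rewrite !lt_min r0 !subr_gt0 kr; case/andP: s01.
split=> [z t zr|x y /andP[xr xy] yr nx ny [m [u [e ch]]]]; first by apply: nodbl; exact: lt_le_trans r'r.
have nd z t : c - r' < z < c + r' -> ~ double n P z t.
  move=> zr; have [->|/eqP zc] := eqVneq z c; first by move=> h; apply: nc; exists t.
  by apply: nodbl zc; exact: near r'r zr.
have G (x' y' : R) : x <= x' -> x' < y' -> y' <= y -> y' <= c \/ c <= x' -> good_piece n P Y x' y' 1.
  move=> xx xy' yy yc; split=> //; last 2 first.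
  - by move=> t; split; apply: nd; move: xx xy' yy xr yr; clear; flra.
  - by move=> z t xz _ /nd []; move: xz xx xy' yy xr yr; clear; flra.
  - case: yc => yc; [exists k => //|exists i => //; rewrite iS].
      by move: xr xx yc kc r's; clear; flra.
    by move: yy yr yc cE r's1 s01; clear; flra.
  - by left.
have [yc|yc] := leP y c.
  by have [u' [e' [ch' _ _]]] := chain_extend ch (G x y (lexx _) xy (lexx _) (or_introl yc)); exists m.+1, u', e'.
have [cx|cx] := leP c x.
  by have [u' [e' [ch' _ _]]] := chain_extend ch (G x y (lexx _) xy (lexx _) (or_intror cx)); exists m.+1, u', e'.
have [u' [e' [ch' _ _]]] := chain_extend ch (G x c (lexx _) cx (ltW yc) (or_introl (lexx _))).
have [u'' [e'' [ch'' _ _]]] := chain_extend ch' (G c y (ltW cx) yc (lexx _) (or_intror (lexx _))).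
by exists m.+2, u'', e''.
Qed.

(** The supremum of the parameters reached by chains is [n], by [chain_local]. Shortly before [n]
    there are no double points, so two more pieces can be appended: one of sign 1, so that the last
    horizontal segment is above the height 1, and one that becomes the last arc. *)
Lemma diagram_chain n P Y : (0 < n)%N -> diagram n P Y -> exists k u e,
  [/\ chain n P Y n%:R k.+3 u e, e k.+1 = 1 & forall s t, u k.+1 <= s -> ~ double n P s t].
Proof.
move=> n0 dg; have [_ [d1 d2 d3 d4]] := dg.
have n1 : 1 <= n%:R :> R by rewrite ler1n.
pose S := [set a | 0 < a < n%:R /\ exists m u e, chain n P Y a m u e].
have [r0 r00 r0P] := d4 0.
pose a0 := Num.min (r0 / 2) (2^-1 : R).
have a00 : 0 < a0 by rewrite lt_min divr_gt0//= invr_gt0.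
have a0r : a0 < r0 by rewrite gt_min; apply/orP; left; move: r00; clear; flra.
have a01 : a0 <= 2^-1 by rewrite ge_min lexx orbT.
have Sa0 : S a0.
  split; first by move: a00 a01 n1; clear; flra.
  have nd s t : 0 <= s <= a0 -> ~ double n P s t.
    move=> s0 d; have sn : s <> 0 by move=> s0'; apply: (d2 s t 0%N d); rewrite s0'.
    by have := r0P s t d sn; rewrite subr0 ger0_norm; move: s0 a0r; clear; flra.
  exists 1%N, (fun i => if i is 0%N then 0 else a0), (fun=> -1); split=> // -[|//] _; split=> //.
  - by exists 0%N => //; move: a01; clear; flra.
  - by right.
  - by move=> t; split; apply: nd; move: a00; clear; flra.
  - by move=> s t s0 _ /nd[].
have Sub : has_ubound S by exists n%:R => a [/andP[_ /ltW]].
have Ssup : has_sup S by split=> //; exists a0.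
pose c := sup S.
have Sc a : S a -> a <= c by exact: sup_upper_bound Ssup a.
have c0 : 0 < c by apply: (lt_le_trans a00); exact: Sc.
have cn : c <= n%:R by apply: ge_sup => [|a [/andP[_ /ltW]]//]; exists a0.
have {cn} cE : c = n%:R.
  apply/eqP; rewrite eq_le cn /= leNgt; apply/negP => {}cn.
  have [|r r_gt0 [rP1 rP2]] := @chain_local n P Y c dg; first by rewrite c0.
  have [a Sa ac] := @sup_adherent R S r r_gt0 Ssup; have ac' : a <= c by exact: Sc.
  have [/andP[a_gt0 an] ch] := Sa.
  pose y := Num.min (c + r / 2) ((c + n%:R) / 2).
  have yc : c < y by rewrite lt_min; move: r_gt0 cn; clear => *; apply/andP; split; flra.
  have yr : y < c + r by rewrite gt_min; apply/orP; left; move: r_gt0; clear; flra.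
  have yn : y < n%:R by rewrite gt_min; apply/orP; right; move: cn; clear; flra.
  have Sy : S y.
    split; first by move: c0 yc yn; clear => *; apply/andP; split; flra.
    apply: (rP2 a y) => //.
    - by rewrite ac; move: ac' yc; clear; flra.
    - move=> t; have [m [u [e [m0 _ <- _ /(_ m.-1)]]]] := ch.
      by rewrite ltn_predL m0 prednK// => /(_ isT)[_ _ _ /(_ t)[]].
    - by move=> t; apply: rP1; [rewrite ltr_norml|]; move: yc yr r_gt0; clear; flra.
  by have := Sc y Sy; rewrite leNgt yc.
have [r r_gt0 rP] := d4 n%:R.
pose r1 := Num.min r 1.
have r1r : r1 <= r by rewrite ge_min lexx.
have r11 : r1 <= 1 by rewrite ge_min lexx orbT.
have [|a Sa] := @sup_adherent R S r1 _ Ssup; first by rewrite lt_min r_gt0 ltr01.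
rewrite -/c cE => ac; have [/andP[a_gt0 an] [m [u [e ch]]]] := Sa.
have nd s t : a <= s -> ~ double n P s t.
  move=> sa d; have [/andP[_ sn] _ _ _] := d; have ne : s <> n%:R by move: sn; clear; flra.
  by have := rP s t d ne; rewrite ltr0_norm; move: sn sa ac r1r; clear; flra.
have G (x y : R) : a <= x -> x < y -> y <= n%:R -> good_piece n P Y x y 1.
  move=> ax xy yn; split=> //.
  - exists n.-1; rewrite ?ltn_predL// prednK//; split=> //.
    have : n%:R = n.-1%:R + 1 :> R by rewrite natr1 prednK.
    by move: ax ac r11; clear; flra.
  - by left.
  - by move=> t; split; apply: nd => //; apply: le_trans ax (ltW xy).
  - by move=> s t /andP[xs _] _ /nd[]; exact: le_trans xs.
pose b := (a + n%:R) / 2.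
have ab : a < b by rewrite /b; move: an; clear; flra.
have bn : b < n%:R by rewrite /b; move: an; clear; flra.
have [m0 _ _ _ _] := ch.
have [u1 [e1 [ch1 u1m e1m]]] := chain_extend ch (G a b (lexx _) ab (ltW bn)).
have [u2 [e2 [ch2 u2m e2m]]] : exists u2 e2, [/\ chain n P Y n%:R m.+2 u2 e2, u2 m = a & e2 m = 1].
  have [m1 h0 h1 h2 h3] := ch1.
  exists (fun i => if (i <= m.+1)%N then u1 i else n%:R), (fun i => if (i <= m)%N then e1 i else 1).
  rewrite leqnSn leqnn u1m e1m; split=> //; split=> //; first by rewrite ltnn.
  move=> i im2; have /orP[/eqP ->|im] : (i == m.+1) || (i < m.+1)%N by rewrite -leq_eqVlt.
    by rewrite leqnn !ltnn h1; apply: G => //; exact: ltW.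
  by rewrite (ltnW im) im -ltnS im; exact: h3.
case: m m0 ch ch1 u1m e1m ch2 u2m e2m => // k _ _ _ _ _ ch2 u2m e2m.
by exists k, u2, e2; split=> // s t; rewrite u2m; exact: nd.
Qed.
End Diagrams.

(** * Moving a knot diagram onto poles *)

Section PolePosition.
Context {R : realType}.
Local Notation Q := (R * R)%type.
Implicit Types (n k i : nat) (P : R -> Q) (Y : R -> R) (u e : nat -> R).

Definition pl {V : lmodType R} (c : nat -> V) (s : R) : V :=
  (1 - (s - (Num.truncn s)%:R)) *: c (Num.truncn s) + (s - (Num.truncn s)%:R) *: c (Num.truncn s).+1.

Lemma pl_piece {V : lmodType R} (c : nat -> V) k (x : R) : 0 <= x <= 1 ->
  pl c (k%:R + x) = (1 - x) *: c k + x *: c k.+1.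
Proof.
move=> /andP[x0]; rewrite le_eqVlt => /orP[/eqP ->|x1]; rewrite /pl.
  have -> : Num.truncn (k%:R + 1 : R) = k.+1 by apply: truncn_def; rewrite natr1 lexx ltr_nat ltnS leqnn.
  by rewrite natr1 !subrr subr0 !scale0r !scale1r addr0 add0r.
have -> : Num.truncn (k%:R + x : R) = k by apply: truncn_def; rewrite lerDl x0 -natr1 ltrD2l.
by rewrite [k%:R + x]addrC addrK.
Qed.

(* Each piece [u i, u (i+1)] of the parameter is traversed in two unit steps, the
   first one covering a fraction (1 - th) * kap of it: at th = 1 the first step
   stays over one point, and only the height moves there. *)
Definition knee u (kap th : R) j : R :=
  u j./2 + (if odd j then (1 - th) * kap * (u j./2.+1 - u j./2) else 0).
Definition slide u (kap th s : R) : R := pl (knee u kap th : nat -> R^o) s.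
(** The heights [hh] of the pole knot; 0 and 1 are those between which the last arc is stretched. *)
Definition level k e i : R := if i is i'.+1 then (if (i' < k.+2)%N then e i' * (i'%:R + 2) else 1) else 0.
(** During the first step over a piece the height changes to the level of that piece, during the
    second it is constant, except over the last piece, where it comes down from 1 to 0. *)
Definition level_knee k e j : R := if j == k.+3.*2 then 0 else level k e (uphalf j).
Definition height k e (s : R) : R := pl (level_knee k e : nat -> R^o) s.

Lemma natr_double i : 2 * i%:R = i.*2%:R :> R.
Proof. by rewrite -mul2n natrM. Qed.

Lemma slide_even u kap th i (x : R) : 0 <= x <= 1 ->
  slide u kap th (2 * i%:R + x) = u i + x * ((1 - th) * kap * (u i.+1 - u i)).
Proof.
move=> x01; rewrite /slide natr_double pl_piece// /knee -[i.*2.+1./2]/(uphalf i.*2) uphalf_double doubleK /= odd_double /=.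
by rewrite /GRing.scale /=; ring.
Qed.

Lemma slide_odd u kap th i (x : R) : 0 <= x <= 1 ->
  slide u kap th (2 * i%:R + 1 + x) = (1 - x) * (u i + (1 - th) * kap * (u i.+1 - u i)) + x * u i.+1.
Proof.
move=> x01; rewrite /slide natr_double natr1 pl_piece// /knee -[i.*2.+1./2]/(uphalf i.*2) uphalf_double -doubleS doubleK /= odd_double /=.
by rewrite /GRing.scale /=; ring.
Qed.

Lemma height_even k e i (x : R) : (i < k.+3)%N -> 0 <= x <= 1 ->
  height k e (2 * i%:R + x) = (1 - x) * level k e i + x * level k e i.+1.
Proof.
move=> ik x01; rewrite /height natr_double pl_piece// /level_knee.
have -> : (i.*2 == k.+3.*2) = false by rewrite (inj_eq double_inj) ltn_eqF.
have -> : (i.*2.+1 == k.+3.*2) = false by apply/eqP => /(congr1 odd); rewrite /= !odd_double.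
by rewrite -[uphalf i.*2.+1]/(i.*2./2.+1) doubleK uphalf_double.
Qed.

Lemma height_odd k e i (x : R) : (i < k.+3)%N -> 0 <= x <= 1 ->
  height k e (2 * i%:R + 1 + x) = if i == k.+2 then 1 - x else level k e i.+1.
Proof.
move=> ik x01; rewrite /height natr_double natr1 pl_piece// /level_knee.
have -> : (i.*2.+1 == k.+3.*2) = false by apply/eqP => /(congr1 odd); rewrite /= !odd_double.
rewrite -doubleS (inj_eq double_inj) eqSS -[uphalf i.*2.+1]/(i.*2./2.+1) doubleK uphalf_double.
have [-> |_] := eqVneq i k.+2; rewrite /GRing.scale /=; last by ring.
by rewrite ltnn; ring.
Qed.

Lemma locate k (s : R) : 0 <= s < 2 * k%:R -> exists i (x : R), [/\ (i < k)%N, 0 <= x < 1 &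
  s = 2 * i%:R + x \/ s = 2 * i%:R + 1 + x].
Proof.
rewrite natr_double => /floor_piece[j [x [jk x01 ->]]]; exists j./2, x; split=> //.
  by rewrite -ltn_double; apply: leq_ltn_trans jk; rewrite -{2}(odd_double_half j) leq_addl.
rewrite natr_double -{1 3}(odd_double_half j); case: (odd j); [right|left]; rewrite ?add0n// add1n natr1//.
Qed.

(** [kap] is the fraction of each piece over which the height changes; it is chosen small enough to
    exclude double points there. *)
Definition prepared n P Y k u e (kap : R) := [/\ diagram n P Y, chain n P Y n%:R k.+3 u e, e k.+1 = 1,
  forall s t, u k.+1 <= s -> ~ double n P s t &
  0 < kap <= 2^-1 /\ forall i s t, (i < k.+3)%N -> u i <= s <= u i + kap * (u i.+1 - u i) -> ~ double n P s t].

Lemma prepared_exists n P Y : (0 < n)%N -> diagram n P Y -> exists k u e kap, prepared n P Y k u e kap.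
Proof.
move=> n0 dg; have [k [u [e [ch e1 nd]]]] := diagram_chain n0 dg; exists k, u, e.
have [_ _ _ _ G] := ch; have [_ [_ _ _ d4]] := dg.
have [|r r0 rP] := @common_radius R k.+3 (fun i kap => kap <= 2^-1 /\
    forall s t, u i <= s <= u i + kap * (u i.+1 - u i) -> ~ double n P s t); last first.
  exists r; split=> //; split; last by move=> i s t ik; case: (rP r i ik) => [|_]; [rewrite r0 lexx|apply].
  by rewrite r0 /=; case: (rP r 0%N isT) => //; rewrite r0 lexx.
move=> i ik; have [lt _ _ nu _] := G i ik; have [r r0 rP] := d4 (u i).
have w0 : 0 < 2 * (u i.+1 - u i) by move: lt; clear; flra.
exists (Num.min 2^-1 (r / (2 * (u i.+1 - u i)))); first by rewrite lt_min invr_gt0 ltr0n divr_gt0.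
move=> kap /andP[k0]; rewrite le_min => /andP[-> ]; rewrite ler_pdivlMr// => kr; split=> // s t su d.
have [su'|/eqP su'] := eqVneq s (u i); first by case: (nu t) => + _; rewrite -su'.
have := rP s t d su'; rewrite ger0_norm; move: su kr lt r0; clear; flra.
Qed.

Lemma chain_mono n P Y (a : R) m u e i j : chain n P Y a m u e -> (i <= j <= m)%N -> u i <= u j.
Proof.
move=> [_ _ _ _ G] /andP[ij]; elim: j ij => [|j IH]; first by rewrite leqn0 => /eqP ->.
rewrite leq_eqVlt => /orP[/eqP ->//|ij] jm; apply: le_trans (IH ij (ltnW jm)) _.
by have [/ltW] := G j jm.
Qed.

Lemma affine_piece n (V : completeNormedModType R) (F : R -> V) i (a b x : R) : linear_pieces n F -> (i < n)%N ->
  i%:R <= a <= i.+1%:R -> i%:R <= b <= i.+1%:R -> 0 <= x <= 1 ->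
  F ((1 - x) * a + x * b) = (1 - x) *: F a + x *: F b.
Proof.
move=> lF ilt; rewrite -natr1 => a01 b01 x01.
have A (y : R) : i%:R <= y <= i%:R + 1 -> F y = F i%:R + (y - i%:R) *: (F i.+1%:R - F i%:R).
  move=> y01; have {1}-> : y = i%:R + (y - i%:R) by ring.
  by rewrite lF// ?conv_line//; move: y01; clear; flra.
rewrite (A _ a01) (A _ b01) A; last by move: a01 b01 x01; clear; fnra.
move: (F i.+1%:R - F i%:R) => d; move: (F i%:R) => f.
have -> : (1 - x) * a + x * b - i%:R = (1 - x) * (a - i%:R) + x * (b - i%:R) by ring.
by rewrite [in LHS]scalerDl -!scalerA !scalerDr addrACA -[(1 - x) *: f + x *: f]scalerDl subrK scale1r.
Qed.

Lemma piece_inj n P Y (x y ep s t : R) : diagram n P Y -> good_piece n P Y x y ep ->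
  x <= s <= y -> x <= t <= y -> (P s).1 = (P t).1 -> s = t.
Proof.
move=> [[lP _ _ _ P1] _] [_ [i ilt [xi yi]] _ _ _] sx tx.
have A (z : R) : x <= z <= y -> (P z).1 = (P i%:R).1 + (z - i%:R) * ((P i.+1%:R).1 - (P i%:R).1).
  move=> zx; have {1}-> : z = i%:R + (z - i%:R) by ring.
  rewrite lP//; last by move: zx xi yi; rewrite -natr1; clear; flra.
  by rewrite /= /GRing.scale /=; ring.
rewrite (A _ sx) (A _ tx) => /addrI.
by have := P1 i ilt; rewrite eq_sym -subr_eq0 => ne /(mulIf ne)/addIr.
Qed.

Lemma level_neq n P Y (a : R) k u e i : chain n P Y a k.+3 u e -> e k.+1 = 1 -> (i < k.+3)%N ->
  level k e i != level k e i.+1.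
Proof.
move=> [_ _ _ e0 G] e1 ik; apply/eqP; case: i ik => [|i] ik; first by rewrite /= e0; flra.
rewrite /= (_ : (i < k.+2)%N)//; case: ltnP => ik'.
  have i0 := ler0n R i; have [_ _ [->|->] _ _] := G i (ltnW ik); have [_ _ [->|->] _ _] := G i.+1 ik; rewrite -natr1;
  by move: i0; clear; flra.
have -> : i = k.+1 by apply/eqP; rewrite eqn_leq; apply/andP; split.
by rewrite e1 -natr1; have := ler0n R k; clear; flra.
Qed.

Local Notation step u kap th i := ((1 - th) * kap * (u i.+1 - u i)).

Lemma place n P Y k u e (kap th s : R) : prepared n P Y k u e kap -> 0 <= th <= 1 -> 0 <= s < 2 * k.+3%:R -> exists i (x : R),
  [/\ (i < k.+3)%N, 0 <= x < 1, 0 <= step u kap th i <= (u i.+1 - u i) / 2, u i < u i.+1 &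
   [/\ s = 2 * i%:R + x, slide u kap th s = u i + x * step u kap th i &
       height k e s = (1 - x) * level k e i + x * level k e i.+1] \/
   [/\ s = 2 * i%:R + 1 + x, slide u kap th s = (1 - x) * (u i + step u kap th i) + x * u i.+1 &
       height k e s = if i == k.+2 then 1 - x else level k e i.+1]].
Proof.
move=> [_ [_ _ _ _ G] _ _ [kap01 _]] th01 /locate[i [x [ik x01 sE]]]; exists i, x.
have [lt _ _ _ _] := G i ik; have x01' : 0 <= x <= 1 by move: x01; clear; flra.
split=> //; last by case: sE => ->; [left|right]; rewrite ?slide_even ?slide_odd ?height_even ?height_odd.
move: kap01 th01 lt; move: (u i.+1) (u i) => u1 u0; clear => /andP[k0 k1] /andP[t0 t1] lt.
have q0 : 0 <= (1 - th) * kap by apply: mulr_ge0; flra.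
have q1 : (1 - th) * kap <= 2^-1 by fnra.
by move: q0 q1; move: ((1 - th) * kap) => q *; apply/andP; split; fnra.
Qed.

Lemma slide_bounds (u0 u1 b x g : R) : 0 <= x < 1 -> 0 <= b <= (u1 - u0) / 2 -> u0 < u1 ->
  g = u0 + x * b \/ g = (1 - x) * (u0 + b) + x * u1 -> u0 <= g < u1.
Proof. by move=> /andP[x0 x1] /andP[b0 b1] lt [->|->]; apply/andP; split; fnra. Qed.

Lemma slide_range n P Y k u e (kap th s : R) : prepared n P Y k u e kap -> 0 <= th <= 1 -> 0 <= s < 2 * k.+3%:R -> 0 <= slide u kap th s < n%:R.
Proof.
move=> pr th01 sN; have [i [x [ik x01 b01 lt H]]] := place pr th01 sN; have [_ ch _ _ _] := pr.
have /andP[g0 g1] : u i <= slide u kap th s < u i.+1.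
  by apply: (slide_bounds x01 b01 lt); case: H => -[_ -> _]; [left|right].
have [_ u0 um _ _] := ch.
have := @chain_mono n P Y _ _ u e 0%N i ch (ltnW ik); rewrite u0 => ui.
have := @chain_mono n P Y _ _ u e i.+1 k.+3 ch; rewrite ik leqnn um => /(_ isT) un.
by rewrite (le_trans ui g0) (lt_le_trans g1 un).
Qed.

(** As long as [th < 1] the parameter itself moves injectively. At [th = 1] the first step over a
    piece stays at one point, and only the height, which is then fully in place, distinguishes the
    parameters. *)
Lemma slide_level_inj n P Y k u e (kap th tau s s' : R) : prepared n P Y k u e kap -> 0 <= th <= 1 -> th < 1 \/ tau = 1 ->
  0 <= s < 2 * k.+3%:R -> 0 <= s' < 2 * k.+3%:R -> slide u kap th s = slide u kap th s' ->
  (tau = 1 -> height k e s = height k e s') -> s = s'.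
Proof.
move=> pr th01 tt sN sN'; have [_ ch e1 _ [/andP[kap0 _] _]] := pr.
have [i [x [ik x01 b01 lt H]]] := place pr th01 sN; have [j [y [jk y01 b01' lt' H']]] := place pr th01 sN'.
have /andP[g0 g1] : u i <= slide u kap th s < u i.+1.
  by apply: (slide_bounds x01 b01 lt); case: H => -[_ -> _]; [left|right].
have /andP[g0' g1'] : u j <= slide u kap th s' < u j.+1.
  by apply: (slide_bounds y01 b01' lt'); case: H' => -[_ -> _]; [left|right].
move=> gE hE; have ij : i = j.
  case: (ltngtP i j) => // ij; exfalso.
    have := @chain_mono n P Y _ _ u e i.+1 j ch; rewrite ij (ltnW jk) => /(_ isT).
    by move: g1 g0'; rewrite gE; clear; flra.
  have := @chain_mono n P Y _ _ u e j.+1 i ch; rewrite ij (ltnW ik) => /(_ isT).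
  by move: g1' g0; rewrite gE; clear; flra.
have lv : level k e i - level k e i.+1 != 0 by rewrite subr_eq0; exact: level_neq ch e1 ik.
have bpos : th < 1 -> 0 < step u kap th i by move=> th1; rewrite !mulr_gt0// subr_gt0.
subst j; case: H => [[sE gs hs]|[sE gs hs]]; case: H' => [[sE' gs' hs']|[sE' gs' hs']].
- case: tt => [/bpos b0|t1].
    by move: gE; rewrite gs gs' sE sE' => /addrI/mulIf -> //; rewrite gt_eqF.
  have := hE t1; rewrite hs hs' => E; have /eqP : (x - y) * (level k e i - level k e i.+1) = 0 by move: E; clear; flra.
  by rewrite mulf_eq0 (negPf lv) orbF subr_eq0 => /eqP xy; rewrite sE sE' xy.
- exfalso; move: gE; rewrite gs gs' => gE.
  have [b0 y0] : step u kap th i = 0 /\ y = 0.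
    by move: gE x01 y01 b01 lt; move: (step u kap th i) (u i) (u i.+1); clear => b u0 u1 *; split; fnra.
  case: tt => [/bpos|t1]; first by rewrite b0 ltxx.
  have := hE t1; rewrite hs hs' y0 subr0 => E.
  have /eqP : (1 - x) * (level k e i - level k e i.+1) = 0.
    move: E; case: eqP => [->|_]; last by clear; flra.
    by rewrite [level k e k.+3]/= ltnn; clear; flra.
  by rewrite mulf_eq0 (negPf lv) orbF subr_eq0; move: x01; clear => /andP[_ ?] /eqP; flra.
- exfalso; move: gE; rewrite gs gs' => gE.
  have [b0 x0] : step u kap th i = 0 /\ x = 0.
    by move: gE x01 y01 b01 lt; move: (step u kap th i) (u i) (u i.+1); clear => b u0 u1 *; split; fnra.
  case: tt => [/bpos|t1]; first by rewrite b0 ltxx.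
  have := hE t1; rewrite hs hs' x0 subr0 => E.
  have /eqP : (1 - y) * (level k e i - level k e i.+1) = 0.
    move: E; case: eqP => [->|_]; last by clear; flra.
    by rewrite [level k e k.+3]/= ltnn; clear; flra.
  by rewrite mulf_eq0 (negPf lv) orbF subr_eq0; move: y01; clear => /andP[_ ?] /eqP; flra.
- move: gE; rewrite gs gs' => gE.
  have /eqP : (x - y) * (u i.+1 - u i - step u kap th i) = 0 by move: gE; move: (step u kap th i); clear => *; flra.
  rewrite mulf_eq0 subr_eq0 => /orP[/eqP xy|/eqP]; first by rewrite sE sE' xy.
  move: b01 lt; move: (step u kap th i); clear => *; flra.
Qed.

(** Double points can occur only during the second step over a piece, where the height is the level
    of the piece. *)
Lemma plateau n P Y k u e (kap th s t : R) : prepared n P Y k u e kap -> 0 <= th <= 1 -> 0 <= s < 2 * k.+3%:R -> double n P (slide u kap th s) t ->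
  exists2 i, (i < k.+1)%N & u i <= slide u kap th s < u i.+1 /\ height k e s = e i * (i%:R + 2).
Proof.
move=> pr th01 sN d; have [_ ch e1 nd [/andP[kap0 _] ndk]] := pr.
have [i [x [ik x01 b01 lt H]]] := place pr th01 sN; exists i.
  rewrite ltnNge; apply/negP => ki; apply: (nd _ _ _ d).
  have /andP[g0 g1] : u i <= slide u kap th s < u i.+1.
    by apply: (slide_bounds x01 b01 lt); case: H => -[_ -> _]; [left|right].
  by apply: le_trans g0; apply: chain_mono ch _; rewrite ki ltnW.
have gb : u i <= slide u kap th s < u i.+1.
  by apply: (slide_bounds x01 b01 lt); case: H => -[_ -> _]; [left|right].
split=> //; case: H => -[_ gs hs].
  exfalso; apply: (ndk i _ _ ik _ d); rewrite gs.
  have b2 : step u kap th i <= kap * (u i.+1 - u i).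
    by rewrite -mulrA ler_piMl//; [rewrite mulr_ge0// ?ltW// subr_gt0|move: th01; clear; flra].
  move: b2 x01 b01; move: (step u kap th i) (kap * _); clear => b K *; apply/andP; split; fnra.
have ik1 : (i < k.+1)%N.
  rewrite ltnNge; apply/negP => ki; apply: (nd _ _ _ d); case/andP: gb => g0 _.
  by apply: le_trans g0; apply: chain_mono ch _; rewrite ki ltnW.
by rewrite hs ltn_eqF ?(leqW ik1)//= (leqW ik1).
Qed.

(** At a double point the later piece has the level of larger absolute value, with the sign of its
    original position relative to the earlier piece. The original and the final difference of
    heights have the same sign, and so has every interpolation between them. *)
Lemma double_levels n P Y k u e (kap th tau s s' : R) : prepared n P Y k u e kap -> 0 <= th <= 1 -> 0 <= tau <= 1 ->
  0 <= s < 2 * k.+3%:R -> 0 <= s' < 2 * k.+3%:R -> double n P (slide u kap th s) (slide u kap th s') ->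
  slide u kap th s' < slide u kap th s ->
  (1 - tau) * Y (slide u kap th s) + tau * height k e s <> (1 - tau) * Y (slide u kap th s') + tau * height k e s'.
Proof.
move=> pr th01 tau01 sN sN' d lt; have [d1 d2 ne Pe] := d.
have d' : double n P (slide u kap th s') (slide u kap th s) by split=> // /esym.
have [i ik [gi hi]] := plateau pr th01 sN d; have [j jk [gj hj]] := plateau pr th01 sN' d'.
have [dg ch _ _ _] := pr; have [_ _ _ _ G] := ch.
have ik3 : (i < k.+3)%N by exact: leqW (leqW ik).
have jk3 : (j < k.+3)%N by exact: leqW (leqW jk).
have ji : (j < i)%N.
  rewrite ltn_neqAle; apply/andP; split; last first.
    rewrite leqNgt; apply/negP => ij.
    have := @chain_mono n P Y _ _ u e i.+1 j ch; rewrite ij (ltnW jk3) => /(_ isT).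
    by move: gi gj lt; clear; flra.
  apply/eqP => ji; apply: ne; subst j; apply: (piece_inj dg (G i ik3)) (congr1 fst Pe); [move: gi|move: gj]; clear; flra.
have [_ _ ei _ sg] := G i ik3; have [_ _ ej _ _] := G j jk3.
have gi' : u i <= slide u kap th s <= u i.+1 by move: gi; clear; flra.
have := sg _ _ gi' lt d; rewrite hi hj.
have : j%:R + 1 <= i%:R :> R by rewrite natr1 ler_nat.
have := ler0n R j; move: tau01; clear -ei ej; move: (Y _) (Y _) => y y' /andP[t0 t1] j0 ij.
have [->|tn] := eqVneq tau 0; first by case: ei => ->; flra.
have tpos : 0 < tau by rewrite lt_neqAle eq_sym tn.
have p1 : 0 < tau * (i%:R - j%:R) by apply: mulr_gt0 => //; flra.
have p2 : 0 < tau * (i%:R + j%:R + 4) by apply: mulr_gt0 => //; flra.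
case: ei => ->; case: ej => -> dy.
- have := @mulr_ge0 R (1 - tau) (1 * (y' - y)); flra.
- have := @mulr_ge0 R (1 - tau) (1 * (y' - y)); flra.
- have := @mulr_ge0 R (1 - tau) (-1 * (y' - y)); flra.
- have := @mulr_ge0 R (1 - tau) (-1 * (y' - y)); flra.
Qed.

Lemma position_inj n P Y k u e (kap th tau s s' : R) : prepared n P Y k u e kap -> 0 <= th <= 1 -> 0 <= tau <= 1 -> th < 1 \/ tau = 1 ->
  0 <= s < 2 * k.+3%:R -> 0 <= s' < 2 * k.+3%:R ->
  level_point (P (slide u kap th s)) ((1 - tau) * Y (slide u kap th s) + tau * height k e s) =
  level_point (P (slide u kap th s')) ((1 - tau) * Y (slide u kap th s') + tau * height k e s') -> s = s'.
Proof.
move=> pr th01 tau01 tt sN sN' [P1 hE P2].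
have PE : P (slide u kap th s) = P (slide u kap th s').
  by move: P1 P2; case: (P _) => a1 a2; case: (P _) => b1 b2 /= -> ->.
have r1 := slide_range pr th01 sN; have r2 := slide_range pr th01 sN'.
have [gE|/eqP gE] := eqVneq (slide u kap th s) (slide u kap th s').
  apply: (slide_level_inj pr th01 tt sN sN' gE) => t1; move: hE; rewrite t1 subrr !mul0r !mul1r !add0r//.
exfalso; have d : double n P (slide u kap th s) (slide u kap th s') by split.
have d' : double n P (slide u kap th s') (slide u kap th s) by split=> // /esym.
have := gE; move=> /eqP; rewrite neq_lt => /orP[lt|lt].
  by apply: (double_levels pr th01 tau01 sN' sN d' lt); rewrite hE.
by apply: (double_levels pr th01 tau01 sN sN' d lt); rewrite hE.
Qed.
End PolePosition.

(** * The two motions onto the poles, and the conclusion *)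

Section PoleIsotopy.
Context {R : realType}.
Local Notation Q := (R * R)%type.
Implicit Types (n k i : nat) (P : R -> Q) (Y : R -> R) (u e : nat -> R).

Lemma lipschitz_extendable_space : lipschitz_extendable (R * R * R)%type.
Proof.
move=> A D L L0 lD.
have [||D1 [E1 L1]] := @mcshane R _ A (fun p => (D p).1.1) L => //.
  by move=> a b Aa Ab; apply: le_trans (lD a b Aa Ab); rewrite !prod_normE !le_max lexx.
have [||D2 [E2 L2]] := @mcshane R _ A (fun p => (D p).1.2) L => //.
  by move=> a b Aa Ab; apply: le_trans (lD a b Aa Ab); rewrite !prod_normE !le_max lexx orbT.
have [||D3 [E3 L3]] := @mcshane R _ A (fun p => (D p).2) L => //.
  by move=> a b Aa Ab; apply: le_trans (lD a b Aa Ab); rewrite prod_normE le_max lexx orbT.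
exists (fun p => (D1 p, D2 p, D3 p)); split=> [a Aa|a b].
  by rewrite E1// E2// E3//; case: (D a) => [[? ?] ?].
by rewrite !prod_normE !ge_max L1 L2 L3.
Qed.

Lemma level_pieces N (F : R -> Q) (h : R -> R) : linear_pieces N F -> linear_pieces N (h : R -> R^o) ->
  linear_pieces N (fun s => level_point (F s) (h s)).
Proof.
by move=> lF lh j s jN s01; rewrite /level_point lF// lh.
Qed.

Lemma pl_nat (c : nat -> R^o) j : pl c (j%:R : R) = c j.
Proof. by rewrite -[j%:R]addr0 pl_piece ?lexx ?ler01// subr0 scale1r scale0r addr0. Qed.

Lemma pl_pieces N (c : nat -> R^o) : linear_pieces N (pl c : R -> R^o).
Proof. by move=> j s jN s01; rewrite pl_piece// !pl_nat. Qed.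

(** A unit step stays within one edge of the polygon for all [th], so that composing with an
    edgewise linear map gives motions that are affine in both the parameter and the time. *)
Lemma slide_edge n P Y k u e (kap : R) j : prepared n P Y k u e kap -> (j < k.+3.*2)%N ->
  exists2 i, (i < n)%N & forall th x, 0 <= th <= 1 -> 0 <= x <= 1 ->
    i%:R <= slide u kap th (j%:R + x) <= i.+1%:R.
Proof.
move=> [_ [_ _ _ _ G] _ _ [kap01 _]] jk.
have ik : (j./2 < k.+3)%N by rewrite -ltn_double; apply: leq_ltn_trans jk; rewrite -{2}(odd_double_half j) leq_addl.
have [lt [i ilt iu] _ _ _] := G _ ik; exists i => // th x th01 x01.
have q01 : 0 <= (1 - th) * kap <= 1 by move: th01 kap01; clear => /andP[? ?] /andP[? ?]; apply/andP; split; fnra.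
rewrite -(odd_double_half j); case: (odd j).
  rewrite add1n -natr1 -natr_double slide_odd//.
  move: q01 x01 lt iu; move: ((1 - th) * kap) (u _) (u _) => q u1 u0; clear => /andP[? ?] /andP[x0 x1] ? [? ?].
  have q0 : 0 <= q * (u1 - u0) <= u1 - u0 by apply/andP; split; fnra.
  by move: q0; move: (q * _) => b /andP[? ?]; apply/andP; split; fnra.
rewrite add0n -natr_double slide_even//.
move: q01 x01 lt iu; move: ((1 - th) * kap) (u _) (u _) => q u1 u0; clear => /andP[? ?] /andP[x0 x1] ? [? ?].
have q0 : 0 <= q * (u1 - u0) <= u1 - u0 by apply/andP; split; fnra.
by move: q0; move: (q * _) => b /andP[? ?]; apply/andP; split; fnra.
Qed.

Lemma slide_interpolate u (kap t s : R) : slide u kap t s = (1 - t) * slide u kap 0 s + t * slide u kap 1 s.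
Proof.
rewrite /slide /pl /knee; move: (Num.truncn s) => j /=; case: (odd j) => /=; rewrite /GRing.scale /=; ring.
Qed.

Lemma slide_pieces n P Y k u e (kap th : R) (V : completeNormedModType R) (F : R -> V) :
  prepared n P Y k u e kap -> 0 <= th <= 1 -> linear_pieces n F ->
  linear_pieces k.+3.*2 (fun s => F (slide u kap th s)).
Proof.
move=> pr th01 lF j x jk x01; have [i ilt H] := slide_edge pr jk.
have z01 : 0 <= (0 : R) <= 1 by flra.
have o01 : 0 <= (1 : R) <= 1 by flra.
rewrite {1}/slide (pl_pieces _ jk)//.
have := H th 0 th01 z01; have := H th 1 th01 o01; rewrite addr0 natr1 => h1 h0.
by have := affine_piece lF ilt h0 h1 x01.
Qed.

Lemma slide_ends n P Y k u e (kap th : R) : prepared n P Y k u e kap ->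
  slide u kap th 0 = 0 /\ slide u kap th k.+3.*2%:R = n%:R.
Proof.
move=> [_ [_ u0 um _ _] _ _ _]; rewrite -[0]/(0%:R) /slide !pl_nat /knee doubleK odd_double /= !addr0.
by rewrite u0 um.
Qed.

Lemma height_ends k e : height k e 0 = 0 /\ height k e k.+3.*2%:R = 0.
Proof. by rewrite -[0]/(0%:R) /height !pl_nat /level_knee eqxx. Qed.

Lemma find_break (u : nat -> R) (M : nat) (v : R) : u 0%N <= v <= u M.+1 ->
  exists2 i, (i < M.+1)%N & u i <= v <= u i.+1.
Proof.
move=> /andP[v0]; elim: M => [|M IH] vM; first by exists 0%N; rewrite ?v0.
have [/IH[i iM iv]|vM'] := leP v (u M.+1); first by exists i => //; exact: leqW.
by exists M.+1; rewrite ?(ltW vM') ?vM.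
Qed.

Lemma slide_onto n P Y k u e (kap v : R) : prepared n P Y k u e kap -> 0 <= v <= n%:R ->
  exists2 s, 0 <= s <= k.+3.*2%:R & slide u kap 0 s = v.
Proof.
move=> [_ [_ u0 um _ G] _ _ [kap01 _]] /andP[v0 vn].
have [i ik iv] : exists2 i, (i < k.+3)%N & u i <= v <= u i.+1.
  by apply: find_break; rewrite u0 um v0.
have [lt _ _ _ _] := G i ik; have w0 : 0 < u i.+1 - u i by rewrite subr_gt0.
have ik2 : 2 * i%:R + 2 <= k.+3.*2%:R :> R.
  by rewrite -natr_double -[X in _ + X]mulr1 -mulrDr natr1 ler_wpM2l// ler_nat.
have i0 := ler0n R i; have [kap0 kap1] := andP kap01; have [v1 v2] := andP iv.
have [vk|vk] := leP v (u i + kap * (u i.+1 - u i)).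
  have d0 : 0 < kap * (u i.+1 - u i) by exact: mulr_gt0.
  have x01 : 0 <= (v - u i) / (kap * (u i.+1 - u i)) <= 1.
    apply/andP; split; first by apply: divr_ge0; [rewrite subr_ge0|exact: ltW].
    by rewrite ler_pdivrMr// mul1r; move: vk; clear; flra.
  exists (2 * i%:R + (v - u i) / (kap * (u i.+1 - u i))); first by move: x01 i0 ik2; clear; flra.
  by rewrite slide_even// subr0 mul1r divfK ?gt_eqF// addrC subrK.
have d0 : 0 < (1 - kap) * (u i.+1 - u i) by apply: mulr_gt0 => //; move: kap1; clear; flra.
pose x := (v - u i - kap * (u i.+1 - u i)) / ((1 - kap) * (u i.+1 - u i)).
have x01 : 0 <= x <= 1.
  rewrite divr_ge0 ?(ltW d0)//=; last by move: vk; clear; flra.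
  by rewrite ler_pdivrMr// mul1r; move: v2; clear; flra.
exists (2 * i%:R + 1 + x); first by move: x01 i0 ik2; clear; flra.
have xE : x * ((1 - kap) * (u i.+1 - u i)) = v - u i - kap * (u i.+1 - u i) by rewrite divfK ?gt_eqF.
by rewrite slide_odd// subr0; clearbody x; move: xE; clear => xE; flra.
Qed.

Lemma slide_poles n P Y k u e (kap s : R) : prepared n P Y k u e kap -> 0 <= s <= 2 * k.+2%:R + 1 ->
  P (slide u kap 1 s) = pole_place k.+2 (P \o u) s /\ height k e s = pole_height k.+2 (level k e) s.
Proof.
move=> [[[lP _ _ _ _] _] [_ _ _ _ G] _ _ _] s0.
have [[i [t [im t01 sE -> ->]]]|[i [t [im t01 sE -> ->]]]] := pole_curve_cases (level k e) (P \o u) s0; rewrite sE.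
  by rewrite slide_even// subrr !mul0r mulr0 addr0 height_even.
have ik : (i < k.+3)%N by exact: leqW.
rewrite slide_odd// subrr !mul0r addr0 height_odd// ltn_eqF//; split=> //.
have [lt [j jn [ju uj]] _ _ _] := G i ik.
by rewrite (affine_piece lP jn)//; move: ju uj lt; clear; flra.
Qed.

(** Two linear motions through simple polygons: the heights go to their levels without any change of
    projection, then the first step over each piece shrinks to a pole. The heights have to come
    first, because the shrunk steps are injective only thanks to them. *)
Lemma poles_isotopic n P Y k u e (kap : R) : prepared n P Y k u e kap ->
  let beta v := (1 - v) *: P (u 0%N) + v *: P (u k.+2) in
  pole_disjoint k.+2 (level k e) (P \o u) beta /\
  @isotopic R _ ((fun s => level_point (P s) (Y s)) @` [set s | 0 <= s <= n%:R]) (pole_knot k.+2 (level k e) (P \o u) beta).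
Proof.
move=> pr beta; have [[[lP lY Pn Yn _] _] [_ u0 un _ G] _ _ _] := pr.
have [lt2 [j2 jn2 [ju2 uj2]] _ _ _] := G k.+2 (ltnSn _).
have o01 : 0 <= (1 : R) <= 1 by flra.
have z01 : 0 <= (0 : R) <= 1 by flra.
have Nr : k.+3.*2%:R = 2 * k.+3%:R :> R by rewrite natr_double.
have N2 : k.+3.*2%:R = 2 * k.+2%:R + 2 :> R by rewrite Nr -natr1; ring.
have k0 := ler0n R k.+2.
have [g00 g0N] := slide_ends 0 pr; have [g10 g1N] := slide_ends 1 pr; have [h0 hN] := height_ends k e.
(* The second step over the last piece, run backwards, is the last arc as a function of the
   height. *)
have back (v : R) : 0 <= v <= 1 -> P (slide u kap 1 (2 * k.+2%:R + 1 + (1 - v))) = beta v /\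
    height k e (2 * k.+2%:R + 1 + (1 - v)) = v.
  move=> v01; have v01' : 0 <= 1 - v <= 1 by move: v01; clear; flra.
  rewrite slide_odd// height_odd// eqxx subKr; split=> //; rewrite subrr !mul0r addr0.
  have b1 : j2%:R <= u k.+2 <= j2.+1%:R by move: ju2 uj2 lt2; clear; flra.
  have b2 : j2%:R <= u k.+3 <= j2.+1%:R by move: ju2 uj2 lt2; clear; flra.
  have := affine_piece lP jn2 b1 b2 v01'; rewrite subKr => ->.
  by rewrite un Pn /beta u0 addrC.
split.
  move=> s v s0 v01 Ps hs; have [p1 p2] := slide_poles pr s0; have [b1 b2] := back v v01.
  have sN : 0 <= s < 2 * k.+3%:R by rewrite -Nr N2; move: s0; clear; flra.
  have inj := position_inj pr o01 o01 (or_intror erefl) sN.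
  have [vz|/eqP v0] := eqVneq v 0.
    left; have zN : 0 <= (0 : R) < 2 * k.+3%:R by rewrite -Nr N2; move: k0; clear; flra.
    have b0 : beta 0 = P 0 by rewrite /beta u0 subr0 scale1r scale0r addr0.
    by apply: (inj _ zN); rewrite subrr !mul0r !add0r !mul1r h0 p1 p2 Ps hs vz g10 b0.
  right; have s'N : 0 <= 2 * k.+2%:R + 1 + (1 - v) < 2 * k.+3%:R.
    by rewrite -Nr N2; move: k0 v01 v0; clear; flra.
  have e1 : s = 2 * k.+2%:R + 1 + (1 - v).
    by apply: (inj _ s'N); rewrite subrr !mul0r !add0r !mul1r p1 p2 b1 b2 Ps hs.
  by move: e1 s0 v01; clear; flra.
pose f0 (s : R) := level_point (P (slide u kap 0 s)) (Y (slide u kap 0 s)).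
pose f1 (s : R) := level_point (P (slide u kap 0 s)) (height k e s).
pose f2 (s : R) := level_point (P (slide u kap 1 s)) (height k e s).
pose D0 (s : R) := level_point (0 : Q) (height k e s - Y (slide u kap 0 s)).
pose D1 (s : R) := level_point (P (slide u kap 1 s) - P (slide u kap 0 s)) 0.
have lpE (p q : Q) (x y t : R) : level_point p x + t *: level_point q y = level_point (p + t *: q) (x + t * y) by [].
have lpD (p q : Q) (x y : R) : level_point p x + level_point q y = level_point (p + q) (x + y) by [].
have lh : linear_pieces k.+3.*2 (height k e : R -> R^o) by exact: pl_pieces.
have lP0 := slide_pieces pr z01 lP; have lP1 := slide_pieces pr o01 lP; have lY0 := slide_pieces pr z01 lY.
have E0 : (fun s => level_point (P s) (Y s)) @` [set s | 0 <= s <= n%:R] = f0 @` [set s | 0 <= s <= k.+3.*2%:R].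
  apply/seteqP; split=> _ [s s0 <-].
    by have [s' s'0 sE] := slide_onto pr s0; exists s' => //; rewrite /f0 sE.
  exists (slide u kap 0 s) => //.
  have [|j jN jx] := @find_piece R k.+3.*2 s _ s0; first by rewrite double_gt0.
  have [i ilt H] := slide_edge pr jN; have := H 0 (s - j%:R) z01 jx.
  rewrite [j%:R + _]addrC subrK => /andP[a1 a2]; rewrite /= (le_trans (ler0n R i) a1).
  by rewrite (le_trans a2)// ler_nat.
have N3 : (2 < k.+3.*2)%N by [].
have I1 : @isotopic R _ (f0 @` [set s | 0 <= s <= k.+3.*2%:R]) (f1 @` [set s | 0 <= s <= k.+3.*2%:R]).
  have -> : f1 = (fun s => f0 s + D0 s).
    by apply: funext => s; rewrite /f1 /f0 /D0 lpD addr0 [Y _ + _]addrC subrK.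
  apply: (@polygon_isotopy R (R * R * R)%type lipschitz_extendable_space _ f0 D0 N3).
  - exact: level_pieces.
  - apply: level_pieces; first by move=> j s _ _; rewrite !scaler0 addr0.
    move=> j s jN s01; rewrite lh// lY0//; rewrite /GRing.scale /=; ring.
  - by rewrite /f0 g00 g0N Pn Yn.
  - by rewrite /D0 g00 g0N Yn h0 hN.
  - move=> t s s' t01; rewrite Nr => sN s'N; rewrite /f0 /D0 !lpE !scaler0 !addr0.
    have H (z : R) : Y (slide u kap 0 z) + t * (height k e z - Y (slide u kap 0 z)) =
      (1 - t) * Y (slide u kap 0 z) + t * height k e z by ring.
    by rewrite !H; apply: position_inj pr z01 t01 (or_introl ltr01) sN s'N.
have I2 : @isotopic R _ (f1 @` [set s | 0 <= s <= k.+3.*2%:R]) (f2 @` [set s | 0 <= s <= k.+3.*2%:R]).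
  have -> : f2 = (fun s => f1 s + D1 s).
    by apply: funext => s; rewrite /f2 /f1 /D1 lpD addr0 [P _ + _]addrC subrK.
  apply: (@polygon_isotopy R (R * R * R)%type lipschitz_extendable_space _ f1 D1 N3).
  - exact: level_pieces.
  - apply: level_pieces; last by move=> j s _ _; rewrite !scaler0 addr0.
    by move=> j s jN s01; rewrite lP0// lP1// !scalerBr opprD addrACA.
  - by rewrite /f1 g00 g0N Pn h0 hN.
  - by rewrite /D1 g00 g0N g10 g1N Pn.
  - move=> t s s' t01; rewrite Nr => sN s'N; rewrite /f1 /D1 !lpE !mulr0 !addr0.
    have H (z : R) : 0 <= z < 2 * k.+3%:R -> P (slide u kap 0 z) + t *: (P (slide u kap 1 z) - P (slide u kap 0 z)) =
        P (slide u kap t z).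
      rewrite -Nr => /floor_piece[j [x [jN x01 ->]]]; have x01' : 0 <= x <= 1 by move: x01; clear; flra.
      have [i ilt Hi] := slide_edge pr jN.
      by rewrite -conv_line [in RHS]slide_interpolate (affine_piece lP ilt)//; apply: Hi.
    rewrite !H// => E; apply: (position_inj pr t01 o01 (or_intror erefl) sN s'N).
    by rewrite subrr !mul0r !add0r !mul1r.
rewrite E0; apply: isotopic_trans I1 _; move: I2; congr (isotopic _ _).
rewrite /pole_knot; apply/seteqP; split=> [_ [s sN <-]|_ [[s s0 <-]|[v v01 <-]]].
- have [s1|s1] := leP s (2 * k.+2%:R + 1).
    left; have s0 : 0 <= s <= 2 * k.+2%:R + 1 by rewrite s1 andbT; case/andP: sN.
    by have [p1 p2] := slide_poles pr s0; exists s => //; rewrite /f2 p1 p2.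
  right; pose v := 2 * k.+2%:R + 2 - s.
  have v01 : 0 <= v <= 1 by move: sN; rewrite /= N2 /v; move: s1; clear; flra.
  have [b1 b2] := back v v01; exists v => //; rewrite -b1 -{2}b2 /f2.
  by have -> : 2 * k.+2%:R + 1 + (1 - v) = s by rewrite /v; ring.
- exists s; first by rewrite /= N2; move: s0; clear => /= s0; flra.
  by have [p1 p2] := slide_poles pr s0; rewrite /f2 p1 p2.
- exists (2 * k.+2%:R + 1 + (1 - v)); first by rewrite /= N2; move: v01 k0; clear => /= v01 ?; flra.
  by have [b1 b2] := back v v01; rewrite /f2 b1 b2.
Qed.

Lemma polygon_braid n (g : R -> R * R * R) : (0 < n)%N -> simple_polygon n g ->
  exists (k : nat) (b : 'I_k -> R -> R * R), one_pure_braid b /\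
    @isotopic R _ (braid_closure b) (g @` [set s | 0 <= s <= n%:R]).
Proof.
move=> n0 sg; have [P [Y [dg I0]]] := diagram_exists sg.
have [k [u [e [kap pr]]]] := prepared_exists n0 dg.
have [dis I1] := poles_isotopic pr; have [_ ch e1 _ _] := pr; have [_ u0 un e0 G] := ch.
have [[lP _ Pn _ _] _] := dg.
have E1 i : (i < k.+2)%N -> (i < k.+3)%N by exact: leqW.
have sgn i : (i < k.+2)%N -> e i = 1 \/ e i = -1 by move=> /E1/G[].
have pdiff i : (i < k.+3)%N -> (P (u i)).1 != (P (u i.+1)).1.
  move=> ik; apply/eqP => h; have [lt _ _ _ _] := G i ik; move: (lt); rewrite (piece_inj dg (G i ik) _ _ h) ?ltxx//.
    by rewrite lexx ltW.
  by rewrite lexx ltW.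
have [||||||||||||j [b [ob Ib]]] := @pole_knot_isotopic R k.+2 (level k e) (P \o u)
   (fun v => (1 - v) *: P (u 0%N) + v *: P (u k.+2)).
- by [].
- by [].
- by rewrite /= ltnn.
- by rewrite /= e0; flra.
- by rewrite /= ltnSn e1; have := ler0n R k.+1; rewrite -natr1; have := ler0n R k; flra.
- move=> i ik; rewrite /= ik; have i0 := ler0n R i.
  by case: (sgn i ik) => ->; rewrite ?mul1r ?mulN1r ?normrN ger0_norm//; flra.
- by move=> i /E1/pdiff.
(* A later pole on a horizontal segment would be a double point at a breakpoint, which is excluded
   by [good_piece]. *)
- move=> i l s ik /andP[il lk] s01 /= h; have ik3 := E1 i ik.
  have [lti [j jn [ji ij]] _ _ _] := G i ik3; have [lti' _ _ _ _] := G i.+1 (leq_trans il (leqW lk)).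
  have lk3 : (l < k.+3)%N by []; have [_ _ _ nd _] := G l lk3; have [ltk _ _ _ _] := G k.+2 (ltnSn _).
  have a01 : u i <= (1 - s) * u i + s * u i.+1 <= u i.+1 by move: s01 lti; clear; fnra.
  case: (nd ((1 - s) * u i + s * u i.+1)) => + _; apply.
  have m1 := @chain_mono R n P Y _ _ u e i.+2 l ch; rewrite il (ltnW lk3) in m1.
  have m2 := @chain_mono R n P Y _ _ u e l k.+2 ch; rewrite lk leqnSn in m2.
  have m0 := @chain_mono R n P Y _ _ u e 0%N i ch; rewrite (ltnW ik3) u0 in m0.
  have {}m1 := m1 isT; have {}m2 := m2 isT; have {}m0 := m0 isT.
  split; try by move: m0 m1 m2 lti lti' ltk a01; rewrite -un; clear; flra.
    by move=> ul; move: m1 lti' a01; rewrite -ul; clear; flra.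
  have b1 : j%:R <= u i <= j.+1%:R by move: ji ij lti; clear; flra.
  have b2 : j%:R <= u i.+1 <= j.+1%:R by move: ji ij lti; clear; flra.
  by rewrite (affine_piece lP jn b1 b2 s01).
- by cont.
- by rewrite subr0 scale1r scale0r addr0.
- by rewrite subrr scale1r scale0r add0r.
- exact: dis.
exists j, b; split=> //; apply: isotopic_sym; exact: isotopic_trans I0 (isotopic_trans I1 Ib).
Qed.
End PoleIsotopy.

Theorem corollary1p5 (R : realType) (K : set (R * R * R))
    (hK : is_knot K) (tameK : tame K) :
  exists (k : nat) (b : 'I_k -> R -> R * R),
    one_pure_braid b /\ ambient_isotopic (braid_closure b) K.
Proof.
have [P0 [n [f [n0 [_ f01 finj] fl ->]]] aK] := tameK.
have nR : 0 < n%:R :> R by rewrite ltr0n.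
(* Parametrized by [[0, n]], the polygon has its vertices at the integers. *)
pose g (s : R) := f (s / n%:R).
have sg : simple_polygon n g.
  split.
  - by move=> k s kn s01; rewrite /g; have := fl (Ordinal kn) s; rewrite in_itv /= => ->.
  - by rewrite /g divff ?gt_eqF// mul0r -f01.
  - move=> s s' s0 s'0 /finj; rewrite !in_itv /= => e.
    have /(mulIf _) -> // : s / n%:R = s' / n%:R.
      apply: e; rewrite divr_ge0 ?ltr_pdivrMr ?mul1r ?(ltW nR)//; [by case/andP: s0|by case/andP: s0|by case/andP: s'0|by case/andP: s'0].
    by rewrite invr_eq0 gt_eqF.
have [k [b [ob Ib]]] := polygon_braid n0 sg; exists k, b; split=> //.
apply: isotopic_ambient aK; move: Ib; congr (isotopic _ _); apply/seteqP; split=> _ [s s0 <-].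
  exists (s / n%:R) => //; rewrite /= in_itv /= divr_ge0 ?(ltW nR)//; last by case/andP: s0.
  by rewrite ler_pdivrMr// mul1r; case/andP: s0.
move: s0; rewrite /= in_itv /= => /andP[s0 s1]; exists (s * n%:R); last by rewrite /g mulfK ?gt_eqF.
by rewrite /= mulr_ge0 ?(ltW nR)//= ler_piMl ?(ltW nR).
Qed.
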